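(* Let $q\in\mathbb{N}$, $q\ge 3$, $\lambda=2\cos\frac{\pi}{q}$, let $\Gamma_\lambda$ be the cofinite Hecke triangle group with parameter $\lambda$, let $(V,\chi)$ be a finite-dimensional unitary representation of $\Gamma_\lambda$, and let $\Lambda$, $\eta$, $h_k$, $\beta_s$, the disks $\mathcal{E}_1,\mathcal{E}_r,\mathcal{E}_{q-1}$, the Banach space $B(\mathcal{E};V)$, the transfer operator $\widetilde{\mathcal{L}}_{s,\eta}$ and the degree of singularity $\mathrm{sd}(\eta)$ be as defined in the context. Then: (i) For $\mathrm{Re}\, s>\frac12$, the transfer operator $\widetilde{\mathcal{L}}_{s,\eta}$ is an operator on the Banach space $B(\mathcal{E};V)$ and as such nuclear of order $0$. (ii) The map $s\mapsto\widetilde{\mathcal{L}}_{s,\eta}$ extends meromorphically to all of $\mathbb{C}$ (the extension is also denoted $\widetilde{\mathcal{L}}_{s,\eta}$). Its poles are all simple and contained in $\frac12(1-\mathbb{N}_0)=\{\frac{1-k}{2} : k\in\mathbb{N}_0\}$. For each pole $s_0$ there is a neighborhood $U$ of $s_0$ such that on $U$ $$\widetilde{\mathcal{L}}_{s,\eta}=\frac{1}{s-s_0}\mathcal{A}_s+\mathcal{B}_s,$$ where the operators $\mathcal{A}_s$ and $\mathcal{B}_s$ depend holomorphically on $s\in U$, and $\mathcal{A}_s$ is of rank at most $4\,\mathrm{sd}(\eta)$.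
   Context: **Group.** $\Gamma_\lambda\le \mathrm{PSL}_2(\mathbb{R})$ is generated by $S=\begin{bmatrix}0&1\\-1&0\end{bmatrix}$ and $T=T_\lambda=\begin{bmatrix}1&\lambda\\0&1\end{bmatrix}$; matrices act by fractional linear transformations, written $g.z$. For $k\in\mathbb{Z}$ let $g_k=\big((TS)^kS\big)^{-1}\in\Gamma_\lambda$. In particular $g_1=T^{-1}$ and $g_{q-1}=STS$. **Conjugation.** Let $\mathcal{T}=\frac{1}{\sqrt2}\begin{bmatrix}1&-1\\1&1\end{bmatrix}$, $\Lambda=\mathcal{T}\Gamma_\lambda\mathcal{T}^{-1}$, $h_k=\mathcal{T}g_k\mathcal{T}^{-1}$, and $\eta\colon\Lambda\to U(V)$, $\eta(h)=\chi(\mathcal{T}^{-1}h\mathcal{T})$. The degree of singularity is $\mathrm{sd}(\eta)=\max\{\dim\ker(\eta(p)-1) : p\in\Lambda \text{ parabolic}\}$; here it equals $\dim\ker(\eta(h_1)-1)$. **Action.** For $g=\begin{bmatrix}a&b\\c&d\end{bmatrix}\in\mathrm{PSL}_2(\mathbb{R})$, $s\in\mathbb{C}$, put $j_s(g,x)=\big((cx+d)^{-2}\big)^s$, and for a $V$-valued function $f$ put $\tau_s(g^{-1})f(x)=j_s(g,x)f(g.x)$ wherever this makes sense. Put $\beta_s(h)=\eta(h^{-1})\tau_s(h)$, i.e. $\beta_s(h)f(z)=j_s(h^{-1},z)\,\eta(h^{-1})\big(f(h^{-1}.z)\big)$. On the complex disks below, $j_s(h^{-1},\cdot)$ denotes the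 holomorphic extension of the real function (a power of a positive number) from the real interval contained in the disk; for $h=h_1^n$ it is $\big(\tfrac{n\lambda(1-z)+2}{2}\big)^{-2s}$ and for $h=h_{q-1}^n$ it is $\big(\tfrac{n\lambda(1+z)+2}{2}\big)^{-2s}$ with the principal branch. **Disks.** Let $E_1=\big(\frac{\lambda-1}{\lambda+1},1\big)$, $E_r=\big(-\frac{\lambda-1}{\lambda+1},\frac{\lambda-1}{\lambda+1}\big)$, $E_{q-1}=\big(-1,-\frac{\lambda-1}{\lambda+1}\big)$. Fixed open bounded disks $\mathcal{E}_1,\mathcal{E}_r,\mathcal{E}_{q-1}\subseteq\mathbb{C}$ are chosen (such disks exist) such that (1) $\overline{E_j}\subseteq\mathcal{E}_j$ for $j\in\{1,r,q-1\}$; (2) $J.\mathcal{E}_r=\mathcal{E}_r$ and $J.\mathcal{E}_1=\mathcal{E}_{q-1}$, where $J.z=-\overline{z}$; (3) for $k=2,\dots,q-2$: $h_k^{-1}.\overline{\mathcal{E}}_1\subseteq\mathcal{E}_r$, $h_k^{-1}.\overline{\mathcal{E}}_r\subseteq\mathcal{E}_r$, $h_k^{-1}.\overline{\mathcal{E}}_{q-1}\subseteq\mathcal{E}_r$; (4) for all $n\in\mathbb{N}$: $h_1^{-n}.\overline{\mathcal{E}}_r\subseteq\mathcal{E}_1$ and $h_1^{-n}.\overline{\mathcal{E}}_{q-1}\subseteq\mathcal{E}_1$; (5) for all $n\in\mathbb{N}$: $h_{q-1}^{-n}.\overline{\mathcal{E}}_1\subseteq\mathcal{E}_{q-1}$ and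 $h_{q-1}^{-n}.\overline{\mathcal{E}}_r\subseteq\mathcal{E}_{q-1}$; (6) $\mathrm{Re}\,z>-1$ for $z\in\overline{\mathcal{E}}_1$; (7) $\mathrm{Re}\,z<1$ for $z\in\overline{\mathcal{E}}_{q-1}$; (8) $-1<\mathrm{Re}\,z<1$ for $z\in\overline{\mathcal{E}}_r$. **Banach space.** For an open bounded disk $\mathcal{C}$, $B(\mathcal{C};V)=\{f\colon\overline{\mathcal{C}}\to V \text{ continuous, } f|_{\mathcal{C}} \text{ holomorphic}\}$ with supremum norm, and $B(\mathcal{E};V)=B(\mathcal{E}_1;V)\oplus B(\mathcal{E}_r;V)\oplus B(\mathcal{E}_{q-1};V)$. **Transfer operator.** On vectors $(f_1,f_r,f_{q-1})^\top\in B(\mathcal{E};V)$, $$\widetilde{\mathcal{L}}_{s,\eta}=\begin{pmatrix}0&\sum_{k=2}^{q-2}\beta_s(h_k)&\sum_{n\in\mathbb{N}}\beta_s(h_{q-1}^n)\\ \sum_{n\in\mathbb{N}}\beta_s(h_1^n)&\sum_{k=2}^{q-2}\beta_s(h_k)&\sum_{n\in\mathbb{N}}\beta_s(h_{q-1}^n)\\ \sum_{n\in\mathbb{N}}\beta_s(h_1^n)&\sum_{k=2}^{q-2}\beta_s(h_k)&0\end{pmatrix},$$ with $\mathbb{N}=\{1,2,\dots\}$, $\mathbb{N}_0=\mathbb{N}\cup\{0\}$ (empty sums are $0$). **Nuclear of order $0$** is meant in Grothendieck's sense. *)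

(* Defs.v *)
From HB Require Import structures.
From mathcomp Require Import all_boot all_order all_algebra.
From mathcomp Require Import all_classical reals topology normedtype sequences.
From mathcomp Require Import derive exp trigo.
From mathcomp Require Import interval_inference complex.
Set Implicit Arguments.
Unset Strict Implicit.
Unset Printing Implicit Defensive.
Import Order.TTheory GRing.Theory Num.Theory numFieldNormedType.Exports.
Local Open Scope classical_set_scope.
Local Open Scope ring_scope.
Local Open Scope complex_scope.

Local Notation Re := complex.Re.
Local Notation Im := complex.Im.

(* R[i] as a normed module over itself: the library only provides this for
   types declared as numClosedFieldType, through the regular module R[i]^o. *)
HB.instance Definition _ (R : realType) := GRing.ComAlgebra.copy R[i] R[i]^o.
HB.instance Definition _ (R : realType) := Vector.copy R[i] R[i]^o.
HB.instance Definition _ (R : realType) := NormedModule.copy R[i] R[i]^o.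

Section complex_topology.
Variable R : realType.
Implicit Types z w : R[i].

Lemma norm_ReE (V : normedModType R[i]) (v : V) : `|v| = (Re `|v|)%:C.
Proof. by rewrite RRe_real // ger0_real. Qed.

Lemma Re_continuous : continuous (@Re R).
Proof.
move=> z.
apply: (proj2 (@cvgrPdist_lt _ R _ (nbhs z) (nbhs_filter z) (@Re R) (Re z))).
move=> e e0; near=> w.
rewrite -raddfB /= -ltcR; apply: le_lt_trans (normc_ge_Re _) _.
by near: w; apply/nbhs_normP; exists e%:C => //=; rewrite ltcR.
Unshelve. all: by end_near. Qed.

Lemma complex_pair_continuous : continuous (fun p : R * R => p.1 +i* p.2).
Proof.
move=> [x y].
apply: (proj2 (@cvgrPdist_lt _ R[i] _ (nbhs (x, y)) (nbhs_filter (x, y))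
  (fun p : R * R => p.1 +i* p.2) (x +i* y))) => e e0.
have eE : e = (Re e)%:C by rewrite RRe_real // gtr0_real.
have re0 : 0 < Re e / 2 by rewrite divr_gt0 //; move: e0; rewrite {1}eE ltcR.
near=> p.
have -> : (x +i* y) - (p.1 +i* p.2) = (x - p.1)%:C + 'i * (y - p.2)%:C.
  by apply/eqP; rewrite eq_complex /=; simpc; rewrite ?eqxx.
apply: le_lt_trans (ler_normD _ _) _.
rewrite normrM !normc_def /= !expr0n /= !addr0 !add0r !expr1n !sqrtr1.
rewrite !sqrtr_sqr mul1r -rmorphD /= eE ltcR [ltRHS](splitr (Re e)) ltrD //.
- by near: p; apply: (@cvgr_dist_lt _ R) => //; exact: cvg_fst.
- by near: p; apply: (@cvgr_dist_lt _ R) => //; exact: cvg_snd.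
Unshelve. all: by end_near. Qed.

Lemma normc_ge_Im z : `|Im z|%:C <= `|z|.
Proof.
rewrite -[Im z]opprK -ReiNIm normrN; apply: le_trans (normc_ge_Re _) _.
by rewrite normrM [`|'i|]normc_def /= expr0n add0r expr1n sqrtr1 mulr1.
Qed.

Lemma closure_ball_compact z (r : R) : compact (closure (ball z r%:C)).
Proof.
pose I (x : R) : set R := `[x - (r + 1), x + (r + 1)]%classic.
apply: (@subclosed_compact _ _ ((fun p : R * R => p.1 +i* p.2) @`
  (I (Re z) `*` I (Im z)))).
- exact: closed_closure.
- apply: continuous_compact.
    by apply: continuous_subspaceT; exact: complex_pair_continuous.
  by apply: compact_setX; exact: segment_compact.
move=> w /(_ (ball w 1) (nbhsx_ballx _ _ ltr01))[u []].
rewrite -!ball_normE /= => zu wu.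
have zw : `|z - w| < (r + 1)%:C.
  rewrite -(subrK u z) -addrA (le_lt_trans (ler_normD _ _)) // rmorphD /=.
  by rewrite ltrD // distrC.
exists (Re w, Im w); last by case: w {wu zw}.
split; rewrite /I /= in_itv /= -ler_distlC -raddfB /= -lecR.
- by apply: le_trans (normc_ge_Re _) _; rewrite ltW // distrC.
- by apply: le_trans (normc_ge_Im _) _; rewrite ltW // distrC.
Qed.

End complex_topology.

Section hermitian_norm.
Variables (R : realType) (d : nat).
Implicit Types v : 'cV[R[i]]_d.

(* The Hermitian norm; the normed-module structure of 'cV[R[i]]_d in the library
   is the (equivalent) max norm, which has the same topology. *)
Definition hnorm v : R := Re (sqrtC (dotmx v^T v^T)).

Lemma hnormE v : (hnorm v)%:C = sqrtC (dotmx v^T v^T).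
Proof. by rewrite /hnorm RRe_real // ger0_real // sqrt_dnorm_ge0. Qed.

Lemma hnorm_ge0 v : 0 <= hnorm v.
Proof. by rewrite -lecR hnormE sqrt_dnorm_ge0. Qed.

Lemma hnorm_eq0 v : hnorm v = 0 -> v = 0.
Proof.
move=> v0; apply: trmx_inj; rewrite trmx0; apply/eqP.
by rewrite -(sqrt_dnorm_eq0 (@dotmx R[i] d)) -hnormE v0.
Qed.

Lemma ler_hnormD v w : hnorm (v + w) <= hnorm v + hnorm w.
Proof.
have E : (v + w)^T = v^T + w^T by apply/matrixP => i j; rewrite !mxE.
suff : (hnorm (v + w))%:C <= (hnorm v)%:C + (hnorm w)%:C.
  by rewrite -(rmorphD (real_complex R)) lecR.
move: (hnormE v) (hnormE w) (hnormE (v + w)).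
move: (hnorm v) (hnorm w) (hnorm (v + w)) => a b c -> -> ->; rewrite E.
exact: (triangle_lerif (@dotmx R[i] d) v^T w^T).1.
Qed.

Lemma hnormZ a v : (hnorm (a *: v))%:C = `|a| * (hnorm v)%:C.
Proof.
have E : (a *: v)^T = a *: v^T by apply/matrixP => i j; rewrite !mxE.
move: (hnormE v) (hnormE (a *: v)); move: (hnorm v) (hnorm (a *: v)).
move=> b c -> ->; rewrite E dnormZ.
by rewrite sqrtCM ?sqrCK // nnegrE ?exprn_ge0 // dnorm_ge0.
Qed.

Lemma hnorm_le v : (hnorm v)%:C <= d%:R * `|v|.
Proof.
have v_ge0 : 0 <= d%:R * `|v| by rewrite mulr_ge0.
have coord_le i : `|v i 0| <= `|v|.
  apply: (@le_trans _ _ (`|v i 0|%:nng)%:num) => //.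
  rewrite [leRHS]/Num.norm /= mx_normE num_le.
  apply/bigmax_geP; right; exists (i, 0) => //=.
  by rewrite -num_le.
rewrite hnormE -(sqrCK v_ge0) ler_sqrtC ?nnegrE ?exprn_ge0 ?dnorm_ge0 //.
rewrite dotmxE mxE (@le_trans _ _ (\sum_(i < d) `|v| ^+ 2)) //.
  by apply: ler_sum => i _; rewrite !mxE -normCK lerXn2r ?nnegrE.
rewrite sumr_const card_ord exprMn -[_ *+ d]mulr_natl.
apply: ler_wpM2r; first exact: exprn_ge0.
by rewrite -natrX ler_nat -[leqLHS]expn1; case: (d) => // n; exact: leq_pexp2l.
Qed.

End hermitian_norm.

Section Banach_space.
Variable R : realType.

Record disk := Disk {
  center : R[i];
  radius : R;
  radius_gt0 : 0 < radius }.

Definition disk_set (D : disk) : set R[i] := ball (center D) (radius D)%:C.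

Lemma center_closure (D : disk) : closure (disk_set D) (center D).
Proof.
by apply: subset_closure; apply: ballxx; rewrite ltcR; exact: radius_gt0.
Qed.

Variables (D : disk) (d : nat).

(* A continuous function on the closed disk is represented by its extension by
   zero to R[i], so that equality in the space is equality on the closed disk.
   Holomorphy is complex differentiability at each point of the open disk, since
   [derivable] takes its increments in the scalar field R[i]. *)
Definition holo_disk : {pred (R[i] -> 'cV[R[i]]_d)} := fun f =>
  `[< [/\ {within closure (disk_set D), continuous f},
          forall z, disk_set D z -> derivable f z 1 &
          forall z, ~ closure (disk_set D) z -> f z = 0] >].

Lemma holo_disk_submod : submod_closed holo_disk.
Proof.
split.
  apply/asboolP; split => //.
  by apply: continuous_subspaceT => z; exact: cst_continuous.
move=> a f g /asboolP[cf df f0] /asboolP[cg dg g0]; apply/asboolP; split.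
- move=> z; apply: cvgD; last exact: cg.
  by apply: cvgZl_tmp; exact: cf.
- move=> z Dz; apply: derivableD; last exact: dg.
  by apply: derivableZ; exact: df.
- by move=> z nDz; rewrite !fctE f0 // g0 // scaler0 addr0.
Qed.

HB.instance Definition _ := GRing.isSubmodClosed.Build _ _ holo_disk
  holo_disk_submod.

Record holo_space := HoloSpace {
  holo_fun :> R[i] -> 'cV[R[i]]_d;
  holo_funP : holo_fun \in holo_disk }.

HB.instance Definition _ := [isSub for holo_fun].
HB.instance Definition _ := [Choice of holo_space by <:].
HB.instance Definition _ := [SubChoice_isSubLmodule of holo_space by <:].

Implicit Types f g : holo_space.

Definition sup_norm f : R := sup [set hnorm (f z) | z in closure (disk_set D)].

Lemma sup_norm_has_sup f :
  has_sup [set hnorm (f z) | z in closure (disk_set D)].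
Proof.
split.
  by exists (hnorm (f (center D))), (center D) => //; exact: center_closure.
have /asboolP[cf _ _] := holo_funP f.
have cN : continuous (fun v : 'cV[R[i]]_d => Re `|v|).
  move=> v; apply: (continuous_comp (f := fun v : 'cV[R[i]]_d => `|v| : R[i])
    (g := @Re R)).
    exact: norm_continuous.
  exact: Re_continuous.
have : compact ((fun z => Re `|f z|) @` closure (disk_set D)).
  apply: continuous_compact; last exact: closure_ball_compact.
  move=> z; apply: (@continuous_comp (subspace (closure (disk_set D))) _ _ f
    (fun v : 'cV[R[i]]_d => Re `|v|)); first exact: cf.
  exact: cN.
move=> /(@compact_bounded R R)[M [_ MP]].
exists (d%:R * (M + 1)) => _ [z Dz <-].
rewrite -lecR (le_trans (hnorm_le _)) // rmorphM /= rmorph_nat.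
rewrite ler_wpM2l // norm_ReE lecR.
apply: le_trans (ler_norm _) _; apply: (MP (M + 1)); first by rewrite ltrDl.
by exists z.
Qed.

Lemma sup_norm_ge f z : closure (disk_set D) z -> hnorm (f z) <= sup_norm f.
Proof.
by move=> Dz; apply: sup_upper_bound; [exact: sup_norm_has_sup|exists z].
Qed.

Lemma sup_norm_le f (M : R) :
  (forall z, closure (disk_set D) z -> hnorm (f z) <= M) -> sup_norm f <= M.
Proof.
move=> fM; apply: ge_sup; first exact: (sup_norm_has_sup f).1.
by move=> _ [z Dz <-]; exact: fM.
Qed.

Lemma ler_sup_normD f g :
  (sup_norm (f + g))%:C <= (sup_norm f)%:C + (sup_norm g)%:C.
Proof.
rewrite -rmorphD lecR; apply: sup_norm_le => z Dz.
rewrite (le_trans (ler_hnormD _ _)) // lerD //; exact: sup_norm_ge.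
Qed.

Lemma sup_norm_ge0 f : 0 <= sup_norm f.
Proof.
by apply: (le_trans (hnorm_ge0 (f (center D)))); 
apply: sup_norm_ge; exact: center_closure.
Qed.

Lemma sup_normZ (a : R[i]) f : (sup_norm (a *: f))%:C = `|a| * (sup_norm f)%:C.
Proof.
rewrite (norm_ReE a) -(rmorphM (real_complex R)); congr _%:C.
have hZ z : hnorm ((a *: f) z) = Re `|a| * hnorm (f z).
  by apply: complexI; rewrite hnormZ (norm_ReE a) -(rmorphM (real_complex R)).
have a0 : 0 <= Re `|a| by rewrite normc_def /= sqrtr_ge0.
apply/eqP; rewrite eq_le; apply/andP; split.
  by apply: sup_norm_le => z Dz; rewrite hZ ler_wpM2l // sup_norm_ge.
have [->|an0] := eqVneq (Re `|a|) 0; first by rewrite mul0r sup_norm_ge0.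
have ap : 0 < Re `|a| by rewrite lt_neqAle eq_sym an0.
rewrite mulrC -ler_pdivlMr //; apply: sup_norm_le => z Dz.
by rewrite ler_pdivlMr // mulrC -hZ sup_norm_ge.
Qed.

Lemma sup_norm_eq0 f : (sup_norm f)%:C = 0 -> f = 0.
Proof.
move=> /complexI f0; apply/val_inj/funext => z.
change (f z = 0).
have [Dz|nDz] := pselect (closure (disk_set D) z); last first.
  by have /asboolP[_ _ ->] := holo_funP f.
by apply: hnorm_eq0; apply/eqP; rewrite eq_le hnorm_ge0 andbT -f0 sup_norm_ge.
Qed.

HB.instance Definition _ := Lmodule_isNormed.Build R[i] holo_space
  ler_sup_normD sup_normZ sup_norm_eq0.

End Banach_space.

Section operators.
Variables (R : realType) (X : normedModType R[i]).
Implicit Types A : {linear X -> X}.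

(* Grothendieck: A is p-summable if A = \sum_n lam_n phi_n(.) e_n with
   ||phi_n||, ||e_n|| <= 1 and \sum_n |lam_n|^p < +oo; its order is the infimum
   of such p, so order 0 means p-summability for every p in ]0, 1]. *)
Definition p_summable_op (p : R) A : Prop :=
  exists (lam : nat -> R[i]) (phi : nat -> {scalar X}) (e : nat -> X),
    [/\ forall n x, `|phi n x| <= `|x|,
        forall n, `|e n| <= 1,
        cvgn (series (fun n => Re `|lam n| `^ p)) &
        forall x, series (fun n => (lam n * phi n x) *: e n) @ \oo --> A x].

Definition nuclear_order0 A : Prop :=
  forall p : R, 0 < p -> p <= 1 -> p_summable_op p A.

Definition rank_le (m : nat) A : Prop :=
  exists e : 'I_m -> X, forall x, exists c : 'I_m -> R[i],
    A x = \sum_(i < m) c i *: e i.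

(* Operator families, with respect to the operator norm.  Continuity of a linear
   map is its boundedness (linear_bounded_continuous). *)
Implicit Types (F G : R[i] -> {linear X -> X}) (U : set R[i]) (s : R[i]).

Definition op_derivable F s : Prop :=
  exists2 D : {linear X -> X}, continuous D &
    forall e : R, 0 < e -> \forall h \near (0 : R[i])^',
      forall x, `|h^-1 *: (F (s + h) x - F s x) - D x| <= e%:C * `|x|.

Definition op_holomorphic U F : Prop :=
  open U /\ forall s, U s -> continuous (F s) /\ op_derivable F s.

Definition pole_of_order (m : nat) F s0 : Prop :=
  exists U G, [/\ U s0, op_holomorphic U G, exists x, G s0 x <> 0 &
    forall s x, U s -> s != s0 -> F s x = (s - s0) ^- m *: G s x].

Definition is_pole F s0 : Prop :=
  exists2 m : nat, (0 < m)%N & pole_of_order m F s0.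

(* The value of F at a pole is irrelevant. *)
Definition op_meromorphic F : Prop :=
  forall s0, (exists2 U, U s0 & op_holomorphic U F) \/ is_pole F s0.

End operators.

Section complex_functions.
Variable R : realType.

(* Principal branches: carg takes its values in ]-pi, pi] on z != 0. *)
Definition cexp (z : R[i]) : R[i] :=
  (expR (Re z))%:C * (cos (Im z) +i* sin (Im z)).

Definition carg (z : R[i]) : R :=
  let t := acos (Re z / Re `|z|) in if 0 <= Im z then t else - t.

Definition clog (z : R[i]) : R[i] := ln (Re `|z|) +i* carg z.

Definition cpow (z w : R[i]) : R[i] := cexp (w * clog z).

Lemma clog_gt0 (r : R) : 0 < r -> clog r%:C = (ln r)%:C.
Proof.
move=> r0; have nE : Re `|r%:C| = r.
  by rewrite normc_def /= expr0n addr0 sqrtr_sqr ger0_norm // ltW.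
rewrite /clog /carg nE /= lexx divff ?gt_eqF // acos1.
by [].
Qed.

End complex_functions.

Section Hecke.
Variable R : realType.

Definition mat2 (a b c d : R) : 'M[R]_2 :=
  \matrix_(i < 2, j < 2)
    (if i == 0 then if j == 0 then a else b else if j == 0 then c else d).

Definition mobius_den (g : 'M[R]_2) (z : R[i]) : R[i] :=
  (g 1 0)%:C * z + (g 1 1)%:C.

Definition mobius (g : 'M[R]_2) (z : R[i]) : R[i] :=
  ((g 0 0)%:C * z + (g 0 1)%:C) / mobius_den g z.

(* The condition on the denominator says that no point is sent to infinity. *)
Definition mobius_maps (g : 'M[R]_2) (A B : set R[i]) : Prop :=
  forall z, A z -> mobius_den g z != 0 /\ B (mobius g z).

Variable q : nat.

Definition lambda : R := 2 * cos (pi / q%:R).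

Definition matS : 'M[R]_2 := mat2 0 1 (- 1) 0.
Definition matT : 'M[R]_2 := mat2 1 lambda 0 1.

(* Elements of PSL_2(R) are represented by their two matrices g and - g.  As
   matS * matS = - 1, [Gamma] is the full preimage of the Hecke group in
   SL_2(R); a map on the Hecke group is a map on [Gamma] invariant by
   g |-> - g. *)
Inductive Gamma : 'M[R]_2 -> Prop :=
| Gamma_S : Gamma matS
| Gamma_T : Gamma matT
| Gamma_1 : Gamma 1
| Gamma_M g h : Gamma g -> Gamma h -> Gamma (g * h)
| Gamma_V g : Gamma g -> Gamma g^-1.

Definition gelt (k : int) : 'M[R]_2 := ((matT * matS) ^ k * matS)^-1.

Definition calT : 'M[R]_2 := (Num.sqrt 2)^-1 *: mat2 1 (- 1) 1 1.

Definition Lambda (h : 'M[R]_2) : Prop := Gamma (calT^-1 * h * calT).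

Definition helt (k : int) : 'M[R]_2 := calT * gelt k * calT^-1.

Definition parabolic (h : 'M[R]_2) : Prop :=
  [/\ h <> 1, h <> - 1 & `|\tr h| = 2].

Definition xlam : R := (lambda - 1) / (lambda + 1).

(* For q = 3 the interval E_r is empty. *)
Record admissible_disks (E1 Er Eq : disk R) : Prop := AdmissibleDisks {
  adm_E1 : closure [set x%:C | x in `]xlam, 1[%classic] `<=` disk_set E1;
  adm_Er : closure [set x%:C | x in `](- xlam), xlam[%classic]
    `<=` disk_set Er;
  adm_Eq : closure [set x%:C | x in `](- 1), (- xlam)[%classic]
    `<=` disk_set Eq;
  adm_J_Er : [set - conjc z | z in disk_set Er] = disk_set Er;
  adm_J_E1 : [set - conjc z | z in disk_set E1] = disk_set Eq;
  adm_middle : forall k : nat, (2 <= k <= q - 2)%N ->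
    [/\ mobius_maps (helt k)^-1 (closure (disk_set E1)) (disk_set Er),
        mobius_maps (helt k)^-1 (closure (disk_set Er)) (disk_set Er) &
        mobius_maps (helt k)^-1 (closure (disk_set Eq)) (disk_set Er)];
  adm_cusp1 : forall n : nat, (0 < n)%N ->
    mobius_maps (helt 1 ^- n) (closure (disk_set Er)) (disk_set E1) /\
    mobius_maps (helt 1 ^- n) (closure (disk_set Eq)) (disk_set E1);
  adm_cuspq : forall n : nat, (0 < n)%N ->
    mobius_maps (helt (q - 1)%N ^- n) (closure (disk_set E1)) (disk_set Eq) /\
    mobius_maps (helt (q - 1)%N ^- n) (closure (disk_set Er)) (disk_set Eq);
  adm_Re_E1 : forall z, closure (disk_set E1) z -> - 1 < Re z;
  adm_Re_Eq : forall z, closure (disk_set Eq) z -> Re z < 1;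
  adm_Re_Er : forall z, closure (disk_set Er) z -> - 1 < Re z < 1 }.

(* j_s(g, .) on a disk, where x0 is a real base point (see x_1, x_r, x_q, the
   midpoints of the intervals E_1, E_r, E_{q-1}): the extension of
   x |-> ((c x + d)^-2)^s is (e (c z + d))^(- 2 s) for the principal branch,
   the sign e being such that e (c x0 + d) > 0 (see jfactorE).  It is unchanged
   by g |-> - g.  For z on the disk, e (c z + d) avoids ]-oo, 0] since c z + d
   has no zero there.  For g = h_1^(- n) and g = h_{q-1}^(- n) this is
   ((n lambda (1 - z) + 2) / 2)^(- 2 s) and
   ((n lambda (1 + z) + 2) / 2)^(- 2 s). *)
Definition jfactor (x0 : R) (s : R[i]) (g : 'M[R]_2) (z : R[i]) : R[i] :=
  cpow ((Num.sg (g 1 0 * x0 + g 1 1))%:C * mobius_den g z) (- 2 * s).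

Definition x_1 : R := lambda / (lambda + 1).
Definition x_r : R := 0.
Definition x_q : R := - (lambda / (lambda + 1)).

Lemma jfactorE (x0 : R) (s : R[i]) (g : 'M[R]_2) (x : R) :
  let y := g 1 0 * x + g 1 1 in
  0 < Num.sg (g 1 0 * x0 + g 1 1) * y ->
  jfactor x0 s g x%:C = cpow (y ^- 2)%:C s.
Proof.
move=> y; set e := Num.sg _ => ey_gt0.
have yN0 : y != 0 by apply: contraTneq ey_gt0 => ->; rewrite mulr0 ltxx.
have eyE : e * y = `|y|.
  have : `|e * y| = `|y|.
    rewrite normrM normr_sg; case: eqP => [E|_]; last by rewrite mul1r.
    by move: ey_gt0; rewrite /e E sgr0 mul0r ltxx.
  by rewrite ger0_norm // ltW.
have -> : jfactor x0 s g x%:C = cpow (`|y|)%:C (- 2 * s).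
  by rewrite -eyE rmorphM /= rmorphD rmorphM.
have y2E : y ^- 2 = (`|y| ^+ 2)^-1 by rewrite real_normK // num_real.
rewrite /cpow y2E !clog_gt0 ?invr_gt0 ?exprn_gt0 ?normr_gt0 //.
rewrite lnV ?posrE ?exprn_gt0 ?normr_gt0 // lnXn ?normr_gt0 //.
congr cexp; rewrite rmorphN rmorphMn !mulNr mulrN; congr (- _).
by rewrite -[in RHS]mulr_natl mulrCA mulrA.
Qed.

Variables (d : nat) (chi : 'M[R]_2 -> 'M[R[i]]_d).

(* V = C^d, by the choice of an orthonormal basis. *)
Record unitary_rep : Prop := UnitaryRep {
  rep_unitary : forall g, Gamma g -> chi g \is unitarymx;
  rep_1 : chi 1 = 1%:M;
  rep_M : forall g h, Gamma g -> Gamma h -> chi (g * h) = chi g *m chi h;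
  rep_N : forall g, Gamma g -> chi (- g) = chi g }.

Definition eta (h : 'M[R]_2) : 'M[R[i]]_d := chi (calT^-1 * h * calT).

(* cokermx: the column kernel, as matrices act on column vectors. *)
Definition dim_fix (h : 'M[R]_2) : nat := \rank (cokermx (eta h - 1%:M)).

Definition sd : nat :=
  \max_(m < d.+1 |
    `[< exists p, [/\ Lambda p, parabolic p & dim_fix p = m] >]) m.

Definition beta (x0 : R) (s : R[i]) (h : 'M[R]_2) (f : R[i] -> 'cV[R[i]]_d)
    (z : R[i]) : 'cV[R[i]]_d :=
  jfactor x0 s h^-1 z *: (eta h^-1 *m f (mobius h^-1 z)).

Definition mid_sum x0 s f z : 'cV[R[i]]_d :=
  \sum_(2 <= k < q - 1) beta x0 s (helt k) f z.

Definition cusp_series x0 s h f z : nat -> 'cV[R[i]]_d :=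
  series (fun n => beta x0 s (h ^+ n.+1) f z).

Definition cusp_sum x0 s h f z : 'cV[R[i]]_d := limn (cusp_series x0 s h f z).

Variables E1 Er Eq : disk R.

(* Direct sum with the max norm. *)
Definition BE : normedModType R[i] :=
  (holo_space E1 d * holo_space Er d * holo_space Eq d)%type.

Definition is_transfer_op (s : R[i]) (L : {linear BE -> BE}) : Prop :=
  let h_1 := helt 1 in let h_q := helt (q - 1)%N in
  forall f : BE, let: (f_1, f_r, f_q) := f in let: (g_1, g_r, g_q) := L f in
  [/\ forall z, closure (disk_set E1) z ->
        cvgn (cusp_series x_1 s h_q f_q z) /\
        g_1 z = mid_sum x_1 s f_r z + cusp_sum x_1 s h_q f_q z,
      forall z, closure (disk_set Er) z ->
        [/\ cvgn (cusp_series x_r s h_1 f_1 z),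
            cvgn (cusp_series x_r s h_q f_q z) &
            g_r z = cusp_sum x_r s h_1 f_1 z + mid_sum x_r s f_r z
                    + cusp_sum x_r s h_q f_q z] &
      forall z, closure (disk_set Eq) z ->
        cvgn (cusp_series x_q s h_1 f_1 z) /\
        g_q z = cusp_sum x_q s h_1 f_1 z + mid_sum x_q s f_r z].

End Hecke.

(* Main.v *)
Require Import Defs.
From HB Require Import structures.
From mathcomp Require Import all_boot all_order all_algebra.
From mathcomp Require Import all_classical reals topology normedtype sequences.
From mathcomp Require Import derive exp trigo.
From mathcomp Require Import interval_inference complex.
From mathcomp Require Import ring lra.
Set Implicit Arguments.
Unset Strict Implicit.
Unset Printing Implicit Defensive.
Import Order.TTheory GRing.Theory Num.Theory numFieldNormedType.Exports.
Local Open Scope classical_set_scope.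
Local Open Scope ring_scope.
Local Open Scope complex_scope.

(* Conjugated to the coordinate w = (2 / lambda) / (1 - z), respectively
   (2 / lambda) / (1 + z), the parabolic elements h_1 and h_{q-1} act by w + 1,
   and after diagonalizing eta(h^-1) each coordinate of a cusp sum is
   sum_n u^n (n + w)^(-2 s) F(1 / (n + w)) with |u| = 1 and F holomorphic at 0.
   Up to finitely many terms this is continued to Re(2 s) > 2 - k by peeling off
   k Taylor coefficients of F: for u <> 1 this creates no pole, while for u = 1
   the l-th coefficient contributes a multiple of (2 s + l - 1)^-1, of rank one.
   Hence each of the four cusp entries has residues of rank at most the number of
   eigenvalues u = 1, which is at most sd(eta).  These residues vanish either all
   or not at all, and in the second case a function supported on one disk, with
   F(y) = y^l, shows that the pole is really there.  Nuclearity and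
   holomorphy in s follow from Cauchy estimates, since all entries only use the
   values of f on strictly smaller concentric disks. *)

(** * The modulus as a real number, open to real arithmetic *)

Section modulus.
Variable R : realType.
Implicit Types z w : R[i].

(** The cusps 1 and -1 are endpoints of E_1 and E_{q-1}, hence interior points of the open disks:
    this is where the Taylor coefficients of F come from. They describe f only near the cusp, so a
    fixed number N of terms is kept as plain compositions with f, and peeling is applied to the
    rest, where |1 / (n + w)| is at most half the radius [dl] of the coefficient bound. Each peeling
    subtracts a multiple of a function E with E(0) = 1 for which u^n (n + w)^(-s) E(1 / (n + w)) is
    an exact difference. Hence only elementary functions occur, and continuations with different k
    agree by an identity, not by uniqueness of continuation. The shape of the statement forces the
    discussion of vanishing residues: at each point the family must either be holomorphic, its value
    there included, or have a true pole. A removable singularity at a candidate 2 s + l = 1 could be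
    neither, because the value chosen there is arbitrary. The passage from scalar formulas to
    operators is made once, in [kernel_op]: linearity, holomorphy in z and in s, and one locally
    uniform bound are all that is needed. *)

Definition nm (z : R[i]) : R := complex.Re `|z|.

Lemma nmE z : `|z| = (nm z)%:C. Proof. by rewrite /nm RRe_real // ger0_real. Qed.

Lemma nm_ge0 z : 0 <= nm z. Proof. by rewrite -lecR -nmE rmorph0 normr_ge0. Qed.

Lemma nm0 : nm 0 = 0. Proof. by rewrite /nm normr0. Qed.

Lemma nm1 : nm 1 = 1. Proof. by rewrite /nm normr1. Qed.

Lemma nm_eq0 z : (nm z == 0) = (z == 0).
Proof. by rewrite -(inj_eq (@complexI R)) -nmE normr_eq0. Qed.

Lemma nm_gt0 z : (0 < nm z) = (z != 0).
Proof. by rewrite lt_neqAle nm_ge0 andbT eq_sym nm_eq0. Qed.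

Lemma nmM z w : nm (z * w) = nm z * nm w.
Proof. by apply: (@complexI R); rewrite rmorphM /= -!nmE normrM. Qed.

Lemma nmV z : nm z^-1 = (nm z)^-1.
Proof. by apply: (@complexI R); rewrite fmorphV /= -!nmE normfV. Qed.

Lemma nmX z n : nm (z ^+ n) = nm z ^+ n.
Proof. by elim: n => [|n IH]; rewrite ?expr0 ?nm1 // !exprS nmM IH. Qed.

Lemma nmN z : nm (- z) = nm z. Proof. by rewrite /nm normrN. Qed.

Lemma nmB z w : nm (z - w) = nm (w - z). Proof. by rewrite -nmN opprB. Qed.

Lemma nmD z w : nm (z + w) <= nm z + nm w.
Proof. by rewrite -lecR rmorphD /= -!nmE ler_normD. Qed.

Lemma nmBD z w : nm (z - w) <= nm z + nm w.
Proof. by rewrite (le_trans (nmD _ _)) // nmN. Qed.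

Lemma nm_tri z w u : nm (z - u) <= nm (z - w) + nm (w - u).
Proof. by rewrite (le_trans _ (nmD _ _)) // subrKA. Qed.

Lemma nmDB z w : nm z - nm w <= nm (z + w).
Proof. by have := nmD (z + w) (- w); rewrite addrK nmN; lra. Qed.

Lemma nmR (x : R) : nm x%:C = `|x|.
Proof. by rewrite /nm normc_def /= expr0n addr0 sqrtr_sqr. Qed.

Lemma nmRp (x : R) : 0 <= x -> nm x%:C = x.
Proof. by move=> x0; rewrite nmR ger0_norm. Qed.

Lemma nmn (n : nat) : nm (n%:R) = n%:R.
Proof. by rewrite -(rmorph_nat (real_complex R)) nmRp. Qed.

Lemma nmi : nm 'i = 1.
Proof. by rewrite /nm normc_def /= expr0n add0r expr1n sqrtr1. Qed.

Lemma nmsqr z : nm z ^+ 2 = complex.Re z ^+ 2 + complex.Im z ^+ 2.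
Proof. by rewrite /nm normc_def /= sqr_sqrtr // addr_ge0 // sqr_ge0. Qed.

Lemma nm_Re z : `|complex.Re z| <= nm z.
Proof. by rewrite -lecR -nmE normc_ge_Re. Qed.

Lemma nm_Im z : `|complex.Im z| <= nm z.
Proof. by rewrite -lecR -nmE normc_ge_Im. Qed.

Lemma Re_le_nm z : complex.Re z <= nm z.
Proof. exact: le_trans (ler_norm _) (nm_Re z). Qed.

Lemma complexRI z : z = (complex.Re z)%:C + 'i * (complex.Im z)%:C.
Proof. by case: z => a b; simpc. Qed.

Lemma nm_ReIm z : nm z <= `|complex.Re z| + `|complex.Im z|.
Proof.
rewrite {1}(complexRI z) (le_trans (nmD _ _)) // nmM nmi mul1r !nmR.
exact: lexx.
Qed.

Lemma nm_sum (I : Type) (r : seq I) (P : pred I) (F : I -> R[i]) :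
  nm (\sum_(i <- r | P i) F i) <= \sum_(i <- r | P i) nm (F i).
Proof.
elim/big_rec2 : _ => [|i y z _ H]; first by rewrite nm0.
by rewrite (le_trans (nmD _ _)) // lerD2l.
Qed.

Lemma nm_le0 z : nm z <= 0 -> z = 0.
Proof. by move=> H; apply/eqP; rewrite -nm_eq0 eq_le H nm_ge0. Qed.

(** Turns estimates into equalities: uniqueness of limits and of derivatives and the vanishing of
    integrals are all obtained this way, with any fixed K in front of the error. *)
Lemma nm_small z (K : R) : (forall e : R, 0 < e -> nm z <= e * K) -> z = 0.
Proof.
move=> H; apply: nm_le0; rewrite leNgt; apply/negP => z0.
have K1 : 0 < `|K| + 1 by rewrite ltr_wpDl.
have := H (nm z / 2 / (`|K| + 1)); rewrite !divr_gt0 // => /(_ isT).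
have : nm z / 2 / (`|K| + 1) * K <= nm z / 2.
  rewrite -mulrA ler_piMr ?divr_ge0 ?nm_ge0 // mulrC ler_pdivrMr // mul1r.
  by rewrite (le_trans (ler_norm _)) // lerDl.
lra.
Qed.
End modulus.

(** * Continuity and complex derivatives at a point *)

Section continuity.
Variable R : realType.
Implicit Types (z w l : R[i]) (f g : R[i] -> R[i]).

Definition cts f z := forall e : R, 0 < e ->
  exists2 d : R, 0 < d & forall h, nm h < d -> nm (f (z + h) - f z) <= e.

Lemma cts_cst l z : cts (fun=> l) z.
Proof. by move=> e e0; exists 1 => // h _; rewrite subrr nm0 ltW. Qed.

Lemma cts_id z : cts id z.
Proof. by move=> e e0; exists e => // h he; rewrite addrAC subrr add0r ltW. Qed.

Lemma cts_comp f g z : cts f z -> cts g (f z) -> cts (fun x => g (f x)) z.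
Proof.
move=> cf cg e e0; have [d d0 dP] := cg e e0.
have [d' d'0 d'P] := cf (d / 2) ltac:(lra); exists d' => // h /d'P hd.
have := dP (f (z + h) - f z); rewrite [f z + _]addrC subrK; apply; lra.
Qed.

Lemma ctsD f g z : cts f z -> cts g z -> cts (fun x => f x + g x) z.
Proof.
move=> cf cg e e0; have [d d0 dP] := cf (e / 2) ltac:(lra).
have [d' d'0 d'P] := cg (e / 2) ltac:(lra).
exists (Num.min d d'); first by rewrite lt_min d0.
move=> h; rewrite lt_min => /andP[/dP h1 /d'P h2].
by rewrite opprD addrACA (le_trans (nmD _ _)) //; lra.
Qed.

Lemma ctsM f g z : cts f z -> cts g z -> cts (fun x => f x * g x) z.
Proof.
move=> cf cg e e0; set a := nm (f z); set b := nm (g z).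
have a0 : 0 <= a by exact: nm_ge0.
have b0 : 0 <= b by exact: nm_ge0.
(* Expanding both factors around z leaves an error of at most e' (e' + a + b). *)
pose e' := Num.min 1 (e / (a + b + 1)).
have e'0 : 0 < e' by rewrite lt_min ltr01 divr_gt0 //; lra.
have [d d0 dP] := cf e' e'0; have [d' d'0 d'P] := cg e' e'0.
exists (Num.min d d'); first by rewrite lt_min d0.
move=> h; rewrite lt_min => /andP[/dP h1 /d'P h2].
have -> : f (z + h) * g (z + h) - f z * g z =
  (f (z + h) - f z) * (g (z + h) - g z) + (f (z + h) - f z) * g z
  + f z * (g (z + h) - g z) by ring.
have e1 : e' <= 1 by rewrite ge_min lexx.
have e2 : e' * (a + b + 1) <= e.
  by rewrite -ler_pdivlMr ?ge_min ?lexx ?orbT //; lra.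
have := nmD ((f (z + h) - f z) * (g (z + h) - g z) + (f (z + h) - f z) * g z)
  (f z * (g (z + h) - g z)).
have := nmD ((f (z + h) - f z) * (g (z + h) - g z)) ((f (z + h) - f z) * g z).
rewrite !nmM -/a -/b.
have := nm_ge0 (f (z + h) - f z); have := nm_ge0 (g (z + h) - g z).
move: h1 h2; set u := nm (f _ - _); set v := nm (g _ - _) => *; nra.
Qed.

Lemma cts_inv z : z != 0 -> cts (fun x => x^-1) z.
Proof.
rewrite -nm_gt0 => z0 e e0; pose m := nm z.
exists (Num.min (m / 2) (e * m ^+ 2 / 2)).
  by rewrite lt_min !divr_gt0 // mulr_gt0 // exprn_gt0.
move=> h; rewrite lt_min => /andP[h1 h2].
have zh : m / 2 <= nm (z + h) by have := nmDB z h; rewrite -/m; lra.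
have zh0 : z + h != 0 by rewrite -nm_gt0; rewrite /m in zh; lra.
have zn0 : z != 0 by rewrite -nm_gt0.
have -> : (z + h)^-1 - z^-1 = - h * ((z + h)^-1 * z^-1) by field; rewrite zn0.
rewrite !nmM nmN !nmV mulrA -/m.
have m0 : 0 < m by [].
rewrite ler_pdivrMr // ler_pdivrMr; last by lra.
have := ler_wpM2l (mulr_ge0 (ltW e0) (ltW m0)) zh; move: h2; rewrite expr2; lra.
Qed.

Lemma ctsV f z : cts f z -> f z != 0 -> cts (fun x => (f x)^-1) z.
Proof. by move=> cf fz; apply: cts_comp cf _; exact: cts_inv. Qed.

Lemma ctsN f z : cts f z -> cts (fun x => - f x) z.
Proof.
move=> cf; have -> : (fun x => - f x) = (fun x => -1 * f x).
  by apply/funext => x; rewrite mulN1r.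
by apply: ctsM cf; exact: cts_cst.
Qed.

Lemma ctsB f g z : cts f z -> cts g z -> cts (fun x => f x - g x) z.
Proof. by move=> cf cg; apply: ctsD cf _; exact: ctsN. Qed.

Lemma cts_near f g z (r : R) : 0 < r ->
  (forall x, nm (x - z) < r -> f x = g x) -> cts f z -> cts g z.
Proof.
move=> r0 fg cf e e0; have [d d0 dP] := cf e e0.
exists (Num.min r d); first by rewrite lt_min r0.
move=> h; rewrite lt_min => /andP[h1 /dP].
by rewrite !fg ?subrr ?nm0 // addrAC subrr add0r.
Qed.
End continuity.

Section derivative.
Variable R : realType.
Implicit Types (z w l : R[i]) (f g : R[i] -> R[i]).

(** The derivative without a quotient, so that h = 0 needs no exception. *)
Definition hd f z l := forall e : R, 0 < e -> exists2 d : R, 0 < d &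
  forall h, nm h < d -> nm (f (z + h) - f z - l * h) <= e * nm h.

Definition cdiff f z := exists l, hd f z l.

(** Caratheodory's form of the derivative: a slope function [phi] continuous at 0. It makes the
    product, chain and inverse rules algebraic identities between slopes. *)
Lemma hdP f z l : hd f z l <-> exists phi,
  [/\ cts phi 0, phi 0 = l & forall h, f (z + h) = f z + phi h * h].
Proof.
split=> [fl|[phi [cphi phi0 fE]] e e0].
  exists (fun h => if h == 0 then l else (f (z + h) - f z) / h); split.
  - move=> e e0; have [d d0 dP] := fl e e0; exists d => // h hd.
    rewrite add0r eqxx; case: eqVneq => [_|h0]; first by rewrite subrr nm0 ltW.
    have := dP h hd; rewrite -ler_pdivrMr ?nm_gt0 // -nmV -nmM mulrBl mulfK //.
  - by rewrite eqxx.
  - move=> h; case: eqVneq => [->|h0]; first by rewrite mulr0 !addr0.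
    by rewrite divfK // [RHS]addrC subrK.
have [d d0 dP] := cphi e e0; exists d => // h hd; rewrite fE.
have -> : f z + phi h * h - f z - l * h = (phi h - l) * h by ring.
rewrite nmM ler_wpM2r ?nm_ge0 //.
by have := dP h hd; rewrite add0r phi0.
Qed.

Lemma hd_cts f z l : hd f z l -> cts f z.
Proof.
move=> /hdP[phi [cphi _ fE]].
have : cts (fun h => f z + phi h * h) 0.
  by apply: ctsD; [exact: cts_cst|apply: ctsM => //; exact: cts_id].
by move=> H e /H[d d0 dP]; exists d => // h /dP; rewrite mulr0 addr0 add0r -fE.
Qed.

Lemma hd_cst l z : hd (fun=> l) z 0.
Proof. by move=> e e0; exists 1 => // h _; rewrite /= subrr mul0r subrr nm0 mulr_ge0 ?nm_ge0 // ltW. Qed.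

Lemma hd_id z : hd id z 1.
Proof. by move=> e e0; exists 1 => // h _; rewrite /= mul1r [z + h]addrC addrK subrr nm0 mulr_ge0 ?nm_ge0 // ltW. Qed.

Lemma hdD f g z l m : hd f z l -> hd g z m -> hd (fun x => f x + g x) z (l + m).
Proof.
move=> /hdP[p [cp <- fE]] /hdP[q [cq <- gE]]; apply/hdP.
exists (fun h => p h + q h); split=> //; first exact: ctsD.
by move=> h; rewrite fE gE; ring.
Qed.

Lemma hdM f g z l m :
  hd f z l -> hd g z m -> hd (fun x => f x * g x) z (l * g z + f z * m).
Proof.
move=> fl gm; have cg := hd_cts gm.
move: fl gm => /hdP[p [cp <- fE]] /hdP[q [cq <- gE]]; apply/hdP.
exists (fun h => p h * g (z + h) + f z * q h); split=> //.
- apply: ctsD; last by apply: ctsM => //; exact: cts_cst.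
  apply: ctsM => // e /cg[d d0 dP]; exists d => // h /dP.
  by rewrite add0r addr0.
- by rewrite addr0.
- by move=> h; rewrite fE gE; ring.
Qed.

Lemma hd_comp f g z l m :
  hd f z l -> hd g (f z) m -> hd (fun x => g (f x)) z (m * l).
Proof.
move=> /hdP[p [cp <- fE]] /hdP[q [cq <- gE]]; apply/hdP.
exists (fun h => q (p h * h) * p h); split=> //.
- apply: ctsM => //.
  have c : cts (fun h => p h * h) 0 by apply: ctsM => //; exact: cts_id.
  by apply: cts_comp c _; rewrite mulr0.
- by rewrite mulr0.
- by move=> h; rewrite fE gE mulrA.
Qed.

Lemma hd_inv z : z != 0 -> hd (fun x => x^-1) z (- z ^- 2).
Proof.
move=> z0; apply: (proj2 (hdP _ _ _)).
(* At h = - z the inverse takes the value 0 by convention, and the slope is set accordingly;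
   continuity only looks at h near 0. *)
exists (fun h => if z + h == 0 then - h^-1 * z^-1 else - (z^-1 * (z + h)^-1)); split.
- have c : cts (fun h => - (z^-1 * (z + h)^-1)) 0.
    apply: ctsN; apply: ctsM; first exact: cts_cst.
    apply: ctsV; last by rewrite addr0.
    by apply: ctsD; [exact: cts_cst|exact: cts_id].
  apply: cts_near c; first by rewrite -nm_gt0 in z0; exact: z0.
  move=> x; rewrite subr0 => xz; case: eqP => // /eqP.
  by rewrite addrC addr_eq0 => /eqP E; rewrite E nmN ltxx in xz.
- by rewrite addr0 (negbTE z0) expr2 invfM.
- move=> h; have [E|E] := eqVneq (z + h) 0; last by field; rewrite E.
  rewrite E invr0; have h0 : h != 0.
    by apply: contra_neq z0 => h0; rewrite h0 addr0 in E.
  by field; rewrite z0.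
Qed.

Lemma hd_near f g z l (r : R) : 0 < r ->
  (forall x, nm (x - z) < r -> f x = g x) -> hd f z l -> hd g z l.
Proof.
move=> r0 fg cf e e0; have [d d0 dP] := cf e e0.
exists (Num.min r d); first by rewrite lt_min r0.
move=> h; rewrite lt_min => /andP[h1 /dP].
by rewrite !fg ?subrr ?nm0 // addrAC subrr add0r.
Qed.

Lemma hd_unique f z l m : hd f z l -> hd f z m -> l = m.
Proof.
move=> fl fm; apply/eqP; rewrite -subr_eq0; apply/eqP.
apply: (@nm_small R _ 2) => e e0.
have [d d0 dP] := fl e e0; have [d' d'0 d'P] := fm e e0.
pose h : R[i] := ((Num.min d d') / 2)%:C.
have m0 : 0 < Num.min d d' by rewrite lt_min d0.
have hE : nm h = Num.min d d' / 2 by rewrite nmRp //; lra.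
have h1 : nm h < d.
  by apply: (@lt_le_trans _ _ (Num.min d d')); [lra|rewrite ge_min lexx].
have h2 : nm h < d'.
  by apply: (@lt_le_trans _ _ (Num.min d d')); [lra|rewrite ge_min lexx orbT].
have hp : 0 < nm h by rewrite hE; lra.
rewrite -(ler_pM2r hp) -nmM.
have -> : (l - m) * h = (f (z + h) - f z - m * h) - (f (z + h) - f z - l * h) by ring.
apply: le_trans (nmBD _ _) _; have := dP h h1; have := d'P h h2; lra.
Qed.

Lemma cdiff_cts f z : cdiff f z -> cts f z.
Proof. by move=> [l /hd_cts]. Qed.

Lemma cdiff_cst l z : cdiff (fun=> l) z.
Proof. by exists 0; exact: hd_cst. Qed.

Lemma cdiff_id z : cdiff id z. Proof. by exists 1; exact: hd_id. Qed.

Lemma cdiffD f g z : cdiff f z -> cdiff g z -> cdiff (fun x => f x + g x) z.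
Proof. by move=> [l fl] [m gm]; exists (l + m); exact: hdD. Qed.

Lemma cdiffM f g z : cdiff f z -> cdiff g z -> cdiff (fun x => f x * g x) z.
Proof. by move=> [l fl] [m gm]; exists (l * g z + f z * m); exact: hdM. Qed.

Lemma cdiffN f z : cdiff f z -> cdiff (fun x => - f x) z.
Proof.
move=> cf; have -> : (fun x => - f x) = (fun x => -1 * f x).
  by apply/funext => x; rewrite mulN1r.
by apply: cdiffM cf; exact: cdiff_cst.
Qed.

Lemma cdiffB f g z : cdiff f z -> cdiff g z -> cdiff (fun x => f x - g x) z.
Proof. by move=> cf cg; apply: cdiffD cf _; exact: cdiffN. Qed.

Lemma cdiff_comp f g z :
  cdiff f z -> cdiff g (f z) -> cdiff (fun x => g (f x)) z.
Proof. by move=> [l fl] [m gm]; exists (m * l); exact: hd_comp. Qed.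

Lemma cdiffV f z : cdiff f z -> f z != 0 -> cdiff (fun x => (f x)^-1) z.
Proof.
by move=> cf fz; apply: cdiff_comp cf _; exists (- f z ^- 2); exact: hd_inv.
Qed.

Lemma cdiffX f z n : cdiff f z -> cdiff (fun x => f x ^+ n) z.
Proof.
move=> cf; elim: n => [|n IH]; first exact: cdiff_cst.
have -> : (fun x => f x ^+ n.+1) = (fun x => f x * f x ^+ n).
  by apply/funext => x; rewrite exprS.
exact: cdiffM.
Qed.

Lemma cdiff_sum (I : Type) (r : seq I) (P : pred I) (F : I -> R[i] -> R[i]) z :
  (forall i, P i -> cdiff (F i) z) -> cdiff (fun x => \sum_(i <- r | P i) F i x) z.
Proof.
move=> H; elim: r => [|i r IH].
  have -> : (fun x => \sum_(i <- [::] | P i) F i x) = (fun=> 0).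
    by apply/funext => x; rewrite big_nil.
  exact: cdiff_cst.
have -> : (fun x => \sum_(j <- i :: r | P j) F j x) = (fun x =>
    (if P i then F i x else 0) + \sum_(j <- r | P j) F j x).
  by apply/funext => x; rewrite big_cons; case: ifP => // _; rewrite add0r.
by apply: cdiffD => //; case Pi: (P i); [exact: H|exact: cdiff_cst].
Qed.

Lemma cdiff_near f g z (r : R) : 0 < r ->
  (forall x, nm (x - z) < r -> f x = g x) -> cdiff f z -> cdiff g z.
Proof. by move=> r0 fg [l fl]; exists l; exact: hd_near r0 fg fl. Qed.
End derivative.

(** * Limits of sequences, absolute convergence, geometric decay *)

Section sequences.
Variable R : realType.
Implicit Types (u v : nat -> R[i]) (l m : R[i]).

Definition cvs u l := forall e : R, 0 < e ->
  exists N, forall n, (N <= n)%N -> nm (u n - l) <= e.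

Definition lims u : R[i] := xget 0 [set l | cvs u l].

Lemma cvs_unique u l m : cvs u l -> cvs u m -> l = m.
Proof.
move=> ul um; apply/eqP; rewrite -subr_eq0; apply/eqP.
apply: (@nm_small R _ 2) => e e0.
have [N NP] := ul e e0; have [N' N'P] := um e e0.
have h1 := NP _ (leq_maxl N N'); have h2 := N'P _ (leq_maxr N N').
have := nm_tri l (u (maxn N N')) m; rewrite (nmB l (u _)); lra.
Qed.

Lemma limsE u l : cvs u l -> lims u = l.
Proof. by move=> ul; apply: xget_unique => // m um; exact: cvs_unique um ul. Qed.

Lemma cvs_cst l : cvs (fun=> l) l.
Proof. by move=> e e0; exists 0%N => n _; rewrite subrr nm0 ltW. Qed.

Lemma cvsD u v l m : cvs u l -> cvs v m -> cvs (fun n => u n + v n) (l + m).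
Proof.
move=> ul vm e e0; have [N NP] := ul (e / 2) ltac:(lra).
have [N' N'P] := vm (e / 2) ltac:(lra).
exists (maxn N N') => n; rewrite geq_max => /andP[/NP h1 /N'P h2].
by rewrite opprD addrACA (le_trans (nmD _ _)) //; lra.
Qed.

Lemma cvsM u v l m : cvs u l -> cvs v m -> cvs (fun n => u n * v n) (l * m).
Proof.
move=> ul vm e e0; set a := nm l; set b := nm m.
have a0 : 0 <= a by exact: nm_ge0.
have b0 : 0 <= b by exact: nm_ge0.
pose e' := Num.min 1 (e / (a + b + 1)).
have e'0 : 0 < e' by rewrite lt_min ltr01 divr_gt0 //; lra.
have [N NP] := ul e' e'0; have [N' N'P] := vm e' e'0.
exists (maxn N N') => n; rewrite geq_max => /andP[/NP h1 /N'P h2].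
have -> : u n * v n - l * m =
  (u n - l) * (v n - m) + (u n - l) * m + l * (v n - m) by ring.
have e1 : e' <= 1 by rewrite ge_min lexx.
have e2 : e' * (a + b + 1) <= e.
  by rewrite -ler_pdivlMr ?ge_min ?lexx ?orbT //; lra.
have := nmD ((u n - l) * (v n - m) + (u n - l) * m) (l * (v n - m)).
have := nmD ((u n - l) * (v n - m)) ((u n - l) * m).
rewrite !nmM -/a -/b.
have := nm_ge0 (u n - l); have := nm_ge0 (v n - m).
move: h1 h2; set x := nm (u _ - _); set y := nm (v _ - _) => *; nra.
Qed.

Lemma cvsZ u l a : cvs u l -> cvs (fun n => a * u n) (a * l).
Proof. by move=> ul; apply: cvsM => //; exact: cvs_cst. Qed.

Lemma cvsN u l : cvs u l -> cvs (fun n => - u n) (- l).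
Proof.
move=> ul; have -> : (fun n => - u n) = (fun n => -1 * u n).
  by apply/funext => n; rewrite mulN1r.
rewrite -[- l]mulN1r; exact: cvsZ.
Qed.

Lemma cvsB u v l m : cvs u l -> cvs v m -> cvs (fun n => u n - v n) (l - m).
Proof. by move=> ul vm; apply: cvsD => //; exact: cvsN. Qed.

Lemma cvs_sum (I : Type) (r : seq I) (P : pred I) (F : I -> nat -> R[i]) G :
  (forall i, P i -> cvs (F i) (G i)) ->
  cvs (fun n => \sum_(i <- r | P i) F i n) (\sum_(i <- r | P i) G i).
Proof.
move=> H; elim: r => [|i r IH].
  have -> : (fun x => \sum_(i <- [::] | P i) F i x) = (fun=> 0).
    by apply/funext => x; rewrite big_nil.
  by rewrite big_nil; exact: cvs_cst.
have -> : (fun x => \sum_(j <- i :: r | P j) F j x) = (fun x =>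
    (if P i then F i x else 0) + \sum_(j <- r | P j) F j x).
  by apply/funext => x; rewrite big_cons; case: ifP => // _; rewrite add0r.
have -> : \sum_(j <- i :: r | P j) G j =
    (if P i then G i else 0) + \sum_(j <- r | P j) G j.
  by rewrite big_cons; case: ifP => // _; rewrite add0r.
by apply: cvsD => //; case Pi: (P i); [exact: H|exact: cvs_cst].
Qed.

Lemma cvs_sub u l (k : nat -> nat) : (forall n, (n <= k n)%N) ->
  cvs u l -> cvs (fun n => u (k n)) l.
Proof.
move=> kn ul e /ul[N NP]; exists N => n Nn; apply: NP.
exact: leq_trans Nn (kn n).
Qed.

Lemma cvs_shift u l k : cvs (fun n => u (n + k)%N) l -> cvs u l.
Proof.
move=> ul e /ul[N NP]; exists (N + k)%N => n Nn.
have kn : (k <= n)%N by rewrite (leq_trans _ Nn) // leq_addl.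
by have := NP (n - k)%N; rewrite subnK //; apply; rewrite leq_subRL // addnC.
Qed.

Lemma cvs_le u l (b : R) (N : nat) :
  (forall n, (N <= n)%N -> nm (u n) <= b) -> cvs u l -> nm l <= b.
Proof.
move=> ub ul; rewrite leNgt; apply/negP => bl.
have [M MP] := ul ((nm l - b) / 2) ltac:(lra).
have h1 := MP _ (leq_maxr N M); have h2 := ub _ (leq_maxl N M).
by have := nm_tri l (u (maxn N M)) 0; rewrite !subr0 nmB; lra.
Qed.

Lemma real_cauchy (u : nat -> R) :
  (forall e : R, 0 < e -> exists N, forall n, (N <= n)%N -> `|u n - u N| <= e) ->
  exists l : R, forall e : R, 0 < e -> exists N, forall n, (N <= n)%N -> `|u n - l| <= e.
Proof.
move=> H.
have : cvgn u.
  apply/cauchy_cvgP/cauchy_exP => e e0.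
  have [N NP] := H (e / 2) ltac:(lra).
  exists (u N); exists N => // n /= /NP h.
  by rewrite -ball_normE /= distrC; lra.
move=> /cvgrPdist_le ul; exists (limn u) => e /ul[N _ NP]; exists N => n Nn.
by rewrite distrC; exact: NP.
Qed.

Lemma cauchy_cvs u :
  (forall e : R, 0 < e -> exists N, forall n, (N <= n)%N -> nm (u n - u N) <= e) ->
  exists l, cvs u l.
Proof.
move=> H.
have [x xP] : exists x : R, forall e : R, 0 < e -> exists N, forall n, (N <= n)%N ->
    `|complex.Re (u n) - x| <= e.
  apply: real_cauchy => e /H[N NP]; exists N => n /NP h.
  by rewrite -raddfB (le_trans (nm_Re _)).
have [y yP] : exists y : R, forall e : R, 0 < e -> exists N, forall n, (N <= n)%N ->
    `|complex.Im (u n) - y| <= e.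
  apply: real_cauchy => e /H[N NP]; exists N => n /NP h.
  by rewrite -raddfB (le_trans (nm_Im _)).
exists (x +i* y) => e e0.
have [N NP] := xP (e / 2) ltac:(lra); have [N' N'P] := yP (e / 2) ltac:(lra).
exists (maxn N N') => n; rewrite geq_max => /andP[/NP h1 /N'P h2].
rewrite (le_trans (nm_ReIm _)) // !raddfB /=; lra.
Qed.

(** Absolute convergence: from an index where the sum of moduli is e-close to its supremum, every
    tail is at most e. *)
Lemma summable_cvs (a : nat -> R[i]) (b : R) :
  (forall n, \sum_(k < n) nm (a k) <= b) ->
  exists2 l, cvs (fun n => \sum_(k < n) a k) l & nm l <= b.
Proof.
move=> H.
have [l lP] : exists l, cvs (fun n => \sum_(k < n) a k) l.
  apply: cauchy_cvs => e e0.
  pose S := [set \sum_(k < n) nm (a k) | n in [set: nat]].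
  have hS : has_sup S.
    split; first by exists (\sum_(k < 0) nm (a k)); exists 0%N.
    by exists b => _ [n _ <-].
  have [_ [N _ <-] NP] := sup_adherent e0 hS.
  exists N => n Nn.
  have le_s : \sum_(k < n) nm (a k) <= sup S.
    by apply: sup_upper_bound => //; exists n.
  rewrite -!(big_mkord xpredT) (@big_cat_nat _ _ _ N 0 n) //=.
  rewrite addrAC subrr add0r (le_trans (nm_sum _ _ _)) //.
  move: NP le_s; rewrite -!(big_mkord xpredT (fun k => nm (a k))).
  by rewrite (@big_cat_nat _ _ _ N 0 n) //=; lra.
exists l => //; apply: (cvs_le (N := 0%N) _ lP) => n _.
exact: le_trans (nm_sum _ _ _) (H n).
Qed.

Lemma geometric_le (t : R) n : 0 <= t -> t < 1 ->
  \sum_(k < n) t ^+ k <= (1 - t)^-1.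
Proof.
move=> t0 t1; have t1' : 0 < 1 - t by rewrite subr_gt0.
rewrite -[leRHS]mul1r ler_pdivlMr // mulrC.
have -> : (1 - t) * \sum_(k < n) t ^+ k = 1 - t ^+ n.
  by rewrite -[1 - t ^+ n]opprB subrX1 -mulNr opprB.
by rewrite gerBl exprn_ge0.
Qed.

Lemma pow_small (t : R) : 0 <= t -> t < 1 -> forall e : R, 0 < e ->
  exists N, forall n, (N <= n)%N -> t ^+ n <= e.
Proof.
move=> t0 t1 e e0.
have : (fun n => t ^+ n) @ \oo --> (0 : R) by apply: cvg_expr; rewrite ger0_norm.
move=> /cvgrPdist_le /(_ e e0)[N _ NP]; exists N => n /NP.
by rewrite sub0r normrN ger0_norm // exprn_ge0.
Qed.

Lemma inv_small (e : R) : 0 < e -> exists N, forall n, (N <= n)%N -> n.+1%:R^-1 <= e.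
Proof.
move=> e0; exists (Num.bound e^-1) => n Nn.
rewrite -[leRHS]invrK lef_pV2 ?posrE ?invr_gt0 //.
have := archi_boundP (ltW (_ : 0 < e^-1)).
rewrite invr_gt0 => /(_ e0) h; rewrite (le_trans (ltW h)) // ler_nat.
exact: leq_trans Nn _.
Qed.
End sequences.

(** * Compactness of the unit interval *)

Section compactness.
Variable R : realType.

(** Makes a local choice of d uniform. Both the Heine-Cantor theorem and the continuity of circle
    means in the radius are instances. *)
Lemma tube (Q : R -> R -> Prop) :
  (forall x d d', 0 < d' -> d' <= d -> Q x d -> Q x d') ->
  (forall x, 0 <= x <= 1 -> exists2 d, 0 < d &
     forall x', 0 <= x' <= 1 -> `|x' - x| < d -> Q x' d) ->
  exists2 d, 0 < d & forall x, 0 <= x <= 1 -> Q x d.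
Proof.
move=> Qd Qloc.
have /compact_near_coveringP K := @segment_compact R 0 1.
have : \forall d \near 0^'+, `[0, 1]%classic `<=` [set x : R | 0 <= x <= 1 -> Q x d].
  apply: (K R (0^'+) (fun d x => 0 <= x <= 1 -> Q x d)) => x /=.
  rewrite in_itv /= => /Qloc[d d0 dP].
  exists ([set y | `|y - x| < d], [set e | 0 < e <= d]) => /=.
    split; last first.
      by near=> e; apply/andP; split; near: e;
        [exact: nbhs_right_gt|exact: nbhs_right_le].
    by exists d => // y /=; rewrite distrC.
  move=> [y e] [/= yx /andP[e0 ed]] y01; apply: (Qd _ d) => //.
  exact: dP.
move=> H.
have : \forall d \near (0:R)^'+, 0 < d /\ forall x, 0 <= x <= 1 -> Q x d.
  near=> d; split; first by near: d; exact: nbhs_right_gt.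
  near: d; apply: filterS H => d H x x01.
  by apply: H => //=; rewrite in_itv.
by move=> /(@filter_ex _ _ _)[d [d0 dP]]; exists d.
Unshelve. all: by end_near. Qed.
End compactness.

(** * Integration of continuous functions over [0, 1] *)

Section mean.
Variable R : realType.
Implicit Types (f g : R -> R[i]) (x y : R).

(* The limit of the dyadic averages plays the role of the integral over [0, 1]. *)
Fixpoint avg n g : R[i] := if n is m.+1
  then (avg m (fun x => g (x / 2)) + avg m (fun x => g ((x + 1) / 2))) / 2
  else g 0.

Definition mean g : R[i] := lims (fun n => avg n g).

Definition uc g := forall e : R, 0 < e -> exists2 d : R, 0 < d &
  forall x y, 0 <= x <= 1 -> 0 <= y <= 1 -> `|x - y| < d -> nm (g x - g y) <= e.

Lemma uc_pointwise g :
  (forall x, 0 <= x <= 1 -> forall e : R, 0 < e -> exists2 d : R, 0 < d &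
     forall y, 0 <= y <= 1 -> `|y - x| < d -> nm (g y - g x) <= e) -> uc g.
Proof.
move=> H e e0.
have [] := @tube R (fun x d => forall y, 0 <= y <= 1 -> `|y - x| < d ->
    nm (g y - g x) <= e).
- move=> x d d' _ dd' Q y y01 yx; apply: Q => //; exact: lt_le_trans dd'.
- move=> x x01; have [d d0 dP] := H x x01 (e / 2) ltac:(lra).
  exists (d / 2); first lra.
  move=> x' x'01 x'x y y01 yx'.
  have h1 : `|y - x| < d.
    have := ler_distD x' y x; lra.
  have := dP y y01 h1; have := dP x' x'01 ltac:(lra).
  have := nm_tri (g y) (g x) (g x'); rewrite (nmB (g x) (g x')); lra.
move=> d d0 dP; exists d => // x y x01 y01 xy; exact: dP.
Qed.

Lemma eq_avg f g n : (forall x, 0 <= x <= 1 -> f x = g x) -> avg n f = avg n g.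
Proof.
elim: n f g => [|n IH] f g fg /=; first by apply: fg; rewrite lexx ler01.
by congr ((_ + _) / 2); apply: IH => x x01; apply: fg; lra.
Qed.

Lemma eq_mean f g : (forall x, 0 <= x <= 1 -> f x = g x) -> mean f = mean g.
Proof.
by move=> fg; congr lims; apply/funext => n; exact: eq_avg.
Qed.

Lemma avg_cst n (a : R[i]) : avg n (fun=> a) = a.
Proof. by elim: n => [|n IH] //=; rewrite IH; field. Qed.

Lemma avgD n f g : avg n (fun x => f x + g x) = avg n f + avg n g.
Proof. by elim: n f g => [|n IH] f g //=; rewrite !IH; field. Qed.

Lemma avgZ n (a : R[i]) g : avg n (fun x => a * g x) = a * avg n g.
Proof. by elim: n g => [|n IH] g //=; rewrite !IH; field. Qed.

Lemma avg_le n g (M : R) :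
  (forall x, 0 <= x <= 1 -> nm (g x) <= M) -> nm (avg n g) <= M.
Proof.
elim: n g => [|n IH] g gM /=; first by apply: gM; rewrite lexx ler01.
rewrite nmM nmV nmn ler_pdivrMr //.
have h1 : nm (avg n (fun x => g (x / 2))) <= M by apply: IH => x x01; apply: gM; lra.
have h2 : nm (avg n (fun x => g ((x + 1) / 2))) <= M by apply: IH => x x01; apply: gM; lra.
by apply: le_trans (nmD _ _) _; lra.
Qed.

(** Refining beyond level n replaces each sample by an average over its own dyadic interval of
    length 2^-n, so the oscillation there bounds the change. *)
Lemma avg_osc n m g (e : R) :
  (forall x y, 0 <= x <= 1 -> 0 <= y <= 1 -> `|x - y| <= 2^-1 ^+ n ->
     nm (g x - g y) <= e) -> nm (avg (n + m) g - avg n g) <= e.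
Proof.
elim: n g => [|n IH] g ge.
  have -> : avg (0 + m) g - avg 0 g = avg m (fun x => g x + - g 0).
    by rewrite avgD avg_cst.
  by apply: avg_le => x x01; apply: ge; rewrite ?lexx ?ler01 // expr0 subr0 ger0_norm; lra.
rewrite addSn /=.
have h1 : nm (avg (n + m) (fun x => g (x / 2)) - avg n (fun x => g (x / 2))) <= e.
  apply: (IH (fun x => g (x / 2))) => x y x01 y01 xy; apply: ge; try lra.
  by rewrite -mulrBl normrM (@ger0_norm _ 2^-1) ?invr_ge0 // exprSr ler_pM2r ?invr_gt0.
have h2 : nm (avg (n + m) (fun x => g ((x + 1) / 2)) - avg n (fun x => g ((x + 1) / 2))) <= e.
  apply: (IH (fun x => g ((x + 1) / 2))) => x y x01 y01 xy; apply: ge; try lra.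
  rewrite -mulrBl normrM (@ger0_norm _ 2^-1) ?invr_ge0 // exprSr ler_pM2r ?invr_gt0 //.
  by rewrite (_ : x + 1 - (y + 1) = x - y) //; ring.
move: h1 h2; set a := avg _ _; set b := avg _ _; set c := avg _ _; set d := avg _ _.
move=> h1 h2; have -> : (a + c) / 2 - (b + d) / 2 = ((a - b) + (c - d)) / 2 by field.
by rewrite nmM nmV nmn ler_pdivrMr // (le_trans (nmD _ _)) //; lra.
Qed.

Lemma half_pow_small (e : R) : 0 < e -> exists N, forall n, (N <= n)%N -> (2^-1 : R) ^+ n <= e.
Proof. by move=> e0; apply: pow_small => //; lra. Qed.

Lemma mean_cvs g : uc g -> cvs (fun n => avg n g) (mean g).
Proof.
move=> ug; suff [l lP] : exists l, cvs (fun n => avg n g) l.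
  by rewrite /mean (limsE lP).
apply: cauchy_cvs => e e0; have [d d0 dP] := ug e e0.
have [N NP] := half_pow_small (e := d / 2) ltac:(lra).
exists N => n Nn; rewrite -(subnKC Nn); apply: avg_osc => x y x01 y01 xy.
by apply: dP => //; have := NP N (leqnn N); lra.
Qed.

Lemma uc_cst (a : R[i]) : uc (fun=> a).
Proof. by move=> e e0; exists 1 => // x y _ _ _; rewrite subrr nm0 ltW. Qed.

Lemma ucD f g : uc f -> uc g -> uc (fun x => f x + g x).
Proof.
move=> uf ug e e0; have [d d0 dP] := uf (e / 2) ltac:(lra).
have [d' d'0 d'P] := ug (e / 2) ltac:(lra).
exists (Num.min d d'); first by rewrite lt_min d0.
move=> x y x01 y01; rewrite lt_min => /andP[/(dP x y x01 y01) h1 /(d'P x y x01 y01) h2].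
by rewrite opprD addrACA (le_trans (nmD _ _)) //; lra.
Qed.

Lemma ucZ (a : R[i]) g : uc g -> uc (fun x => a * g x).
Proof.
move=> ug e e0; have a0 := nm_ge0 a.
have [d d0 dP] := ug (e / (nm a + 1)) ltac:(rewrite divr_gt0 //; lra).
exists d => // x y x01 y01 /(dP x y x01 y01).
rewrite -mulrBr nmM ler_pdivlMr; last lra.
have := nm_ge0 (g x - g y); nra.
Qed.

Lemma uc_half g : uc g -> uc (fun x => g (x / 2)).
Proof.
move=> ug e /ug[d d0 dP]; exists d => // x y x01 y01 xy; apply: dP; try lra.
rewrite -mulrBl normrM (@ger0_norm _ 2^-1) ?invr_ge0 //.
have := normr_ge0 (x - y); lra.
Qed.

Lemma uc_half' g : uc g -> uc (fun x => g ((x + 1) / 2)).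
Proof.
move=> ug e /ug[d d0 dP]; exists d => // x y x01 y01 xy; apply: dP; try lra.
rewrite -mulrBl (_ : x + 1 - (y + 1) = x - y); last ring.
rewrite normrM (@ger0_norm _ 2^-1) ?invr_ge0 //.
have := normr_ge0 (x - y); lra.
Qed.

Lemma mean_cst (a : R[i]) : mean (fun=> a) = a.
Proof.
rewrite /mean; apply: limsE; rewrite (_ : (fun n => _) = (fun=> a)).
  exact: cvs_cst.
by apply/funext => n; rewrite avg_cst.
Qed.

Lemma meanD f g : uc f -> uc g -> mean (fun x => f x + g x) = mean f + mean g.
Proof.
move=> uf ug; apply: limsE; rewrite (_ : (fun n => _) = (fun n => avg n f + avg n g)).
  by apply: cvsD; exact: mean_cvs.
by apply/funext => n; rewrite avgD.
Qed.

Lemma meanZ (a : R[i]) g : uc g -> mean (fun x => a * g x) = a * mean g.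
Proof.
move=> ug; apply: limsE; rewrite (_ : (fun n => _) = (fun n => a * avg n g)).
  by apply: cvsZ; exact: mean_cvs.
by apply/funext => n; rewrite avgZ.
Qed.

Lemma mean_le g (M : R) : uc g ->
  (forall x, 0 <= x <= 1 -> nm (g x) <= M) -> nm (mean g) <= M.
Proof.
move=> ug gM; apply: (cvs_le (N := 0%N) _ (mean_cvs ug)) => n _.
exact: avg_le.
Qed.

Lemma mean_half g : uc g ->
  mean g = (mean (fun x => g (x / 2)) + mean (fun x => g ((x + 1) / 2))) / 2.
Proof.
move=> ug; apply: limsE; apply: (@cvs_shift _ _ _ 1).
rewrite (_ : (fun n => _) = (fun n => (avg n (fun x => g (x / 2)) +
   avg n (fun x => g ((x + 1) / 2))) * 2^-1)); last first.
  by apply/funext => n; rewrite addn1.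
apply: cvsM; last exact: cvs_cst.
by apply: cvsD; apply: mean_cvs; [exact: uc_half|exact: uc_half'].
Qed.

Lemma uc_id : uc (fun x => x%:C).
Proof. by move=> e e0; exists e => // x y _ _ xy; rewrite -rmorphB nmR ltW. Qed.

(** Halving the interval gives m = m / 2 + 1 / 4 for the mean m, which determines it. *)
Lemma mean_id : mean (fun x => x%:C) = 2^-1.
Proof.
have := mean_half uc_id.
have -> : mean (fun x => (x / 2)%:C) = 2^-1 * mean (fun x => x%:C).
  rewrite -meanZ; last exact: uc_id.
  by congr mean; apply/funext => x; rewrite rmorphM fmorphV rmorph_nat mulrC.
have -> : mean (fun x => ((x + 1) / 2)%:C) = 2^-1 * mean (fun x => x%:C) + 2^-1.
  rewrite -meanZ; last exact: uc_id.
  rewrite -[X in _ + X]mean_cst -meanD; [|exact/ucZ/uc_id|exact: uc_cst].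
  congr mean; apply/funext => x.
  by rewrite rmorphM fmorphV rmorph_nat rmorphD rmorph1 mulrC mulrDr mulr1.
set m := mean _ => E.
have E2 : m = m / 2 + 2^-1 / 2 by rewrite {1}E; field.
apply/eqP; rewrite -subr_eq0.
have -> : m - 2^-1 = 2 * (m - (m / 2 + 2^-1 / 2)) by field.
by rewrite -E2 subrr mulr0.
Qed.
End mean.

(** * Line integrals and Goursat's theorem on rectangles *)

Section line_integral.
Variable R : realType.
Implicit Types (H G : R[i] -> R[i]) (p v z : R[i]) (a b : R).

(** The integral of H along the segment from p to p + v. *)
Definition li H p v : R[i] := v * mean (fun x => H (p + x%:C * v)).

Definition cseg H p v := forall x : R, 0 <= x <= 1 -> cts H (p + x%:C * v).

Lemma cseg_uc H p v : cseg H p v -> uc (fun x => H (p + x%:C * v)).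
Proof.
move=> cH; apply: uc_pointwise => x x01 e e0.
have [d d0 dP] := cH x x01 e e0.
have v0 := nm_ge0 v.
exists (d / (nm v + 1)); first by rewrite divr_gt0 //; lra.
move=> y y01 xy; have := dP ((y - x)%:C * v).
rewrite nmM nmR (_ : p + _ + _ = p + y%:C * v); last by rewrite rmorphB; ring.
apply; move: xy; rewrite ltr_pdivlMr; last lra.
have := normr_ge0 (y - x); nra.
Qed.

Lemma li_half H p v : cseg H p v ->
  li H p v = li H p (v / 2) + li H (p + v / 2) (v / 2).
Proof.
move=> cH; rewrite /li (mean_half (cseg_uc cH)) -mulrDr.
rewrite [v * _]mulrA mulrAC; congr (_ * (_ + _)); congr mean; apply/funext => x; congr H.
  by rewrite rmorphM fmorphV rmorph_nat mulrAC mulrA.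
by rewrite rmorphM fmorphV rmorph_nat rmorphD rmorph1; ring.
Qed.

Lemma li_le H p v (M : R) : cseg H p v ->
  (forall x : R, 0 <= x <= 1 -> nm (H (p + x%:C * v)) <= M) ->
  nm (li H p v) <= nm v * M.
Proof.
move=> cH HM; rewrite nmM ler_wpM2l ?nm_ge0 //.
by apply: mean_le => //; exact: cseg_uc.
Qed.

Lemma liD H G p v : cseg H p v -> cseg G p v ->
  li (fun z => H z + G z) p v = li H p v + li G p v.
Proof. by move=> cH cG; rewrite /li meanD ?mulrDr //; exact: cseg_uc. Qed.

Lemma li_affine (A B p v : R[i]) :
  li (fun z => A + B * z) p v = A * v + B * (p * v + v ^+ 2 / 2).
Proof.
rewrite /li (_ : (fun x : R => _) = (fun x => (A + B * p) + (B * v) * x%:C)).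
  rewrite meanD; [|exact: uc_cst|exact/ucZ/uc_id].
  by rewrite mean_cst meanZ ?mean_id; [field|exact: uc_id].
by apply/funext => x; ring.
Qed.

(** The counterclockwise boundary integral of the rectangle with lower left corner x + i y and sides
    a, b. *)
Definition rectint H (x y a b : R) : R[i] :=
  li H (x +i* y) a%:C + li H ((x + a) +i* y) (b%:C * 'i)
  - li H (x +i* (y + b)) a%:C - li H (x +i* y) (b%:C * 'i).

Definition rect_all (P : R[i] -> Prop) (x y a b : R) :=
  forall u v : R, x <= u <= x + a -> y <= v <= y + b -> P (u +i* v).

Lemma rect_hseg H x y a b (u v c : R) : rect_all (cts H) x y a b ->
  0 <= c -> x <= u -> u + c <= x + a -> y <= v <= y + b ->
  cseg H (u +i* v) c%:C.
Proof.
move=> cH c0 xu uc yv t t01; rewrite (_ : _ + _ = (u + t * c) +i* v).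
  by apply: cH => //; nra.
by simpc.
Qed.

Lemma rect_vseg H x y a b (u v c : R) : rect_all (cts H) x y a b ->
  0 <= c -> y <= v -> v + c <= y + b -> x <= u <= x + a ->
  cseg H (u +i* v) (c%:C * 'i).
Proof.
move=> cH c0 xu uc yv t t01; rewrite (_ : _ + _ = u +i* (v + t * c)).
  by apply: cH => //; nra.
by simpc.
Qed.

Lemma half_complex (x : R) : (x / 2)%:C = x%:C / 2 :> R[i].
Proof. by rewrite rmorphM fmorphV rmorph_nat. Qed.

Lemma rectint_split H x y a b : 0 <= a -> 0 <= b -> rect_all (cts H) x y a b ->
  rectint H x y a b = rectint H x y (a / 2) (b / 2)
    + rectint H (x + a / 2) y (a / 2) (b / 2)
    + rectint H x (y + b / 2) (a / 2) (b / 2)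
    + rectint H (x + a / 2) (y + b / 2) (a / 2) (b / 2).
Proof.
move=> a0 b0 cH.
have hh (v : R) : y <= v <= y + b -> li H (x +i* v) a%:C =
    li H (x +i* v) (a / 2)%:C + li H ((x + a / 2) +i* v) (a / 2)%:C.
  move=> yv; rewrite half_complex li_half; last by apply: (rect_hseg cH) => //; lra.
  by rewrite -half_complex; congr (_ + li _ _ _); simpc.
have vv (u : R) : x <= u <= x + a -> li H (u +i* y) (b%:C * 'i) =
    li H (u +i* y) ((b / 2)%:C * 'i) + li H (u +i* (y + b / 2)) ((b / 2)%:C * 'i).
  move=> xu; rewrite (_ : (b / 2)%:C * 'i = b%:C * 'i / 2); last by rewrite half_complex mulrAC.
  rewrite li_half; last by apply: (rect_vseg cH) => //; lra.
  rewrite -mulrAC -half_complex; congr (_ + li _ _ _); simpc; congr (_ +i* _).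
rewrite /rectint (hh y ltac:(lra)) (hh (y + b) ltac:(lra)) (vv x ltac:(lra)) (vv (x + a) ltac:(lra)).
rewrite (_ : x + a / 2 + a / 2 = x + a); last by field.
rewrite (_ : y + b / 2 + b / 2 = y + b); last by field.
ring.
Qed.

Lemma rect_sides H x y a b : 0 <= a -> 0 <= b -> rect_all (cts H) x y a b ->
  [/\ cseg H (x +i* y) a%:C, cseg H ((x + a) +i* y) (b%:C * 'i),
      cseg H (x +i* (y + b)) a%:C & cseg H (x +i* y) (b%:C * 'i)].
Proof.
move=> a0 b0 cH.
by split; [apply: (rect_hseg cH)|apply: (rect_vseg cH)|apply: (rect_hseg cH)
  |apply: (rect_vseg cH)] => //; lra.
Qed.

Lemma rectintD H G x y a b : 0 <= a -> 0 <= b ->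
  rect_all (cts H) x y a b -> rect_all (cts G) x y a b ->
  rectint (fun z => H z + G z) x y a b = rectint H x y a b + rectint G x y a b.
Proof.
move=> a0 b0 /(rect_sides a0 b0)[h1 h2 h3 h4] /(rect_sides a0 b0)[k1 k2 k3 k4].
rewrite /rectint !liD //.
repeat match goal with |- context [li ?F ?p ?v] => generalize (li F p v); intro end.
ring.
Qed.

Lemma rectint_affine A B x y a b : rectint (fun z => A + B * z) x y a b = 0.
Proof.
rewrite /rectint !li_affine.
have -> : (x + a) +i* y = x +i* y + a%:C :> R[i] by simpc.
have -> : x +i* (y + b) = x +i* y + b%:C * 'i :> R[i] by simpc.
by field.
Qed.

Lemma rectint_le H x y a b (M : R) : 0 <= a -> 0 <= b ->
  rect_all (cts H) x y a b -> rect_all (fun z => nm (H z) <= M) x y a b ->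
  nm (rectint H x y a b) <= 2 * (a + b) * M.
Proof.
move=> a0 b0 cH HM.
have h (u v c : R) : 0 <= c -> x <= u -> u + c <= x + a -> y <= v <= y + b ->
    nm (li H (u +i* v) c%:C) <= c * M.
  move=> c0 xu uc yv; rewrite -{2}(nmRp c0); apply: li_le.
    exact: (rect_hseg cH).
  move=> t t01; rewrite (_ : _ + _ = (u + t * c) +i* v).
    by apply: HM => //; nra.
  by simpc.
have k (u v c : R) : 0 <= c -> y <= v -> v + c <= y + b -> x <= u <= x + a ->
    nm (li H (u +i* v) (c%:C * 'i)) <= c * M.
  move=> c0 xu uc yv.
  have -> : c * M = nm (c%:C * 'i) * M by rewrite nmM nmi mulr1 nmRp.
  apply: li_le; first exact: (rect_vseg cH).
  move=> t t01; rewrite (_ : _ + _ = u +i* (v + t * c)).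
    by apply: HM => //; nra.
  by simpc.
have h1 := h x y a; have h2 := h x (y + b) a.
have k1 := k x y b; have k2 := k (x + a) y b.
rewrite /rectint.
have {}h1 : nm (li H (x +i* y) a%:C) <= a * M by apply: h1 => //; lra.
have {}h2 : nm (li H (x +i* (y + b)) a%:C) <= a * M by apply: h2 => //; lra.
have {}k1 : nm (li H (x +i* y) (b%:C * 'i)) <= b * M by apply: k1 => //; lra.
have {}k2 : nm (li H ((x + a) +i* y) (b%:C * 'i)) <= b * M by apply: k2 => //; lra.
apply: le_trans (nmBD _ _) (le_trans (lerD (nmBD _ _) k1) _).
apply: le_trans (lerD (lerD (nmD _ _) h2) (lexx _)) _.
apply: le_trans (lerD (lerD (lerD h1 k2) (lexx _)) (lexx _)) _; clear; lra.
Qed.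

Lemma bisect_corner H a b n (p : R * R) (e : R) :
  0 <= a -> 0 <= b -> rect_all (cts H) p.1 p.2 (a / 2 ^+ n) (b / 2 ^+ n) ->
  e <= nm (rectint H p.1 p.2 (a / 2 ^+ n) (b / 2 ^+ n)) ->
  exists p' : R * R, [/\ p.1 <= p'.1, p.2 <= p'.2,
    p'.1 + a / 2 ^+ n.+1 <= p.1 + a / 2 ^+ n,
    p'.2 + b / 2 ^+ n.+1 <= p.2 + b / 2 ^+ n &
    e / 4 <= nm (rectint H p'.1 p'.2 (a / 2 ^+ n.+1) (b / 2 ^+ n.+1))].
Proof.
move=> a0 b0 cH; have h (c : R) : c / 2 ^+ n.+1 = c / 2 ^+ n / 2.
  by rewrite exprSr invfM mulrA.
rewrite !h; have an : 0 <= a / 2 ^+ n by rewrite divr_ge0 // exprn_ge0.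
have bn : 0 <= b / 2 ^+ n by rewrite divr_ge0 // exprn_ge0.
rewrite rectint_split //; move: (a / _) (b / _) an bn cH => {}a {}b {}a0 {}b0 cH.
set r1 := rectint _ _ _ _ _; set r2 := rectint _ _ _ _ _.
set r3 := rectint _ _ _ _ _; set r4 := rectint _ _ _ _ _ => er.
have [h1|h1] := leP (e / 4) (nm r1).
  by exists p; split=> //; lra.
have [h2|h2] := leP (e / 4) (nm r2).
  by exists (p.1 + a / 2, p.2); split=> //=; lra.
have [h3|h3] := leP (e / 4) (nm r3).
  by exists (p.1, p.2 + b / 2); split=> //=; lra.
have [h4|h4] := leP (e / 4) (nm r4).
  by exists (p.1 + a / 2, p.2 + b / 2); split=> //=; lra.
have := nmD (r1 + r2 + r3) r4; have := nmD (r1 + r2) r3; have := nmD r1 r2; lra.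
Qed.

(* Goursat: a rectangle with nonzero integral contains, at each scale 2^-n, a
   subrectangle whose integral is at least 4^-n times as large; differentiability
   at the limit point contradicts this. *)
Lemma goursat H x y a b : 0 <= a -> 0 <= b -> rect_all (cdiff H) x y a b ->
  rectint H x y a b = 0.
Proof.
move=> a0 b0 dH; apply/eqP; rewrite -nm_eq0; apply/negPn/negP => F0.
pose eta := nm (rectint H x y a b).
have eta0 : 0 < eta by rewrite lt_neqAle eq_sym F0 nm_ge0.
have cH : rect_all (cts H) x y a b by move=> u v hu hv; apply/cdiff_cts/dH.
pose inv n (p : R * R) := [/\ x <= p.1, y <= p.2, p.1 + a / 2 ^+ n <= x + a,
  p.2 + b / 2 ^+ n <= y + b &
  eta / 4 ^+ n <= nm (rectint H p.1 p.2 (a / 2 ^+ n) (b / 2 ^+ n))].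
(* The invariant stands under the existential quantifier, so that the choice of the next corner is a
   total function. *)
have step n (p : R * R) : exists p' : R * R, inv n p -> [/\ p.1 <= p'.1, p.2 <= p'.2,
    p'.1 + a / 2 ^+ n.+1 <= p.1 + a / 2 ^+ n,
    p'.2 + b / 2 ^+ n.+1 <= p.2 + b / 2 ^+ n & inv n.+1 p'].
  have [[i1 i2 i3 i4 i5]|ninv] := pselect (inv n p); last by exists p.
  have cp : rect_all (cts H) p.1 p.2 (a / 2 ^+ n) (b / 2 ^+ n).
    by move=> u v hu hv; apply: cH; lra.
  have [p' [j1 j2 j3 j4 j5]] := bisect_corner a0 b0 cp i5.
  exists p' => _; split=> //; split=> //; try lra.
  by rewrite exprSr invfM mulrA.
pose nx n (p : R * R) := sval (cid (step n p)).
have nxP n (p : R * R) : inv n p -> [/\ p.1 <= (nx n p).1, p.2 <= (nx n p).2,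
    (nx n p).1 + a / 2 ^+ n.+1 <= p.1 + a / 2 ^+ n,
    (nx n p).2 + b / 2 ^+ n.+1 <= p.2 + b / 2 ^+ n & inv n.+1 (nx n p)].
  by rewrite /nx; case: cid.
pose fix s n := if n is m.+1 then nx m (s m) else (x, y).
have sinv n : inv n (s n).
  elim: n => [|n IH]; last by case: (nxP n _ IH).
  by rewrite /inv /= !expr0 !divr1; split.
have pos (c : R) n : 0 <= c -> 0 <= c / 2 ^+ n by move=> c0; rewrite divr_ge0 // exprn_ge0.
have smono n m : [/\ (s n).1 <= (s (n + m)%N).1, (s n).2 <= (s (n + m)%N).2,
    (s (n + m)%N).1 + a / 2 ^+ (n + m) <= (s n).1 + a / 2 ^+ n &
    (s (n + m)%N).2 + b / 2 ^+ (n + m) <= (s n).2 + b / 2 ^+ n].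
  elim: m => [|m [k1 k2 k3 k4]]; first by rewrite addn0.
  have [j1 j2 j3 j4 _] := nxP _ _ (sinv (n + m)%N).
  by rewrite addnS /=; split; lra.
have small (c e : R) : 0 <= c -> 0 < e -> exists N, c / 2 ^+ N <= e.
  move=> c0 e0; have [N NP] := half_pow_small (e := e / (c + 1)) ltac:(rewrite divr_gt0 //; lra).
  exists N; have := NP N (leqnn N); rewrite ler_pdivlMr; last lra.
  have : 0 <= 2^-1 ^+ N :> R by rewrite exprn_ge0.
  rewrite exprVn; nra.
have [u uP] : exists u : R, forall e : R, 0 < e -> exists N, forall n, (N <= n)%N ->
    `|(s n).1 - u| <= e.
  apply: real_cauchy => e e0; have [N NP] := small _ _ a0 e0; exists N => n Nn.
  have [] := smono N (n - N)%N; rewrite subnKC // => k1 _ k3 _.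
  have := pos a n a0; rewrite ger0_norm; lra.
have [v vP] : exists u : R, forall e : R, 0 < e -> exists N, forall n, (N <= n)%N ->
    `|(s n).2 - u| <= e.
  apply: real_cauchy => e e0; have [N NP] := small _ _ b0 e0; exists N => n Nn.
  have [] := smono N (n - N)%N; rewrite subnKC // => _ k1 _ k3.
  have := pos b n b0; rewrite ger0_norm; lra.
have uvn n : (s n).1 <= u <= (s n).1 + a / 2 ^+ n /\ (s n).2 <= v <= (s n).2 + b / 2 ^+ n.
  split; apply/andP; split; rewrite leNgt; apply/negP => lt.
  - have [N NP] := uP (((s n).1 - u) / 2) ltac:(lra).
    have := NP _ (leq_addl n N); have [] := smono n N; rewrite ler_norml; lra.
  - have [N NP] := uP ((u - ((s n).1 + a / 2 ^+ n)) / 2) ltac:(lra).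
    have := NP _ (leq_addl n N); have [] := smono n N; have := pos a (n + N)%N a0.
    rewrite ler_norml; lra.
  - have [N NP] := vP (((s n).2 - v) / 2) ltac:(lra).
    have := NP _ (leq_addl n N); have [] := smono n N; rewrite ler_norml; lra.
  - have [N NP] := vP ((v - ((s n).2 + b / 2 ^+ n)) / 2) ltac:(lra).
    have := NP _ (leq_addl n N); have [] := smono n N; have := pos b (n + N)%N b0.
    rewrite ler_norml; lra.
have [l lP] : cdiff H (u +i* v).
  by have := uvn 0%N; rewrite /= !expr0 !divr1 => -[hu hv]; apply: dH.
(* On the n-th rectangle the error of the affine approximation integrates to at most e K / 4^n; e is
   chosen so that this is below the lower bound eta / 4^n. *)
pose K := 2 * (a + b) * (a + b).
have K0 : 0 <= K by rewrite /K; nra.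
pose e := eta / (K + 1) / 2.
have e0 : 0 < e by rewrite !divr_gt0 //; lra.
have eK : e * K < eta.
  rewrite /e mulrAC ltr_pdivrMr // mulrAC ltr_pdivrMr; last lra.
  nra.
have [d d0 dP] := lP e e0.
have [n nP] := small (a + b) (d / 2) ltac:(lra) ltac:(lra).
have [i1 i2 i3 i4 i5] := sinv n; have [un vn] := uvn n.
set an := a / 2 ^+ n in i3 i5 un; set bn := b / 2 ^+ n in i4 i5 vn.
have an0 : 0 <= an by exact: pos.
have bn0 : 0 <= bn by exact: pos.
have abn : an + bn <= d / 2 by rewrite /an /bn -mulrDl.
have cHn : rect_all (cts H) (s n).1 (s n).2 an bn.
  by move=> u' v' hu hv; apply: cH; lra.
pose A := H (u +i* v) - l * (u +i* v).
have ca z : cts (fun z => A + l * z) z.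
  by apply: ctsD; [exact: cts_cst|apply: ctsM; [exact: cts_cst|exact: cts_id]].
pose r z := H z - (A + l * z).
have cr : rect_all (cts r) (s n).1 (s n).2 an bn.
  by move=> u' v' hu hv; apply: ctsB; [exact: cHn|exact: ca].
have HE : H = (fun z => (A + l * z) + r z) by apply/funext => z; rewrite /r addrC subrK.
have ra : nm (rectint H (s n).1 (s n).2 an bn) <= 2 * (an + bn) * (e * (an + bn)).
  rewrite HE rectintD // rectint_affine add0r; apply: rectint_le => // u' v' hu hv.
  have E : u' +i* v' = u +i* v + (u' - u) +i* (v' - v) by simpc; rewrite ![_ + (_ - _)]addrC !subrK.
  have nh : nm ((u' - u) +i* (v' - v)) <= an + bn.
    apply: le_trans (nm_ReIm _) _; rewrite lerD //= ler_norml; lra.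
  have El : l * (u' +i* v') = l * (u +i* v) + l * ((u' - u) +i* (v' - v)).
    by rewrite E mulrDr.
  have := dP ((u' - u) +i* (v' - v)) ltac:(lra).
  rewrite -E (_ : H _ - _ - _ = r (u' +i* v')); last by
    rewrite /r /A El; ring.
  move=> /le_trans; apply; rewrite ler_wpM2l //; lra.
have : eta / 4 ^+ n <= e * K / 4 ^+ n.
  apply: le_trans i5 (le_trans ra _).
  rewrite (_ : 4 = 2 * 2); last ring.
  rewrite exprMn /an /bn -mulrDl /K le_eqVlt; apply/orP; left; apply/eqP.
  by field; rewrite expf_neq0.
rewrite ler_pM2r ?invr_gt0 ?exprn_gt0 //; lra.
Qed.
End line_integral.

(** * Transfer of real derivatives and real continuity *)

Section real_derivatives.
Variable R : realType.

Lemma is_derive_eps (f : R -> R) (x l : R) : is_derive x 1 f l ->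
  forall e : R, 0 < e -> exists2 d : R, 0 < d &
  forall h, `|h| < d -> `|f (x + h) - f x - l * h| <= e * `|h|.
Proof.
move=> [/cvg_ex[/= l' fl'] fl] e e0.
have ll' : l' = l by rewrite -fl; apply/esym/cvg_lim.
move: fl' => /cvgrPdist_le /(_ e e0)[d /= d0 dP].
exists d => // h hd; have [->|h0] := eqVneq h 0.
  by rewrite addr0 mulr0 subrr subr0 normr0 mulr0.
have := dP h; rewrite /= sub0r normrN => /(_ hd h0).
rewrite ll' distrC -ler_pdivrMr ?normr_gt0 // -normfV -normrM.
suff -> : h^-1 *: (f (h%:A + x) - f x) - l = (f (x + h) - f x - l * h) / h by [].
rewrite -[h%:A]/(h * 1) mulr1 -[_ *: _]/(h^-1 * _) [h + x]addrC.
by field.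
Qed.

Lemma cts_real (F : R -> R) (q : R[i] -> R) z :
  {for q z, continuous F} -> cts (fun x => (q x)%:C) z ->
  cts (fun x => (F (q x))%:C) z.
Proof.
move=> /cvgrPdist_le cF cq e e0; have [d /= d0 dP] := cF e e0.
have [d' d'0 d'P] := cq (d / 2) ltac:(lra).
exists d' => // h /d'P; rewrite -!rmorphB !nmR distrC => hd.
by rewrite distrC; apply: dP => /=; lra.
Qed.
End real_derivatives.

(** * Exponential, principal logarithm and complex powers *)

Section cexp.
Variable R : realType.
Implicit Types z w : R[i].

Lemma cexpE z : cexp z = (expR (complex.Re z) * cos (complex.Im z)) +i*
  (expR (complex.Re z) * sin (complex.Im z)).
Proof. by rewrite /cexp; simpc. Qed.

Lemma cexp0 : cexp 0 = 1 :> R[i].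
Proof. by rewrite /cexp /= expR0 cos0 sin0 mul1r. Qed.

Lemma cexpD z w : cexp (z + w) = cexp z * cexp w.
Proof.
rewrite /cexp !raddfD /= expRD cosD sinD; simpc.
by apply/eqP; rewrite eq_complex /=; apply/andP; split; apply/eqP; ring.
Qed.

Lemma nm_cexp z : nm (cexp z) = expR (complex.Re z).
Proof.
rewrite /cexp nmM nmRp ?expR_ge0 //.
have -> : nm (cos (complex.Im z) +i* sin (complex.Im z)) = 1.
  by rewrite /nm normc_def /= cos2Dsin2 sqrtr1.
by rewrite mulr1.
Qed.

Lemma cexp_neq0 z : cexp z != 0.
Proof. by rewrite -nm_gt0 nm_cexp expR_gt0. Qed.

Lemma cexpN z : cexp (- z) = (cexp z)^-1.
Proof.
apply: (mulfI (cexp_neq0 z)); rewrite divff ?cexp_neq0 //.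
by rewrite -cexpD subrr cexp0.
Qed.

Lemma hd_cexp z : hd (@cexp R) z (cexp z).
Proof.
move=> e e0; pose K := nm (cexp z).
have K0 : 0 < K by rewrite nm_gt0 cexp_neq0.
(* The expansion of e^x cos y and e^x sin y below produces 4 + 5 = 9 errors of size t |h|. *)
pose t := Num.min 1 (e / K / 9).
have t0 : 0 < t by rewrite lt_min ltr01 !divr_gt0.
have t1 : t <= 1 by rewrite ge_min lexx.
have tK : 9 * t * K <= e.
  have : t <= e / K / 9 by rewrite ge_min lexx orbT.
  by rewrite ler_pdivlMr // ler_pdivlMr // [t * 9]mulrC.
clearbody t.
have [d1 d10 D1] := is_derive_eps (is_derive_expR (0 : R)) t0.
have [d2 d20 D2] := is_derive_eps (is_derive_cos (0 : R)) t0.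
have [d3 d30 D3] := is_derive_eps (is_derive_sin (0 : R)) t0.
exists (Num.min t (Num.min d1 (Num.min d2 d3))); first by rewrite !lt_min t0 d10 d20.
move=> h; rewrite !lt_min => /and4P[h0 h1 h2 h3].
have -> : cexp (z + h) - cexp z - cexp z * h = cexp z * (cexp h - 1 - h).
  by rewrite cexpD; ring.
rewrite nmM -/K.
suff : nm (cexp h - 1 - h) <= 9 * t * nm h.
  by have := nm_ge0 h; nra.
have [rx ry] := (nm_Re h, nm_Im h).
case: h h0 h1 h2 h3 rx ry => x y /= h0 h1 h2 h3 rx ry.
set n := nm (x +i* y) in h0 h1 h2 h3 rx ry *.
have n0 : 0 <= n by exact: nm_ge0.
have := D1 x (le_lt_trans rx h1); rewrite expR0 mul1r add0r => E1.
have := D2 y (le_lt_trans ry h2); rewrite cos0 sin0 oppr0 mul0r subr0 add0r => E2.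
have := D3 y (le_lt_trans ry h3); rewrite cos0 sin0 mul1r subr0 add0r => E3.
rewrite /cexp /=; apply: le_trans (nm_ReIm _) _; simpc => /=.
move: E1 E2 E3; set r1 := _ - _ - x; set r2 := _ - _; set r3 := _ - y => E1 E2 E3.
have -> : expR x = 1 + x + r1 by rewrite /r1; ring.
have -> : cos y = 1 + r2 by rewrite /r2; ring.
have -> : sin y = y + r3 by rewrite /r3; ring.
have E1' : `|r1| <= t * n by nra.
have E2' : `|r2| <= t * n by nra.
have E3' : `|r3| <= t * n by nra.
have X3 : `|1 + x + r1| <= 3.
  have := ler_normD (1 + x) r1; have := ler_normD 1 x; rewrite normr1; nra.
have X2 : `|x + r1| <= 2 * t.
  have := ler_normD x r1; nra.
rewrite (_ : (1 + x + r1) * (1 + r2) - 1 - x = r1 + (1 + x + r1) * r2); last ring.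
rewrite (_ : (1 + x + r1) * (y + r3) - y = (1 + x + r1) * r3 + (x + r1) * y); last ring.
have B1 : `|r1 + (1 + x + r1) * r2| <= t * n + 3 * (t * n).
  by rewrite (le_trans (ler_normD _ _)) // lerD // normrM ler_pM.
have B2 : `|(1 + x + r1) * r3 + (x + r1) * y| <= 3 * (t * n) + 2 * t * n.
  by rewrite (le_trans (ler_normD _ _)) // lerD // normrM ler_pM.
lra.
Qed.

Lemma cdiff_cexp z : cdiff (@cexp R) z.
Proof. by exists (cexp z); exact: hd_cexp. Qed.

Lemma Re_nm_bnd z : z != 0 -> -1 <= complex.Re z / nm z <= 1.
Proof.
rewrite -nm_gt0 => z0; have := nm_Re z; rewrite ler_norml => h.
by rewrite ler_pdivlMr // ler_pdivrMr //; lra.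
Qed.

Lemma cexp_clog z : z != 0 -> cexp (clog z) = z.
Proof.
move=> z0; have nz := nm_gt0 z; rewrite z0 in nz.
rewrite /cexp /clog /= -/(nm z) lnK ?posrE //.
have bnd := Re_nm_bnd z0.
have cE : cos (carg z) = complex.Re z / nm z.
  by rewrite /carg -/(nm z); case: ifP => _; rewrite ?cosN acosK // in_itv.
have sE : sin (carg z) = complex.Im z / nm z.
  have : sin (acos (complex.Re z / nm z)) = `|complex.Im z| / nm z.
    rewrite sin_acos //.
    have -> : 1 - (complex.Re z / nm z) ^+ 2 = (complex.Im z / nm z) ^+ 2.
      rewrite !expr_div_n -[1](@divff _ (nm z ^+ 2)); last by rewrite expf_neq0 // gt_eqF.
      by rewrite -mulrBl {1}nmsqr addrAC subrr add0r.
    by rewrite sqrtr_sqr normrM normfV (gtr0_norm nz).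
  rewrite /carg -/(nm z) => sE; case: ifP => I0.
    by rewrite sE ger0_norm.
  by rewrite sinN sE ltr0_norm ?mulNr ?opprK // ltNge I0.
rewrite cE sE; have nz' : nm z != 0 by rewrite gt_eqF.
apply/eqP; rewrite eq_complex /=; apply/andP; split; apply/eqP.
  by rewrite mul0r subr0 mulrCA divff // mulr1.
by rewrite mul0r addr0 mulrCA divff // mulr1.
Qed.

Lemma clogK z : - pi < complex.Im z -> complex.Im z <= pi -> clog (cexp z) = z.
Proof.
move=> h1 h2; rewrite /clog -/(nm (cexp z)) nm_cexp expRK.
suff -> : carg (cexp z) = complex.Im z by case: (z).
rewrite /carg -/(nm (cexp z)) nm_cexp cexpE /=.
have e0 := expR_gt0 (complex.Re z).
rewrite mulrAC divff ?gt_eqF // mul1r pmulr_rge0 //.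
have [y0|y0] := leP 0 (complex.Im z).
  by rewrite sin_ge0_pi ?y0 // cosK // in_itv /= y0.
rewrite ifF; last first.
  apply/negbTE; rewrite -ltNge -[complex.Im z]opprK sinN oppr_lt0.
  by apply: sin_gt0_pi; lra.
by rewrite cosKN ?opprK //; lra.
Qed.

Lemma Re_clog z : complex.Re (clog z) = ln (nm z). Proof. by []. Qed.

Lemma nm_clog_arg z : z != 0 -> - pi <= complex.Im (clog z) <= pi.
Proof.
move=> /Re_nm_bnd bnd; rewrite /clog /= /carg -/(nm z).
have := acos_ge0 bnd; have := acos_lepi bnd; case: ifP => _; lra.
Qed.

Lemma clog_arg_Re z : 0 < complex.Re z ->
  - (pi / 2) < complex.Im (clog z) < pi / 2.
Proof.
move=> z0; have z1 : z != 0 by apply: contraTneq z0 => ->; rewrite ltxx.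
have nz : 0 < nm z by rewrite nm_gt0.
have bnd := Re_nm_bnd z1; rewrite /clog /= /carg -/(nm z).
have a0 := acos_ge0 bnd; have ap := acos_lepi bnd.
suff : acos (complex.Re z / nm z) < pi / 2.
  by have := pi_gt0 R; case: ifP => _; lra.
rewrite ltNge; apply/negP => h.
have : 0 < cos (acos (complex.Re z / nm z)) by rewrite acosK ?in_itv //= divr_gt0.
have : 0 <= cos (pi - acos (complex.Re z / nm z)).
  by apply: cos_ge0_pihalf; have := pi_gt0 R; lra.
by rewrite addrC cosDpi cosN; lra.
Qed.

(** Two arguments in ]-pi/2, pi/2[ have their sum in ]-pi, pi[, so no correction by 2 pi i
    arises. *)
Lemma clogM z w : 0 < complex.Re z -> 0 < complex.Re w ->
  clog (z * w) = clog z + clog w.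
Proof.
move=> z0 w0.
have z1 : z != 0 by apply: contraTneq z0 => ->; rewrite ltxx.
have w1 : w != 0 by apply: contraTneq w0 => ->; rewrite ltxx.
rewrite -{1}(cexp_clog z1) -{1}(cexp_clog w1) -cexpD.
have := clog_arg_Re z0; have := clog_arg_Re w0.
by case: (clog z) (clog w) => [a b] [c e] /= *; apply: clogK => /=; lra.
Qed.

(** The half-angle formula gives the argument by one expression on the whole slit plane, whereas
    [carg] is defined by cases; continuity of the logarithm is read off from it. *)
Lemma clog_half z : 0 < nm z + complex.Re z ->
  carg z = 2 * atan (complex.Im z / (nm z + complex.Re z)).
Proof.
move=> z0; have z1 : z != 0 by apply: contraTneq z0 => ->; rewrite nm0 addr0 ltxx.
have nz : 0 < nm z by rewrite nm_gt0.
have bnd := Re_nm_bnd z1.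
have := cexp_clog z1; rewrite cexpE /clog /= -/(nm z) lnK ?posrE // => E.
have [cE sE] : nm z * cos (carg z) = complex.Re z /\ nm z * sin (carg z) = complex.Im z.
  by split; [move/(congr1 (@complex.Re R)): E|move/(congr1 (@complex.Im R)): E].
have c1 : -1 < complex.Re z / nm z by rewrite ltr_pdivlMr //; lra.
have tb : - pi < carg z < pi.
  rewrite /carg -/(nm z); have := acos_ge0 bnd.
  have := @acos_ltpi _ (complex.Re z / nm z); have := pi_gt0 R.
  case: ifP => _; lra.
pose t := carg z / 2; have tE : carg z = t *+ 2 by rewrite /t -mulr_natr; field.
have ct : 0 < cos t by apply: cos_gt0_pihalf; rewrite /t; lra.
have tt : - (pi / 2) < t < pi / 2 by rewrite /t; lra.
clearbody t; suff -> : complex.Im z / (nm z + complex.Re z) = tan t.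
  by rewrite tanK ?tE ?mulr_natl // in_itv.
rewrite tE sin_mulr2n cos_mulr2n !mulr2n in cE sE.
move: (complex.Re z) (complex.Im z) (nm z) nz cE sE => a b n n0 <- <-; rewrite /tan.
have -> : n + n * (cos t ^+ 2 + cos t ^+ 2 - 1) = n * (cos t * 2) * cos t by ring.
have -> : n * (cos t * sin t + cos t * sin t) = n * (cos t * 2) * sin t by ring.
by rewrite -mulf_div divff ?mul1r // !mulf_neq0 // ?gt_eqF.
Qed.

(** [nm z + Re z] is zero exactly on ]-oo, 0], so the slit plane is described by a single
    inequality. *)
Definition slit z := 0 < nm z + complex.Re z.

Lemma slit_Re z : 0 < complex.Re z -> slit z.
Proof. by move=> z0; rewrite /slit; have := nm_ge0 z; lra. Qed.

Lemma slit_neq0 z : slit z -> z != 0.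
Proof. by rewrite /slit; apply: contraTneq => ->; rewrite nm0 addr0 ltxx. Qed.

Lemma cts_Re z : cts (fun x => (complex.Re x)%:C) z.
Proof.
move=> e e0; exists e => // h he; rewrite -rmorphB nmR -raddfB /=.
by rewrite [z + h]addrC addrK (le_trans (nm_Re _)) // ltW.
Qed.

Lemma cts_Im z : cts (fun x => (complex.Im x)%:C) z.
Proof.
move=> e e0; exists e => // h he; rewrite -rmorphB nmR -raddfB /=.
by rewrite [z + h]addrC addrK (le_trans (nm_Im _)) // ltW.
Qed.

Lemma cts_nm z : cts (fun x => (nm x)%:C) z.
Proof.
move=> e e0; exists e => // h he; rewrite -rmorphB nmR ler_norml.
have := nmD z h; have := nmDB z h; lra.
Qed.

Lemma cts_clog z : slit z -> cts (@clog R) z.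
Proof.
move=> sz; have z0 := slit_neq0 sz.
have nz : 0 < nm z by rewrite nm_gt0.
pose q (x : R[i]) : R := complex.Im x / (nm x + complex.Re x).
have cq : cts (fun x => (q x)%:C) z.
  rewrite (_ : (fun x => _) = (fun x => (complex.Im x)%:C *
      ((nm x)%:C + (complex.Re x)%:C)^-1)); last first.
    by apply/funext => x; rewrite rmorphM fmorphV rmorphD.
  apply: ctsM; first exact: cts_Im.
  apply: ctsV; first by apply: ctsD; [exact: cts_nm|exact: cts_Re].
  by rewrite -rmorphD /= -nm_gt0 nmRp // ltW.
have c1 : cts (fun x => (ln (nm x))%:C) z.
  by apply: cts_real; [exact: continuous_ln|exact: cts_nm].
have c2 : cts (fun x => (atan (q x))%:C) z.
  by apply: cts_real => //; exact: continuous_atan.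
have cg : cts (fun x => (ln (nm x))%:C + 2 * (atan (q x))%:C * 'i) z.
  by apply: ctsD => //; do 2!(apply: ctsM => //; try exact: cts_cst).
pose r := (nm z + complex.Re z) / 2.
apply: (cts_near (r := r)) cg; first by rewrite /r divr_gt0.
move=> x xz; have sx : slit x.
  rewrite /slit.
  have := nm_Re (x - z); have := nmDB z (x - z); rewrite [z + _]addrC subrK.
  rewrite raddfB /= ler_norml; move: xz; rewrite /r /slit in sz *; lra.
rewrite /clog -/(nm x) clog_half // -/(q x) -(rmorph_nat (real_complex R)) -rmorphM.
by simpc.
Qed.

(** Since [cexp] inverts [clog], the slope of [clog] is the inverse of the slope of [cexp] taken at
    the increment of [clog]; continuity of [clog] makes this slope continuous. *)
Lemma hd_clog z : slit z -> hd (@clog R) z z^-1.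
Proof.
move=> sz; have z0 := slit_neq0 sz.
have /hdP[phi [cphi phi0 phiE]] := hd_cexp (clog z).
pose k h := clog (z + h) - clog z.
have ck : cts k 0.
  have := cts_clog sz => H e /H[d d0 dP]; exists d => // h /dP.
  by rewrite /k add0r addr0 subrr subr0.
have k0 : k 0 = 0 by rewrite /k addr0 subrr.
apply/hdP; exists (fun h => if z + h == 0 then (clog (z + h) - clog z) / h else (phi (k h))^-1).
split.
- have c : cts (fun h => (phi (k h))^-1) 0.
    apply: ctsV; last by rewrite k0 phi0 cexp_clog.
    by apply: cts_comp; rewrite ?k0.
  apply: cts_near c; first by rewrite -nm_gt0 in z0; exact: z0.
  move=> x; rewrite subr0 => xz; case: eqP => // /eqP.
  by rewrite addrC addr_eq0 => /eqP E; rewrite E nmN ltxx in xz.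
- by rewrite addr0 (negbTE z0) k0 phi0 cexp_clog.
- move=> h; case: eqVneq => [E|zh].
    have h0 : h != 0 by apply: contra_neq z0 => h0; rewrite h0 addr0 in E.
    by rewrite divfK // [RHS]addrC subrK.
  have := phiE (k h); rewrite {1}/k [clog z + _]addrC subrK !cexp_clog //.
  move=> /addrI hE; have [h0|h0] := eqVneq h 0; first by rewrite h0 addr0 mulr0 addr0.
  have p0 : phi (k h) != 0.
    by apply: contra_neq h0 => p0; rewrite hE p0 mul0r.
  by rewrite [X in _^-1 * X]hE mulKf // /k [RHS]addrC subrK.
Qed.

Lemma cdiff_clog z : slit z -> cdiff (@clog R) z.
Proof. by move=> sz; exists z^-1; exact: hd_clog. Qed.

(** The power x^(-s) for the principal branch; the sign is built in because the cusp sums are sums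
    of inverse powers. *)
Definition pw (s x : R[i]) : R[i] := cexp (- s * clog x).

Lemma pwD s t x : pw (s + t) x = pw s x * pw t x.
Proof. by rewrite /pw -cexpD; congr cexp; ring. Qed.

Lemma pw1 x : x != 0 -> pw 1 x = x^-1.
Proof. by move=> x0; rewrite /pw mulN1r cexpN cexp_clog. Qed.

Lemma pwM s x y : 0 < complex.Re x -> 0 < complex.Re y ->
  pw s (x * y) = pw s x * pw s y.
Proof. by move=> x0 y0; rewrite /pw clogM // mulrDr cexpD. Qed.

Lemma nm_pw_le s x (S L : R) : nm s <= S -> nm (clog x) <= L -> nm (pw s x) <= expR (S * L).
Proof.
move=> sS xL; rewrite nm_cexp ler_expR (le_trans (Re_le_nm _)) // nmM nmN.
by rewrite ler_pM ?nm_ge0.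
Qed.

Lemma nm_pw s x : x != 0 ->
  nm (pw s x) <= expR (- complex.Re s * ln (nm x)) * expR (nm s * pi).
Proof.
move=> x0; rewrite nm_cexp -expRD ler_expR.
have -> : complex.Re (- s * clog x) =
    - complex.Re s * complex.Re (clog x) + complex.Im s * complex.Im (clog x).
  by case: s (clog x) => [a b] [c d]; simpc => /=; ring.
rewrite Re_clog lerD2l; apply: le_trans (ler_norm _) _.
by rewrite normrM ler_pM ?nm_Im // ler_norml nm_clog_arg.
Qed.

Lemma cdiff_pw (s x : R[i] -> R[i]) z : cdiff s z -> cdiff x z -> slit (x z) ->
  cdiff (fun t => pw (s t) (x t)) z.
Proof.
move=> ds dx sx; apply: (@cdiff_comp _ (fun t => - s t * clog (x t))).
  apply: cdiffM; first exact: cdiffN.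
  by apply: cdiff_comp => //; exact: cdiff_clog.
exact: cdiff_cexp.
Qed.
End cexp.

(** * Circle means and Cauchy's integral formula *)

Section circle.
Variable R : realType.
Implicit Types (z w c h : R[i]) (f g : R[i] -> R[i]).

Definition turn : R[i] := (pi *+ 2)%:C * 'i.
Definition circ c (r x : R) : R[i] := c + r%:C * cexp (x%:C * turn).
(** This is (2 pi i)^-1 times the integral of f(z) / (z - c) over the circle. *)
Definition cmean f c (r : R) : R[i] := mean (fun x => f (circ c r x)).

Lemma cexp_turn : cexp turn = 1.
Proof. by rewrite /turn cexpE; simpc => /=; rewrite expR0 cos2pi sin2pi !mul1r. Qed.

Lemma nm_unit (x : R) : nm (cexp (x%:C * turn)) = 1.
Proof. by rewrite nm_cexp /turn; simpc => /=; rewrite expR0. Qed.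

Lemma nm_circ c (r x : R) : 0 <= r -> nm (circ c r x - c) = r.
Proof. by move=> r0; rewrite /circ addrC addKr nmM nm_unit mulr1 nmRp. Qed.

Lemma circ_uc f c (r : R) : 0 <= r -> (forall z, nm (z - c) = r -> cts f z) ->
  uc (fun x => f (circ c r x)).
Proof.
move=> r0 cf.
have := @cseg_uc R (fun z => f (c + r%:C * cexp z)) 0 turn.
rewrite (_ : (fun x : R => _) = (fun x => f (circ c r x))); last first.
  by apply/funext => x; rewrite add0r.
apply=> x x01; rewrite add0r.
apply: (@cts_comp _ (fun z => c + r%:C * cexp z)).
  apply: ctsD; first exact: cts_cst.
  by apply: ctsM; [exact: cts_cst|exact/cdiff_cts/cdiff_cexp].
by apply: cf; rewrite -/(circ c r x) nm_circ.
Qed.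

Lemma cmean_le f c (r M : R) : 0 <= r -> (forall z, nm (z - c) = r -> cts f z) ->
  (forall z, nm (z - c) = r -> nm (f z) <= M) -> nm (cmean f c r) <= M.
Proof.
move=> r0 cf fM; apply: mean_le => [|x x01]; first exact: circ_uc.
by apply: fM; rewrite nm_circ.
Qed.

Lemma eq_cmean f g c (r : R) : 0 <= r ->
  (forall z, nm (z - c) = r -> f z = g z) -> cmean f c r = cmean g c r.
Proof. by move=> r0 fg; apply: eq_mean => x x01; apply: fg; rewrite nm_circ. Qed.

Lemma cmeanD f g c (r : R) : 0 <= r -> (forall z, nm (z - c) = r -> cts f z) ->
  (forall z, nm (z - c) = r -> cts g z) ->
  cmean (fun z => f z + g z) c r = cmean f c r + cmean g c r.
Proof. by move=> r0 cf cg; rewrite /cmean meanD //; exact: circ_uc. Qed.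

Lemma cmeanZ f c (r : R) (a : R[i]) : 0 <= r -> (forall z, nm (z - c) = r -> cts f z) ->
  cmean (fun z => a * f z) c r = a * cmean f c r.
Proof. by move=> r0 cf; rewrite /cmean meanZ //; exact: circ_uc. Qed.

(** The map z -> c + e^z sends a rectangle of height 2 pi onto the annulus. The horizontal sides
    cancel by periodicity, and Goursat's theorem equates the vertical ones, which are the two circle
    means. *)
Lemma cmean_annulus f c (r1 r2 : R) : 0 < r1 -> r1 <= r2 ->
  (forall z, r1 <= nm (z - c) <= r2 -> cdiff f z) -> cmean f c r1 = cmean f c r2.
Proof.
move=> r10 r12 df; have r20 : 0 < r2 by exact: lt_le_trans r12.
pose H z := f (c + cexp z).
pose a := ln r2 - ln r1.
have a0 : 0 <= a by rewrite subr_ge0 ler_ln.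
have b0 : 0 <= pi *+ 2 :> R by rewrite mulrn_wge0 // pi_ge0.
have dH : rect_all (cdiff H) (ln r1) 0 a (pi *+ 2).
  move=> u v /andP[u1 u2] _; apply: (@cdiff_comp _ (fun z => c + cexp z)).
    by apply: cdiffD; [exact: cdiff_cst|exact: cdiff_cexp].
  apply: df; rewrite addrC addKr nm_cexp /=.
  have E (t : R) : 0 < t -> expR (ln t) = t by move=> t0; apply: lnK; rewrite posrE.
  apply/andP; split; [rewrite -(E r1) //|rewrite -(E r2) //]; rewrite ler_expR //.
  by move: u2; rewrite /a addrC subrK.
have HE (r : R) : 0 < r -> li H (ln r +i* 0) turn = turn * cmean f c r.
  move=> r0; congr (_ * mean _); apply/funext => x; congr (f (_ + _)).
  by rewrite cexpD -[ln r +i* 0]/((ln r)%:C) cexpE /= cos0 sin0 mulr0 mulr1 lnK.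
have := goursat a0 b0 dH; rewrite /rectint -/turn.
have -> : li H (ln r1 +i* (0 + pi *+ 2)) a%:C = li H (ln r1 +i* 0) a%:C.
  congr (_ * mean _); apply/funext => x; congr (f (_ + _)).
  rewrite (_ : ln r1 +i* (0 + pi *+ 2) = ln r1 +i* 0 + turn); last by rewrite /turn; simpc.
  by rewrite addrAC [LHS]cexpD cexp_turn mulr1.
rewrite [X in X - _ - _]addrC addrK (_ : ln r1 + a = ln r2); last by rewrite /a addrC subrK.
rewrite !HE // -mulrBr => /eqP; rewrite mulf_eq0 subr_eq0.
have /negbTE-> : turn != 0.
  by rewrite -nm_gt0 /turn nmM nmi mulr1 nmRp // pmulrn_lgt0 // pi_gt0.
by move=> /eqP.
Qed.

(** Serves to cross the circle through w in Cauchy's formula, where the difference quotient is only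
    known to be continuous and the annulus argument stops. *)
Lemma cmean_cts f c (r : R) : 0 <= r -> (forall z, nm (z - c) = r -> cts f z) ->
  forall e : R, 0 < e -> exists2 d : R, 0 < d & forall r', 0 <= r' ->
   (forall z, nm (z - c) = r' -> cts f z) -> `|r' - r| < d ->
   nm (cmean f c r' - cmean f c r) <= e.
Proof.
move=> r0 cf e e0.
have [] := @tube R (fun x d => forall r' : R, `|r' - r| < d ->
    nm (f (circ c r' x) - f (circ c r x)) <= e).
- by move=> x d d' d'0 dd' H r' rr'; apply: H; exact: lt_le_trans dd'.
- move=> x x01.
  have [d d0 dP] := cf (circ c r x) (nm_circ c x r0) (e / 2) ltac:(lra).
  have ux := @cseg_uc R (@cexp R) 0 turn (fun x _ => cdiff_cts (cdiff_cexp _)).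
  have [d' d'0 d'P] := ux (d / 2 / (r + 1)) ltac:(rewrite !divr_gt0 //; lra).
  exists (Num.min d' (d / 2)); first by rewrite lt_min d'0 divr_gt0.
  move=> y y01; rewrite lt_min => /andP[yx1 _] r'; rewrite lt_min => /andP[_ rr'].
  have near_r (r2 : R) : `|r2 - r| < d / 2 -> nm (f (circ c r2 y) - f (circ c r x)) <= e / 2.
    move=> r2r; have := dP (circ c r2 y - circ c r x).
    rewrite [circ c r x + _]addrC subrK; apply.
    have -> : circ c r2 y - circ c r x = (r2 - r)%:C * cexp (y%:C * turn) +
       r%:C * (cexp (y%:C * turn) - cexp (x%:C * turn)) by rewrite /circ rmorphB; ring.
    apply: le_lt_trans (nmD _ _) _; rewrite (nmM (r2 - r)%:C) (nmM r%:C) nm_unit mulr1 nmR (nmRp r0).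
    have := d'P y x y01 x01 yx1; rewrite !add0r ler_pdivlMr; last lra.
    have := nm_ge0 (cexp (y%:C * turn) - cexp (x%:C * turn)); nra.
  have h1 := near_r r' rr'; have h2 := near_r r ltac:(rewrite subrr normr0; lra).
  have := nm_tri (f (circ c r' y)) (f (circ c r x)) (f (circ c r y)).
  rewrite (nmB (f (circ c r x))); lra.
move=> d d0 dP; exists d => // r' r'0 cf' rr'.
rewrite (_ : _ - _ = mean (fun x => f (circ c r' x) + -1 * f (circ c r x))); last first.
  rewrite meanD ?meanZ ?mulN1r //; try apply: ucZ; exact: circ_uc.
apply: mean_le => [|x x01]; last by rewrite mulN1r dP.
by apply: ucD; [exact: circ_uc|apply/ucZ/circ_uc].
Qed.

(** The mean does not depend on the radius and tends to 1 as the radius grows, the integrand being 1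
    + (w - c) / (z - w). *)
Lemma cauchy_kernel c w (r : R) : nm (w - c) < r ->
  cmean (fun z => (z - c) / (z - w)) c r = 1.
Proof.
move=> wr; have r0 : 0 < r by exact: le_lt_trans (nm_ge0 _) wr.
have zw (r' : R) z : r <= r' -> nm (z - c) = r' -> r' - nm (w - c) <= nm (z - w).
  by move=> rr' E; have := nm_tri z w c; rewrite E; lra.
have zw0 (r' : R) z : r <= r' -> nm (z - c) = r' -> z - w != 0.
  by move=> rr' E; rewrite -nm_gt0; have := zw _ _ rr' E; lra.
apply/eqP; rewrite -subr_eq0; apply/eqP; apply: (@nm_small R _ (nm (w - c))) => e e0.
(* On the circle of this radius |z - w| is at least 1 / e. *)
pose r' := r + nm (w - c) + e^-1.
have ei : 0 < e^-1 by rewrite invr_gt0.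
have rr' : r <= r' by rewrite /r'; have := nm_ge0 (w - c); lra.
have dk z : r <= nm (z - c) -> cdiff (fun z => (z - c) / (z - w)) z.
  move=> rz; apply: cdiffM; first by apply: cdiffB; [exact: cdiff_id|exact: cdiff_cst].
  apply: cdiffV; first by apply: cdiffB; [exact: cdiff_id|exact: cdiff_cst].
  exact: (zw0 (nm (z - c))).
rewrite (@cmean_annulus _ c r r') //; last by move=> z /andP[rz _]; exact: dk.
rewrite -{1}(@mean_cst R 1) (_ : _ - _ = cmean (fun z => (z - c) / (z - w) + -1 * 1) c r'); last first.
  rewrite cmeanD; [|lra| |]; first by rewrite /cmean !mean_cst mulr1.
    by move=> z E; apply/cdiff_cts/dk; rewrite E.
  by move=> z E; exact: cts_cst.
apply: cmean_le; first lra.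
  move=> z E; apply: ctsD; last exact: cts_cst.
  by apply/cdiff_cts/dk; rewrite E.
move=> z E; have z0 := zw0 r' z rr' E.
have -> : (z - c) / (z - w) + -1 * 1 = (w - c) / (z - w) by field.
rewrite nmM nmV mulrC ler_wpM2r ?nm_ge0 // -[leRHS]invrK lef_pV2 ?posrE //.
  by apply: le_trans (zw _ _ rr' E); rewrite /r'; lra.
by rewrite nm_gt0.
Qed.

(* The mean of [(z - c) (f z - f w) / (z - w)] over the circle of radius t does
   not depend on t on ]0, |w - c|[ nor on ]|w - c|, r[, and is continuous in t. *)
Lemma cauchy f c w (r rho : R) : (forall z, nm (z - c) < r -> cdiff f z) ->
  rho < r -> nm (w - c) < rho ->
  f w = cmean (fun z => f z * ((z - c) / (z - w))) c rho.
Proof.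
move=> df rr wr; have r0 : 0 < rho by exact: le_lt_trans (nm_ge0 _) wr.
have [l lP] := df w (lt_trans wr rr).
have /hdP[phi [cphi phi0 phiE]] := lP.
(* Through the slope function [phi] the difference quotient is extended continuously to z = w. *)
pose g z := (z - c) * phi (z - w).
have gE z : z != w -> g z = (z - c) * ((f z - f w) / (z - w)).
  move=> zw; have := phiE (z - w); rewrite [w + _]addrC subrK => ->.
  by rewrite /g [f w + _]addrC addrK mulfK // subr_eq0.
have dg z : nm (z - c) < r -> z != w -> cdiff g z.
  move=> zr zw; have zw' : 0 < nm (z - w) by rewrite nm_gt0 subr_eq0.
  apply: (cdiff_near (r := nm (z - w)) (f := fun z => (z - c) * ((f z - f w) / (z - w)))) => //.
    move=> x xz; rewrite gE //; apply: contraTneq xz => ->.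
    by rewrite nmB ltxx.
  apply: cdiffM; first by apply: cdiffB; [exact: cdiff_id|exact: cdiff_cst].
  apply: cdiffM; first by apply: cdiffB; [exact: df|exact: cdiff_cst].
  apply: cdiffV; first by apply: cdiffB; [exact: cdiff_id|exact: cdiff_cst].
  by rewrite subr_eq0.
have cg z : nm (z - c) < r -> cts g z.
  move=> zr; have [->|zw] := eqVneq z w; last by apply/cdiff_cts/dg.
  apply: ctsM; first by apply: ctsB; [exact: cts_id|exact: cts_cst].
  apply: (@cts_comp _ (fun z => z - w)); first by apply: ctsB; [exact: cts_id|exact: cts_cst].
  by rewrite subrr.
have cgc (t : R) : t < r -> forall z, nm (z - c) = t -> cts g z.
  by move=> tr z E; apply: cg; rewrite E.
have hi (t : R) : nm (w - c) < t -> t < r -> cmean g c t = cmean g c rho.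
  move=> tw tr; have ann (t1 t2 : R) : nm (w - c) < t1 -> t1 <= t2 -> t2 < r ->
      cmean g c t1 = cmean g c t2.
    move=> h1 h2 h3; apply: cmean_annulus => //; first by exact: le_lt_trans (nm_ge0 _) h1.
    move=> z /andP[z1 z2]; apply: dg; first exact: le_lt_trans h3.
    by apply: contraTneq z1 => ->; rewrite -ltNge.
  by have [h|h] := leP t rho; [exact: ann|rewrite -(ann rho t) // ltW].
have lo (t1 t2 : R) : 0 < t1 -> t1 <= t2 -> t2 < nm (w - c) -> cmean g c t1 = cmean g c t2.
  move=> h1 h2 h3; apply: cmean_annulus => // z /andP[z1 z2].
  apply: dg; first lra.
  by apply: contraTneq z2 => ->; rewrite -ltNge.
have M0 : cmean g c rho = 0.
  apply: (@nm_small R _ 2) => e e0.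
  have g0 : g c = 0 by rewrite /g subrr mul0r.
  have [d d0 dP] : exists2 d : R, 0 < d & forall t, 0 < t -> t < d -> nm (cmean g c t) <= e.
    have rp : 0 < r by exact: lt_trans rr.
    have [|d d0 dP] := cg c _ e e0; first by rewrite subrr nm0.
    exists (Num.min d r); first by rewrite lt_min d0.
    move=> t t0; rewrite lt_min => /andP[td tr]; apply: cmean_le; [exact: ltW|exact: cgc|].
    move=> z E; have := dP (z - c); rewrite g0 subr0 [c + _]addrC subrK E; exact.
  have mid (u v t : R) : u < v -> 0 < t -> exists x, [/\ u < x, x < v & x < u + t].
    move=> uv t0; exists (u + Num.min (v - u) t / 2).
    have m0 : 0 < Num.min (v - u) t by rewrite lt_min t0 subr_gt0 uv.
    have m1 : Num.min (v - u) t <= v - u by rewrite ge_min lexx.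
    have m2 : Num.min (v - u) t <= t by rewrite ge_min lexx orbT.
    by clear -m0 m1 m2 uv t0; split; lra.
  (* If w = c, small circles suffice. Otherwise three circles are used: t1 just outside the circle
     through w, t2 just inside, and t3 so small that the mean there is at most e. *)
  have [w0|w0] := eqVneq (nm (w - c)) 0.
    have [t [t0 t1 t2]] := mid 0 rho d r0 d0; rewrite add0r in t2.
    rewrite -(hi t) ?w0 ?(lt_trans t1) //.
    by have := dP t t0 t2; clear -e0; lra.
  have {w0} w0 : 0 < nm (w - c) by rewrite lt_neqAle eq_sym w0 nm_ge0.
  have [d' d'0 d'P] := cmean_cts (ltW w0) (cgc _ (lt_trans wr rr)) (e := e / 2) ltac:(clear -e0; lra).
  have [t1 [a1 a2 a3]] := mid _ _ _ wr d'0.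
  have t1r := lt_trans a2 rr; have t10 := lt_trans w0 a1.
  have F1 : nm (cmean g c t1 - cmean g c (nm (w - c))) <= e / 2.
    apply: d'P (ltW t10) (cgc _ t1r) _.
    by rewrite ger0_norm; clear -a1 a3; lra.
  have [t2 [b1 b2 b3]] : exists t, [/\ 0 < t, t < nm (w - c) & nm (w - c) < t + d'].
    have [|t [b1 b2 b3]] := mid (- nm (w - c)) 0 d' _ d'0; first by rewrite oppr_lt0.
    by exists (- t); clear -b1 b2 b3; split; lra.
  have F2 : nm (cmean g c t2 - cmean g c (nm (w - c))) <= e / 2.
    apply: d'P (ltW b1) (cgc _ (lt_trans b2 (lt_trans wr rr))) _.
    by rewrite ltr0_norm; clear -b2 b3; lra.
  have [t3 [c1 c2 c3]] := mid _ _ _ b1 d0; rewrite add0r in c3.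
  have F3 := dP t3 c1 c3; rewrite (lo t3 t2 c1 (ltW c2) b2) in F3.
  rewrite -(hi t1 a1 t1r).
  have := nm_tri (cmean g c t1) (cmean g c (nm (w - c))) (cmean g c t2).
  have := nm_tri (cmean g c t1) (cmean g c t2) 0; rewrite !subr0.
  by rewrite (nmB (cmean g c (nm (w - c)))); clear -F1 F2 F3; lra.
have zw0 z : nm (z - c) = rho -> z - w != 0.
  by move=> E; rewrite subr_eq0; apply: contraTneq wr => <-; rewrite E ltxx.
have ck z : nm (z - c) = rho -> cts (fun z => (z - c) / (z - w)) z.
  move=> E; apply: ctsM; first by apply: ctsB; [exact: cts_id|exact: cts_cst].
  apply: ctsV; last exact: zw0.
  by apply: ctsB; [exact: cts_id|exact: cts_cst].
have : cmean (fun z => f z * ((z - c) / (z - w))) c rho =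
    cmean (fun z => g z + f w * ((z - c) / (z - w))) c rho.
  apply: eq_cmean; first lra.
  move=> z E; rewrite gE; last by have := zw0 z E; rewrite subr_eq0.
  by field; exact: zw0.
move=> ->; rewrite cmeanD; [|lra|exact: cgc|].
  by rewrite M0 add0r cmeanZ ?cauchy_kernel ?mulr1 //; lra.
by move=> z E; apply: ctsM; [exact: cts_cst|exact: ck].
Qed.
End circle.

(** Differentiates along the shape of the expression; nonzero denominators and functions outside the
    field operations remain as goals. *)
Ltac cd_step := lazymatch goal with
  | |- cdiff (fun _ => ?a) _ => exact (cdiff_cst a _)
  | |- cdiff (fun x => x) _ => exact (cdiff_id _)
  | |- cdiff (fun x => @GRing.add _ (@?f x) (@?g x)) _ => refine (@cdiffD _ f g _ _ _)
  | |- cdiff (fun x => @GRing.opp _ (@?f x)) _ => refine (@cdiffN _ f _ _)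
  | |- cdiff (fun x => @GRing.mul _ (@?f x) (@?g x)) _ => refine (@cdiffM _ f g _ _ _)
  | |- cdiff (fun x => @GRing.exp _ (@?f x) ?n) _ => refine (@cdiffX _ f _ n _)
  | |- cdiff (fun x => @GRing.inv _ (@?f x)) _ => refine (@cdiffV _ f _ _ _)
  end.
Ltac cd := repeat cd_step.

(** * Taylor expansion with remainder and limits of holomorphic functions *)

Section taylor.
Variable R : realType.
Implicit Types (z w c h : R[i]) (f g : R[i] -> R[i]).

(** Cauchy's formula for the m-th Taylor coefficient of f at c. *)
Definition tc f c (rho : R) (m : nat) : R[i] := cmean (fun z => f z * (z - c) ^- m) c rho.

Lemma cts_tc f c (rho : R) m : 0 < rho -> (forall z, nm (z - c) = rho -> cts f z) ->
  forall z, nm (z - c) = rho -> cts (fun z => f z * (z - c) ^- m) z.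
Proof.
move=> r0 cf z E; apply: ctsM; first exact: cf.
apply: ctsV; last by rewrite expf_neq0 // -nm_gt0 E.
by apply/cdiff_cts/cdiffX/cdiffB; [exact: cdiff_id|exact: cdiff_cst].
Qed.

Lemma tc_le f c (rho M : R) m : 0 < rho ->
  (forall z, nm (z - c) = rho -> cts f z) ->
  (forall z, nm (z - c) = rho -> nm (f z) <= M) -> nm (tc f c rho m) <= M / rho ^+ m.
Proof.
move=> r0 cf fM; apply: cmean_le; [exact: ltW|exact: cts_tc|] => z E.
by rewrite nmM nmV nmX E ler_wpM2r ?invr_ge0 ?exprn_ge0 ?fM // ltW.
Qed.

Lemma tcD f g c (rho : R) m : 0 < rho -> (forall z, nm (z - c) = rho -> cts f z) ->
  (forall z, nm (z - c) = rho -> cts g z) ->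
  tc (fun z => f z + g z) c rho m = tc f c rho m + tc g c rho m.
Proof.
move=> r0 cf cg; rewrite -cmeanD; [|exact: ltW|exact: cts_tc|exact: cts_tc].
by apply: eq_cmean => [|z _]; [exact: ltW|rewrite mulrDl].
Qed.

Lemma tcZ f c (rho : R) (a : R[i]) m : 0 < rho -> (forall z, nm (z - c) = rho -> cts f z) ->
  tc (fun z => a * f z) c rho m = a * tc f c rho m.
Proof.
move=> r0 cf; rewrite -cmeanZ; [|exact: ltW|exact: cts_tc].
by apply: eq_cmean => [|z _]; [exact: ltW|rewrite mulrA].
Qed.

Lemma eq_tc f g c (rho : R) m : 0 <= rho ->
  (forall z, nm (z - c) = rho -> f z = g z) -> tc f c rho m = tc g c rho m.
Proof. by move=> r0 fg; apply: eq_cmean => // z /fg ->. Qed.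

(** The Cauchy kernel 1 / (z - c - h) is expanded by finitely many geometric steps; the remainder is
    again a circle mean, that of [F n], and is bounded by its integrand. *)
Lemma taylor f c h (r rho M : R) n : (forall z, nm (z - c) < r -> cdiff f z) ->
  rho < r -> nm h < rho -> (forall z, nm (z - c) = rho -> nm (f z) <= M) ->
  nm (f (c + h) - \sum_(m < n) tc f c rho m * h ^+ m)
    <= M * ((nm h / rho) ^+ n / (1 - nm h / rho)).
Proof.
move=> df rr hr fM; have r0 : 0 < rho by exact: le_lt_trans (nm_ge0 _) hr.
have cf z : nm (z - c) = rho -> cts f z by move=> E; apply/cdiff_cts/df; rewrite E.
rewrite (cauchy df rr); last by rewrite addrC addKr.
have z0 z : nm (z - c) = rho -> z - c != 0 by move=> E; rewrite -nm_gt0 E.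
have zh z : nm (z - c) = rho -> z - (c + h) != 0.
  move=> E; rewrite opprD addrA subr_eq0; apply: contraTneq hr => <-.
  by rewrite E ltxx.
pose F k z := h ^+ k * (f z * (z - c) ^- k * ((z - c) / (z - (c + h)))).
have cF k z : nm (z - c) = rho -> cts (F k) z.
  move=> E; apply: cdiff_cts; rewrite /F; cd.
  - by apply: df; rewrite E.
  - by rewrite expf_neq0 // z0.
  - exact: zh.
have step k : cmean (F k) c rho = h ^+ k * tc f c rho k + cmean (F k.+1) c rho.
  rewrite -cmeanZ; [|exact: ltW|exact: cts_tc].
  rewrite -cmeanD; [|exact: ltW| |exact: cF]; last first.
    by move=> z E; apply: ctsM; [exact: cts_cst|exact: (cts_tc k r0 cf)].
  apply: eq_cmean => [|z E]; first exact: ltW.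
  rewrite /F !exprSr; move: (z0 z E) (zh z E) (expf_neq0 k (z0 z E)).
  rewrite opprD addrA; move: (z - c) (h ^+ k) (f z) => u a b; move: (u ^+ k) => v u0 uh v0.
  by field; rewrite u0 uh.
have -> : cmean (fun z => f z * ((z - c) / (z - (c + h)))) c rho =
    \sum_(m < n) tc f c rho m * h ^+ m + cmean (F n) c rho.
  elim: n => [|n IH].
    rewrite big_ord0 add0r; apply: eq_cmean => [|z _]; first exact: ltW.
    by rewrite /F expr0 invr1 mul1r mulr1.
  by rewrite IH big_ord_recr /= -addrA step [h ^+ n * _]mulrC.
rewrite addrC addKr.
have q1 : 0 < 1 - nm h / rho by rewrite subr_gt0 ltr_pdivrMr // mul1r.
apply: cmean_le; [exact: ltW|exact: cF|] => z E.
rewrite /F !nmM !nmV !nmX E.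
have zhn : rho * (1 - nm h / rho) <= nm (z - (c + h)).
  rewrite mulrBr mulr1 mulrCA divff ?mulr1 ?gt_eqF //.
  by rewrite opprD addrA -E; have := nmDB (z - c) (- h); rewrite nmN.
have zh0 : 0 < nm (z - (c + h)) by rewrite nm_gt0 zh.
have -> : nm h ^+ n * (nm (f z) / rho ^+ n * (rho / nm (z - (c + h)))) =
    nm (f z) * ((nm h / rho) ^+ n * (rho / nm (z - (c + h)))).
  by rewrite expr_div_n; ring.
apply: ler_pM; rewrite ?nm_ge0 ?fM //.
  by rewrite mulr_ge0 ?exprn_ge0 ?divr_ge0 ?nm_ge0 // ltW.
apply: ler_wpM2l; first by rewrite exprn_ge0 // divr_ge0 ?nm_ge0 // ltW.
by rewrite ler_pdivrMr // mulrC ler_pdivlMr.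
Qed.

Lemma tc0 f c (r rho : R) : (forall z, nm (z - c) < r -> cdiff f z) ->
  0 < rho -> rho < r -> tc f c rho 0 = f c.
Proof.
move=> df r0 rr; rewrite (cauchy (w := c) df rr); last by rewrite subrr nm0.
apply: eq_cmean => [|z E]; first exact: ltW.
by rewrite expr0 invr1 divff // -nm_gt0 E.
Qed.

Lemma taylor2 f c h (r rho M : R) : (forall z, nm (z - c) < r -> cdiff f z) ->
  0 < rho -> rho < r -> nm h <= rho / 2 -> (forall z, nm (z - c) = rho -> nm (f z) <= M) ->
  nm (f (c + h) - f c - tc f c rho 1 * h) <= 2 * M / rho ^+ 2 * nm h ^+ 2.
Proof.
move=> df r0 rr hr fM.
have M0 : 0 <= M.
  by apply: le_trans (nm_ge0 _) (fM (c + rho%:C) _); rewrite addrC addKr nmRp // ltW.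
have hr' : nm h < rho by lra.
have := taylor 2 df rr hr' fM.
rewrite !big_ord_recl big_ord0 /= (tc0 df) // expr0 mulr1 addr0 expr1 opprD addrA.
move=> /le_trans; apply.
have q : nm h / rho <= 1 / 2 by rewrite ler_pdivrMr // mulrC mulrA mulr1.
apply: (@le_trans _ _ (M * (2 * (nm h / rho) ^+ 2))).
  rewrite ler_wpM2l // ler_pdivrMr; last lra.
  by have := sqr_ge0 (nm h / rho); nra.
rewrite le_eqVlt expr_div_n; apply/orP; left; apply/eqP.
by field; rewrite gt_eqF.
Qed.

Lemma hd_tc f c (r rho : R) : (forall z, nm (z - c) < r -> cdiff f z) ->
  0 < rho -> rho < r -> (exists M, forall z, nm (z - c) = rho -> nm (f z) <= M) ->
  hd f c (tc f c rho 1).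
Proof.
move=> df r0 rr [M fM] e e0.
pose K := 2 * M / rho ^+ 2.
exists (Num.min (rho / 2) (e / (`|K| + 1))).
  by rewrite lt_min !divr_gt0 // ltr_wpDl.
move=> h; rewrite lt_min => /andP[h1 h2].
apply: le_trans (taylor2 df r0 rr (ltW h1) fM) _; rewrite -/K.
rewrite expr2 mulrA ler_wpM2r ?nm_ge0 //.
move: h2; rewrite ltr_pdivlMr; last by rewrite ltr_wpDl.
have := ler_norm K; have := nm_ge0 h; nra.
Qed.

(* Pointwise convergence and a uniform bound suffice, because the second order
   Taylor estimates are uniform. *)
Lemma bounded_limit (F : nat -> R[i] -> R[i]) f c (r M : R) : 0 < r ->
  (forall n z, nm (z - c) < r -> cdiff (F n) z) ->
  (forall n z, nm (z - c) < r -> nm (F n z) <= M) ->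
  (forall z, nm (z - c) < r -> cvs (fun n => F n z) (f z)) ->
  exists2 l, hd f c l & forall D, (forall n, hd (F n) c (D n)) -> cvs D l.
Proof.
move=> r0 dF FM Ff; pose rho := r / 2.
have rho0 : 0 < rho by rewrite divr_gt0.
have rr : rho < r by rewrite /rho; lra.
have M0 : 0 <= M by apply: le_trans (nm_ge0 _) (FM 0%N c _); rewrite subrr nm0.
pose K := 2 * M / rho ^+ 2.
have K0 : 0 <= K by rewrite /K divr_ge0 ?mulr_ge0 ?exprn_ge0 // ltW.
have FM' n z : nm (z - c) = rho -> nm (F n z) <= M by move=> E; apply: FM; rewrite E.
pose a n := tc (F n) c rho 1.
have est n h : nm h <= rho / 2 -> nm (F n (c + h) - F n c - a n * h) <= K * nm h ^+ 2.
  by move=> hr; apply: taylor2 (dF n) rho0 rr hr (FM' n).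
have ncr h : nm h <= rho / 2 -> nm (c + h - c) < r.
  by move=> hr; rewrite addrC addKr; lra.
have [l al] : exists l, cvs a l.
  apply: cauchy_cvs => e e0.
  (* With |h| = t, the two Taylor errors K t^2 and the two errors e t / 4 of pointwise convergence
     together are at most e t. *)
  pose t := Num.min (rho / 2) (e / (4 * (K + 1))).
  have t0 : 0 < t by rewrite lt_min !divr_gt0 //; lra.
  have t1 : t <= rho / 2 by rewrite ge_min lexx.
  have t2 : 4 * (K + 1) * t <= e.
    by rewrite mulrC -ler_pdivlMr ?ge_min ?lexx ?orbT //; lra.
  clearbody t; pose h : R[i] := t%:C.
  have ht : nm h = t by rewrite nmRp // ltW.
  have cv : cvs (fun n => F n (c + h) - F n c) (f (c + h) - f c).
    apply: cvsB; apply: Ff; first by apply: ncr; rewrite ht.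
    by rewrite subrr nm0.
  have [N NP] := cv (e / 4 * t) ltac:(rewrite mulr_gt0 //; lra).
  exists N => n Nn; rewrite -(ler_pM2r t0) -{1}ht -nmM.
  have -> : (a n - a N) * h = (F N (c + h) - F N c - a N * h)
     - (F n (c + h) - F n c - a n * h)
     + ((F n (c + h) - F n c - (f (c + h) - f c)) - (F N (c + h) - F N c - (f (c + h) - f c))).
    by ring.
  have e1 := est N h ltac:(rewrite ht //); have e2 := est n h ltac:(rewrite ht //).
  have c1 := NP _ (leqnn N); have c2 := NP _ Nn.
  rewrite ht in e1 e2.
  apply: le_trans (nmD _ _) _.
  apply: le_trans (lerD (nmBD _ _) (nmBD _ _)) _.
  apply: le_trans (lerD (lerD e1 e2) (lerD c2 c1)) _.
  by clear -t0 t2 K0; nra.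
have fl : hd f c l.
  move=> e e0; exists (Num.min (rho / 2) (e / (K + 1))).
    by rewrite lt_min !divr_gt0 //; lra.
  move=> h; rewrite lt_min => /andP[h1 h2].
  have : nm (f (c + h) - f c - l * h) <= K * nm h ^+ 2.
    apply: (cvs_le (N := 0%N) (u := fun n => F n (c + h) - F n c - a n * h)) => [n _|].
      by apply: est; exact: ltW.
    apply: cvsB; last by apply: cvsM => //; exact: cvs_cst.
    apply: cvsB; apply: Ff; first by apply/ncr/ltW.
    by rewrite subrr nm0.
  move=> /le_trans; apply; rewrite expr2 mulrA ler_wpM2r ?nm_ge0 //.
  move: h2; rewrite ltr_pdivlMr; last lra.
  by have := nm_ge0 h; clear -K0; nra.
exists l => // D DF; suff -> : D = a by [].
apply/funext => n; apply: hd_unique (DF n) _.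
by apply: hd_tc (dF n) rho0 rr _; exists M; exact: FM'.
Qed.

Lemma cdiff_limit (F : nat -> R[i] -> R[i]) f c (r M : R) : 0 < r ->
  (forall n z, nm (z - c) < r -> cdiff (F n) z) ->
  (forall n z, nm (z - c) < r -> nm (F n z) <= M) ->
  (forall z, nm (z - c) < r -> cvs (fun n => F n z) (f z)) -> cdiff f c.
Proof.
by move=> r0 dF FM Ff; have [l fl _] := bounded_limit r0 dF FM Ff; exists l.
Qed.

(** Differentiation under the integral: the dyadic averages are holomorphic, uniformly bounded and
    converge pointwise to the mean. *)
Lemma cdiff_mean (G : R[i] -> R -> R[i]) c (r M : R) : 0 < r ->
  (forall x z, 0 <= x <= 1 -> nm (z - c) < r -> cdiff (fun z => G z x) z) ->
  (forall x z, 0 <= x <= 1 -> nm (z - c) < r -> nm (G z x) <= M) ->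
  (forall z, nm (z - c) < r -> uc (G z)) ->
  cdiff (fun z => mean (G z)) c.
Proof.
move=> r0 dG GM uG.
apply: (@cdiff_limit (fun n z => avg n (G z)) _ c r M) => //.
- move=> n z zr; elim: n G dG {GM uG} => [|n IH] G dG /=.
    by apply: dG => //; rewrite lexx ler01.
  apply: cdiffM; last exact: cdiff_cst.
  by apply: cdiffD; apply: IH => x z' x01; apply: dG; lra.
- by move=> n z zr; apply: avg_le => x x01; exact: GM.
- by move=> z zr; apply: mean_cvs; exact: uG.
Qed.
End taylor.

(** * Boundedness on compact disks *)

Section bounded.
Variable R : realType.
Implicit Types (z w c h : R[i]) (f g : R[i] -> R[i]).

Lemma closure_ball_le c (r : R) z : closure (ball c r%:C) z -> nm (z - c) <= r.
Proof.
move=> cz; rewrite leNgt; apply/negP => rz.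
have e0 : 0 < (nm (z - c) - r)%:C :> R[i] by rewrite ltcR; lra.
have [w []] := cz (ball z (nm (z - c) - r)%:C) (nbhsx_ballx _ _ e0).
rewrite -!ball_normE /= !nmE !ltcR => h1 h2.
by have := nm_tri z w c; rewrite (nmB w); lra.
Qed.

Lemma compact_bounded_nm (K : set R[i]) f : compact K ->
  (forall z, K z -> cts f z) -> exists M : R, forall z, K z -> nm (f z) <= M.
Proof.
move=> /compact_near_coveringP cK cf.
have : \forall d \near 0^'+, K `<=` [set x : R[i] | nm (f x) <= d^-1].
  apply: (cK R (0^'+) (fun d x => nm (f x) <= d^-1)) => z Kz.
  have [d d0 dP] := cf z Kz 1 ltr01.
  exists ([set y | nm (y - z) < d], [set e : R | 0 < e <= (nm (f z) + 1)^-1]) => /=.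
    split.
      apply/nbhs_ballP; exists d%:C => /=; first by rewrite ltcR.
      by move=> y /=; rewrite -ball_normE /= nmE ltcR nmB.
    have m0 : 0 < (nm (f z) + 1)^-1 by rewrite invr_gt0 ltr_wpDl ?nm_ge0.
    by near=> e; apply/andP; split; near: e; [exact: nbhs_right_gt|exact: nbhs_right_le].
  move=> [y e] [/= yz /andP[e0 ed]].
  have := dP (y - z) yz; rewrite [z + _]addrC subrK => h1.
  apply: (@le_trans _ _ (nm (f z) + 1)).
    by have := nmD (f y - f z) (f z); rewrite subrK; lra.
  by rewrite -[leLHS]invrK lef_pV2 // posrE // invr_gt0 ltr_wpDl ?nm_ge0.
by move=> /(@filter_ex _ _ _)[d dP]; exists d^-1.
Unshelve. all: by end_near. Qed.

Lemma ball_bounded f c (r rho : R) : rho < r ->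
  (forall z, nm (z - c) < r -> cts f z) ->
  exists M : R, forall z, nm (z - c) <= rho -> nm (f z) <= M.
Proof.
move=> rr cf; pose t := (r + rho) / 2.
have [|M MP] := @compact_bounded_nm (closure (ball c t%:C)) f
  (@closure_ball_compact R c t).
  by move=> z /closure_ball_le zt; apply: cf; rewrite /t in zt; lra.
exists M => z zr; apply: MP; apply: subset_closure.
by rewrite -ball_normE /= nmE ltcR nmB /t; lra.
Qed.
End bounded.

(** * Removable singularity of a difference quotient *)

Section divided_difference.
Variable R : realType.
Implicit Types (z w c h : R[i]) (f g : R[i] -> R[i]).

(** Only h = 0 is at stake. There the derivative is the second Taylor coefficient of f, by the
    Taylor estimate with three terms divided by h. *)
Lemma cdiff_quot f l (r : R) : 0 < r -> (forall z, nm z < r -> cdiff f z) -> hd f 0 l ->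
  forall h, nm h < r -> cdiff (fun h => if h == 0 then l else (f h - f 0) / h) h.
Proof.
move=> r0 df fl h hr; have [h0|h0] := eqVneq h 0; last first.
  apply: (@cdiff_near _ (fun h => (f h - f 0) / h) _ h (nm h)); first by rewrite nm_gt0.
    move=> x xh; case: eqVneq => // x0.
    by move: xh; rewrite x0 sub0r nmN ltxx.
  by cd => //; exact: df.
pose rho := r / 2; have rho0 : 0 < rho by rewrite divr_gt0.
have rr : rho < r by rewrite /rho; lra.
have df' z : nm (z - 0) < r -> cdiff f z by rewrite subr0; exact: df.
have [M MP] := ball_bounded (c := 0) rr (fun z zr => cdiff_cts (df' z zr)).
have MP' z : nm (z - 0) = rho -> nm (f z) <= M by move=> E; apply: MP; rewrite E.
have M0 : 0 <= M by apply: le_trans (nm_ge0 _) (MP 0 _); rewrite subrr nm0 ltW.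
have lE : l = tc f 0 rho 1.
  by apply: hd_unique fl _; apply: hd_tc df' rho0 rr _; exists M.
rewrite h0; exists (tc f 0 rho 2) => e e0.
pose K := 2 * M / rho ^+ 3; have K0 : 0 <= K by rewrite divr_ge0 ?mulr_ge0 ?exprn_ge0 // ltW.
exists (Num.min (rho / 2) (e / (K + 1))).
  by rewrite lt_min !divr_gt0 //; lra.
move=> k; rewrite lt_min => /andP[k1 k2]; rewrite add0r eqxx.
have [->|k0] := eqVneq k 0; first by rewrite mulr0 !subr0 subrr nm0 mulr0.
have k_gt0 : 0 < nm k by rewrite nm_gt0.
have := taylor 3 df' rr (h := k) _ MP'; rewrite add0r !big_ord_recl big_ord0 /=.
rewrite (tc0 df') // expr0 mulr1 addr0 expr1 -lE => /(_ ltac:(lra)) T.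
rewrite -(ler_pM2r k_gt0) -nmM.
have -> : ((f k - f 0) / k - l - tc f 0 rho 2 * k) * k =
    f k - (f 0 + (l * k + tc f 0 rho 2 * k ^+ 2)) by field.
apply: le_trans T _.
have q : nm k / rho <= 1 / 2 by rewrite ler_pdivrMr // mulrC mulrA mulr1 ltW.
apply: (@le_trans _ _ (M * (2 * (nm k / rho) ^+ 3))).
  rewrite ler_wpM2l // ler_pdivrMr; last lra.
  have : 0 <= (nm k / rho) ^+ 3 by rewrite exprn_ge0 // divr_ge0 ?nm_ge0 // ltW.
  nra.
have -> : M * (2 * (nm k / rho) ^+ 3) = K * nm k * (nm k * nm k).
  by rewrite /K; field; rewrite gt_eqF.
rewrite -[leRHS]mulrA ler_wpM2r ?mulr_ge0 ?nm_ge0 //.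
by move: k2; rewrite ltr_pdivlMr; [nra|lra].
Qed.
End divided_difference.

(** * Elementary functions whose twisted sums telescope *)

Section telescoping.
Variable R : realType.
Implicit Types (u s y x w : R[i]).

(** [epsf] and [lamf] are (e^t - 1) / t and log(1 + y) / y with the singularity removed; the values
    at 0 are left unreduced to be literal difference quotients. *)
Definition epsf (t : R[i]) : R[i] := if t == 0 then 1 else (cexp t - cexp 0) / t.
Definition lamf y : R[i] := if y == 0 then 1 else (clog (1 + y) - clog (1 + 0)) / y.

Lemma clog1 : clog 1 = 0 :> R[i].
Proof. by rewrite -(rmorph1 (real_complex R)) clog_gt0 ?ltr01 // ln1. Qed.

Lemma Re_1D y : nm y < 1 -> 0 < complex.Re (1 + y).
Proof.
move=> y1; have -> : complex.Re (1 + y) = 1 + complex.Re y by case: (y).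
by have := nm_Re y; rewrite ler_norml; lra.
Qed.

Lemma cdiff_epsf t : cdiff epsf t.
Proof.
apply: (@cdiff_quot R (@cexp R) 1 (nm t + 1)); first by rewrite ltr_wpDl ?nm_ge0.
- by move=> z _; exact: cdiff_cexp.
- by have := @hd_cexp R 0; rewrite cexp0.
- by rewrite ltrDl.
Qed.

Lemma cdiff_lamf y : nm y < 1 -> cdiff lamf y.
Proof.
apply: (@cdiff_quot R (fun y => clog (1 + y)) 1 1) => //.
  move=> z z1; apply: (@cdiff_comp _ (fun y => 1 + y)); first by cd.
  exact/cdiff_clog/slit_Re/Re_1D.
rewrite -[1 in X in hd _ _ X](mulr1 (1 : R[i])).
apply: (@hd_comp _ (fun y => 1 + y)).
  by rewrite -[1 in X in hd _ _ X]add0r; apply: hdD; [exact: hd_cst|exact: hd_id].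
rewrite addr0 -[1 in X in hd _ _ X]invr1; apply: hd_clog.
by apply: slit_Re; rewrite -[complex.Re 1]/(1 : R).
Qed.

(* For u = 1 this is [(1 - (1 + y)^(1 - s)) / ((s - 1) y)], so that
   [x^(- s) Efun s (1 / x)] telescopes; [epsf] and [lamf] remove the
   singularities at [s = 1] and [y = 0]. *)
Definition Efun u s y : R[i] := if u == 1
  then epsf ((1 - s) * clog (1 + y)) * lamf y
  else (1 - u * pw s (1 + y)) / (1 - u).

Lemma Efun0 u s : Efun u s 0 = 1.
Proof.
rewrite /Efun /epsf /lamf /pw addr0 clog1 !mulr0 eqxx mulr1 cexp0.
by case: eqVneq => // u1; rewrite mulr1 divff // subr_eq0 eq_sym.
Qed.

Lemma cdiff_Efun u (s y : R[i] -> R[i]) z : cdiff s z -> cdiff y z -> nm (y z) < 1 ->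
  cdiff (fun z => Efun u (s z) (y z)) z.
Proof.
move=> ds dy y1.
have s1 : slit (1 + y z) by exact/slit_Re/Re_1D.
have dl : cdiff (fun z => clog (1 + y z)) z.
  by apply: (@cdiff_comp _ (fun z => 1 + y z)); [cd|exact: cdiff_clog].
rewrite /Efun; case: eqVneq => _; cd => //.
- apply: (@cdiff_comp _ (fun z => (1 - s z) * clog (1 + y z))); first by cd.
  exact: cdiff_epsf.
- by apply: cdiff_comp => //; exact: cdiff_lamf.
- by apply: cdiff_pw => //; cd.
Qed.

Lemma Efun_bounded u (S : R) : exists2 B : R, 0 <= B &
  forall s y, nm s <= S -> nm y <= 1 / 2 -> nm (Efun u s y) <= B.
Proof.
have [L LP] : exists L : R, forall y, nm (y - 0) <= 1 / 2 -> nm (clog (1 + y)) <= L.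
  apply: (@ball_bounded R (fun y => clog (1 + y)) 0 1); first lra.
  move=> z; rewrite subr0 => z1; apply: cdiff_cts.
  by apply: (@cdiff_comp _ (fun z => 1 + z)); [cd|exact/cdiff_clog/slit_Re/Re_1D].
have [L' LP'] : exists L : R, forall y, nm (y - 0) <= 1 / 2 -> nm (lamf y) <= L.
  apply: (@ball_bounded R lamf 0 1); first lra.
  by move=> z; rewrite subr0 => z1; apply/cdiff_cts/cdiff_lamf.
have [X XP] : exists X : R, forall t, nm (t - 0) <= (`|S| + 1) * L -> nm (epsf t) <= X.
  apply: (@ball_bounded R epsf 0 ((`|S| + 1) * L + 1)); first lra.
  by move=> z _; apply/cdiff_cts/cdiff_epsf.
have h0 : nm (0 : R[i]) <= 1 / 2 by rewrite nm0; lra.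
have L0 : 0 <= L by apply: le_trans (nm_ge0 _) (LP 0 _); rewrite subrr.
exists (`|X| * `|L'| + (1 + nm u * expR (`|S| * L)) / nm (1 - u)).
  by rewrite addr_ge0 ?divr_ge0 ?addr_ge0 ?mulr_ge0 ?nm_ge0 ?expR_ge0.
move=> s y sS y1; have sS' := le_trans sS (ler_norm S).
have lg : nm (clog (1 + y)) <= L by apply: LP; rewrite subr0.
rewrite /Efun; case: eqVneq => [u1|u1].
  apply: (@le_trans _ _ (`|X| * `|L'|)); last first.
    by rewrite lerDl divr_ge0 ?addr_ge0 ?mulr_ge0 ?nm_ge0 ?expR_ge0.
  rewrite nmM ler_pM ?nm_ge0 //.
    apply: le_trans (ler_norm X); apply: XP; rewrite subr0 nmM ler_pM ?nm_ge0 //.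
    by rewrite (le_trans (nmBD _ _)) // nm1 addrC lerD2r.
  by apply: le_trans (ler_norm L'); apply: LP'; rewrite subr0.
rewrite nmM nmV; apply: ler_wpDl; first by rewrite mulr_ge0.
rewrite ler_wpM2r ?invr_ge0 ?nm_ge0 // (le_trans (nmBD _ _)) // nm1 lerD2l.
by rewrite nmM ler_wpM2l ?nm_ge0 //; exact: nm_pw_le.
Qed.

(** The circle of radius 1/2 stays in the unit disk, where log(1 + y) is holomorphic. The resulting
    growth 2^m is the reason for the condition [dl * 2 <= 1]. *)
Definition ecoef u s m : R[i] := tc (Efun u s) 0 (1 / 2) m.

Lemma cdiff_Efun_y u s y : nm y < 1 -> cdiff (Efun u s) y.
Proof. by move=> y1; apply: (@cdiff_Efun u (fun=> s) id); cd. Qed.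

Lemma cts_Efun_circle u s z : nm (z - 0) = 1 / 2 -> cts (Efun u s) z.
Proof. by rewrite subr0 => E; apply/cdiff_cts/cdiff_Efun_y; rewrite E; lra. Qed.

Lemma ecoef0 u s : ecoef u s 0 = 1.
Proof.
rewrite /ecoef (@tc0 _ _ _ 1) ?Efun0 //; try lra.
by move=> z; rewrite subr0; exact: cdiff_Efun_y.
Qed.

Lemma ecoef_le u (S : R) : exists2 B : R, 0 <= B &
  forall s m, nm s <= S -> nm (ecoef u s m) <= B * 2 ^+ m.
Proof.
have [B B0 BP] := Efun_bounded u S; exists B => // s m sS.
have -> : B * 2 ^+ m = B / (1 / 2) ^+ m by rewrite div1r exprVn invrK.
apply: tc_le; first lra.
  exact: cts_Efun_circle.
by move=> z; rewrite subr0 => E; apply: BP => //; rewrite E.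
Qed.

Lemma cdiff_ecoef u (s : R[i] -> R[i]) z0 (r S : R) m : 0 < r ->
  (forall z, nm (z - z0) < r -> cdiff s z) ->
  (forall z, nm (z - z0) < r -> nm (s z) <= S) -> cdiff (fun z => ecoef u (s z) m) z0.
Proof.
move=> r0 ds sS; have [B B0 BP] := Efun_bounded u S.
have h0 : 0 <= 1 / 2 :> R by lra.
rewrite /ecoef /tc /cmean; apply: (@cdiff_mean R (fun z (x : R) => Efun u (s z) (circ 0 (1 / 2) x) * (circ 0 (1 / 2) x - 0) ^- m)
  z0 r (B / (1 / 2) ^+ m)) => //.
- move=> x z x01 zr; cd.
  by apply: (@cdiff_Efun u s); [exact: ds|cd|rewrite -[circ _ _ _]subr0 nm_circ; lra].
- move=> x z x01 zr; rewrite nmM nmV nmX nm_circ // ler_wpM2r ?invr_ge0 ?exprn_ge0 //.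
  by apply: BP; [exact: sS|rewrite -[circ _ _ _]subr0 nm_circ].
- move=> z zr; apply: (circ_uc (f := fun y => Efun u (s z) y * (y - 0) ^- m)) => //.
  by apply: cts_tc; [lra|exact: cts_Efun_circle].
Qed.

Lemma ecoef_series u s y : nm y < 1 / 2 ->
  cvs (fun n => \sum_(m < n) ecoef u s m * y ^+ m) (Efun u s y).
Proof.
move=> y1 e e0; have [B B0 BP] := Efun_bounded u (nm s).
pose q := nm y / (1 / 2).
have q0 : 0 <= q by rewrite divr_ge0 ?nm_ge0 //; lra.
have q1 : q < 1 by rewrite ltr_pdivrMr ?mul1r //; lra.
have [N NP] := pow_small q0 q1 (e := e * (1 - q) / (B + 1)) ltac:(rewrite divr_gt0 ?mulr_gt0 //; lra).
exists N => n /NP; rewrite ler_pdivlMr; last lra.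
move=> h; rewrite nmB.
have df z : nm (z - 0) < 1 -> cdiff (Efun u s) z by rewrite subr0; exact: cdiff_Efun_y.
have := @taylor R (Efun u s) 0 y 1 (1 / 2) B n df ltac:(lra) y1.
rewrite add0r; move=> T; apply: le_trans (T _) _.
  by move=> z; rewrite subr0 => E; apply: BP => //; rewrite E.
rewrite -/q mulrA ler_pdivrMr; last lra.
have : 0 <= q ^+ n by rewrite exprn_ge0.
by move: h; clear; nra.
Qed.
End telescoping.

(** * Power series with a Cauchy bound, and one peeling step *)

Section power_series.
Variables (R : realType) (dl : R).
Hypotheses (dl0 : 0 < dl) (dl2 : dl * 2 <= 1).
Implicit Types (u s y x w : R[i]) (a b : nat -> R[i]).

(** A Cauchy estimate on the circle of radius [dl]. Series are only evaluated for |y| <= dl / 2,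
    where their terms decay like 2^-m. *)
Definition geom_bound a (M : R) := forall m, nm (a m) * dl ^+ m <= M.
Definition ps a y := lims (fun n => \sum_(m < n) a m * y ^+ m).

Lemma geom_bound_ge0 a M : geom_bound a M -> 0 <= M.
Proof. by move=> /(_ 0%N); apply: le_trans; rewrite mulr_ge0 ?nm_ge0 ?exprn_ge0 // ltW. Qed.

Lemma ps_term_le a (M : R) y m : geom_bound a M -> nm y <= dl / 2 ->
  nm (a m * y ^+ m) <= M * 2^-1 ^+ m.
Proof.
move=> aM yd; rewrite nmM nmX.
apply: (@le_trans _ _ (nm (a m) * (dl / 2) ^+ m)).
  by rewrite ler_wpM2l ?nm_ge0 // lerXn2r ?nnegrE ?nm_ge0 // divr_ge0 // ltW.
by rewrite exprMn mulrA ler_wpM2r // exprn_ge0 // invr_ge0.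
Qed.

Lemma ps_partial_le a (M : R) y n : geom_bound a M -> nm y <= dl / 2 ->
  \sum_(m < n) nm (a m * y ^+ m) <= 2 * M.
Proof.
move=> aM yd; have M0 := geom_bound_ge0 aM.
apply: (@le_trans _ _ (\sum_(m < n) M * 2^-1 ^+ m)).
  by apply: ler_sum => m _; exact: ps_term_le.
rewrite -mulr_sumr mulrC ler_wpM2r //.
have h2 : (1 - 2^-1)^-1 = 2 :> R by field.
by rewrite -[leRHS]h2; apply: geometric_le; rewrite ?invr_ge0 ?invf_lt1 ?ltr1n.
Qed.

Lemma ps_cvs a (M : R) y : geom_bound a M -> nm y <= dl / 2 ->
  cvs (fun n => \sum_(m < n) a m * y ^+ m) (ps a y) /\ nm (ps a y) <= 2 * M.
Proof.
move=> aM yd.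
have [l lP l0] := @summable_cvs R (fun m => a m * y ^+ m) (2 * M)
  (fun n => ps_partial_le n aM yd).
by rewrite /ps (limsE lP).
Qed.

Lemma psD a b (M N : R) (c : R[i]) y : geom_bound a M -> geom_bound b N -> nm y <= dl / 2 ->
  ps (fun m => c * a m + b m) y = c * ps a y + ps b y.
Proof.
move=> aM bN yd; have [ca _] := ps_cvs aM yd; have [cb _] := ps_cvs bN yd.
apply: limsE; rewrite (_ : (fun n => _) = (fun n =>
    c * (\sum_(m < n) a m * y ^+ m) + \sum_(m < n) b m * y ^+ m)); last first.
  apply/funext => n; rewrite mulr_sumr -big_split; apply: eq_bigr => m _ /=.
  by rewrite mulrDl mulrA.
by apply: cvsD => //; exact: cvsZ.
Qed.

(** The coefficients of (F(y) - F(0) E(y)) / y, where F has coefficients a and E is [Efun u s]. *)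
Definition taylor_shift u s a : nat -> R[i] := fun m => a m.+1 - a 0%N * ecoef u s m.+1.

(** The radius [dl] does not shrink and the factor only depends on a bound for s, so peeling can be
    iterated uniformly. In the factor, [dl^-1] pays for the index shift and [2 * B] for the
    coefficients of E. *)
Lemma geom_bound_remainder u (S : R) : exists2 B : R, 0 <= B & forall s a M, nm s <= S -> geom_bound a M ->
  geom_bound (taylor_shift u s a) (B * M).
Proof.
have [B B0 BP] := ecoef_le u S; exists (dl^-1 + 2 * B).
  by rewrite addr_ge0 ?mulr_ge0 ?invr_ge0 // ltW.
move=> s a M sS aM m; have M0 := geom_bound_ge0 aM.
have d1 : 0 <= dl ^+ m by rewrite exprn_ge0 // ltW.
apply: (@le_trans _ _ ((nm (a m.+1) + nm (a 0%N) * nm (ecoef u s m.+1)) * dl ^+ m)).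
  by rewrite ler_wpM2r // (le_trans (nmBD _ _)) // nmM.
rewrite mulrDl mulrDl; apply: lerD.
  by rewrite [leRHS]mulrC ler_pdivlMr // -mulrA -exprSr; exact: aM.
have a0 : nm (a 0%N) <= M by have := aM 0%N; rewrite mulr1.
have -> : 2 * B * M = M * (B * 2) by ring.
rewrite -mulrA ler_pM ?mulr_ge0 ?nm_ge0 //.
apply: (@le_trans _ _ (B * 2 ^+ m.+1 * dl ^+ m)).
  by rewrite ler_wpM2r // BP.
rewrite exprS -!mulrA ler_wpM2l // ler_piMr // -exprMn exprn_ile1 //.
  by rewrite mulr_ge0 // ltW.
by rewrite mulrC.
Qed.

Lemma ps_step u s a (M : R) y : geom_bound a M -> nm y <= dl / 2 ->
  ps a y = a 0%N * Efun u s y + y * ps (taylor_shift u s a) y.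
Proof.
move=> aM yd; have [ca _] := ps_cvs aM yd.
have [B B0 BP] := geom_bound_remainder u (nm s); have [cb _] := ps_cvs (BP s a M (lexx _) aM) yd.
have y1 : nm y < 1 / 2 by have := dl2; have := dl0; lra.
have ce := ecoef_series u s y1.
have sub (v : nat -> R[i]) l : cvs v l -> cvs (fun n => v n.+1) l.
  by move=> vl; apply: (cvs_sub (k := succn)) vl => n; exact: leqnSn.
apply: cvs_unique (sub _ _ ca) _.
have := cvsD (cvsZ (a 0%N) (sub _ _ ce)) (cvsM (cvs_cst y) cb).
congr cvs; apply/funext => n; rewrite !big_ord_recl ecoef0 expr0 mulr1.
rewrite mulrDr mulr1 -addrA; congr (_ + _).
rewrite !mulr_sumr -big_split; apply: eq_bigr => m _.
rewrite /taylor_shift /= /bump /= add1n exprS; ring.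
Qed.
End power_series.

(** * Twisted sums of Hurwitz type in their domain of convergence *)

Section zeta.
Variables (R : realType) (dl : R).
Hypotheses (dl0 : 0 < dl) (dl2 : dl * 2 <= 1).
Implicit Types (u s y x w : R[i]) (a b : nat -> R[i]).

Definition shifted w n : R[i] := n.+1%:R + w.
(** For F = 1 the sum of these terms is a Lerch zeta function; indices n >= 0 stand for n + 1 in the
    sum. *)
Definition hurwitz_term u s a w n : R[i] := u ^+ n.+1 * pw s (shifted w n) * ps a (shifted w n)^-1.
Definition hurwitz0 u s a w : R[i] := lims (fun M => \sum_(n < M) hurwitz_term u s a w n).

(** Puts all the points 1 / (n + w) into the disk of radius dl / 2 (see [xn_inv]), and all n + w
    into the right half-plane. *)
Definition wok w := 2 / dl <= complex.Re w.

Lemma ReDn (n : nat) w : complex.Re (n%:R + w) = n%:R + complex.Re w.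
Proof. by rewrite -(rmorph_nat (real_complex R)); case: w => x y /=. Qed.

Lemma Re_xn w n : complex.Re (shifted w n) = n.+1%:R + complex.Re w.
Proof. exact: ReDn. Qed.

Lemma wok_gt0 w : wok w -> 4 <= complex.Re w.
Proof.
by apply: le_trans; rewrite ler_pdivlMr //; have := dl2; lra.
Qed.

Lemma Re_xn_gt0 w n : wok w -> 0 < complex.Re (shifted w n).
Proof. by move=> /wok_gt0 w4; rewrite Re_xn ltr_wpDl //; lra. Qed.

Lemma xn_neq0 w n : wok w -> shifted w n != 0.
Proof. by move=> wk; apply/slit_neq0/slit_Re/Re_xn_gt0. Qed.

Lemma xn_inv w n : wok w -> nm (shifted w n)^-1 <= dl / 2.
Proof.
move=> wk; rewrite nmV -[leRHS]invrK lef_pV2 ?posrE ?invr_gt0 ?nm_gt0 ?xn_neq0 ?divr_gt0 //.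
rewrite invf_div (le_trans wk) // (le_trans _ (Re_le_nm _)) // Re_xn.
by rewrite lerDr.
Qed.

Lemma nm_xn_ge w n : wok w -> n.+1%:R <= nm (shifted w n).
Proof.
move=> /wok_gt0 wk; rewrite (le_trans _ (Re_le_nm _)) // Re_xn lerDl; lra.
Qed.

Lemma sum_inv_sqr n : \sum_(k < n) (k.+1%:R ^- 2) <= 2 :> R.
Proof.
suff H m : \sum_(k < m.+1) (k.+1%:R ^- 2) <= 2 - m.+1%:R^-1 :> R.
  case: n => [|n]; first by rewrite big_ord0.
  by apply: le_trans (H n) _; rewrite gerBl invr_ge0.
elim: m => [|m IH]; first by rewrite big_ord1 expr1n invr1; lra.
rewrite big_ord_recr /= (le_trans (lerD IH (lexx _))) //.
have n0 : 0 < m.+1%:R :> R by rewrite ltr0n.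
have -> : m.+2%:R = m.+1%:R + 1 :> R by rewrite -natr1.
move: (m.+1%:R : R) n0 => t t0; have t1 : 0 < t + 1 by lra.
rewrite -lerBrDl.
have -> : 2 - (t + 1)^-1 - (2 - t^-1) = (t * (t + 1))^-1.
  by field; rewrite !gt_eqF.
rewrite lef_pV2 ?posrE ?mulr_gt0 ?exprn_gt0 // expr2 ler_wpM2r //; lra.
Qed.

Section unit_multiplier.
Variable u : R[i].
Hypothesis u1 : nm u = 1.

Lemma hurwitz_term_le s a w (M : R) n : geom_bound dl a M -> wok w ->
  nm (hurwitz_term u s a w n) <= expR (- complex.Re s * ln (nm (shifted w n))) * (expR (nm s * pi) * (2 * M)).
Proof.
move=> aM wk; rewrite /hurwitz_term nmM nmM nmX u1 expr1n mul1r mulrA.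
apply: ler_pM; rewrite ?nm_ge0 //; first exact/nm_pw/xn_neq0.
by have [] := ps_cvs dl0 aM (xn_inv n wk).
Qed.

(** For Re s >= 2 comparison with the sum of 1 / n^2 suffices; the strip 1 < Re s < 2 is reached
    afterwards by one peeling step. *)
Lemma hurwitz0_cvs s a w (M : R) : 2 <= complex.Re s -> geom_bound dl a M -> wok w ->
  cvs (fun m => \sum_(n < m) hurwitz_term u s a w n) (hurwitz0 u s a w) /\
  forall m, nm (\sum_(n < m) hurwitz_term u s a w n) <= 2 * (expR (nm s * pi) * (2 * M)).
Proof.
move=> s2 aM wk; have M0 := geom_bound_ge0 dl0 aM.
have H m : \sum_(n < m) nm (hurwitz_term u s a w n) <= 2 * (expR (nm s * pi) * (2 * M)).
  apply: (@le_trans _ _ (\sum_(n < m) (n.+1%:R ^- 2) * (expR (nm s * pi) * (2 * M)))).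
    apply: ler_sum => n _; apply: le_trans (hurwitz_term_le s n aM wk) _.
    apply: ler_wpM2r; first by rewrite !mulr_ge0 ?expR_ge0.
    have n0 : 0 < n.+1%:R :> R by rewrite ltr0n.
    have -> : n.+1%:R ^- 2 = expR (- 2 * ln n.+1%:R) :> R.
      rewrite mulNr expRN; congr (_^-1); rewrite mulr_natl mulr2n expRD lnK ?posrE //.
    rewrite ler_expR.
    have l0 : 0 <= ln n.+1%:R :> R by rewrite ln_ge0 // ler1n.
    have l1 : ln n.+1%:R <= ln (nm (shifted w n)).
      by rewrite ler_ln ?posrE ?nm_xn_ge // nm_gt0 xn_neq0.
    by nra.
  by rewrite -mulr_suml ler_wpM2r ?sum_inv_sqr // !mulr_ge0 ?expR_ge0.
have [l lP _] := @summable_cvs R (hurwitz_term u s a w) _ H; split; first by rewrite /hurwitz0 (limsE lP).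
by move=> m; apply: le_trans (nm_sum _ _ _) (H m).
Qed.

Lemma pw_xn_small s w : 0 < complex.Re s -> wok w ->
  cvs (fun n => pw s (shifted w n)) 0.
Proof.
move=> s0 wk e e0; pose K := expR (nm s * pi).
have K0 : 0 < K by exact: expR_gt0.
have [N NP] := inv_small (e := expR (ln (e / K) / complex.Re s)) (expR_gt0 _).
exists N => n /NP h; rewrite subr0 (le_trans (nm_pw _ (xn_neq0 n wk))) //.
rewrite -/K -ler_pdivlMr // -[leRHS](lnK (_ : e / K \in Num.pos)) ?posrE ?divr_gt0 //.
rewrite ler_expR.
have n0 : 0 < n.+1%:R :> R by rewrite ltr0n.
have l1 : ln n.+1%:R <= ln (nm (shifted w n)).
  by rewrite ler_ln ?posrE ?nm_xn_ge // nm_gt0 xn_neq0.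
have : - ln n.+1%:R <= ln (e / K) / complex.Re s.
  by rewrite -lnV ?posrE // -[leRHS]expRK ler_ln ?posrE ?invr_gt0 ?expR_gt0.
rewrite ler_pdivlMr //; nra.
Qed.

(* [kap] stands for [(s - 1)^-1]; it is a parameter because the pole is isolated
   by varying it. *)
Definition tel (kap s : R[i]) w n : R[i] := if u == 1 then kap * pw (s - 1) (shifted w n)
  else u ^+ n.+1 / (1 - u) * pw s (shifted w n).

Definition tel0 (kap s : R[i]) w := tel kap s w 0.

Lemma pw_succ s w n : wok w ->
  pw s (shifted w n) * pw s (1 + (shifted w n)^-1) = pw s (shifted w n.+1).
Proof.
move=> wk; have x0 := Re_xn_gt0 n wk; have xn0 := xn_neq0 n wk.
rewrite -pwM //; last first.
  apply: Re_1D; apply: le_lt_trans (xn_inv n wk) _; have := dl2; lra.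
by rewrite mulrDr mulr1 divff // /shifted -[n.+2%:R]natr1; congr pw; ring.
Qed.

(** Both cases come from x^(-t) (1 + 1/x)^(-t) = (x + 1)^(-t), with t = s if u is not 1 and t = s -
    1 if u = 1. In the second case the factors [epsf] and [lamf] combine so that the logarithms
    cancel. *)
Lemma Efun_tel s w n : wok w -> (u = 1 -> s != 1) ->
  u ^+ n.+1 * (pw s (shifted w n) * Efun u s (shifted w n)^-1) =
  tel (s - 1)^-1 s w n - tel (s - 1)^-1 s w n.+1.
Proof.
move=> wk s1; have xn0 := xn_neq0 n wk.
have pE := pw_succ (s - 1) n wk; have pE' := pw_succ s n wk.
rewrite /tel /Efun; case: eqVneq => [E|u1']; last first.
  rewrite -pE' [u ^+ n.+2]exprSr; move: (u ^+ n.+1) (pw s _) (pw s _) => v p p'.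
  by field; rewrite subr_eq0 eq_sym.
have s10 : s - 1 != 0 by rewrite subr_eq0 s1.
rewrite -pE E expr1n mul1r /epsf /lamf invr_eq0 (negbTE xn0) addr0 clog1 subr0 invrK cexp0.
have -> : pw s (shifted w n) = pw (s - 1) (shifted w n) * (shifted w n)^-1.
  by rewrite -pw1 // -pwD subrK.
have -> : pw (s - 1) (1 + (shifted w n)^-1) = cexp ((1 - s) * clog (1 + (shifted w n)^-1)).
  by rewrite /pw opprB.
have l0 : clog (1 + (shifted w n)^-1) != 0.
  apply: contra_neq (xn0) => l0; have : 1 + (shifted w n)^-1 = 1.
    rewrite -(@cexp_clog _ (1 + _)) ?l0 ?cexp0 //.
    apply/slit_neq0/slit_Re/Re_1D; apply: le_lt_trans (xn_inv n wk) _; have := dl2; lra.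
  by rewrite -[RHS]addr0 => /addrI /eqP; rewrite invr_eq0 => /eqP.
have t0 : 1 - s != 0 by rewrite -opprB oppr_eq0.
rewrite mulf_eq0 (negbTE t0) (negbTE l0) /=.
move: (cexp _) => e; move: (clog _) l0 => L L0; move: (pw _ _) => p.
by field; rewrite s10 xn0 t0 L0.
Qed.
End unit_multiplier.
End zeta.

(** * Continuation by repeated peeling *)

Section continuation.
Variables (R : realType) (dl : R) (u : R[i]).
Hypotheses (dl0 : 0 < dl) (dl2 : dl * 2 <= 1) (u1 : nm u = 1).
Implicit Types (s y x w : R[i]) (a b : nat -> R[i]) (kap : nat -> R[i]).

(* Each step splits off the constant Taylor coefficient [a 0], whose sum is
   telescoping, and leaves a sum with exponent [s + 1].  For [u = 1] the
   parameters [kap j] stand for [(s + j - 1)^-1]. *)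
Fixpoint hurwitz (k : nat) kap s a w : R[i] := if k is k'.+1
  then a 0%N * tel0 u (kap 0%N) s w + hurwitz k' (fun j => kap j.+1) (s + 1) (taylor_shift u s a) w
  else hurwitz0 u s a w.

(* [0] at the pole, which is harmless since the value of a family at a pole is
   irrelevant. *)
Definition pole_factor s (j : nat) : R[i] := (s + j%:R - 1)^-1.

Lemma hurwitz_term_step s a w (M : R) n : geom_bound dl a M -> wok dl w ->
  hurwitz_term u s a w n = a 0%N * (u ^+ n.+1 * (pw s (shifted w n) * Efun u s (shifted w n)^-1))
   + hurwitz_term u (s + 1) (taylor_shift u s a) w n.
Proof.
move=> aM wk; have xn0 := xn_neq0 dl0 dl2 n wk.
rewrite /hurwitz_term (ps_step dl0 dl2 u s aM (xn_inv dl0 dl2 n wk)) pwD pw1 //.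
move: (Efun _ _ _) (ps _ _) (pw _ _) (u ^+ _) => e p q v; ring.
Qed.

Lemma sum_step s a w (M : R) m : geom_bound dl a M -> wok dl w -> (u = 1 -> s != 1) ->
  \sum_(n < m) hurwitz_term u s a w n = a 0%N * (tel0 u (s - 1)^-1 s w - tel u (s - 1)^-1 s w m)
   + \sum_(n < m) hurwitz_term u (s + 1) (taylor_shift u s a) w n.
Proof.
move=> aM wk s1; elim: m => [|m IH].
  by rewrite !big_ord0 /tel0 subrr mulr0 addr0.
rewrite !big_ord_recr /= IH (hurwitz_term_step s m aM wk) (Efun_tel dl0 dl2 m wk s1).
by move: (\sum_(_ < _) _) => S; ring.
Qed.

Lemma tel_small s w : 1 < complex.Re s -> wok dl w -> cvs (tel u (s - 1)^-1 s w) 0.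
Proof.
move=> s1 wk; rewrite /tel; case: eqVneq => [_|_].
  rewrite -[X in cvs _ X](mulr0 (s - 1)^-1); apply/cvsZ/(pw_xn_small dl0 dl2) => //.
  by rewrite raddfB /= subr_gt0.
have : cvs (fun n => (1 - u)^-1 * pw s (shifted w n)) 0.
  rewrite -[X in cvs _ X](mulr0 (1 - u)^-1); apply/cvsZ/(pw_xn_small dl0 dl2) => //.
  by apply: lt_trans s1.
move=> H e /H[N NP]; exists N => n /NP; rewrite !subr0.
by move=> h; rewrite -mulrA nmM nmX u1 expr1n mul1r.
Qed.

Lemma Re1 (n : nat) s : complex.Re (s + n%:R) = complex.Re s + n%:R.
Proof. by rewrite addrC ReDn addrC. Qed.

Lemma cvs_step s a w (M : R) : geom_bound dl a M -> wok dl w -> 1 < complex.Re s ->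
  cvs (fun m => \sum_(n < m) hurwitz_term u s a w n)
    (a 0%N * tel0 u (s - 1)^-1 s w + hurwitz0 u (s + 1) (taylor_shift u s a) w).
Proof.
move=> aM wk s1; have [B B0 BP] := geom_bound_remainder dl0 dl2 u (nm s).
have s1' : u = 1 -> s != 1.
  by move=> _; apply: contraTneq s1 => ->; rewrite -[complex.Re 1]/(1 : R) ltxx.
rewrite (_ : (fun m => _) = (fun m => a 0%N * (tel0 u (s - 1)^-1 s w - tel u (s - 1)^-1 s w m)
   + \sum_(n < m) hurwitz_term u (s + 1) (taylor_shift u s a) w n)); last first.
  by apply/funext => m; exact: sum_step.
apply: cvsD; last first.
  have [] := @hurwitz0_cvs R dl dl0 dl2 u u1 (s + 1) (taylor_shift u s a) w (B * M) => //.
    by have := Re1 1 s; lra.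
  exact: BP.
apply: cvsZ; rewrite -[X in cvs _ X]subr0; apply: cvsB; first exact: cvs_cst.
exact: tel_small.
Qed.

Lemma pole_factorS s : (fun j => pole_factor s j.+1) = pole_factor (s + 1).
Proof. by apply/funext => j; rewrite /pole_factor -natr1; congr (_^-1); ring. Qed.

Lemma pole_factor0 s : pole_factor s 0 = (s - 1)^-1. Proof. by rewrite /pole_factor addr0. Qed.

(** The recursion carries the claim to the innermost sum; there both sides are limits of the same
    partial sums, before and after one peeling. *)
Lemma hurwitz_step k s a w (M : R) : geom_bound dl a M -> wok dl w -> 2 <= complex.Re s + k%:R ->
  hurwitz k (pole_factor s) s a w = hurwitz k.+1 (pole_factor s) s a w.
Proof.
elim: k s a M => [|k IH] s a M aM wk sk.
  rewrite /= pole_factor0; have s2 : 2 <= complex.Re s by rewrite addr0 in sk.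
  have [cZ _] := hurwitz0_cvs dl0 dl2 u1 s2 aM wk.
  by apply: cvs_unique cZ (cvs_step aM wk _); lra.
have [B B0 BP] := geom_bound_remainder dl0 dl2 u (nm s).
change (a 0%N * tel0 u (pole_factor s 0) s w + hurwitz k (fun j => pole_factor s j.+1) (s + 1) (taylor_shift u s a) w =
  a 0%N * tel0 u (pole_factor s 0) s w + hurwitz k.+1 (fun j => pole_factor s j.+1) (s + 1) (taylor_shift u s a) w).
rewrite pole_factorS; congr (_ + _).
apply: (IH _ _ (B * M)) => //; first exact: BP.
by move: sk; have := Re1 1 s; rewrite -natr1; lra.
Qed.

Lemma hurwitz_ext k m s a w (M : R) : geom_bound dl a M -> wok dl w -> 2 <= complex.Re s + k%:R ->
  (k <= m)%N -> hurwitz m (pole_factor s) s a w = hurwitz k (pole_factor s) s a w.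
Proof.
move=> aM wk sk km; rewrite -(subnK km).
elim: (m - k)%N => [//|i IH]; rewrite -IH addSn -(@hurwitz_step _ _ _ _ M) //.
by rewrite natrD; have : 0 <= i%:R :> R by []; lra.
Qed.

Lemma hurwitz_cvs k s a w (M : R) : geom_bound dl a M -> wok dl w -> 1 < complex.Re s -> (0 < k)%N ->
  cvs (fun m => \sum_(n < m) hurwitz_term u s a w n) (hurwitz k (pole_factor s) s a w).
Proof.
move=> aM wk s1 k0; rewrite (@hurwitz_ext 1%N _ _ _ _ M) //; last lra.
by rewrite /= pole_factor0; exact: cvs_step.
Qed.

Lemma hurwitz_le k (S K L : R) : 0 <= S -> 0 <= K -> 0 <= L -> exists2 C : R, 0 <= C &
  forall kap s a w M, nm s <= S -> (forall j, (j < k)%N -> nm (kap j) <= K) ->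
  nm (clog (shifted w 0)) <= L -> wok dl w -> 2 <= complex.Re s + k%:R -> geom_bound dl a M ->
  nm (hurwitz k kap s a w) <= C * M.
Proof.
move=> S0 K0 L0; elim: k S S0 => [|k IH] S S0.
  exists (2 * (expR (S * pi) * 2)); first by rewrite !mulr_ge0 ?expR_ge0.
  move=> kap s a w M sS _ _ wk s2 aM; rewrite addr0 in s2.
  have [cZ ZM] := hurwitz0_cvs dl0 dl2 u1 s2 aM wk.
  apply: (cvs_le (N := 0%N) _ cZ) => n _; apply: le_trans (ZM n) _.
  rewrite -!mulrA ler_wpM2l // ler_wpM2r ?mulr_ge0 ?(geom_bound_ge0 dl0 aM) //.
  by rewrite ler_expR ler_wpM2r // pi_ge0.
have [C C0 CP] := IH (S + 1) ltac:(lra).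
have [B B0 BP] := geom_bound_remainder dl0 dl2 u S.
pose D := K * expR ((S + 1) * L) + (nm (1 - u))^-1 * expR (S * L).
have D0 : 0 <= D by rewrite addr_ge0 ?mulr_ge0 ?expR_ge0 ?invr_ge0 ?nm_ge0.
exists (D + C * B); first by rewrite addr_ge0 ?mulr_ge0.
move=> kap s a w M sS kK wL wk sk aM; have M0 := geom_bound_ge0 dl0 aM.
rewrite /= (le_trans (nmD _ _)) // mulrDl lerD //; last first.
  rewrite -mulrA; apply: CP => //.
  - by rewrite (le_trans (nmD _ _)) // nm1 lerD2r.
  - by move=> j jk; apply: kK.
  - by move: sk; have := Re1 1 s; rewrite -natr1; lra.
  - exact: BP.
rewrite nmM mulrC ler_pM ?nm_ge0 //; last by have := aM 0%N; rewrite mulr1.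
rewrite /tel0 /tel /D; case: eqVneq => _.
  apply: ler_wpDr; first by rewrite mulr_ge0 ?invr_ge0 ?nm_ge0 ?expR_ge0.
  rewrite nmM ler_pM ?nm_ge0 ?kK //; apply: nm_pw_le => //.
  by rewrite (le_trans (nmBD _ _)) // nm1 lerD2r.
apply: ler_wpDl; first by rewrite mulr_ge0 ?expR_ge0.
rewrite -[_ / _ * _]mulrA nmM nmX u1 expr1n mul1r nmM nmV ler_wpM2l ?invr_ge0 ?nm_ge0 //.
exact: nm_pw_le.
Qed.

Lemma subball (z0 z : R[i]) (r : R) : nm (z - z0) < r ->
  exists2 r', 0 < r' & forall x, nm (x - z) < r' -> nm (x - z0) < r.
Proof.
move=> zr; exists (r - nm (z - z0)); first lra.
by move=> x xz; have := nm_tri x z z0; lra.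
Qed.

Lemma cdiff_ps (a : R[i] -> nat -> R[i]) (y : R[i] -> R[i]) z0 (r M : R) : 0 < r ->
  (forall z, nm (z - z0) < r -> [/\ forall m, cdiff (fun z => a z m) z, geom_bound dl (a z) M,
     cdiff y z & nm (y z) <= dl / 2]) ->
  cdiff (fun z => ps (a z) (y z)) z0.
Proof.
move=> r0 H; apply: (@cdiff_limit R (fun n z => \sum_(m < n) a z m * y z ^+ m) _ z0 r (2 * M)) => //.
- move=> n z /H[da _ dy _]; apply: cdiff_sum => m _; cd => //; exact: da.
- move=> n z /H[_ aM _ yd]; rewrite (le_trans (nm_sum _ _ _)) //.
  exact: (ps_partial_le dl0 n aM yd).
- by move=> z /H[_ aM _ yd]; have [] := ps_cvs dl0 aM yd.
Qed.

(** All arguments depend on one complex parameter, so the same statement yields holomorphy in s and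
    in the point of the disk. *)
Definition good_family (k : nat) (kap : R[i] -> nat -> R[i]) (s : R[i] -> R[i])
  (a : R[i] -> nat -> R[i]) (w : R[i] -> R[i]) (S M : R) z :=
  [/\ cdiff s z /\ nm (s z) <= S, cdiff w z /\ wok dl (w z),
      (forall m, cdiff (fun z => a z m) z) /\ geom_bound dl (a z) M,
      forall j, (j < k)%N -> cdiff (fun z => kap z j) z &
      2 <= complex.Re (s z) + k%:R].

Lemma hurwitz_cdiff k (kap : R[i] -> nat -> R[i]) (s : R[i] -> R[i])
  (a : R[i] -> nat -> R[i]) (w : R[i] -> R[i]) (z0 : R[i]) (r S M : R) : 0 < r ->
  (forall z, nm (z - z0) < r -> good_family k kap s a w S M z) ->
  cdiff (fun z => hurwitz k (kap z) (s z) (a z) (w z)) z0.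
Proof.
move=> r0; elim: k kap s a S M => [|k IH] kap s a S M H.
  apply: (@cdiff_limit R (fun m z => \sum_(n < m) hurwitz_term u (s z) (a z) (w z) n) _ z0 r
    (2 * (expR (S * pi) * (2 * M)))) => //.
  - move=> n z zr; apply: cdiff_sum => m _; rewrite /hurwitz_term.
    have [[ds _] [dw wk] _ _ _] := H z zr.
    have [r' r'0 r'P] := subball zr.
    have dx x : cdiff w x -> cdiff (fun z => shifted (w z) m) x by move=> dw'; rewrite /shifted; cd.
    cd.
    + apply: cdiff_pw => //; first exact: dx.
      exact/slit_Re/(Re_xn_gt0 dl0 dl2).
    + apply: (@cdiff_ps a (fun z => (shifted (w z) m)^-1) z r' M) => // x /r'P/H[_ [dw' wk'] [da aM] _ _].
      split=> //; last exact: xn_inv.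
      by cd; [exact: dx|exact: (xn_neq0 dl0 dl2)].
  - move=> n z /H[[_ sS] [_ wk] [_ aM] _]; rewrite addr0 => s2.
    have [_ ZM] := hurwitz0_cvs dl0 dl2 u1 s2 aM wk.
    apply: le_trans (ZM n) _; rewrite ler_wpM2l // ler_wpM2r ?mulr_ge0 ?(geom_bound_ge0 dl0 aM) //.
    by rewrite ler_expR ler_wpM2r // pi_ge0.
  - move=> z /H[_ [_ wk] [_ aM] _]; rewrite addr0 => s2.
    by have [] := hurwitz0_cvs dl0 dl2 u1 s2 aM wk.
have [B B0 BP] := geom_bound_remainder dl0 dl2 u S.
have z00 : nm (z0 - z0) < r by rewrite subrr nm0.
apply: (@cdiffD _ (fun z => a z 0%N * tel0 u (kap z 0%N) (s z) (w z))).
  have [[ds _] [dw wk] [da _] dk _] := H z0 z00.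
  have dx : cdiff (fun z => shifted (w z) 0) z0 by rewrite /shifted; cd.
  have sx : slit (shifted (w z0) 0) by exact/slit_Re/(Re_xn_gt0 dl0 dl2).
  apply: cdiffM; first exact: da.
  rewrite /tel0 /tel; case: eqVneq => _.
    apply: cdiffM; first exact: dk.
    by apply: (@cdiff_pw R (fun z => s z - 1)) => //; cd.
  by cd; apply: cdiff_pw.
apply: (IH (fun z j => kap z j.+1) (fun z => s z + 1) (fun z => taylor_shift u (s z) (a z)) (S + 1) (B * M)).
move=> z zr; have [[ds sS] [dw wk] [da aM] dk s2] := H z zr; split=> //.
- by split; [cd|rewrite (le_trans (nmD _ _)) // nm1 lerD2r].
- split; last exact: BP.
  move=> m; rewrite /taylor_shift; cd; try exact: da.
  have [r' r'0 r'P] := subball zr.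
  by apply: (@cdiff_ecoef R u s z r' S) => // x /r'P/H[[]].
- by move=> j jk; apply: dk.
- by move: s2; have := Re1 1 (s z); rewrite -natr1; lra.
Qed.

Lemma taylor_shiftD s a b (c : R[i]) : taylor_shift u s (fun m => c * a m + b m) =
  (fun m => c * taylor_shift u s a m + taylor_shift u s b m).
Proof. by apply/funext => m; rewrite /taylor_shift; ring. Qed.

Lemma hurwitz_lin k kap s a b w (c : R[i]) (M N : R) : geom_bound dl a M -> geom_bound dl b N -> wok dl w ->
  2 <= complex.Re s + k%:R ->
  hurwitz k kap s (fun m => c * a m + b m) w = c * hurwitz k kap s a w + hurwitz k kap s b w.
Proof.
elim: k kap s a b M N => [|k IH] kap s a b M N aM bN wk sk.
  rewrite addr0 in sk; have [ca _] := hurwitz0_cvs dl0 dl2 u1 sk aM wk.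
  have [cb _] := hurwitz0_cvs dl0 dl2 u1 sk bN wk.
  apply: limsE; rewrite (_ : (fun m => _) = (fun m => c * \sum_(n < m) hurwitz_term u s a w n +
     \sum_(n < m) hurwitz_term u s b w n)); first by apply: cvsD => //; exact: cvsZ.
  apply/funext => m; rewrite mulr_sumr -big_split; apply: eq_bigr => n _ /=.
  by rewrite /hurwitz_term (psD dl0 c aM bN (xn_inv dl0 dl2 n wk)); ring.
have [B B0 BP] := geom_bound_remainder dl0 dl2 u (nm s).
rewrite /= taylor_shiftD (IH _ _ _ _ (B * M) (B * N)) //; try exact: BP.
  by move: (hurwitz _ _ _ _ _) (hurwitz _ _ _ _ _) (tel0 _ _ _ _) => x y t; ring.
by move: sk; have := Re1 1 s; rewrite -natr1; lra.
Qed.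

(** The constant coefficient left after j peelings; in [hurwitz] it is the scalar in front of the
    j-th telescoped term, which carries [kap j] when u = 1. Being one linear functional of a, it
    makes the residue have rank one. *)
Fixpoint lead (j : nat) s a : R[i] := if j is j'.+1 then lead j' (s + 1) (taylor_shift u s a) else a 0%N.

Lemma hurwitz_kap k kap kap' s a w : u <> 1 -> hurwitz k kap s a w = hurwitz k kap' s a w.
Proof.
move=> uN; elim: k kap kap' s a => [//|k IH] kap kap' s a /=.
rewrite (IH _ (fun j => kap' j.+1)); congr (_ * _ + _).
by rewrite /tel0 /tel; case: eqVneq.
Qed.

Lemma lead_lin j s a b (c : R[i]) :
  lead j s (fun m => c * a m + b m) = c * lead j s a + lead j s b.
Proof. by elim: j s a b => [//|j IH] s a b /=; rewrite taylor_shiftD IH. Qed.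

(** For F(y) = y^j peeling is a mere index shift, which ends in the constant 1; this is what keeps
    the residue from vanishing. *)
Lemma lead_delta j s : lead j s (fun m => (m == j)%:R) = 1.
Proof.
elim: j s => [//|j IH] s /=; rewrite -[RHS](IH (s + 1)); congr lead.
by apply/funext => m; rewrite /taylor_shift mul0r subr0 eqSS.
Qed.

Lemma lead_le j (S : R) : exists2 C : R, 0 <= C & forall s a M, nm s <= S ->
  geom_bound dl a M -> nm (lead j s a) <= C * M.
Proof.
elim: j S => [|j IH] S.
  by exists 1 => // s a M _ /(_ 0%N); rewrite mulr1 mul1r.
have [C C0 CP] := IH (S + 1); have [B B0 BP] := geom_bound_remainder dl0 dl2 u S.
exists (C * B); first exact: mulr_ge0.
move=> s a M sS aM /=; rewrite -mulrA; apply: CP; last exact: BP.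
by rewrite (le_trans (nmD _ _)) // nm1 lerD2r.
Qed.

Lemma lead_cdiff j (s : R[i] -> R[i]) (a : R[i] -> nat -> R[i]) (z0 : R[i])
  (r S M : R) : 0 < r ->
  (forall z, nm (z - z0) < r -> [/\ cdiff s z, nm (s z) <= S,
     forall m, cdiff (fun z => a z m) z & geom_bound dl (a z) M]) ->
  cdiff (fun z => lead j (s z) (a z)) z0.
Proof.
move=> r0; elim: j s a S M => [|j IH] s a S M H /=.
  by have [] := H z0; rewrite ?subrr ?nm0.
have [B B0 BP] := geom_bound_remainder dl0 dl2 u S.
apply: (IH (fun z => s z + 1) (fun z => taylor_shift u (s z) (a z)) (S + 1) (B * M)) => z zr.
have [ds sS da aM] := H z zr; split; first by cd.
- by rewrite (le_trans (nmD _ _)) // nm1 lerD2r.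
- move=> m; rewrite /taylor_shift; cd; try exact: da.
  have [r' r'0 r'P] := subball zr.
  by apply: (@cdiff_ecoef R u s z r' S) => // x /r'P/H[].
- exact: BP.
Qed.
End continuation.

(** * Reduction of vectors to their coordinates *)

Section coordinates.
Variable R : realType.

Lemma nm_le_norm d (v : 'cV[R[i]]_d) i : (nm (v i 0))%:C <= `|v|.
Proof.
rewrite -nmE; apply: (@le_trans _ _ (`|v i 0|%:nng)%:num) => //.
rewrite [leRHS]/Num.norm /= mx_normE num_le.
apply/bigmax_geP; right; exists (i, 0) => //=.
by rewrite -num_le.
Qed.

Lemma norm_le_nm d (v : 'cV[R[i]]_d) (M : R) : 0 <= M ->
  (forall i, nm (v i 0) <= M) -> `|v| <= M%:C.
Proof.
move=> M0 H; have MC : 0 <= M%:C :> R[i] by rewrite lecR.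
rewrite [leLHS]/Num.norm /= mx_normE.
have -> : M%:C = (NngNum MC)%:num by [].
rewrite num_le; apply/bigmax_leP; split; first by rewrite -num_le.
move=> [i j] _ /=; rewrite -num_le /= (ord1 j) nmE lecR; exact: H.
Qed.

Lemma nm_le_hnorm d (v : 'cV[R[i]]_d) i : nm (v i 0) <= hnorm v.
Proof.
rewrite -(@ler_sqr R) ?nnegrE ?nm_ge0 ?hnorm_ge0 // -lecR !rmorphXn /= hnormE sqrtCK.
rewrite dotmxE mxE (bigD1 i) //= !mxE -normCK -nmE lerDl.
by apply: sumr_ge0 => j _; rewrite !mxE -normCK exprn_ge0.
Qed.

Lemma derivable_coord d (f : R[i] -> 'cV[R[i]]_d) z i :
  derivable f z 1 -> cdiff (fun z => f z i 0) z.
Proof.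
move=> /cvg_ex[/= l fl]; exists (l i 0) => e e0.
move: fl => /cvgrPdist_le /(_ e%:C) []; first by rewrite ltcR.
move=> d0 /= d0p dP; have dE : d0 = (complex.Re d0)%:C by rewrite RRe_real // gtr0_real.
have d0r : 0 < complex.Re d0 by rewrite -ltcR -dE.
exists (complex.Re d0) => // h hd; have [->|h0] := eqVneq h 0.
  by rewrite addr0 mulr0 subrr subr0 nm0 mulr0.
have := dP h; rewrite /= sub0r normrN nmE dE ltcR => /(_ hd h0) H.
have {}H := le_trans (nm_le_norm _ i) H; rewrite lecR !mxE nmB in H.
rewrite -ler_pdivrMr ?nm_gt0 // -nmV -nmM.
apply: le_trans H; rewrite le_eqVlt; apply/orP; left; apply/eqP; congr nm.
rewrite -[h%:A]/(h * 1) mulr1 [h + z]addrC.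
by field.
Qed.

Lemma coord_derivable d (f : R[i] -> 'cV[R[i]]_d) z :
  (forall i, cdiff (fun z => f z i 0) z) -> derivable f z 1.
Proof.
move=> df; pose l i := sval (cid (df i)).
have lP i : hd (fun z => f z i 0) z (l i) by rewrite /l; case: cid.
apply/cvg_ex; exists (\col_i l i); apply/cvgrPdist_le => e e0.
have eE : e = (complex.Re e)%:C by rewrite RRe_real // gtr0_real.
have e0r : 0 < complex.Re e by rewrite -ltcR -eE.
have : \forall h \near (0 : R[i])^', forall i, nm (l i - h^-1 * (f (h + z) i 0 - f z i 0)) <= complex.Re e.
  apply: filter_forall => i; have [d0 d00 dP] := lP i _ e0r.
  exists d0%:C => /=; first by rewrite ltcR.
  move=> h /=; rewrite sub0r normrN nmE ltcR => hd h0.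
  have := dP h hd; rewrite -ler_pdivrMr ?nm_gt0 // -nmV -nmM nmB [z + h]addrC.
  apply: le_trans; rewrite le_eqVlt; apply/orP; left; apply/eqP; congr nm.
  by field.
apply: filterS => h H; rewrite eE; apply: norm_le_nm; first exact: ltW.
by move=> i; rewrite !mxE -[h%:A]/(h * 1) mulr1; exact: H.
Qed.
End coordinates.

(** * The function spaces and operators in coordinates *)

Section spaces.
Variables (R : realType) (d : nat).

Definition wcts (D : disk R) (g : R[i] -> 'cV[R[i]]_d) := forall z,
  closure (disk_set D) z -> forall e : R, 0 < e -> exists2 r : R, 0 < r &
  forall w, closure (disk_set D) w -> nm (w - z) < r -> forall i, nm (g w i 0 - g z i 0) <= e.

(** What has to hold on the disk for the extension by zero of [g] to belong to the space; the values
    of [g] off the closed disk are not constrained. *)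
Definition good (D : disk R) (g : R[i] -> 'cV[R[i]]_d) := wcts D g /\
  forall z, disk_set D z -> forall i, cdiff (fun z => g z i 0) z.

Lemma disk_setE (D : disk R) z : disk_set D z <-> nm (z - Defs.center D) < Defs.radius D.
Proof. by rewrite /disk_set -ball_normE /= nmE ltcR nmB. Qed.

Lemma disk_closure (D : disk R) z : disk_set D z -> closure (disk_set D) z.
Proof. exact: subset_closure. Qed.

Lemma disk_inner (D : disk R) z : disk_set D z -> exists2 r : R, 0 < r &
  forall w, nm (w - z) < r -> disk_set D w.
Proof.
move=> /disk_setE zD; exists (Defs.radius D - nm (z - Defs.center D)); first by rewrite subr_gt0.
by move=> w wz; apply/disk_setE; have := nm_tri w z (Defs.center D); lra.
Qed.

Lemma holo_ex (D : disk R) (g : R[i] -> 'cV[R[i]]_d) : good D g ->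
  exists f : holo_space D d, forall z, closure (disk_set D) z -> f z = g z.
Proof.
move=> [cg dg]; pose F (z : R[i]) := if pselect (closure (disk_set D) z) then g z else 0.
have FE z : closure (disk_set D) z -> F z = g z by rewrite /F; case: pselect.
suff FP : F \in @holo_disk R D d by exists (HoloSpace FP).
apply/asboolP; split; last by move=> z; rewrite /F; case: pselect.
- apply/subspace_continuousP => z zD; apply/cvgrPdist_le => e e0.
  have eE : e = (complex.Re e)%:C by rewrite RRe_real // gtr0_real.
  have e0r : 0 < complex.Re e by rewrite -ltcR -eE.
  have [r r0 rP] := cg z zD _ e0r.
  apply/nbhs_ballP; exists r%:C => /=; first by rewrite ltcR.
  move=> w; rewrite -ball_normE /= nmE ltcR nmB => wr wD.
  change (`|F z - F w| <= e); rewrite !FE // eE.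
  apply: norm_le_nm => [|i]; first exact: ltW.
  by rewrite !mxE nmB; exact: rP.
- move=> z zD; apply: coord_derivable => i; have [r r0 rP] := disk_inner zD.
  apply: (cdiff_near r0) (dg z zD i) => w /rP/disk_closure wD.
  by rewrite FE.
Qed.

Lemma holo_good (D : disk R) (f : holo_space D d) : good D f.
Proof.
have /asboolP[cf df _] := holo_funP f; split; last first.
  by move=> z zD i; apply: derivable_coord; exact: df.
move=> z zD e e0; move/subspace_continuousP: cf => /(_ z zD)/cvgrPdist_le/(_ e%:C).
rewrite ltcR => /(_ e0)/nbhs_ballP[r /= r0 rP].
have rE : r = (complex.Re r)%:C by rewrite RRe_real // gtr0_real.
have r0r : 0 < complex.Re r by rewrite -ltcR -rE.
exists (complex.Re r) => // w wD wz i.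
have := rP w; rewrite -ball_normE /= nmE rE ltcR (nmB z w) => /(_ wz wD) H.
have {}H : `|f z - f w| <= e%:C by exact: H.
by have := le_trans (nm_le_norm _ i) H; rewrite lecR !mxE nmB.
Qed.

Lemma good_open (D : disk R) (g : R[i] -> 'cV[R[i]]_d) :
  (forall z, closure (disk_set D) z -> forall i, cdiff (fun z => g z i 0) z) -> good D g.
Proof.
move=> dg; split=> [z zD e e0|z /disk_closure]; last exact: dg.
suff [r r0 rP] : exists2 r : R, 0 < r & forall i w, nm (w - z) < r -> nm (g w i 0 - g z i 0) <= e.
  by exists r => // w _ wz i; exact: rP.
have H i := cdiff_cts (dg z zD i) e0.
pose r i := s2val (cid2 (H i)).
have r0 i : 0 < r i by rewrite /r; case: cid2.
have rP i w : nm (w - z) < r i -> nm (g w i 0 - g z i 0) <= e.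
  rewrite /r; case: cid2 => /= t t0 tP /tP.
  by rewrite [z + _]addrC subrK.
exists (\big[Num.min/1]_i r i); first by apply/bigmin_gtP; split.
by move=> i w /bigmin_gtP[_ H']; apply: rP; exact: H'.
Qed.

Lemma holo_eq (D : disk R) (f g : holo_space D d) :
  (forall z, closure (disk_set D) z -> f z = g z) -> f = g.
Proof.
move=> fg; apply/val_inj/funext => z; change (f z = g z).
have [zD|zD] := pselect (closure (disk_set D) z); first exact: fg.
have /asboolP[_ _ f0] := holo_funP f; have /asboolP[_ _ g0] := holo_funP g.
by rewrite f0 ?g0.
Qed.

Variables E1 Er Eq : disk R.
Notation X := (BE d E1 Er Eq).

Inductive ix := I1 | Ir | Iq.

Definition Dk b := match b with I1 => E1 | Ir => Er | Iq => Eq end.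

Definition cmp (f : X) b : holo_space (Dk b) d :=
  match b return holo_space (Dk b) d with
  | I1 => f.1.1 | Ir => f.1.2 | Iq => f.2 end.

Definition mkBE (g : forall b, holo_space (Dk b) d) : X := (g I1, g Ir, g Iq).

Lemma cmp_mk g b : cmp (mkBE g) b = g b. Proof. by case: b. Qed.

Lemma BE_eq (f g : X) :
  (forall b z, closure (disk_set (Dk b)) z -> cmp f b z = cmp g b z) -> f = g.
Proof.
case: f g => [[f1 fr] fq] [[g1 gr] gq] H; congr (_, _, _); apply: holo_eq.
- exact: (H I1).
- exact: (H Ir).
- exact: (H Iq).
Qed.

Lemma cmpZD (c : R[i]) (f g : X) b z i :
  cmp (c *: f + g) b z i 0 = c * cmp f b z i 0 + cmp g b z i 0.
Proof. by case: b => /=; rewrite !mxE. Qed.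

Lemma cmpD (f g : X) b z i : cmp (f + g) b z i 0 = cmp f b z i 0 + cmp g b z i 0.
Proof. by case: b => /=; rewrite !mxE. Qed.

Lemma cmpZ (c : R[i]) (f : X) b z i : cmp (c *: f) b z i 0 = c * cmp f b z i 0.
Proof. by case: b => /=; rewrite !mxE. Qed.

Lemma cmpB (f g : X) b z i : cmp (f - g) b z i 0 = cmp f b z i 0 - cmp g b z i 0.
Proof. by case: b => /=; rewrite !mxE. Qed.

Lemma cmp0 b z i : cmp 0 b z i 0 = 0.
Proof. by case: b => /=; rewrite !mxE. Qed.

Definition nrm (f : X) : R := complex.Re `|f|.

Lemma nrmE (f : X) : `|f| = (nrm f)%:C.
Proof. by rewrite /nrm RRe_real // ger0_real. Qed.

Lemma nrm_ge0 (f : X) : 0 <= nrm f.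
Proof. by rewrite -lecR -nrmE rmorph0 normr_ge0. Qed.

Lemma nrm_max (f : X) : nrm f =
  Num.max (Num.max (sup_norm f.1.1) (sup_norm f.1.2)) (sup_norm f.2).
Proof.
apply: (@complexI R); rewrite -nrmE.
have maxC (x y : R) : (Num.max x y)%:C = Num.max x%:C y%:C :> R[i].
  by rewrite /Order.max ltcR; case: ifP.
by rewrite !maxC.
Qed.

Lemma nrm_ge (f : X) b z i : closure (disk_set (Dk b)) z -> nm (cmp f b z i 0) <= nrm f.
Proof.
move=> zD; apply: le_trans (nm_le_hnorm _ _) _; rewrite nrm_max.
case: b zD => /= zD; rewrite !le_max.
- by apply/orP; left; apply/orP; left; exact: sup_norm_ge.
- by apply/orP; left; apply/orP; right; exact: sup_norm_ge.
- by apply/orP; right; exact: sup_norm_ge.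
Qed.

(** The factor d compares the Hermitian norm with the largest coordinate. *)
Lemma nrm_le (f : X) (M : R) : 0 <= M ->
  (forall b z i, closure (disk_set (Dk b)) z -> nm (cmp f b z i 0) <= M) -> nrm f <= d%:R * M.
Proof.
move=> M0 H; rewrite nrm_max !ge_max.
have K b z : closure (disk_set (Dk b)) z -> hnorm (cmp f b z) <= d%:R * M.
  move=> zD; rewrite -lecR (le_trans (hnorm_le _)) // rmorphM /= rmorph_nat.
  by rewrite ler_wpM2l //; apply: norm_le_nm => // i; exact: H.
by apply/andP; split; [apply/andP; split|]; apply: sup_norm_le => z zD;
  [exact: (K I1)|exact: (K Ir)|exact: (K Iq)].
Qed.

Lemma op_ex (T : X -> ix -> R[i] -> 'cV[R[i]]_d) :
  (forall f b, good (Dk b) (T f b)) ->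
  (forall c f g b z, closure (disk_set (Dk b)) z ->
     T (c *: f + g) b z = c *: T f b z + T g b z) ->
  exists L : {linear X -> X}, forall f b z, closure (disk_set (Dk b)) z ->
    cmp (L f) b z = T f b z.
Proof.
move=> gT lT; pose h f b := sval (cid (holo_ex (gT f b))).
have hP f b z : closure (disk_set (Dk b)) z -> h f b z = T f b z.
  by rewrite /h; case: cid => /= g; apply.
pose L f := mkBE (h f).
have LE f b z : closure (disk_set (Dk b)) z -> cmp (L f) b z = T f b z.
  by move=> zD; rewrite cmp_mk hP.
have lL : linear L.
  move=> c f g; apply: BE_eq => b z zD; rewrite LE // lT //.
  apply/colP => i; rewrite cmpZD !LE // !mxE //.
pose A := GRing.isLinear.Build R[i] X X _ L lL.
pose L' : {linear X -> X} := HB.pack L A.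
by exists L'.
Qed.

Lemma bounded_continuous (L : {linear X -> X}) (C : R) :
  (forall f, nrm (L f) <= C * nrm f) -> continuous L.
Proof.
move=> LC; apply/bounded_linear_continuous/linear_boundedP.
have C0 : 0 <= `|C|%:C :> R[i] by rewrite lecR.
exists `|C|%:C; split; first exact: ger0_real.
move=> r Cr f; have r0 : r = (complex.Re r)%:C.
  by rewrite RRe_real // ger0_real // (le_trans C0) // ltW.
rewrite r0 !nrmE -rmorphM lecR (le_trans (LC f)) // ler_wpM2r ?nrm_ge0 //.
by rewrite (le_trans (ler_norm C)) // -lecR -r0 ltW.
Qed.
End spaces.

(** * Holomorphy in operator norm from holomorphy of the values *)

Section operator_families.
Variables (R : realType) (d : nat) (E1 Er Eq : disk R).
Notation X := (BE d E1 Er Eq).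
Notation Dk := (Dk E1 Er Eq).
Implicit Types (f g : X) (b : ix) (z s h : R[i]).

(** Weierstrass's theorem on uniform limits; it shows that the derivative in s of a family of
    functions is again in the space. *)
Lemma holo_limit b (g : R[i] -> 'cV[R[i]]_d) (Q : nat -> X) (M : R) :
  (forall e : R, 0 < e -> exists N, forall n z i, (N <= n)%N -> closure (disk_set (Dk b)) z ->
    nm (cmp (Q n) b z i 0 - g z i 0) <= e) ->
  (forall n z i, closure (disk_set (Dk b)) z -> nm (cmp (Q n) b z i 0) <= M) -> good (Dk b) g.
Proof.
move=> Qg QM; split.
  move=> z zD e e0; have e3 : 0 < e / 3 by rewrite divr_gt0.
  have [N NP] := Qg (e / 3) e3.
  have [/(_ z zD (e / 3) e3)[r r0 rP] _] := holo_good (cmp (Q N) b).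
  exists r => // w wD wz i.
  have h1 := NP N w i (leqnn N) wD; have h2 := NP N z i (leqnn N) zD.
  have h3 := rP w wD wz i.
  have := nm_tri (g w i 0) (cmp (Q N) b w i 0) (g z i 0).
  have := nm_tri (cmp (Q N) b w i 0) (cmp (Q N) b z i 0) (g z i 0).
  by rewrite (nmB (g w i 0) (cmp _ _ _ _ _)); lra.
move=> z zD i; have [r r0 rP] := disk_inner zD.
apply: (@cdiff_limit R (fun n z => cmp (Q n) b z i 0) _ z r M) => //.
- by move=> n w /rP wD; have [_ /(_ w wD i)] := holo_good (cmp (Q n) b).
- by move=> n w /rP/disk_closure wD; exact: QM.
- move=> w /rP/disk_closure wD e e0; have [N NP] := Qg e e0.
  by exists N => n Nn; exact: NP.
Qed.

(** For fixed f and z the second order Taylor error in s is at most K |f| |h|^2 with K independent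
    of f and z. Hence pointwise differentiability becomes differentiability in operator norm, the
    derivative being the first Taylor coefficient in s. *)
Lemma op_holo (U : set R[i]) (F : R[i] -> {linear X -> X}) : open U ->
  (forall s0, U s0 -> exists2 r : R, 0 < r & exists2 C : R, 0 <= C &
     forall s, nm (s - s0) < r ->
     (forall f, nrm (F s f) <= C * nrm f) /\
     (forall f b z i, closure (disk_set (Dk b)) z ->
        cdiff (fun s => cmp (F s f) b z i 0) s)) ->
  op_holomorphic U F.
Proof.
move=> oU H; split => // s0 /H[r r0 [C C0 FP]]; split.
  by have [] := FP s0 ltac:(rewrite subrr nm0 //) => LC _; exact: bounded_continuous LC.
pose rho := r / 2; have rho0 : 0 < rho by rewrite divr_gt0.
have rr : rho < r by rewrite /rho; lra.
pose K := 2 * C / rho ^+ 2; have K0 : 0 <= K by rewrite divr_ge0 ?mulr_ge0 ?exprn_ge0 // ltW.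
pose phi f b z i s := cmp (F s f) b z i 0.
have dphi f b z i : closure (disk_set (Dk b)) z -> forall s, nm (s - s0) < r -> cdiff (phi f b z i) s.
  by move=> zD s /FP[_]; apply.
have bphi f b z i : closure (disk_set (Dk b)) z -> forall s, nm (s - s0) < r ->
    nm (phi f b z i s) <= C * nrm f.
  by move=> zD s /FP[LC _]; apply: le_trans (LC f); exact: nrm_ge.
have on s : nm (s - s0) = rho -> nm (s - s0) < r by move=> ->.
pose T f b z : 'cV[R[i]]_d := \col_i tc (phi f b z i) s0 rho 1.
have est f b z i h : closure (disk_set (Dk b)) z -> nm h <= rho / 2 ->
    nm (cmp (F (s0 + h) f) b z i 0 - cmp (F s0 f) b z i 0 - T f b z i 0 * h) <= K * nrm f * nm h ^+ 2.
  move=> zD hr; rewrite mxE.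
  have -> : K * nrm f * nm h ^+ 2 = 2 * (C * nrm f) / rho ^+ 2 * nm h ^+ 2 by rewrite /K; ring.
  exact: taylor2 (dphi f b z i zD) rho0 rr hr (fun s E => bphi f b z i zD s (on s E)).
have Tle f b z i : closure (disk_set (Dk b)) z -> nm (T f b z i 0) <= C * nrm f / rho.
  move=> zD; rewrite mxE -[X in _ / X]expr1; apply: tc_le => // s E.
    exact: cdiff_cts (dphi f b z i zD s (on s E)).
  exact: (bphi f b z i zD s (on s E)).
have est2 f b z i h : h != 0 -> closure (disk_set (Dk b)) z -> nm h <= rho / 2 ->
    nm (cmp (h^-1 *: (F (s0 + h) f - F s0 f)) b z i 0 - T f b z i 0) <= K * nrm f * nm h.
  move=> h0 zD hr; have hp : 0 < nm h by rewrite nm_gt0.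
  rewrite cmpZ cmpB -(ler_pM2r hp) -nmM.
  have -> : (h^-1 * (cmp (F (s0 + h) f) b z i 0 - cmp (F s0 f) b z i 0) - T f b z i 0) * h =
    cmp (F (s0 + h) f) b z i 0 - cmp (F s0 f) b z i 0 - T f b z i 0 * h by field.
  by apply: le_trans (est f b z i h zD hr) _; rewrite expr2 mulrA.
have gT f b : good (Dk b) (T f b).
  (* Along these steps the difference quotients converge to [T f b] uniformly on the closed disk. *)
  pose hn (n : nat) : R[i] := (rho / 2 / n.+1%:R)%:C.
  have hE n : nm (hn n) = rho / 2 / n.+1%:R by rewrite nmRp // !divr_ge0 // ltW.
  have h0 n : hn n != 0 by rewrite -nm_gt0 hE !divr_gt0.
  have hr n : nm (hn n) <= rho / 2.
    by rewrite hE ler_pdivrMr // ler_peMr ?ler1n // divr_ge0 ?(ltW rho0).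
  have KM : 0 <= K * nrm f by rewrite mulr_ge0 // nrm_ge0.
  apply: (@holo_limit b (T f b) (fun n => (hn n)^-1 *: (F (s0 + hn n) f - F s0 f))
    (C * nrm f / rho + K * nrm f * (rho / 2))).
    move=> e e0; set A := K * nrm f * (rho / 2).
    have A0 : 0 <= A by rewrite mulr_ge0 // divr_ge0 // ltW.
    have A1 : 0 < A + 1 by rewrite ltr_wpDl.
    have eA : 0 < e / (A + 1) by rewrite divr_gt0.
    have [N NP] := inv_small eA.
    exists N => n z i /NP Nn zD; apply: le_trans (est2 f b z i _ (h0 n) zD (hr n)) _.
    rewrite hE mulrA -/A; apply: le_trans (ler_wpM2l A0 Nn) _.
    by rewrite mulrA ler_pdivrMr // mulrC ler_pM2l // lerDl.
  move=> n z i zD.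
  have h1 := est2 f b z i _ (h0 n) zD (hr n); have h2 := Tle f b z i zD.
  have h3 := ler_wpM2l KM (hr n).
  have := nmD (cmp ((hn n)^-1 *: (F (s0 + hn n) f - F s0 f)) b z i 0 - T f b z i 0) (T f b z i 0).
  rewrite subrK; lra.
have lT c f g b z : closure (disk_set (Dk b)) z -> T (c *: f + g) b z = c *: T f b z + T g b z.
  move=> zD; apply/colP => i; rewrite !mxE.
  have cphi f' : forall s, nm (s - s0) = rho -> cts (phi f' b z i) s.
    by move=> s E; exact: cdiff_cts (dphi f' b z i zD s (on s E)).
  have cZ s : nm (s - s0) = rho -> cts (fun s => c * phi f b z i s) s.
    by move=> E; apply: ctsM; [exact: cts_cst|exact: cphi].
  have Z1 := @tcZ R (phi f b z i) s0 rho c 1 rho0 (cphi f).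
  have Z2 := @tcD R _ (phi g b z i) s0 rho 1 rho0 cZ (cphi g).
  rewrite -Z1 -Z2; apply: eq_tc => [|s _]; first exact: ltW.
  by rewrite /phi linearP cmpZD.
have [D DP] := op_ex gT lT.
exists D.
  apply: (@bounded_continuous _ _ _ _ _ D (d%:R * (C / rho))) => f.
  rewrite -mulrA; apply: nrm_le => [|b z i zD].
    by rewrite mulr_ge0 ?nrm_ge0 // divr_ge0 // ltW.
  by rewrite DP // mulrAC; exact: Tle.
move=> e e0.
have A0 : 0 <= d%:R * K by rewrite mulr_ge0.
pose t := Num.min (rho / 2) (e / (d%:R * K + 1)).
have t0 : 0 < t by rewrite lt_min !divr_gt0 // ltr_wpDl.
exists t%:C => /=; first by rewrite ltcR.
move=> h /=; rewrite sub0r normrN nmE ltcR lt_min => /andP[h1 h2] h0 f.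
rewrite !nrmE -rmorphM lecR.
apply: (@le_trans _ _ (d%:R * (K * nrm f * nm h))); last first.
  move: h2; rewrite ltr_pdivlMr ?ltr_wpDl // => h2.
  have hh := nm_ge0 h; have ff := nrm_ge0 f.
  have -> : d%:R * (K * nrm f * nm h) = (d%:R * K * nm h) * nrm f by ring.
  by apply: ler_wpM2r => //; lra.
apply: nrm_le => [|b z i zD].
  by apply: mulr_ge0; [apply: mulr_ge0 => //; exact: nrm_ge0|exact: nm_ge0].
by rewrite cmpB DP //; apply: est2 => //; exact: ltW.
Qed.

Lemma op_holomorphic_eq (U : set R[i]) (F G : R[i] -> {linear X -> X}) :
  (forall s f, U s -> F s f = G s f) -> op_holomorphic U F -> op_holomorphic U G.
Proof.
move=> FG [oU H]; split; first exact: oU.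
move=> s Us; have [cF [D cD DP]] := H s Us; split.
  have -> : (G s : X -> X) = F s by apply/funext => f; rewrite FG.
  exact: cF.
exists D; first exact: cD.
move=> e e0; have [r r0 rP] : exists2 r : R, 0 < r & forall h, nm h < r -> U (s + h).
  move: oU; rewrite openE => /(_ s Us)/nbhs_ballP[r /= r0 rP].
  have rE : r = (complex.Re r)%:C by rewrite RRe_real // gtr0_real.
  exists (complex.Re r); first by rewrite -ltcR -rE.
  move=> h hr; apply: rP; rewrite -ball_normE /= opprD addrA subrr sub0r normrN.
  by rewrite nmE rE ltcR.
have : \forall h \near (0 : R[i])^', nm h < r.
  exists r%:C => /=; first by rewrite ltcR.
  by move=> h /=; rewrite sub0r normrN nmE ltcR.
apply: filterS2 (DP e e0) => h H1 hr f; rewrite -!FG //; exact: rP.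
Qed.
End operator_families.

(** * Merging two series into one *)

Section interleaving.

(** Two nuclear representations have to be merged into one indexed by the natural numbers. *)
Definition interleave (T : Type) (u v : nat -> T) n := if odd n then v n./2 else u n./2.

Lemma series_interleave (V : zmodType) (u v : nat -> V) n :
  series (interleave u v) n = series u (uphalf n) + series v n./2.
Proof.
elim: n => [|n IH]; first by rewrite /series /= !big_geq // addr0.
rewrite seriesS IH /interleave -[uphalf n.+1]/(n./2.+1) -[n.+1./2]/(uphalf n) uphalf_half.
case: (odd n); rewrite ?add1n ?add0n.
  by rewrite [series v _.+1]seriesS addrCA.
by rewrite [series u _.+1]seriesS addrA.
Qed.

Lemma half_cvg : (fun n => n./2) @ \oo --> \oo.
Proof.
move=> A [N _ NA]; exists N.*2 => // n /= Nn; apply: NA => /=.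
by rewrite -(doubleK N); exact: half_leq.
Qed.

Lemma uphalf_cvg : uphalf @ \oo --> \oo.
Proof.
move=> A [N _ NA]; exists N.*2 => // n /= Nn; apply: NA => /=.
by rewrite uphalf_half (leq_trans _ (leq_addl _ _)) // -(doubleK N); exact: half_leq.
Qed.
End interleaving.

(** * Nuclearity of operators that only see smaller disks *)

Section nuclear.
Variables (R : realType) (d : nat) (E1 Er Eq : disk R).
Notation X := (BE d E1 Er Eq).
Notation Dk := (Dk E1 Er Eq).
Implicit Types (f g : X) (b : ix) (z : R[i]).

Definition psum (p : R) (A : X -> X) : Prop :=
  exists (lam : nat -> R[i]) (phi : nat -> {scalar X}) (e : nat -> X),
    [/\ forall n x, `|phi n x| <= `|x|, forall n, `|e n| <= 1,
        cvgn (series (fun n => complex.Re `|lam n| `^ p)) &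
        forall x, series (fun n => (lam n * phi n x) *: e n) @ \oo --> A x].

Lemma psum0 p : 0 < p -> psum p (fun=> 0).
Proof.
move=> p0; pose z : {scalar X} := \0.
exists (fun=> 0), (fun=> z), (fun=> 0); split.
- by move=> n x; rewrite normr0.
- by move=> n; rewrite normr0.
- rewrite (_ : series _ = fun=> 0); first exact: is_cvg_cst.
  apply/funext => n; rewrite /series; apply: big1 => k _.
  by rewrite normr0 -[complex.Re 0]/(0 : R) powR0 // gt_eqF.
- move=> x; rewrite (_ : series _ = fun=> 0); first exact: cvg_cst.
  by apply/funext => n; rewrite /series /= big1 // => k _; rewrite scaler0.
Qed.

Lemma psumD p A B : psum p A -> psum p B -> psum p (fun x => A x + B x).
Proof.
move=> [la [pa [ea [a1 a2 a3 a4]]]] [lb [pb [eb [b1 b2 b3 b4]]]].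
exists (interleave la lb), (interleave pa pb), (interleave ea eb); split.
- by move=> n x; rewrite /interleave; case: odd.
- by move=> n; rewrite /interleave; case: odd.
- rewrite (_ : series _ = fun n => series (fun n => complex.Re `|la n| `^ p) (uphalf n) +
      series (fun n => complex.Re `|lb n| `^ p) n./2).
    apply: is_cvgD.
      apply/cvg_ex; exists (limn (series (fun n => complex.Re `|la n| `^ p))).
      by apply: cvg_comp uphalf_cvg _; exact: a3.
    apply/cvg_ex; exists (limn (series (fun n => complex.Re `|lb n| `^ p))).
    by apply: cvg_comp half_cvg _; exact: b3.
  apply/funext => n; rewrite -series_interleave; congr series; apply/funext => k.
  by rewrite /interleave; case: odd.
- move=> x; rewrite (_ : series _ = fun n => series (fun n => (la n * pa n x) *: ea n) (uphalf n) +
      series (fun n => (lb n * pb n x) *: eb n) n./2).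
    apply: cvgD.
      by apply: cvg_comp uphalf_cvg _; exact: a4.
    by apply: cvg_comp half_cvg _; exact: b4.
  apply/funext => n; rewrite -series_interleave; congr series; apply/funext => k.
  by rewrite /interleave; case: odd.
Qed.

Lemma psum_sum p (I : Type) (r : seq I) (A : I -> X -> X) : 0 < p ->
  (forall i, psum p (A i)) -> psum p (fun x => \sum_(i <- r) A i x).
Proof.
move=> p0 H; elim: r => [|i r IH].
  rewrite (_ : (fun x => _) = fun=> 0); first exact: psum0.
  by apply/funext => x; rewrite big_nil.
rewrite (_ : (fun x => _) = fun x => A i x + \sum_(j <- r) A j x); first exact: psumD.
by apply/funext => x; rewrite big_cons.
Qed.

(** Only f on the concentric disks of ratio [th] enters, where the Taylor series at the center
    converges geometrically if th < 1. *)
Definition tame (th C : R) (L : X -> X) := forall f (M : R), 0 <= M ->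
  (forall b z i, nm (z - Defs.center (Dk b)) <= th * Defs.radius (Dk b) ->
     nm (cmp f b z i 0) <= M) ->
  forall b z i, closure (disk_set (Dk b)) z -> nm (cmp (L f) b z i 0) <= C * M.

Lemma tame_bounded (th C : R) L : 0 <= C -> 0 < th -> th < 1 -> tame th C L ->
  forall f, nrm (L f) <= d%:R * C * nrm f.
Proof.
move=> C0 th0 th1 tL f; rewrite -mulrA; apply: nrm_le.
  by apply: mulr_ge0 => //; exact: nrm_ge0.
apply: tL => [|b z i zth]; first exact: nrm_ge0.
apply: nrm_ge; apply/disk_closure/disk_setE; apply: le_lt_trans zth _.
by rewrite gtr_pMl // radius_gt0.
Qed.

Definition sameix b b' : bool := match b, b' with
  | I1, I1 => true | Ir, Ir => true | Iq, Iq => true | _, _ => false end.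

Lemma sameixP b b' : sameix b b' -> b = b'. Proof. by case: b b' => [] []. Qed.

Lemma emb_ex b (i : 'I_d) (h : R[i] -> R[i]) :
  (forall z, cdiff h z) -> exists f, forall b' z i', closure (disk_set (Dk b')) z ->
    cmp f b' z i' 0 = if sameix b b' && (i' == i) then h z else 0.
Proof.
move=> dh; pose g b' z : 'cV[R[i]]_d := \col_i' (if sameix b b' && (i' == i) then h z else 0).
have gg b' : good (Dk b') (g b').
  apply: good_open => z _ i'; rewrite /g.
  rewrite (_ : (fun z => _) = fun z => if sameix b b' && (i' == i) then h z else 0).
    by case: andP => _; [exact: dh|exact: cdiff_cst].
  by apply/funext => w; rewrite mxE.
pose F b' := sval (cid (holo_ex (gg b'))).
have FE b' z : closure (disk_set (Dk b')) z -> F b' z = g b' z.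
  by rewrite /F; case: cid => ? /=; apply.
by exists (mkBE F) => b' z i' zD; rewrite cmp_mk FE // mxE.
Qed.

Lemma proj_ex b (i : 'I_d) : exists P : X -> X, forall f b' z i', closure (disk_set (Dk b')) z ->
  cmp (P f) b' z i' 0 = if sameix b b' && (i' == i) then cmp f b' z i 0 else 0.
Proof.
suff H f : exists g, forall b' z i', closure (disk_set (Dk b')) z ->
    cmp g b' z i' 0 = if sameix b b' && (i' == i) then cmp f b' z i 0 else 0.
  by exists (fun f => sval (cid (H f))) => f; case: cid.
pose g b' z : 'cV[R[i]]_d := \col_i' (if sameix b b' && (i' == i) then cmp f b' z i 0 else 0).
have gg b' : good (Dk b') (g b').
  have [c1 d1] := holo_good (cmp f b'); split.
    move=> z zD e e0; have [r r0 rP] := c1 z zD e e0; exists r => // w wD wz i'.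
    by rewrite !mxE; case: andP => _; [exact: rP|rewrite subrr nm0 ltW].
  move=> z zD i'; rewrite (_ : (fun z => _) = fun z => if sameix b b' && (i' == i) then cmp f b' z i 0 else 0).
    by case: andP => _; [exact: d1|exact: cdiff_cst].
  by apply/funext => w; rewrite mxE.
pose F b' := sval (cid (holo_ex (gg b'))).
have FE b' z : closure (disk_set (Dk b')) z -> F b' z = g b' z.
  by rewrite /F; case: cid => ? /=; apply.
by exists (mkBE F) => b' z i' zD; rewrite cmp_mk FE // mxE.
Qed.

Lemma cmp_sum (I : Type) (r : seq I) (F : I -> X) b z i :
  cmp (\sum_(j <- r) F j) b z i 0 = \sum_(j <- r) cmp (F j) b z i 0.
Proof.
elim: r => [|j r IH]; first by rewrite !big_nil cmp0.
by rewrite !big_cons cmpD IH.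
Qed.

(** L is applied to the Taylor series at the center, one coordinate at a time. On a circle of radius
    rho between t = th r and r, the m-th coefficient is at most |f| / rho^m, while the image of the
    m-th monomial has norm O(t^m). The weights (t / rho)^m are p-summable for every p > 0. *)
Lemma nuclear_component (L : {linear X -> X}) (th C p : R) b i (P : X -> X) :
  0 <= C -> 0 < th -> th < 1 -> 0 < p -> tame th C L ->
  (forall f b' z i', closure (disk_set (Dk b')) z ->
    cmp (P f) b' z i' 0 = if sameix b b' && (i' == i) then cmp f b' z i 0 else 0) ->
  psum p (fun f => L (P f)).
Proof.
move=> C0 th0 th1 p0 tL PE; have LC := tame_bounded C0 th0 th1 tL.
set c := Defs.center (Dk b); set r := Defs.radius (Dk b).
have r0 : 0 < r by exact: radius_gt0.
pose rho := (1 + th) / 2 * r; have rho0 : 0 < rho by rewrite /rho; nra.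
have rr : rho < r by rewrite /rho; nra.
pose t := th * r; have t0 : 0 < t by exact: mulr_gt0.
have tr : t < rho by rewrite /t /rho; nra.
pose q := t / rho; have q0 : 0 < q by exact: divr_gt0.
have q1 : q < 1 by rewrite ltr_pdivrMr // mul1r.
(* Adding 1 keeps [Cn] positive even if d or C is 0, as it will be divided by. *)
pose Cn := d%:R * C + 1; have Cn0 : 0 < Cn by rewrite ltr_wpDl // mulr_ge0.
pose phi f z := cmp f b z i 0.
have dphi f z : nm (z - c) < r -> cdiff (phi f) z.
  by move=> zr; have [_ H] := holo_good (cmp f b); apply: H; apply/disk_setE.
have on z : nm (z - c) = rho -> nm (z - c) < r by move=> ->.
have cphi f z : nm (z - c) = rho -> cts (phi f) z by move=> /on/(dphi f)/cdiff_cts.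
have bphi f z : nm (z - c) = rho -> nm (phi f z) <= nrm f.
  by move=> /on zr; apply: nrm_ge; apply/disk_closure/disk_setE.
pose a m f := tc (phi f) c rho m.
pose ph m f := (rho ^+ m)%:C * a m f.
have lph m : linear_for *%R (ph m).
  move=> k f g; rewrite /ph /a mulrCA -mulrDr; congr (_ * _).
  have ck z : nm (z - c) = rho -> cts (fun z => k * phi f z) z.
    by move=> E; apply: ctsM; [exact: cts_cst|exact: cphi].
  have Z1 := @tcZ R (phi f) c rho k m rho0 (cphi f).
  have Z2 := @tcD R _ (phi g) c rho m rho0 ck (cphi g).
  by rewrite -Z1 -Z2; apply: eq_tc => [|z _]; [exact: ltW|rewrite /phi cmpZD].
pose phs m : {scalar X} := HB.pack (ph m) (GRing.isLinear.Build R[i] X R[i] *%R (ph m) (lph m)).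
have dmono m z : cdiff (fun z => (z - c) ^+ m) z by cd.
pose mono m := sval (cid (emb_ex b i (dmono m))).
have monoE m b' z i' : closure (disk_set (Dk b')) z ->
    cmp (mono m) b' z i' 0 = if sameix b b' && (i' == i) then (z - c) ^+ m else 0.
  by rewrite /mono; case: cid => ? /= H; exact: H.
have inner b' z : nm (z - Defs.center (Dk b')) <= th * Defs.radius (Dk b') -> closure (disk_set (Dk b')) z.
  move=> zth; apply/disk_closure/disk_setE; apply: le_lt_trans zth _.
  by rewrite gtr_pMl // radius_gt0.
have Lmono m : nrm (L (mono m)) <= d%:R * C * t ^+ m.
  rewrite -mulrA; apply: nrm_le; first by rewrite mulr_ge0 ?exprn_ge0 // ltW.
  apply: tL => [|b' z i' zth]; first by rewrite exprn_ge0 // ltW.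
  rewrite monoE; last exact: inner.
  case: ifP => [/andP[/sameixP E _]|_]; last by rewrite nm0 exprn_ge0 // ltW.
  rewrite nmX lerXn2r ?nnegrE ?nm_ge0 ?(ltW t0) //.
  by move: zth; rewrite -E.
have tail f n : nrm (L (P f) - \sum_(m < n) a m f *: L (mono m)) <=
    d%:R * (C * (nrm f * (q ^+ n / (1 - q)))).
  rewrite (_ : \sum_(m < n) _ = L (\sum_(m < n) a m f *: mono m)); last first.
    by rewrite linear_sum; apply: eq_bigr => m _; rewrite linearZ.
  rewrite -linearB.
  have Q0 : 0 <= nrm f * (q ^+ n / (1 - q)).
    by rewrite mulr_ge0 ?nrm_ge0 // divr_ge0 ?exprn_ge0 ?subr_ge0 // ltW.
  apply: nrm_le; first exact: mulr_ge0.
  apply: tL => // b' z i' zth; have zD := inner b' z zth.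
  rewrite cmpB cmp_sum PE //.
  have -> : \sum_(m < n) cmp (a m f *: mono m) b' z i' 0 =
      if sameix b b' && (i' == i) then \sum_(m < n) a m f * (z - c) ^+ m else 0.
    under eq_bigr do rewrite cmpZ monoE //.
    by case: ifP => // _; apply: big1 => m _; rewrite mulr0.
  case: ifP => [/andP[/sameixP E _]|_]; last by rewrite subrr nm0.
  move: zth zD; rewrite -E -/c -/r -/t => zt zD.
  have zr : nm (z - c) < rho by exact: le_lt_trans tr.
  have := taylor n (dphi f) rr zr (bphi f); rewrite [c + _]addrC subrK.
  move=> /le_trans; apply; rewrite ler_wpM2l ?nrm_ge0 //.
  have zq : nm (z - c) / rho <= q by rewrite ler_pM2r ?invr_gt0.
  have z0 : 0 <= nm (z - c) / rho by rewrite divr_ge0 ?nm_ge0 // ltW.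
  apply: ler_pM; rewrite ?exprn_ge0 ?invr_ge0 ?subr_ge0 //.
  - exact: le_trans (ltW q1).
  - by rewrite lerXn2r ?nnegrE // ltW.
  - by rewrite lef_pV2 ?posrE ?subr_gt0 ?lerD2l ?lerN2 // (le_lt_trans zq).
(* Functionals and vectors are normalized to norm at most 1; their decay is moved into the
   weights. *)
exists (fun m => (Cn * q ^+ m)%:C), phs, (fun m => ((Cn * t ^+ m)^-1)%:C *: L (mono m)); split.
- move=> m f; rewrite nrmE nmE lecR /= /ph nmM nmRp ?exprn_ge0 ?(ltW rho0) //.
  have := @tc_le R (phi f) c rho (nrm f) m rho0 (cphi f) (bphi f).
  by rewrite ler_pdivlMr ?exprn_gt0 // mulrC.
- move=> m; have D0 : 0 < Cn * t ^+ m by rewrite mulr_gt0 ?exprn_gt0.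
  rewrite normrZ nrmE nmE nmRp ?invr_ge0 ?(ltW D0) // -rmorphM lecR.
  rewrite mulrC ler_pdivrMr // mul1r (le_trans (Lmono m)) // ler_wpM2r ?exprn_ge0 ?(ltW t0) //.
  by rewrite lerDl.
- have qp : `|q `^ p| < 1.
    rewrite ger0_norm ?powR_ge0 // -[ltRHS](_ : 1 `^ p = 1 :> R); last by rewrite powR1.
    apply: gt0_ltr_powR => //.
      by rewrite nnegrE ltW.
    by rewrite nnegrE.
  apply/cvg_ex; exists (Cn `^ p * (1 - q `^ p)^-1).
  rewrite (_ : series _ = series (geometric (Cn `^ p) (q `^ p))).
    exact: cvg_geometric_series.
  congr series; apply/funext => m.
  transitivity (nm (Cn * q ^+ m)%:C `^ p); first by [].
  rewrite [RHS]/= nmRp; last by rewrite mulr_ge0 ?exprn_ge0 // ltW.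
  rewrite powRM ?exprn_ge0 ?(ltW Cn0) ?(ltW q0) //; congr (_ * _).
  by rewrite -(powR_mulrn m (ltW q0)) -(powR_mulrn m (powR_ge0 q p)) powRAC.
- move=> f; apply/cvgrPdist_le => e e0.
  have eE : e = (complex.Re e)%:C by rewrite RRe_real // gtr0_real.
  have e0r : 0 < complex.Re e by rewrite -ltcR -eE.
  have q1' : 0 < 1 - q by rewrite subr_gt0.
  pose A := d%:R * (C * nrm f) / (1 - q).
  have A0 : 0 <= A by rewrite divr_ge0 ?(ltW q1') // mulr_ge0 // mulr_ge0 // nrm_ge0.
  have A1 : 0 < A + 1 by rewrite ltr_wpDl.
  have [N NP] := pow_small (ltW q0) q1 (divr_gt0 e0r A1).
  exists N => // n /= /NP Nn; rewrite nrmE eE lecR.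
  have -> : series (fun m => ((Cn * q ^+ m)%:C * phs m f) *: (((Cn * t ^+ m)^-1)%:C *: L (mono m))) n
      = \sum_(m < n) a m f *: L (mono m).
    rewrite /series /= big_mkord; apply: eq_bigr => m _; rewrite scalerA /= /ph.
    congr (_ *: _).
    have cE : Cn * q ^+ m * rho ^+ m / (Cn * t ^+ m) = 1.
      rewrite -[Cn * _ * _]mulrA -exprMn /q divfK ?gt_eqF // divff //.
      by rewrite mulf_neq0 ?expf_neq0 // gt_eqF.
    move: (Cn * q ^+ m) (rho ^+ m) ((Cn * t ^+ m)^-1) cE => x y w cE.
    by rewrite mulrA mulrAC -!rmorphM /= cE mul1r.
  apply: le_trans (tail f n) _.
  have -> : d%:R * (C * (nrm f * (q ^+ n / (1 - q)))) = A * q ^+ n.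
    by rewrite /A; field; rewrite gt_eqF.
  have qn : 0 <= q ^+ n by rewrite exprn_ge0 // ltW.
  move: Nn; rewrite ler_pdivlMr // => Nn.
  by apply: le_trans Nn; rewrite mulrC ler_wpM2l // lerDl.
Qed.

Lemma nuclear_tame (L : {linear X -> X}) (th C : R) :
  0 <= C -> 0 < th -> th < 1 -> tame th C L -> nuclear_order0 L.
Proof.
move=> C0 th0 th1 tL p p0 _.
pose P b i := sval (cid (proj_ex b i)).
have PE b i : forall f b' z i', closure (disk_set (Dk b')) z ->
    cmp (P b i f) b' z i' 0 = if sameix b b' && (i' == i) then cmp f b' z i 0 else 0.
  by rewrite /P; case: cid.
suff : psum p (fun f => \sum_(b <- [:: I1; Ir; Iq]) \sum_(i <- enum 'I_d) L (P b i f)).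
  rewrite (_ : (fun f => _) = L) //; apply/funext => f.
  under eq_bigr do rewrite -linear_sum.
  rewrite -linear_sum; congr (L _); apply: BE_eq => b z zD; apply/colP => i.
  rewrite cmp_sum.
  have S b' : cmp (\sum_(j <- enum 'I_d) P b' j f) b z i 0 =
      if sameix b' b then cmp f b z i 0 else 0.
    rewrite cmp_sum big_enum /= (bigD1 i) //= PE // eqxx andbT big1 ?addr0 // => j ji.
    by rewrite PE // eq_sym (negbTE ji) andbF.
  by rewrite !big_cons big_nil !S; case: (b) => /=; rewrite ?addr0 ?add0r.
apply: psum_sum => // b; apply: psum_sum => // i.
exact: (nuclear_component C0 th0 th1 p0 tL (PE b i)).
Qed.
End nuclear.

(** * Parabolic elements and the spectral data of the representation *)

Section matrices.
Variable R : realType.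
Implicit Types (a b c e t : R).

Lemma mat2M a b c e a' b' c' e' : mat2 a b c e * mat2 a' b' c' e' =
  mat2 (a * a' + b * c') (a * b' + b * e') (c * a' + e * c') (c * b' + e * e').
Proof.
apply/matrixP => i j; rewrite !mxE !big_ord_recl big_ord0 !mxE /= addr0.
by case: i => [[|[|//]] ?]; case: j => [[|[|//]] ?].
Qed.

Lemma mat2_1 : mat2 1 0 0 1 = 1 :> 'M[R]_2.
Proof. by apply/matrixP => -[[|[|//]] ?] [[|[|//]] ?]; rewrite !mxE. Qed.

Lemma mat2Z t a b c e : t *: mat2 a b c e = mat2 (t * a) (t * b) (t * c) (t * e).
Proof. by apply/matrixP => -[[|[|//]] ?] [[|[|//]] ?]; rewrite !mxE. Qed.

Lemma mat2E a b c e : [/\ mat2 a b c e 0 0 = a, mat2 a b c e 0 1 = b,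
  mat2 a b c e 1 0 = c & mat2 a b c e 1 1 = e].
Proof. by rewrite !mxE. Qed.

Lemma mat2_inv (X Y : 'M[R]_2) : X * Y = 1 -> X^-1 = Y.
Proof.
move=> XY; have [uX _] := mulmx1_unit XY.
by rewrite -[LHS]mulr1 -XY mulKr.
Qed.

(** [mP] and [mQ] are the one-parameter groups of parabolic matrices fixing 1 and -1 respectively;
    up to sign h_1 and h_{q-1} lie in them. *)
Definition mP t := mat2 (1 - t) t (- t) (1 + t).
Definition mQ t := mat2 (1 - t) (- t) t (1 + t).

Lemma mPD s t : mP s * mP t = mP (s + t).
Proof. by rewrite /mP mat2M; congr mat2; ring. Qed.

Lemma mQD s t : mQ s * mQ t = mQ (s + t).
Proof. by rewrite /mQ mat2M; congr mat2; ring. Qed.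

Lemma mP0 : mP 0 = 1. Proof. by rewrite /mP subr0 oppr0 addr0 mat2_1. Qed.

Lemma mQ0 : mQ 0 = 1. Proof. by rewrite /mQ subr0 oppr0 addr0 mat2_1. Qed.

(** The sign e is there because an element of PSL_2(R) is given by a matrix up to sign. *)
Lemma signed_inv (F : R -> 'M[R]_2) (h : 'M[R]_2) (t e : R) :
  (forall x y, F x * F y = F (x + y)) -> F 0 = 1 -> e * e = 1 -> h = e *: F (- t) ->
  forall n, h ^- n = e ^+ n *: F (n%:R * t).
Proof.
move=> FD F0 ee -> n; rewrite -exprVn.
have -> : (e *: F (- t))^-1 = e *: F t.
  by apply: mat2_inv; rewrite -scalerAl -scalerAr scalerA ee scale1r FD addrC subrr.
elim: n => [|n IH]; first by rewrite mul0r F0 scale1r.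
rewrite exprS IH -scalerAl -scalerAr scalerA FD; congr (_ *: F _).
  by rewrite exprS.
by rewrite -natr1; ring.
Qed.

Definition calTi : 'M[R]_2 := (Num.sqrt 2)^-1 *: mat2 1 1 (- 1) 1.

Lemma calT_inv : calT R * calTi = 1.
Proof.
rewrite /calT /calTi -scalerAl -scalerAr scalerA mat2M -invfM -expr2 sqr_sqrtr //.
by rewrite mat2Z -mat2_1; congr mat2; field.
Qed.

Lemma calTV : (calT R)^-1 = calTi. Proof. exact: mat2_inv calT_inv. Qed.

Lemma calTi_calT : calTi * calT R = 1.
Proof. by rewrite -calTV mulVr //; have [] := mulmx1_unit calT_inv. Qed.

Lemma calT_conj a b c e : calT R * mat2 a b c e * (calT R)^-1 =
  mat2 ((a - b - c + e) / 2) ((a + b - c - e) / 2) ((a - b + c - e) / 2) ((a + b + c + e) / 2).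
Proof.
rewrite calTV /calT /calTi -!scalerAl -scalerAr scalerA !mat2M -invfM -expr2 sqr_sqrtr //.
by rewrite mat2Z; congr mat2; field.
Qed.

Variable q : nat.
Hypothesis hq : (3 <= q)%N.
Notation lam := (lambda R q).
Notation th := (pi / q%:R : R).

Lemma q_gt0 : 0 < q%:R :> R. Proof. by rewrite ltr0n (leq_trans _ hq). Qed.

Lemma th_gt0 : 0 < th. Proof. by rewrite divr_gt0 ?pi_gt0 // q_gt0. Qed.

Lemma sin_th_gt0 : 0 < sin th.
Proof.
apply: sin_gt0_pi; rewrite th_gt0 /= ltr_pdivrMr ?q_gt0 // ltr_pMr ?pi_gt0 //.
by rewrite ltr1n (leq_trans _ hq).
Qed.

Lemma lambda_gt0 : 0 < lam.
Proof.
rewrite mulr_gt0 //; apply: cos_gt0_pihalf.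
have q0 := q_gt0; have t0 := th_gt0; have p0 := pi_gt0 R.
have q2 : 2 < q%:R :> R by rewrite ltr_nat.
have h : th < pi / 2 by rewrite ltr_pM2l // ltf_pV2 // posrE.
by apply/andP; split => //; apply: lt_trans t0; rewrite oppr_lt0 divr_gt0.
Qed.

(** For an angle of at most pi / 4 the cosine of the double angle is nonnegative, which says
    lambda^2 >= 2. It makes the middle interval nonempty, with 0 inside. *)
Lemma lambda_gt1 : (4 <= q)%N -> 1 < lam.
Proof.
move=> q4; have p0 := pi_gt0 R.
have q4' : 4 <= q%:R :> R by rewrite ler_nat.
pose c := cos th; have cE : lam = 2 * c by [].
have t0 := th_gt0.
have t4 : th <= pi / 4 by rewrite ler_pM2l // lef_pV2 ?posrE ?q_gt0.
have c2 : 0 <= cos (th *+ 2).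
  by apply: cos_ge0_pihalf; rewrite [th *+ 2]mulr2n; lra.
have l0 := lambda_gt0.
by move: c2 l0; rewrite cos_mulr2n cE -/c [_ ^+ 2 *+ 2]mulr2n; nra.
Qed.

Lemma TS_E : matT R q * matS R = mat2 (- lam) 1 (- 1) 0.
Proof. by rewrite /matT /matS mat2M; congr mat2; ring. Qed.

(** TS has determinant 1 and trace -2 cos th, so up to sign its powers have Chebyshev entries sin((n
    + 1) th) / sin th; the induction uses their three-term recurrence. *)
Lemma TS_pow n : (matT R q * matS R) ^+ n = ((- 1) ^+ n / sin th) *:
  mat2 (sin (n.+1%:R * th)) (- sin (n%:R * th)) (sin (n%:R * th)) (- sin (n%:R * th - th)).
Proof.
have s0 : sin th != 0 by rewrite gt_eqF // sin_th_gt0.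
elim: n => [|n IH].
  rewrite expr0 mul0r sub0r sinN sin0 mul1r oppr0 opprK mul1r mat2Z -mat2_1.
  by congr mat2; rewrite ?mulr0 // mulVf.
rewrite exprS IH TS_E -scalerAr mat2M !mat2Z exprS.
have A : sin (n.+2%:R * th) + sin (n%:R * th) = lam * sin (n.+1%:R * th).
  rewrite /lambda -[n.+2%:R]natr1 -[n.+1%:R]natr1.
  have -> : (n%:R + 1 + 1) * th = (n%:R + 1) * th + th by ring.
  have -> : n%:R * th = (n%:R + 1) * th - th by ring.
  by rewrite !sinD cosN sinN; ring.
have B : sin (n.+1%:R * th) + sin (n%:R * th - th) = lam * sin (n%:R * th).
  rewrite /lambda -[n.+1%:R]natr1 mulrDl mul1r !sinD cosN sinN; ring.
have -> : n.+1%:R * th - th = n%:R * th by rewrite -natr1; ring.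
congr mat2; try by ring.
- have -> : sin (n.+2%:R * th) = lam * sin (n.+1%:R * th) - sin (n%:R * th) by rewrite -A; ring.
  by ring.
- have -> : sin (n.+1%:R * th) = lam * sin (n%:R * th) - sin (n%:R * th - th) by rewrite -B; ring.
  by ring.
Qed.

Lemma gelt_1 : gelt R q 1 = - mat2 1 (- lam) 0 1.
Proof.
apply: mat2_inv; rewrite expr1z TS_E /matS mat2M mulrN mat2M -[RHS]mat2_1 -scaleN1r mat2Z.
by congr mat2; ring.
Qed.

(** For n = q - 1 the angles are pi and pi - th: this is the relation that (TS)^q is 1 up to
    sign. *)
Lemma gelt_q : exists2 e : R, e * e = 1 & gelt R q (q - 1)%N = e *: mat2 1 0 (- lam) 1.
Proof.
exists ((- 1) ^+ (q - 1)); first by rewrite -expr2 sqrr_sign.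
have s0 : sin th != 0 by rewrite gt_eqF // sin_th_gt0.
apply: mat2_inv; rewrite -exprnP TS_pow.
have q1 : (q - 1)%:R = q%:R - 1 :> R by rewrite natrB // (leq_trans _ hq).
have -> : (q - 1).+1%:R * th = pi.
  by rewrite subn1 prednK ?(leq_trans _ hq) // mulrC divfK // gt_eqF // q_gt0.
have -> : (q - 1)%:R * th = - th + pi.
  by rewrite q1 mulrBl mul1r [_ * th]mulrC divfK 1?addrC // gt_eqF // q_gt0.
have sp : sin pi = 0 :> R by rewrite sinpi.
have -> : sin (- th + pi) = sin th by rewrite sinDpi sinN opprK.
have -> : sin (- th + pi - th) = lam * sin th.
  rewrite addrAC sinDpi -opprD sinN opprK sinD /lambda; ring.
rewrite sp -scalerAl /matS mat2M -scalerAr -scalerAl scalerA mat2M mat2Z -mat2_1.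
have ee : ((- 1) ^+ (q - 1) : R) * (- 1) ^+ (q - 1) = 1 by rewrite -expr2 sqrr_sign.
move: ((- 1) ^+ (q - 1) : R) (sin th) s0 ee => e s s0 ee.
have E x : e * (e / s) * x = x / s by rewrite mulrA ee mul1r mulrC.
by rewrite !E; congr mat2; field.
Qed.

Lemma helt1_pow n : helt R q 1 ^- n = (- 1) ^+ n *: mP (n%:R * (lam / 2)).
Proof.
apply: (signed_inv mPD mP0); first by rewrite mulrNN mulr1.
rewrite /helt gelt_1 mulrN mulNr scaleN1r calT_conj; congr (- mat2 _ _ _ _); by field.
Qed.

Lemma heltq_pow : exists2 e : R, e * e = 1 & forall n,
  helt R q (q - 1)%N ^- n = e ^+ n *: mQ (n%:R * (lam / 2)).
Proof.
have [e ee gE] := gelt_q; exists e => //.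
apply: (signed_inv mQD mQ0) => //.
rewrite /helt gE -scalerAr -scalerAl calT_conj; congr (_ *: mat2 _ _ _ _); by field.
Qed.

Lemma helt1_E : helt R q 1 = - mP (- (lam / 2)).
Proof. rewrite /helt gelt_1 mulrN mulNr calT_conj; congr (- mat2 _ _ _ _); by field. Qed.

Lemma heltq_E : exists2 e : R, e * e = 1 & helt R q (q - 1)%N = e *: mQ (- (lam / 2)).
Proof.
have [e ee gE] := gelt_q; exists e => //.
rewrite /helt gE -scalerAr -scalerAl calT_conj; congr (_ *: mat2 _ _ _ _); by field.
Qed.

Lemma tr_mat2 a b c e : \tr (mat2 a b c e) = a + e.
Proof. by rewrite /mxtrace !big_ord_recl big_ord0 !mxE addr0. Qed.

Lemma parabolic_helt1 : parabolic (helt R q 1).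
Proof.
have l0 := lambda_gt0; have [_ E _ _] := mat2E (1 + lam / 2) (- (lam / 2)) (lam / 2) (1 - lam / 2).
have H : helt R q 1 0 1 = lam / 2 by rewrite helt1_E /mP mxE opprK E opprK.
split.
- by move=> h1; move: H; rewrite h1 mxE /=; lra.
- by move=> h1; move: H; rewrite h1 !mxE /=; lra.
- rewrite helt1_E -scaleN1r mxtraceZ mulN1r tr_mat2 opprK addrA addrAC addrK normrN ger0_norm //; lra.
Qed.

Lemma parabolic_heltq : parabolic (helt R q (q - 1)%N).
Proof.
have l0 := lambda_gt0; have [e ee hE] := heltq_E.
have e0 : e != 0 by apply/eqP => e0; move/eqP: ee; rewrite e0 mul0r eq_sym oner_eq0.
have H : helt R q (q - 1)%N 0 1 = e * (lam / 2).
  by rewrite hE /mQ !mxE /= opprK.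
have H0 : e * (lam / 2) != 0 by rewrite mulf_neq0 // gt_eqF // divr_gt0.
split.
- by move=> h1; move: H0; rewrite -H h1 mxE eqxx.
- by move=> h1; move: H0; rewrite -H h1 !mxE /= oppr0 eqxx.
- rewrite hE mxtraceZ tr_mat2 opprK addrA addrAC addrK normrM.
  have : `|e| * `|e| = 1 by rewrite -normrM ee normr1.
  by have := normr_ge0 e; rewrite [`|_ + _|]ger0_norm //; nra.
Qed.

Lemma Gamma_X (g : 'M[R]_2) n : Gamma q g -> Gamma q (g ^+ n).
Proof.
by move=> Gg; elim: n => [|n IH]; [exact: Gamma_1|rewrite exprS; exact: Gamma_M].
Qed.

Lemma Gamma_gelt (k : nat) : Gamma q (gelt R q k).
Proof.
apply/Gamma_V/Gamma_M; last exact: Gamma_S.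
by rewrite -exprnP; apply/Gamma_X/Gamma_M; [exact: Gamma_T|exact: Gamma_S].
Qed.

Lemma helt_conj (k : nat) : (calT R)^-1 * helt R q k * calT R = gelt R q k.
Proof.
rewrite /helt calTV -!mulrA calTi_calT mulr1 mulrA calTi_calT mul1r //.
Qed.

Lemma gelt_unit (k : nat) : gelt R q k \is a GRing.unit.
Proof.
have u (X Y : 'M[R]_2) : X * Y = 1 -> X \is a GRing.unit by move=> /mulmx1_unit[].
have uS : matS R \is a GRing.unit.
  by apply: (u _ (mat2 0 (-1) 1 0)); rewrite mat2M -mat2_1; congr mat2; ring.
have uT : matT R q \is a GRing.unit.
  by apply: (u _ (mat2 1 (- lam) 0 1)); rewrite mat2M -mat2_1; congr mat2; ring.
by rewrite unitrV unitrMl // -exprnP unitrX // unitrMl.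
Qed.

Lemma helt_conjV (k : nat) n : (calT R)^-1 * helt R q k ^- n * calT R = (gelt R q k)^-1 ^+ n.
Proof.
have uT : calT R \is a GRing.unit by have [] := mulmx1_unit calT_inv.
have ug := gelt_unit k.
rewrite -exprVn.
have -> : (helt R q k)^-1 = calT R * (gelt R q k)^-1 * (calT R)^-1.
  by apply: mat2_inv; rewrite /helt -!mulrA mulKr // mulVKr // divrr.
elim: n => [|n IH]; first by rewrite !expr0 mulr1 mulVr.
by rewrite !exprS -IH !mulrA mulVr // mul1r.
Qed.

Lemma Lambda_helt (k : nat) : Lambda q (helt R q k).
Proof. by rewrite /Lambda helt_conj; exact: Gamma_gelt. Qed.

Lemma rank_diag d (v : 'rV[R[i]]_d) : (\rank (diag_mx v) <= #|[pred i | v 0%R i != 0%R]|)%N.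
Proof.
rewrite -sum1_card big_mkcond diag_mx_sum_delta.
elim/big_rec2: _ => [|i m A _ H]; first by rewrite mxrank0.
apply: leq_trans (mxrank_add _ _) _; apply: leq_add => //.
rewrite inE; case: eqVneq => [->|v0]; first by rewrite scale0r mxrank0.
by rewrite mxrank_scale_nz // mxrank_delta.
Qed.

Variables (d : nat) (chi : 'M[R]_2 -> 'M[R[i]]_d).
Hypothesis hchi : unitary_rep q chi.

Lemma eta_pow (k : nat) n : Defs.eta chi (helt R q k ^- n) = iter n (mulmx (chi (gelt R q k)^-1)) 1%:M.
Proof.
have GV : Gamma q (gelt R q k)^-1 by exact/Gamma_V/Gamma_gelt.
have -> : Defs.eta chi (helt R q k ^- n) = chi ((gelt R q k)^-1 ^+ n) by rewrite -helt_conjV.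
elim: n => [|n IH]; first by rewrite expr0 (rep_1 hchi).
by rewrite exprS (rep_M hchi) // ?IH //; exact: Gamma_X.
Qed.

(** U = chi(g_k^-1) is unitary, hence normal and unitarily diagonalizable with eigenvalues of
    modulus 1. As eta(h_k) - 1 = eta(h_k) (1 - U), its rank is at most the number of eigenvalues
    different from 1, which bounds the multiplicity of 1 by the dimension of the fixed space. *)
Lemma spectral_eta (k : nat) : exists P Q (u : 'I_d -> R[i]),
  [/\ Q *m P = 1%:M /\ P *m Q = 1%:M,
      forall n, Defs.eta chi (helt R q k ^- n) = Q *m diag_mx (\row_i u i ^+ n) *m P,
      forall i, nm (u i) = 1 &
      (#|[pred i | u i == 1%R]| <= dim_fix chi (helt R q k))%N].
Proof.
set U := chi (gelt R q k)^-1.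
have GV : Gamma q (gelt R q k)^-1 by exact/Gamma_V/Gamma_gelt.
have UU : U \is unitarymx by exact: (rep_unitary hchi).
have : U \is normalmx.
  apply/normalmxP; have /unitarymxP E := UU.
  by rewrite E (mulmx1C E).
move=> /orthomx_spectral_subproof[[P D] /= PU UE].
have Pu := unitarymx_unit PU.
pose u i := D 0 i.
have DE : D = \row_i u i by apply/rowP => i; rewrite mxE.
have E1 : invmx P *m P = 1%:M by rewrite mulVmx.
have E2 : P *m invmx P = 1%:M by rewrite mulmxV.
exists P, (invmx P), u; split; first by split.
- move=> n; rewrite eta_pow; elim: n => [|n IH] /=.
    have -> : \row_i u i ^+ 0 = const_mx 1 by apply/rowP => i; rewrite !mxE.
    by rewrite diag_const_mx mulmx1 E1.
  rewrite IH -/U UE !mulmxA -[_ *m P *m invmx P]mulmxA E2 mulmx1; congr (_ *m P).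
  rewrite -mulmxA mulmx_diag; congr (_ *m diag_mx _).
  by apply/rowP => i; rewrite !mxE exprS.
- move=> i.
  have DU : diag_mx D \is unitarymx.
    have -> : diag_mx D = P *m U *m invmx P.
      by rewrite UE !mulmxA E2 mul1mx -mulmxA E2 mulmx1.
    rewrite (invmx_unitary PU); apply: mul_unitarymx; first exact: mul_unitarymx.
    by rewrite trmxC_unitary.
  have /unitarymxP/matrixP/(_ i i) := DU.
  rewrite mxE (bigD1 i) //= big1 => [|j ji]; last first.
    by rewrite !mxE eq_sym (negbTE ji) mulr0n mul0r.
  rewrite !mxE eqxx mulr1n addr0 -normCK nmE => h.
  have : nm (D 0 i) ^+ 2 = 1 by apply: (@complexI R); rewrite rmorphXn h.
  by move/eqP; rewrite sqrp_eq1 ?nm_ge0 // => /eqP.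
- rewrite /dim_fix mxrank_coker.
  have eU : Defs.eta chi (helt R q k) *m U = 1%:M.
    rewrite /Defs.eta (helt_conj k) /U -(rep_M hchi) //; last exact: Gamma_gelt.
    by rewrite divrr ?(rep_1 hchi) // gelt_unit.
  have -> : Defs.eta chi (helt R q k) - 1%:M = Defs.eta chi (helt R q k) *m (1%:M - U).
    by rewrite mulmxBr mulmx1 eU.
  have -> : 1%:M - U = invmx P *m (1%:M - diag_mx D) *m P.
    by rewrite mulmxBr mulmxBl -UE mulmx1 E1.
  have -> : 1%:M - diag_mx D = diag_mx (\row_i (1 - u i)).
    by apply/matrixP => i j; rewrite !mxE -mulrnBl.
  have r1 := rank_diag (\row_i (1 - u i)).
  have r2 := mxrankM_maxr (Defs.eta chi (helt R q k)) (invmx P *m diag_mx (\row_i (1 - u i)) *m P).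
  have r3 := mxrankM_maxl (invmx P *m diag_mx (\row_i (1 - u i))) P.
  have r4 := mxrankM_maxr (invmx P) (diag_mx (\row_i (1 - u i))).
  have r := leq_trans r2 (leq_trans r3 (leq_trans r4 r1)).
  rewrite leq_subRL; last by apply: leq_trans r _; rewrite -[leqRHS]card_ord max_card.
  apply: leq_trans (leq_add r (leqnn _)) _.
  rewrite -[leqRHS]card_ord -[leqRHS](cardC ([pred i | u i == 1%R])) addnC leq_add2l.
  apply: subset_leq_card; apply/fintype.subsetP => i; rewrite !inE mxE subr_eq0 => h.
  by rewrite eq_sym.
Qed.

Lemma sd_ge p : Lambda q p -> parabolic p -> (dim_fix chi p <= sd q chi)%N.
Proof.
move=> Lp pp; have dp : (dim_fix chi p < d.+1)%N by rewrite ltnS rank_leq_col.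
apply: (@leq_bigmax_cond _ _ (fun m : 'I_d.+1 => m : nat) (Ordinal dp)).
by apply/asboolP; exists p.
Qed.

Lemma spectral_cusp (k : nat) : k \in [:: 1; (q - 1)]%N -> exists P Q (u : 'I_d -> R[i]),
  [/\ Q *m P = 1%:M /\ P *m Q = 1%:M,
      forall n, Defs.eta chi (helt R q k ^- n) = Q *m diag_mx (\row_i u i ^+ n) *m P,
      forall i, nm (u i) = 1 & (#|[pred i | u i == 1%R]| <= sd q chi)%N].
Proof.
move=> kk; have [P [Q [u [h1 h2 h3 h4]]]] := spectral_eta k.
exists P, Q, u; split => //; apply: leq_trans h4 _; apply: sd_ge; first exact: Lambda_helt.
by move: kk; rewrite !inE => /orP[]/eqP->; [exact: parabolic_helt1|exact: parabolic_heltq].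
Qed.
End matrices.

(** * Scalar kernels and the operators they define *)

Section kernels.
Variables (R : realType) (d : nat) (E1 Er Eq : disk R).
Notation X := (BE d E1 Er Eq).
Notation Dk := (Dk E1 Er Eq).
Implicit Types (f g : X) (b : ix) (z s h : R[i]) (K : R[i] -> X -> R[i] -> R[i])
  (c : R[i] -> R[i] -> R[i]) (U : set R[i]).

Definition closed_disk b := closure (disk_set (Dk b)).

Definition inner_bound (th : R) f (M : R) := forall b z i,
  nm (z - Defs.center (Dk b)) <= th * Defs.radius (Dk b) -> nm (cmp f b z i 0) <= M.

(* Locally in [s], the values on a closed disk are bounded by those of [f] on
   the concentric disks of ratio [th < 1]; this is what yields nuclearity. *)
Definition kernel b U K :=
  [/\ forall s (a : R[i]) f g z, U s -> closed_disk b z ->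
        K s (a *: f + g) z = a * K s f z + K s g z,
      forall s f z, U s -> closed_disk b z -> cdiff (K s f) z,
      forall s f z, U s -> closed_disk b z -> cdiff (fun s => K s f z) s &
      forall s0, U s0 -> exists th r C : R, [/\ 0 < th < 1, 0 < r, 0 <= C &
        forall s f (M : R) z, nm (s - s0) < r -> 0 <= M -> inner_bound th f M -> closed_disk b z ->
          nm (K s f z) <= C * M]].

Definition coefficient b U c :=
  [/\ forall s z, U s -> closed_disk b z -> cdiff (c s) z,
      forall s z, U s -> closed_disk b z -> cdiff (fun s => c s z) s &
      forall s0, U s0 -> exists r C : R, [/\ 0 < r, 0 <= C &
        forall s z, nm (s - s0) < r -> closed_disk b z -> nm (c s z) <= C]].

Lemma inner_bound_mono (th th' : R) f (M : R) : th <= th' -> inner_bound th' f M -> inner_bound th f M.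
Proof.
move=> tt H b z i zt; apply: H; apply: le_trans zt _.
by rewrite ler_wpM2r // ltW // radius_gt0.
Qed.

Lemma closed_disk_compact b : compact (closed_disk b). Proof. exact: closure_ball_compact. Qed.

Lemma closed_disk_bounded b (f : R[i] -> R[i]) : (forall z, closed_disk b z -> cdiff f z) ->
  exists2 M : R, 0 <= M & forall z, closed_disk b z -> nm (f z) <= M.
Proof.
move=> df; have [M MP] := compact_bounded_nm (@closed_disk_compact b) (fun z zb => cdiff_cts (df z zb)).
exists `|M| => // z zb; exact: le_trans (MP z zb) (ler_norm _).
Qed.

Lemma kernel_sub b U U' K : (forall s, U' s -> U s) -> kernel b U K -> kernel b U' K.
Proof.
move=> UU [h1 h2 h3 h4]; split.
- by move=> s a f g z /UU; exact: h1.
- by move=> s f z /UU; exact: h2.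
- by move=> s f z /UU; exact: h3.
- by move=> s /UU; exact: h4.
Qed.

Lemma kernel0 b U : kernel b U (fun _ _ _ => 0).
Proof.
split=> [s a f g z _ _|s f z _ _|s f z _ _|s0 _]; [by rewrite mulr0 addr0|cd|cd|].
exists (1 / 2), 1, 0; split=> //; first lra.
by move=> s f M z _ M0 _ _; rewrite nm0 mul0r.
Qed.

Lemma kernelD b U K K' : kernel b U K -> kernel b U K' ->
  kernel b U (fun s f z => K s f z + K' s f z).
Proof.
move=> [h1 h2 h3 h4] [g1 g2 g3 g4]; split.
- by move=> s a f g z Us zb; rewrite h1 // g1 //; ring.
- by move=> s f z Us zb; apply: cdiffD; [exact: h2|exact: g2].
- by move=> s f z Us zb; apply: cdiffD; [exact: h3|exact: g3].
- move=> s0 Us; have [th [r [C [th01 r0 C0 H]]]] := h4 s0 Us.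
  have [th' [r' [C' [th01' r0' C0' H']]]] := g4 s0 Us.
  exists (Num.max th th'), (Num.min r r'), (C + C'); split.
  + by rewrite lt_max gt_max; move: th01 th01' => /andP[-> ->] /andP[_ ->].
  + by rewrite lt_min r0.
  + exact: addr_ge0.
  + move=> s f M z; rewrite lt_min => /andP[sr sr'] M0 fM zb.
    apply: le_trans (nmD _ _) _; rewrite mulrDl; apply: lerD.
      by apply: H => //; apply: inner_bound_mono fM; rewrite le_max lexx.
    by apply: H' => //; apply: inner_bound_mono fM; rewrite le_max lexx orbT.
Qed.

Lemma kernel_sum (I : Type) (r : seq I) (p : pred I) b U (K : I -> R[i] -> X -> R[i] -> R[i]) :
  (forall i, p i -> kernel b U (K i)) -> kernel b U (fun s f z => \sum_(i <- r | p i) K i s f z).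
Proof.
move=> H; elim: r => [|i r IH].
  have -> : (fun s f z => \sum_(i <- [::] | p i) K i s f z) = (fun _ _ _ => 0).
    by apply/funext => s; apply/funext => f; apply/funext => z; rewrite big_nil.
  exact: kernel0.
have [pi|pi] := boolP (p i); last first.
  have -> : (fun s f z => \sum_(i <- i :: r | p i) K i s f z) =
    (fun s f z => \sum_(i <- r | p i) K i s f z) => //.
  by apply/funext => s; apply/funext => f; apply/funext => z; rewrite big_cons (negbTE pi).
have -> : (fun s f z => \sum_(i <- i :: r | p i) K i s f z) =
    (fun s f z => K i s f z + \sum_(i <- r | p i) K i s f z).
  by apply/funext => s; apply/funext => f; apply/funext => z; rewrite big_cons pi.
by apply: kernelD => //; exact: H.
Qed.

Lemma kernelM b U c K : coefficient b U c -> kernel b U K ->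
  kernel b U (fun s f z => c s z * K s f z).
Proof.
move=> [c1 c2 c3] [h1 h2 h3 h4]; split.
- by move=> s a f g z Us zb; rewrite h1 //; ring.
- by move=> s f z Us zb; apply: cdiffM; [exact: c1|exact: h2].
- by move=> s f z Us zb; apply: cdiffM; [exact: c2|exact: h3].
- move=> s0 Us; have [th [r [C [th01 r0 C0 H]]]] := h4 s0 Us.
  have [r' [C' [r0' C0' H']]] := c3 s0 Us.
  exists th, (Num.min r r'), (C' * C); split => //.
  + by rewrite lt_min r0.
  + exact: mulr_ge0.
  + move=> s f M z; rewrite lt_min => /andP[sr sr'] M0 fM zb.
    by rewrite nmM -mulrA; apply: ler_pM; rewrite ?nm_ge0 ?H ?H'.
Qed.

Lemma coef_cst b U (a : R[i]) : coefficient b U (fun _ _ => a).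
Proof.
split=> [s z _ _|s z _ _|s0 _]; [cd|cd|].
by exists 1, (nm a); split=> //; exact: nm_ge0.
Qed.

Lemma cdiff_bounded (k : R[i] -> R[i]) s0 : cdiff k s0 -> exists r C : R,
  [/\ 0 < r, 0 <= C & forall s, nm (s - s0) < r -> nm (k s) <= C].
Proof.
move=> /cdiff_cts/(_ _ ltr01)[r r0 rP]; exists r, (nm (k s0) + 1); split => //.
  by rewrite addr_ge0 ?nm_ge0.
move=> s /rP; rewrite [s0 + _]addrC subrK => H.
have := nm_tri (k s) (k s0) 0; rewrite !subr0; lra.
Qed.

Lemma coef_s b U (k : R[i] -> R[i]) : (forall s, U s -> cdiff k s) ->
  coefficient b U (fun s _ => k s).
Proof.
move=> dk; split=> [s z _ _|s z Us _|s0 Us]; [cd|exact: dk|].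
have [r [C [r0 C0 H]]] := cdiff_bounded (dk s0 Us).
by exists r, C; split => // s z sr _; exact: H.
Qed.

Lemma coef_pw b U (k x : R[i] -> R[i]) : (forall s, U s -> cdiff k s) ->
  (forall z, closed_disk b z -> cdiff x z /\ slit (x z)) -> coefficient b U (fun s z => pw (k s) (x z)).
Proof.
move=> dk dx; split=> [s z Us zb|s z Us zb|s0 Us].
- by have [dxz sx] := dx z zb; apply: cdiff_pw => //; cd.
- by have [dxz sx] := dx z zb; apply: (cdiff_pw (x := fun=> x z)) => //; [exact: dk|cd].
- have [r [C [r0 C0 H]]] := cdiff_bounded (dk s0 Us).
  have [L L0 LP] : exists2 L : R, 0 <= L & forall z, closed_disk b z -> nm (clog (x z)) <= L.
    apply: closed_disk_bounded => z zb; have [dxz sx] := dx z zb.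
    by apply: (@cdiff_comp _ x); [|exact: cdiff_clog].
  exists r, (expR (C * L)); split => //.
  by move=> s z sr zb; apply: nm_pw_le; [exact: H|exact: LP].
Qed.

Lemma kernelZ b U (a : R[i]) K : kernel b U K -> kernel b U (fun s f z => a * K s f z).
Proof. exact/kernelM/coef_cst. Qed.

(** The image of the closed disk is compact in an open disk, so 1 / (radius - |m z - center|) is
    bounded on it; this puts the image into a concentric disk of ratio less than 1. *)
Lemma kernel_comp b b' U (m : R[i] -> R[i]) i :
  (forall z, closed_disk b z -> cdiff m z /\ disk_set (Dk b') (m z)) ->
  kernel b U (fun s f z => cmp f b' (m z) i 0).
Proof.
move=> H; split.
- by move=> s a f g z _ zb; rewrite cmpZD.
- move=> s f z _ zb; have [dm mD] := H z zb.
  by apply: (@cdiff_comp _ m (fun z => cmp f b' z i 0)) => //; exact: (holo_good _).2.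
- by move=> s f z _ _; cd.
- move=> s0 _; pose rr := Defs.radius (Dk b'); pose c0 := Defs.center (Dk b').
  have rr0 : 0 < rr by exact: radius_gt0.
  have nD z : closed_disk b z -> nm (m z - c0) < rr by move=> /H[_ /disk_setE].
  have [M MP] : exists M : R, forall z, closed_disk b z -> nm ((rr - nm (m z - c0))%:C ^-1) <= M.
    apply: compact_bounded_nm (@closed_disk_compact b) _ => z zb.
    have h : rr - nm (m z - c0) != 0 by rewrite gt_eqF // subr_gt0 nD.
    apply: ctsV; last by apply: contra_neq h => /complexI.
    have E : (fun x => (rr - nm (m x - c0))%:C) = (fun x => rr%:C - (nm (m x - c0))%:C).
      by apply/funext => x; rewrite rmorphB.
    rewrite E; apply: ctsB; first exact: cts_cst.
    apply: (@cts_comp _ (fun x => m x - c0) (fun x => (nm x)%:C)); last exact: cts_nm.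
    by apply: ctsB; [apply: cdiff_cts; exact: (H z zb).1|exact: cts_cst].
  (* The summand [2 / rr] makes the ratio 1 - 1 / (N rr) at least 1/2. *)
  pose N := `|M| + 2 / rr; have N2 : 2 / rr <= N by rewrite lerDr.
  have N0 : 0 < N by apply: lt_le_trans N2; rewrite divr_gt0.
  have Nr : N^-1 <= rr / 2 by rewrite -[leRHS]invrK invf_div lef_pV2 // posrE ?divr_gt0.
  exists (1 - N^-1 / rr), 1, 1; split => //.
    have h1 : N^-1 / rr <= 1 / 2 by rewrite ler_pdivrMr //; lra.
    have h2 : 0 < N^-1 / rr by rewrite divr_gt0 // invr_gt0.
    by apply/andP; split; lra.
  move=> s f M' z _ M'0 fM zb; rewrite mul1r; apply: fM.
  have pos : 0 < rr - nm (m z - c0) by rewrite subr_gt0 nD.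
  have hx : N^-1 <= rr - nm (m z - c0).
    have := MP z zb; rewrite nmV nmRp ?(ltW pos) // => h.
    rewrite -[leRHS]invrK lef_pV2 ?posrE ?invr_gt0 //.
    by apply: le_trans h _; apply: le_trans (ler_norm _) _; rewrite lerDl divr_ge0 // ltW.
  have -> : (1 - N^-1 / rr) * rr = rr - N^-1 by rewrite mulrBl mul1r divfK ?gt_eqF.
  by move: hx; rewrite -/c0; lra.
Qed.

Lemma kernel_op U (T : R[i] -> X -> ix -> R[i] -> 'cV[R[i]]_d) : open U ->
  (forall b i, kernel b U (fun s f z => T s f b z i 0)) ->
  exists F : R[i] -> {linear X -> X},
    [/\ forall s f b z, U s -> closed_disk b z -> cmp (F s f) b z = T s f b z,
        op_holomorphic U F & forall s, U s -> nuclear_order0 (F s) /\ continuous (F s)].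
Proof.
move=> oU kT.
have opx s : U s -> exists L : {linear X -> X}, forall f b z, closed_disk b z -> cmp (L f) b z = T s f b z.
  move=> Us; apply: op_ex => [f b|a f g b z zb].
    by apply: good_open => z zb i; have [_ h _ _] := kT b i; exact: h.
  by apply/colP => i; rewrite !mxE; have [h _ _ _] := kT b i; exact: h.
(* Outside U the operator is 0 by default; all claims are about U. *)
pose F s : {linear X -> X} := if pselect (U s) is left Us then sval (cid (opx s Us)) else \0.
have FE s f b z : U s -> closed_disk b z -> cmp (F s f) b z = T s f b z.
  by move=> Us zb; rewrite /F; case: pselect => // Us'; case: cid => /= L; apply.
have bd s0 : U s0 -> exists th r C : R, [/\ 0 < th < 1, 0 < r, 0 <= C &
    forall s, nm (s - s0) < r -> U s -> tame th C (F s)].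
  move=> Us0.
  have H b i : exists p : R * R * R, [/\ 0 < p.1.1 < 1, 0 < p.1.2, 0 <= p.2 &
    forall s f (M : R) z, nm (s - s0) < p.1.2 -> 0 <= M -> inner_bound p.1.1 f M -> closed_disk b z ->
      nm (T s f b z i 0) <= p.2 * M].
    by have [_ _ _ /(_ s0 Us0)[th [r [C h]]]] := kT b i; exists (th, r, C).
  have {}H b : exists p : R * R * R, [/\ 0 < p.1.1 < 1, 0 < p.1.2, 0 <= p.2 &
    forall i s f (M : R) z, nm (s - s0) < p.1.2 -> 0 <= M -> inner_bound p.1.1 f M -> closed_disk b z ->
      nm (T s f b z i 0) <= p.2 * M].
    pose p i := sval (cid (H b i)).
    have pP i := svalP (cid (H b i)); change (forall i, [/\ 0 < (p i).1.1 < 1, 0 < (p i).1.2, 0 <= (p i).2 &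
      forall s f (M : R) z, nm (s - s0) < (p i).1.2 -> 0 <= M -> inner_bound (p i).1.1 f M -> closed_disk b z ->
      nm (T s f b z i 0) <= (p i).2 * M]) in (type of pP).
    clearbody p.
    (* The default values keep the ratio in ]0, 1[ and the radius positive even for d = 0. *)
    exists (\big[Num.max/1/2]_i (p i).1.1, \big[Num.min/1]_i (p i).1.2, \sum_i (p i).2); split => /=.
    - apply/andP; split; first by apply/bigmax_gtP; left; lra.
      by apply/bigmax_ltP; split; [lra|move=> i _; have [/andP[]] := pP i].
    - by apply/bigmin_gtP; split => // i _; have [] := pP i.
    - by apply: sumr_ge0 => i _; have [] := pP i.
    - move=> i s f M z /bigmin_gtP[_ sr] M0 fM zb; have [_ _ _ h] := pP i.
      apply: (le_trans (h s f M z (sr i isT) M0 _ zb)).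
        by apply: inner_bound_mono fM; apply/bigmax_geP; right; exists i.
      rewrite ler_wpM2r // (bigD1 i) //= lerDl.
      by apply: sumr_ge0 => j _; have [] := pP j.
  have [[[t1 r1] C1] /= [/andP[t1a t1b] r1p C1p H1]] := H I1.
  have [[[t2 r2] C2] /= [/andP[t2a t2b] r2p C2p H2]] := H Ir.
  have [[[t3 r3] C3] /= [/andP[t3a t3b] r3p C3p H3]] := H Iq.
  exists (Num.max t1 (Num.max t2 t3)), (Num.min r1 (Num.min r2 r3)), (C1 + C2 + C3); split.
  - by rewrite lt_max t1a !gt_max t1b t2b.
  - by rewrite !lt_min r1p r2p.
  - by rewrite !addr_ge0.
  move=> s; rewrite !lt_min => /and3P[s1 s2 s3] Us f M M0 fM b z i zb.
  rewrite FE //.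
  have f1 : inner_bound t1 f M by apply: inner_bound_mono fM; rewrite le_max lexx.
  have f2 : inner_bound t2 f M by apply: inner_bound_mono fM; rewrite !le_max lexx orbT.
  have f3 : inner_bound t3 f M by apply: inner_bound_mono fM; rewrite !le_max lexx !orbT.
  have e1 : C1 * M <= (C1 + C2 + C3) * M by rewrite ler_wpM2r //; lra.
  have e2 : C2 * M <= (C1 + C2 + C3) * M by rewrite ler_wpM2r //; lra.
  have e3 : C3 * M <= (C1 + C2 + C3) * M by rewrite ler_wpM2r //; lra.
  case: b zb => zb.
  - by apply: le_trans e1; exact: H1.
  - by apply: le_trans e2; exact: H2.
  - by apply: le_trans e3; exact: H3.
exists F; split => //.
- apply: op_holo => // s0 Us0; have [th [r [C [/andP[th0 th1] r0 C0 H]]]] := bd s0 Us0.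
  have [r' r'0 r'U] : exists2 r' : R, 0 < r' & forall s, nm (s - s0) < r' -> U s.
    have /nbhs_ballP[e /= e0 eU] : nbhs s0 U by apply: open_nbhs_nbhs.
    have eE : e = (complex.Re e)%:C by rewrite RRe_real // gtr0_real.
    exists (complex.Re e); first by rewrite -ltcR -eE.
    by move=> s ss; apply: eU; rewrite -ball_normE /= nmE eE ltcR nmB.
  exists (Num.min r r'); first by rewrite lt_min r0.
  exists (d%:R * C); first by rewrite mulr_ge0.
  move=> s; rewrite lt_min => /andP[sr sr']; have Us := r'U s sr'; split.
    by move=> f; apply: (tame_bounded C0 th0 th1); exact: H.
  move=> f b z i zb; have [_ _ h _] := kT b i.
  have [r2 r20 r2U] := subball sr'.
  by apply: (cdiff_near r20) (h s f z Us zb) => x /r2U/r'U Ux; rewrite FE.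
- move=> s Us; have [th [r [C [/andP[th0 th1] r0 C0 H]]]] := bd s Us.
  have tF : tame th C (F s) by apply: H => //; rewrite subrr nm0.
  split; first exact: nuclear_tame tF.
  exact: bounded_continuous (tame_bounded C0 th0 th1 tF).
Qed.
End kernels.

(** * Taylor coefficients of monomials and auxiliary estimates *)

Section monomials.
Variable R : realType.
Implicit Types (y z w : R[i]).

(* Scaling the circle by 2 multiplies the mean of [y ^ (l - m)] by [2 ^ (l - m)]. *)
Lemma tc_X l m (rho : R) : 0 < rho -> tc (fun y => y ^+ l) 0 rho m = (m == l)%:R.
Proof.
move=> r0; have rC z : nm (z - 0) = rho -> z != 0 by rewrite subr0 -nm_gt0 => ->.
case: eqVneq => [->|ml].
  rewrite /tc (eq_cmean (g := fun=> 1)) ?(ltW r0) //; last first.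
    by move=> z /rC z0; rewrite subr0 divff // expf_neq0.
  by rewrite /cmean mean_cst.
pose f z := z ^+ l * (z - 0) ^- m.
have df z : z != 0 -> cdiff f z by move=> z0; rewrite /f; cd; rewrite subr0 expf_neq0.
have h1 : cmean f 0 rho = cmean f 0 (2 * rho).
  apply: cmean_annulus => //; first lra.
  by move=> z /andP[h _]; apply: df; rewrite -nm_gt0 -[z]subr0; exact: lt_le_trans h.
have h2 : cmean f 0 (2 * rho) = (2 ^+ l / 2 ^+ m) * cmean f 0 rho.
  have cf z : nm (z - 0) = rho -> cts f z by move=> /rC z0; exact/cdiff_cts/df.
  have E := @cmeanZ R f 0 rho (2 ^+ l / 2 ^+ m) (ltW r0) cf; rewrite -[RHS]E.
  congr mean; apply/funext => x; rewrite /circ /f !add0r !subr0 rmorphM /= -mulrA.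
  move: (_ * cexp _) => t.
  rewrite -[(2 : R)%:C]/(2%:R%:C) (rmorph_nat (real_complex R)).
  by rewrite !exprMn invfM; move: (_ ^- m) (_ ^- m) (_ ^+ l) (_ ^+ l) => p1 p2 p3 p4; ring.
change (cmean f 0 rho = 0); apply/eqP; have := h1; rewrite h2 => /eqP.
rewrite -subr_eq0 -{1}[cmean f 0 rho]mul1r -mulrBl mulf_eq0 => /orP[|//].
rewrite subr_eq0 => /eqP E.
have n2 k : (2 : R[i]) ^+ k != 0 by rewrite expf_neq0 // pnatr_eq0.
have : (2 ^ m)%:R = (2 ^ l)%:R :> R[i].
  by rewrite !natrX; have := congr1 (fun x => x * 2 ^+ m) E; rewrite mul1r divfK.
move=> /(congr1 (@nm R)) E2; rewrite nmn in E2; rewrite nmn in E2.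
by move/eqP: E2; rewrite (eqr_nat R) eqn_exp2l ?(negbTE ml).
Qed.

Lemma geometric_tail (b t e x : R) : 0 <= b -> t < 1 -> 0 <= x ->
  x * (b + 1) <= e * (1 - t) -> b * (x / (1 - t)) <= e.
Proof.
move=> b0 t1 x0 h; rewrite mulrA ler_pdivrMr ?subr_gt0 //.
by apply: le_trans h; rewrite mulrC ler_wpM2l // lerDl.
Qed.

Lemma ReV_gt0 z : 0 < complex.Re z -> 0 < complex.Re z^-1.
Proof.
case: z => x y /= x0; rewrite divr_gt0 //.
by rewrite ltr_pwDl ?exprn_gt0 // sqr_ge0.
Qed.

Lemma ReMr (x : R) z : complex.Re (x%:C * z) = x * complex.Re z.
Proof. by case: z => a b /=; rewrite mul0r subr0. Qed.
End monomials.

(** * Taylor data of a vector at a cusp *)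

Section source.
Variables (R : realType) (d : nat) (E1 Er Eq : disk R).
Notation X := (BE d E1 Er Eq).
Notation Dk := (Dk E1 Er Eq).
Notation inner_bound := (@inner_bound R d E1 Er Eq).
Variables (b' : ix) (sg : R[i]) (k0 : R) (P : 'M[R[i]]_d).
Hypotheses (sg2 : sg * sg = 1) (k00 : 0 < k0) (sgD : disk_set (Dk b') sg).
Implicit Types (f g : X) (y z s : R[i]) (i j : 'I_d).

Lemma nm_sg : nm sg = 1.
Proof.
have : nm sg * nm sg = 1 by rewrite -nmM sg2 nm1.
by have := nm_ge0 sg; nra.
Qed.

(** The point whose cusp coordinate is 1 / y, in particular the cusp itself for y = 0. *)
Definition sigma y := sg * (1 - k0%:C * y).

(** The cusp has a positive distance g to the boundary of the disk. Half of it is left for the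
    points with |y| < 2 dl, the other half keeps them in the concentric disk of ratio 1 - g / (2
    r). *)
Lemma source_radius : exists dl th : R, [/\ 0 < dl, dl * 2 <= 1, 0 < th < 1 &
  forall y, nm y < 2 * dl -> nm (sigma y - Defs.center (Dk b')) <= th * Defs.radius (Dk b')].
Proof.
move/disk_setE: sgD; set c := Defs.center _; set r := Defs.radius _ => h.
have r0 : 0 < r by exact: radius_gt0.
pose g := r - nm (sg - c); have g0 : 0 < g by rewrite subr_gt0.
have gr : g <= r by rewrite /g; have := nm_ge0 (sg - c); lra.
pose dl := Num.min (1 / 2) (g / (4 * k0)).
have dl0 : 0 < dl by rewrite lt_min !divr_gt0 // mulr_gt0.
have dlg : dl * (4 * k0) <= g by rewrite -ler_pdivlMr ?mulr_gt0 // ge_min lexx orbT.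
exists dl, (1 - g / 2 / r); split => //.
- have : dl <= 1 / 2 by rewrite ge_min lexx.
  by lra.
- have h1 : g / 2 / r <= 1 / 2 by rewrite ler_pdivrMr //; lra.
  have h2 : 0 < g / 2 / r by rewrite !divr_gt0.
  by apply/andP; split; lra.
- move=> y yd; have -> : (1 - g / 2 / r) * r = r - g / 2 by rewrite mulrBl mul1r divfK ?gt_eqF.
  have -> : sigma y - c = (sg - c) - sg * k0%:C * y by rewrite /sigma; ring.
  apply: le_trans (nmBD _ _) _; rewrite !nmM nm_sg mul1r nmRp ?(ltW k00) //.
  have : k0 * nm y <= g / 2 by move: dlg yd k00; clear; have := nm_ge0 y; nra.
  by rewrite /g; lra.
Qed.

Variables (dl th : R).
Hypotheses (dl0 : 0 < dl) (dl2 : dl * 2 <= 1) (th01 : 0 < th < 1).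
Hypothesis sigP : forall y, nm y < 2 * dl ->
  nm (sigma y - Defs.center (Dk b')) <= th * Defs.radius (Dk b').

(** A coordinate of f in the eigenbasis of eta(h^-1), near the cusp: this is the function F of the
    cusp sum. *)
Definition pull_coord f i y : R[i] := \sum_j P i j * cmp f b' (sigma y) j 0.
Definition taylor_coef f i : nat -> R[i] := tc (pull_coord f i) 0 dl.
Lemma taylor_coefE f i m : taylor_coef f i m = tc (pull_coord f i) 0 dl m. Proof. by []. Qed.

Definition entries_norm : R := \sum_i \sum_j nm (P i j).

Lemma entries_norm_ge0 : 0 <= entries_norm.
Proof. by apply: sumr_ge0 => i _; apply: sumr_ge0 => j _; exact: nm_ge0. Qed.

Lemma sig_in y : nm y < 2 * dl -> disk_set (Dk b') (sigma y).
Proof.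
move=> /sigP h; apply/disk_setE; apply: le_lt_trans h _.
have /andP[_ t1] := th01.
by have := radius_gt0 (Dk b'); nra.
Qed.

Lemma cdiff_sigma y : cdiff sigma y. Proof. by rewrite /sigma; cd. Qed.

Lemma cdiff_pull_coord f i y : disk_set (Dk b') (sigma y) -> cdiff (pull_coord f i) y.
Proof.
move=> yD; apply: cdiff_sum => j _; apply: cdiffM; first exact: cdiff_cst.
apply: (@cdiff_comp _ sigma (fun z => cmp f b' z j 0)); first exact: cdiff_sigma.
exact: (holo_good _).2.
Qed.

Lemma cdiff_pull_coord0 f i y : nm (y - 0) < 2 * dl -> cdiff (pull_coord f i) y.
Proof. by rewrite subr0 => /sig_in; exact: cdiff_pull_coord. Qed.

Lemma pull_coordD (c : R[i]) f g i y : pull_coord (c *: f + g) i y = c * pull_coord f i y + pull_coord g i y.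
Proof.
rewrite /pull_coord mulr_sumr -big_split; apply: eq_bigr => j _ /=.
by rewrite cmpZD; ring.
Qed.

Lemma pull_coord_le f i (M : R) y : 0 <= M -> inner_bound th f M -> nm y < 2 * dl -> nm (pull_coord f i y) <= entries_norm * M.
Proof.
move=> M0 fM yd; apply: (@le_trans _ _ (\sum_j nm (P i j) * M)).
  apply: le_trans (nm_sum _ _ _) _; apply: ler_sum => j _.
  by rewrite nmM ler_wpM2l ?nm_ge0 //; apply: fM; exact: sigP.
rewrite -mulr_suml ler_wpM2r // /entries_norm [leRHS](bigD1 i) //= lerDl.
by apply: sumr_ge0 => i' _; apply: sumr_ge0 => j _; exact: nm_ge0.
Qed.

Lemma dl_circle z : nm (z - 0) = dl -> nm (z - 0) < 2 * dl.
Proof. by move=> ->; have := dl0; lra. Qed.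

Lemma taylor_coef_bound f i (M : R) : 0 <= M -> inner_bound th f M -> geom_bound dl (taylor_coef f i) (entries_norm * M).
Proof.
move=> M0 fM m; rewrite -ler_pdivlMr ?exprn_gt0 //; apply: tc_le => // z zE.
  by apply/cdiff_cts/cdiff_pull_coord0/dl_circle.
by apply: pull_coord_le fM _ => //; have := dl_circle zE; rewrite subr0.
Qed.

Lemma inner_bound_nrm f : inner_bound th f (nrm f).
Proof.
move=> b z i zt; apply: nrm_ge; apply/disk_closure/disk_setE; apply: le_lt_trans zt _.
have /andP[_ t1] := th01.
by have := radius_gt0 (Dk b); nra.
Qed.

Lemma taylor_coef_bound_nrm f i : geom_bound dl (taylor_coef f i) (entries_norm * nrm f).
Proof. by apply: taylor_coef_bound; [exact: nrm_ge0|exact: inner_bound_nrm]. Qed.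

Lemma taylor_coefD (c : R[i]) f g i : taylor_coef (c *: f + g) i = fun m => c * taylor_coef f i m + taylor_coef g i m.
Proof.
apply/funext => m; rewrite /taylor_coef.
have cG h z : nm (z - 0) = dl -> cts (pull_coord h i) z by move=> /dl_circle/cdiff_pull_coord0 H; exact/cdiff_cts.
rewrite -tcZ //; last by move=> z; exact: cG.
rewrite -tcD //; first by apply: eq_tc => [|z _]; [exact: ltW|exact: pull_coordD].
- by move=> z zE; apply: ctsM; [exact: cts_cst|exact: cG].
- by move=> z; exact: cG.
Qed.

Lemma ps_taylor_coef f i y : nm y <= dl / 2 -> ps (taylor_coef f i) y = pull_coord f i y.
Proof.
move=> yd; apply: limsE => e e0; pose B := entries_norm * nrm f.
have B0 : 0 <= B by rewrite mulr_ge0 ?entries_norm_ge0 ?nrm_ge0.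
pose t := nm y / dl.
have t0 : 0 <= t by rewrite divr_ge0 ?nm_ge0 // ltW.
have t1 : t <= 1 / 2 by rewrite ler_pdivrMr //; move: yd; lra.
have t1' : t < 1 by lra.
have [N NP] := pow_small t0 t1' (e := e * (1 - t) / (B + 1))
  ltac:(rewrite divr_gt0 ?mulr_gt0 //; lra).
exists N => n /NP; rewrite ler_pdivlMr; last lra.
move=> h; rewrite nmB.
have ddl : dl < 2 * dl by have := dl0; lra.
have ydl : nm y < dl by have := dl0; move: yd; lra.
have := @taylor R (pull_coord f i) 0 y (2 * dl) dl B n (fun z => @cdiff_pull_coord0 f i z) ddl ydl.
rewrite add0r; move=> T; apply: le_trans (T _) _.
  move=> z /dl_circle; rewrite subr0; apply: pull_coord_le; first exact: nrm_ge0.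
  exact: inner_bound_nrm.
exact: (geometric_tail B0 t1' (exprn_ge0 n t0) h).
Qed.
End source.

(** * Separation of the pole factors *)

Section splitting.
Variable R : realType.
(** [hurwitz] is affine in the factors [kap]: the value at 0 is free of poles, and for u = 1 each
    [kap l] multiplies a scalar functional of a times a power of the coordinate that does not depend
    on a. *)
Lemma hurwitz_split (u : R[i]) k kap s a w : hurwitz u k kap s a w =
  hurwitz u k (fun=> 0) s a w + (u == 1)%:R *
  \sum_(l < k) kap l * (lead u l s a * pw (s + l%:R - 1) (shifted w 0)).
Proof.
case: eqVneq => [->|u1]; last by rewrite mul0r addr0; apply: hurwitz_kap; apply/eqP.
rewrite mul1r; elim: k kap s a => [|k IH] kap s a; first by rewrite big_ord0 addr0.
rewrite /= IH big_ord_recl /= /tel0 /tel eqxx mul0r mulr0 add0r addr0.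
rewrite [LHS]addrCA; congr (_ + _).
congr (_ + _); first by ring.
apply: eq_bigr => l _; rewrite /bump /= add1n add0n.
by have -> : s + 1 + l%:R - 1 = s + l.+1%:R - 1 by rewrite -[l.+1%:R]natr1; ring.
Qed.
End splitting.

(** * The meromorphic kernel of one cusp entry *)

Section target.
Variables (R : realType) (d : nat) (E1 Er Eq : disk R).
Notation X := (BE d E1 Er Eq).
Notation Dk := (Dk E1 Er Eq).
Notation inner_bound := (@inner_bound R d E1 Er Eq).
Notation closed_disk := (closed_disk E1 Er Eq).
Notation kernel := (@kernel R d E1 Er Eq).
Variables (b' b : ix) (sg : R[i]) (k0 : R) (P Q : 'M[R[i]]_d) (v : 'I_d -> R[i]) (N : nat).
Variables (dl th : R).
Hypotheses (sg2 : sg * sg = 1) (k00 : 0 < k0).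
Hypotheses (dl0 : 0 < dl) (dl2 : dl * 2 <= 1) (th01 : 0 < th < 1).
Hypothesis sigP : forall y, nm y < 2 * dl ->
  nm (sigma sg k0 y - Defs.center (Dk b')) <= th * Defs.radius (Dk b').
Hypotheses (QP : Q *m P = 1%:M) (PQ : P *m Q = 1%:M) (v1 : forall j, nm (v j) = 1).
Hypothesis N2 : 2 / dl <= N%:R.
Hypothesis targ : forall z, closed_disk b z -> 0 < complex.Re (1 - sg * z).

(* In this coordinate the parabolic element is the translation by 1. *)
Definition cusp_coord z : R[i] := k0%:C / (1 - sg * z).
Hypothesis maps : forall n z, closed_disk b z -> disk_set (Dk b') (sigma sg k0 (shifted (cusp_coord z) n)^-1).

Notation taylor_coef := (@taylor_coef R d E1 Er Eq b' sg k0 P dl).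
Notation pull_coord := (@pull_coord R d E1 Er Eq b' sg k0 P).
Notation entries_norm := (entries_norm P).
Implicit Types (f g : X) (y z s : R[i]) (i j : 'I_d).

Lemma near_target z : closed_disk b z -> exists2 r : R, 0 < r &
  forall x, nm (x - z) < r -> 0 < complex.Re (1 - sg * x).
Proof.
move=> /targ h; exists (complex.Re (1 - sg * z)) => // x xz.
have -> : 1 - sg * x = (1 - sg * z) - sg * (x - z) by ring.
have : complex.Re (sg * (x - z)) <= nm (x - z).
  by apply: le_trans (Re_le_nm _) _; rewrite nmM (nm_sg sg2) mul1r.
by rewrite [complex.Re (_ - _ * (x - z))]raddfB /=; move: xz; lra.
Qed.

Lemma cusp_coord_Re z : 0 < complex.Re (1 - sg * z) -> 0 < complex.Re (cusp_coord z).
Proof. by move=> h; rewrite /cusp_coord ReMr mulr_gt0 // ReV_gt0. Qed.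

Lemma cdiff_cusp_coord z : 0 < complex.Re (1 - sg * z) -> cdiff cusp_coord z.
Proof. by move=> h; rewrite /cusp_coord; cd; exact/slit_neq0/slit_Re. Qed.

Lemma shifted_cusp_coord_Re z n : closed_disk b z -> 0 < complex.Re (shifted (cusp_coord z) n).
Proof. by move=> /targ/cusp_coord_Re h; rewrite Re_xn ltr_wpDl. Qed.

(** Dropping the first N terms of the sum shifts w by N, far enough for the Taylor series at the
    cusp to be inserted. *)
Definition tail_coord z : R[i] := cusp_coord z + N%:R.

Lemma tail_coord_wok z : 0 < complex.Re (1 - sg * z) -> wok dl (tail_coord z).
Proof.
move=> /cusp_coord_Re h; rewrite /wok /tail_coord addrC ReDn; apply: le_trans N2 _.
by rewrite lerDl ltW.
Qed.

Lemma cdiff_tail_coord z : 0 < complex.Re (1 - sg * z) -> cdiff tail_coord z.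
Proof. by move=> h; rewrite /tail_coord; apply: cdiffD; [exact: cdiff_cusp_coord|exact: cdiff_cst]. Qed.

Definition tail_kernel k j s f z : R[i] := hurwitz (v j) k (fun=> 0) (2 * s) (taylor_coef f j) (tail_coord z).
Definition lead_kernel l j s f (z : R[i]) : R[i] := lead (v j) l (2 * s) (taylor_coef f j).

(** Here k peelings leave an exponent of real part more than 2; the inequality is strict to make the
    set open. *)
Definition halfplane (k : nat) : set R[i] := [set s | 2 < complex.Re (2 * s) + k%:R].

Lemma Re2 s : complex.Re (2 * s) = 2 * complex.Re s.
Proof. by rewrite -[2](rmorph_nat (real_complex R)) ReMr. Qed.

Lemma halfplane_ball k s0 : halfplane k s0 -> exists2 r : R, 0 < r &
  forall s, nm (s - s0) < r -> halfplane k s.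
Proof.
rewrite /halfplane /= Re2 => h; exists ((2 * complex.Re s0 + k%:R - 2) / 2); first lra.
move=> s; have := nm_Re (s - s0); rewrite Re2 raddfB /= ler_norml => /andP[h1 h2]; lra.
Qed.

Lemma nm2_ball s s0 (r : R) : nm (s - s0) < r -> nm (2 * s) <= nm (2 * s0) + 2 * r.
Proof.
have -> : 2 * s = 2 * s0 + 2 * (s - s0) by ring.
by have := nmD (2 * s0) (2 * (s - s0)); rewrite (nmM _ (s - s0)) nmn; lra.
Qed.

Lemma kernel_tail k j : kernel b (halfplane k) (tail_kernel k j).
Proof.
have sbf f := taylor_coef_bound_nrm P dl0 th01 sigP f j.
split.
- move=> s a f g z Us zb; rewrite /tail_kernel (taylor_coefD P dl0 th01 sigP).
  by apply: (hurwitz_lin dl0 dl2 (v1 j) _ _ (sbf f) (sbf g)); [exact/tail_coord_wok/targ|exact: ltW].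
- move=> s f z Us zb; have [r r0 rP] := near_target zb.
  apply: (@hurwitz_cdiff R dl (v j) dl0 dl2 (v1 j) k (fun=> fun=> 0) (fun=> 2 * s) (fun=> taylor_coef f j)
    tail_coord z r (nm (2 * s)) (entries_norm * nrm f) r0) => x /rP xr; split.
  + by split; [cd|].
  + by split; [exact: cdiff_tail_coord|exact: tail_coord_wok].
  + by split=> // m; cd.
  + by move=> l _; cd.
  + exact: ltW.
- move=> s0 f z Us zb; have [r r0 rP] := halfplane_ball Us.
  apply: (@hurwitz_cdiff R dl (v j) dl0 dl2 (v1 j) k (fun=> fun=> 0) (fun s => 2 * s) (fun=> taylor_coef f j)
    (fun=> tail_coord z) s0 r (nm (2 * s0) + 2 * r) (entries_norm * nrm f) r0) => s sr; split.
  + by split; [cd|exact: nm2_ball].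
  + by split; [cd|exact/tail_coord_wok/targ].
  + by split=> // m; cd.
  + by move=> l _; cd.
  + by apply: ltW; exact: rP.
- move=> s0 Us; have [r r0 rP] := halfplane_ball Us.
  have [L L0 LP] : exists2 L : R, 0 <= L & forall z, closed_disk b z -> nm (clog (shifted (tail_coord z) 0)) <= L.
    apply: closed_disk_bounded => z zb; have zt := targ zb.
    apply: (@cdiff_comp _ (fun z => shifted (tail_coord z) 0)).
      by rewrite /shifted; apply: cdiffD; [cd|exact: cdiff_tail_coord].
    exact/cdiff_clog/slit_Re/(Re_xn_gt0 dl0 dl2)/tail_coord_wok.
  have S0 : 0 <= nm (2 * s0) + 2 * r by rewrite addr_ge0 ?nm_ge0 // mulr_ge0 // ltW.
  have [C C0 CP] := hurwitz_le dl0 dl2 (v1 j) k S0 (lexx 0) L0.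
  exists th, r, (C * entries_norm); split => //; first by rewrite mulr_ge0 ?entries_norm_ge0.
  move=> s f M z sr M0 fM zb; rewrite -mulrA; apply: CP.
  + exact: nm2_ball.
  + by move=> l _; rewrite nm0.
  + exact: LP.
  + exact/tail_coord_wok/targ.
  + by apply: ltW; exact: rP.
  + exact: (taylor_coef_bound P dl0 th01 sigP).
Qed.

Lemma kernel_lead l j : kernel b setT (lead_kernel l j).
Proof.
have sbf f := taylor_coef_bound_nrm P dl0 th01 sigP f j.
split.
- by move=> s a f g z _ zb; rewrite /lead_kernel (taylor_coefD P dl0 th01 sigP) lead_lin.
- by move=> s f z _ _; rewrite /lead_kernel; cd.
- move=> s0 f z _ _.
  apply: (@lead_cdiff R dl (v j) dl0 dl2 l (fun s => 2 * s) (fun=> taylor_coef f j) s0 1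
    (nm (2 * s0) + 2 * 1) (entries_norm * nrm f) ltr01) => s sr; split => //; try by cd.
  + exact: nm2_ball.
  + by move=> m; cd.
- move=> s0 _; have [C C0 CP] := lead_le (v j) dl0 dl2 l (nm (2 * s0) + 2 * 1).
  exists th, 1, (C * entries_norm); split => //; first by rewrite mulr_ge0 ?entries_norm_ge0.
  move=> s f M z sr M0 fM zb; rewrite -mulrA; apply: CP; first exact: nm2_ball.
  exact: (taylor_coef_bound P dl0 th01 sigP).
Qed.

Definition head_kernel j n s f z : R[i] :=
  v j ^+ n.+1 * (pw (2 * s) (shifted (cusp_coord z) n) * pull_coord f j (shifted (cusp_coord z) n)^-1).

Lemma kernel_head j n : kernel b setT (head_kernel j n).
Proof.
apply: kernelZ; apply: (kernelM (c := fun s z => pw (2 * s) (shifted (cusp_coord z) n))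
  (K := fun s f z => pull_coord f j (shifted (cusp_coord z) n)^-1)).
  apply: (coef_pw (k := fun s => 2 * s) (x := fun z => shifted (cusp_coord z) n)) => [s _|z zb]; first by cd.
  split; last exact/slit_Re/shifted_cusp_coord_Re.
  by rewrite /shifted; apply: cdiffD; [cd|exact/cdiff_cusp_coord/targ].
apply: kernel_sum => l _; apply: kernelZ.
apply: (@kernel_comp R d E1 Er Eq b b' setT (fun z => sigma sg k0 (shifted (cusp_coord z) n)^-1) l) => z zb; split; last exact: maps.
apply: (@cdiff_comp _ (fun z => (shifted (cusp_coord z) n)^-1)); last exact: cdiff_sigma.
apply: cdiffV; last exact/slit_neq0/slit_Re/shifted_cusp_coord_Re.
by rewrite /shifted; apply: cdiffD; [cd|exact/cdiff_cusp_coord/targ].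
Qed.

(** The prefactor w^(2 s) comes from the cocycle, since the denominator of the n-th inverse power is
    (n + w) / w up to sign (see [cusp_den]). *)
Definition base_kernel k i s f z : R[i] := pw (- (2 * s)) (cusp_coord z) *
  \sum_j Q i j * (\sum_(n < N) head_kernel j n s f z + v j ^+ N * tail_kernel k j s f z).

Definition residue_kernel l i s f z : R[i] := pw (- (2 * s)) (cusp_coord z) *
  \sum_(j | v j == 1) Q i j * (pw (2 * s + l%:R - 1) (shifted (tail_coord z) 0) * lead_kernel l j s f z).

Definition total_kernel k i s f z : R[i] :=
  base_kernel k i s f z + \sum_(l < k) pole_factor (2 * s) l * residue_kernel l i s f z.

Lemma coef_cusp_coord : coefficient E1 Er Eq b setT (fun s z => pw (- (2 * s)) (cusp_coord z)).
Proof.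
apply: (coef_pw (k := fun s => - (2 * s))) => [s _|z /targ zb]; first by cd.
by split; [exact: cdiff_cusp_coord|exact/slit_Re/cusp_coord_Re].
Qed.

Lemma coef_sub U U' c : (forall s : R[i], U' s -> U s) ->
  coefficient E1 Er Eq b U c -> coefficient E1 Er Eq b U' c.
Proof.
move=> UU [h1 h2 h3]; split.
- by move=> s z /UU; exact: h1.
- by move=> s z /UU; exact: h2.
- by move=> s /UU; exact: h3.
Qed.

Lemma kernel_base k i : kernel b (halfplane k) (base_kernel k i).
Proof.
apply: kernelM; first by apply: coef_sub coef_cusp_coord.
apply: kernel_sum => j _; apply: kernelZ; apply: kernelD.
  by apply: kernel_sum => n _; apply: kernel_sub (kernel_head j n).
by apply: kernelZ; exact: kernel_tail.
Qed.

Lemma kernel_res l i : kernel b setT (residue_kernel l i).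
Proof.
apply: kernelM; first exact: coef_cusp_coord.
apply: kernel_sum => j _; apply: kernelZ.
apply: (kernelM (c := fun s z => pw (2 * s + l%:R - 1) (shifted (tail_coord z) 0))); last exact: kernel_lead.
apply: (coef_pw (k := fun s => 2 * s + l%:R - 1)) => [s _|z /targ zb]; first by cd.
split; first by rewrite /shifted; apply: cdiffD; [cd|exact: cdiff_tail_coord].
exact/slit_Re/(Re_xn_gt0 dl0 dl2)/tail_coord_wok.
Qed.

Lemma total_kernelE k i s f z : total_kernel k i s f z = pw (- (2 * s)) (cusp_coord z) *
  \sum_j Q i j * (\sum_(n < N) head_kernel j n s f z +
     v j ^+ N * hurwitz (v j) k (pole_factor (2 * s)) (2 * s) (taylor_coef f j) (tail_coord z)).
Proof.
rewrite /total_kernel /base_kernel /residue_kernel.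
have -> : \sum_(l < k) pole_factor (2 * s) l * (pw (- (2 * s)) (cusp_coord z) *
    \sum_(j | v j == 1) Q i j * (pw (2 * s + l%:R - 1) (shifted (tail_coord z) 0) * lead_kernel l j s f z)) =
  pw (- (2 * s)) (cusp_coord z) * \sum_j Q i j * ((v j == 1)%:R *
    \sum_(l < k) pole_factor (2 * s) l * (lead (v j) l (2 * s) (taylor_coef f j) * pw (2 * s + l%:R - 1) (shifted (tail_coord z) 0))).
  rewrite mulr_sumr; under [RHS]eq_bigr => j _ do rewrite !mulr_sumr.
  rewrite exchange_big /=; apply: eq_bigr => l _.
  rewrite mulrCA; rewrite !mulr_sumr big_mkcond; apply: eq_bigr => j _ /=.
  by rewrite /lead_kernel; case: eqP => _; [rewrite mul1r; ring|rewrite mul0r !mulr0].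
rewrite -mulrDr -big_split; congr (_ * _); apply: eq_bigr => j _ /=.
rewrite -mulrDr -addrA; congr (_ * (_ + _)); rewrite (hurwitz_split (v j) k (pole_factor _)) /tail_kernel mulrDr; congr (_ + _).
by case: eqP => [->|_]; [rewrite expr1n mul1r|rewrite !mul0r mulr0].
Qed.

Lemma total_kernel_ext k m i s f z : halfplane k s -> closed_disk b z -> (k <= m)%N ->
  total_kernel m i s f z = total_kernel k i s f z.
Proof.
move=> Us zb km; rewrite !total_kernelE; congr (_ * _); apply: eq_bigr => j _.
congr (_ * (_ + _ * _)); apply: (hurwitz_ext dl0 dl2 (v1 j)) km; last exact: ltW.
  exact: (taylor_coef_bound_nrm P dl0 th01 sigP f j).
exact/tail_coord_wok/targ.
Qed.

Definition term n i s f z : R[i] := pw (- (2 * s)) (cusp_coord z) * \sum_j Q i j * head_kernel j n s f z.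

Lemma total_kernel_cvs k i s f z : halfplane k s -> 1 < complex.Re (2 * s) -> closed_disk b z ->
  cvs (fun m => \sum_(n < m) term n i s f z) (total_kernel k i s f z).
Proof.
(* The depth is raised to k + 1 because convergence for 1 < Re (2 s) requires at least one
   peeling. *)
move=> Us s1 zb; rewrite -(total_kernel_ext _ _ Us zb (leqnSn k)) total_kernelE.
apply: (cvs_shift (k := N)).
rewrite (_ : (fun m => _) = (fun m => pw (- (2 * s)) (cusp_coord z) * \sum_j Q i j *
   (\sum_(n < N) head_kernel j n s f z + v j ^+ N *
     \sum_(n < m) hurwitz_term (v j) (2 * s) (taylor_coef f j) (tail_coord z) n))); last first.
  apply/funext => m; rewrite /term -mulr_sumr exchange_big /=; congr (_ * _).
  apply: eq_bigr => j _; rewrite -mulr_sumr addnC big_split_ord /=; congr (_ * (_ + _)).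
  rewrite mulr_sumr; apply: eq_bigr => n _; rewrite /head_kernel /hurwitz_term.
  have xE : shifted (cusp_coord z) (N + n) = shifted (tail_coord z) n.
    by rewrite /shifted /tail_coord -addnS natrD; ring.
  rewrite xE (ps_taylor_coef P dl0 th01 sigP); last exact/(xn_inv dl0 dl2)/tail_coord_wok/targ.
  by rewrite -addnS exprD; ring.
apply: cvsZ; apply: cvs_sum => j _; apply: cvsZ; apply: cvsD; first exact: cvs_cst.
apply: cvsZ; apply: (hurwitz_cvs dl0 dl2 (v1 j)) s1 _ => //.
  exact: (taylor_coef_bound_nrm P dl0 th01 sigP f j).
exact/tail_coord_wok/targ.
Qed.

Lemma residue_nil l i s f z : (forall j, v j != 1) -> residue_kernel l i s f z = 0.
Proof.
by move=> h; rewrite /residue_kernel big_pred0 ?mulr0 // => j; exact: negbTE.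
Qed.

(* The test function is [((1 - sg x) / k0)^l Q e_j0], all of whose Taylor
   coefficients at the cusp vanish, except the one of index [l]. *)
Lemma residue_nonzero l s z j0 : v j0 = 1 -> closed_disk b z -> exists f i,
  (forall b'' z i, ~~ sameix b' b'' -> closed_disk b'' z -> cmp f b'' z i 0 = 0) /\ residue_kernel l i s f z != 0.
Proof.
(* A zero column of Q would contradict P Q = 1. *)
move=> vj zb; have [i Qi] : exists i, Q i j0 != 0.
  apply/existsP; apply: contraT; rewrite negb_exists => /forallP h.
  have := congr1 (fun A : 'M_d => A j0 j0) PQ; rewrite !mxE eqxx big1 => [/eqP|i _].
    by rewrite eq_sym oner_eq0.
  by move/(_ i): h; rewrite negbK => /eqP ->; rewrite mulr0.
pose h x := ((1 - sg * x) / k0%:C) ^+ l.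
have dh x : cdiff h x by rewrite /h; apply: cdiffX; apply: cdiffM; cd.
pose e i : X := sval (cid (emb_ex E1 Er Eq b' i dh)).
have eE i0 b'' x i' : closed_disk b'' x ->
    cmp (e i0) b'' x i' 0 = if sameix b' b'' && (i' == i0) then h x else 0.
  by rewrite /e; case: cid => /= f; apply.
exists (\sum_i0 Q i0 j0 *: e i0), i; split.
  move=> b'' x i' bb xb; rewrite cmp_sum big1 // => i0 _.
  by rewrite cmpZ eE // (negbTE bb) mulr0.
have same : sameix b' b' by case: (b').
have k0C : k0%:C != 0 by rewrite -(rmorph0 (real_complex R)) (inj_eq (@complexI R)) gt_eqF.
have GE j y : nm y < 2 * dl -> pull_coord (\sum_i0 Q i0 j0 *: e i0) j y = (j == j0)%:R * y ^+ l.
  move=> yd; have yD := disk_closure (sig_in th01 sigP yd).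
  have hy : h (sigma sg k0 y) = y ^+ l.
    rewrite /h /sigma mulrA sg2 mul1r; congr (_ ^+ _).
    by rewrite opprB addrC subrK mulrAC divff // mul1r.
  have := congr1 (fun A : 'M_d => A j j0) PQ; rewrite !mxE => <-.
  rewrite mulr_suml; apply: eq_bigr => i1 _; rewrite -mulrA; congr (_ * _).
  rewrite cmp_sum (bigD1 i1) //= big1 => [|i2 ii].
    by rewrite cmpZ eE // same eqxx hy addr0.
  by rewrite cmpZ eE // eq_sym (negbTE ii) andbF mulr0.
have dd : 0 <= dl by exact: ltW.
have aE j : taylor_coef (\sum_i0 Q i0 j0 *: e i0) j = if j == j0 then fun m => (m == l)%:R else fun=> 0.
  apply/funext => m; rewrite taylor_coefE.
  rewrite (eq_tc (g := fun y => (j == j0)%:R * y ^+ l)) //; last first.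
    by move=> y /(dl_circle dl0); rewrite subr0 => /GE.
  rewrite tcZ //; last by move=> y _; apply: cdiff_cts; cd.
  by rewrite tc_X //; case: eqP => _; rewrite ?mul1r ?mul0r.
rewrite /residue_kernel (bigD1 j0) ?vj ?eqxx //= [X in _ * (_ + X)]big1 => [|j /andP[_ jj]]; last first.
  rewrite /lead_kernel aE (negbTE jj).
  have -> : lead (v j) l (2 * s) (fun=> 0) = 0.
    have := lead_lin (v j) l (2 * s) (fun=> 0) (fun=> 0) (-1).
    have -> : (fun m : nat => -1 * 0 + 0 : R[i]) = fun=> 0.
      by apply/funext => m; rewrite mulr0 addr0.
    by rewrite mulN1r addNr.
  by rewrite !mulr0.
rewrite addr0 /lead_kernel aE eqxx lead_delta mulr1.
by apply: mulf_neq0; [exact: cexp_neq0|apply: mulf_neq0 => //; exact: cexp_neq0].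
Qed.
End target.

(** * Powers of parabolic elements in the cusp coordinate *)

Section pack.
Variables (R : realType) (d : nat) (E1 Er Eq : disk R).
Notation X := (BE d E1 Er Eq).
Notation Dk := (Dk E1 Er Eq).
Notation closed_disk := (closed_disk E1 Er Eq).
Notation kernel := (@kernel R d E1 Er Eq).
Implicit Types (f g : X) (y z s : R[i]) (i j : 'I_d).

Lemma pwV s w : 0 < complex.Re w -> pw s w^-1 = pw (- s) w.
Proof.
move=> w0; have w1 : w != 0 by exact/slit_neq0/slit_Re.
have E : clog w^-1 = - clog w.
  apply/eqP; rewrite -subr_eq0 opprK addrC -clogM //; last exact: ReV_gt0.
  by rewrite divff // clog1.
by rewrite /pw E mulrNN opprK.
Qed.

Section matrix.
Variables (sg lam e : R) (n : nat).
Hypotheses (s2 : sg * sg = 1) (l0 : 0 < lam) (e2 : e * e = 1).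

(** Covers both cusps: it is [mP t] for sg = 1 and [mQ t] for sg = -1. *)
Definition cusp_mx (t : R) : 'M[R]_2 := mat2 (1 - t) (sg * t) (- (sg * t)) (1 + t).
Let g := e *: cusp_mx (n.+1%:R * (lam / 2)).
Let w z := cusp_coord sg%:C (2 / lam) z.
Let xi z := shifted (w z) n.

Lemma two_lam : (2 / lam)%:C = 2 / lam%:C :> R[i].
Proof.
have E : (2 : R)%:C = 2 by exact: (rmorph_nat (real_complex R) 2).
by rewrite (rmorphM (real_complex R)) fmorphV /= E.
Qed.

Lemma lamC0 : lam%:C != 0 :> R[i].
Proof. by rewrite -(rmorph0 (real_complex R)) (inj_eq (@complexI R)) gt_eqF. Qed.

Lemma eC0 : e%:C != 0 :> R[i].
Proof.
rewrite -(rmorph0 (real_complex R)) (inj_eq (@complexI R)).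
by apply/eqP => e0; move/eqP: e2; rewrite e0 mul0r eq_sym oner_eq0.
Qed.

Lemma cusp_den z : 0 < complex.Re (1 - sg%:C * z) ->
  mobius_den g z = e%:C * (xi z * (w z)^-1).
Proof.
move=> h; have v0 : 1 - sg%:C * z != 0 by exact/slit_neq0/slit_Re.
rewrite /mobius_den /g /cusp_mx mat2Z.
set a := e * _; set b := e * _; set c := e * _; set c' := e * _.
have [_ _ -> ->] := mat2E a b c c'.
rewrite /c /c' /xi /w /shifted /cusp_coord two_lam !rmorphM rmorphN rmorphD rmorph1 !rmorphM /= fmorphV.
rewrite !(rmorph_nat (real_complex R)).
have l1 := lamC0; move: (lam%:C) l1 v0 => L l1 v0; move: (n.+1%:R : R[i]) => m.
by field; rewrite l1 v0.
Qed.

Lemma cusp_mobius z : 0 < complex.Re (1 - sg%:C * z) ->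
  mobius g z = sigma sg%:C (2 / lam) (xi z)^-1.
Proof.
move=> h; have v0 : 1 - sg%:C * z != 0 by exact/slit_neq0/slit_Re.
have k0 : 0 < 2 / lam by rewrite divr_gt0.
have x0 : 0 < complex.Re (xi z).
  by rewrite /xi Re_xn ltr_wpDl // /w cusp_coord_Re.
rewrite /mobius cusp_den // /g /cusp_mx mat2Z.
set a := e * _; set b := e * _; set c := e * _; set c' := e * _.
have [-> -> _ _] := mat2E a b c c'.
have ss : sg%:C * sg%:C = 1 :> R[i] by rewrite -rmorphM s2 rmorph1.
have {}x0 := slit_neq0 (slit_Re x0); move: x0.
rewrite /a /b /xi /w /shifted /cusp_coord /sigma two_lam !rmorphM rmorphB rmorph1 !rmorphM /= fmorphV.
rewrite !(rmorph_nat (real_complex R)).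
have l1 := lamC0; have e1 := eC0.
move: (lam%:C) l1 v0 => L l1; move: (n.+1%:R : R[i]) => m; move: (e%:C) e1 => ee e1.
move: (sg%:C) ss => S ss v0 x0.
have xE : m + 2 / L / (1 - S * z) = (2 + m * (L * (1 - S * z))) / (L * (1 - S * z)).
  by field; rewrite l1 v0.
have x1 : 2 + m * (L * (1 - S * z)) != 0.
  by apply: contra_neq x0 => x1; rewrite xE x1 mul0r.
rewrite xE; apply: (mulIf (mulf_neq0 e1 x1)); rewrite [_ / (L * _)]mulrC.
have [D DE] : exists D, D = 2 + m * (L * (1 - S * z)) by eexists.
rewrite -DE in x1 *.
have -> : (ee * (1 - m * (L / 2)) * z + ee * (S * (m * (L / 2)))) /
  (ee * ((L * (1 - S * z))^-1 * D / (2 / L / (1 - S * z)))) * (ee * D) =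
  2 * ((ee * (1 - m * (L / 2)) * z + ee * (S * (m * (L / 2))))).
  by field; rewrite ?l1 ?v0 ?e1 ?x1.
have -> : S * (1 - 2 / L * ((L * (1 - S * z))^-1 * D)^-1) * (ee * D) =
  ee * (S * D - 2 * S * (1 - S * z)).
  by field; rewrite ?l1 ?v0 ?e1 ?x1.
have -> : ee * (S * D - 2 * S * (1 - S * z)) =
   ee * (S * m * L + (S * S) * (2 * z - m * L * z)) by rewrite DE; ring.
by rewrite ss; field.
Qed.

(** At the base point the denominator is e times a positive number, so the sign in [jfactor] cancels
    e. Both factors (n + 1) + w and 1 / w lie in the right half-plane, where powers are
    multiplicative. *)
Lemma cusp_jfactor x0 s z : 0 < 1 - sg * x0 -> 0 < complex.Re (1 - sg%:C * z) ->
  jfactor x0 s g z = pw (- (2 * s)) (w z) * pw (2 * s) (xi z).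
Proof.
move=> h0 h; have k0 : 0 < 2 / lam by rewrite divr_gt0.
have w0 : 0 < complex.Re (w z) by exact: cusp_coord_Re.
have xi0 : 0 < complex.Re (xi z) by rewrite /xi Re_xn ltr_wpDl.
rewrite /jfactor cusp_den // /g /cusp_mx mat2Z.
set a := e * _; set b := e * _; set c := e * _; set c' := e * _.
have [_ _ -> ->] := mat2E a b c c'.
have -> : c * x0 + c' = e * (1 + (n.+1%:R * (lam / 2)) * (1 - sg * x0)) by rewrite /c /c'; ring.
have p : 0 < 1 + n.+1%:R * (lam / 2) * (1 - sg * x0).
  by rewrite ltr_wpDr // !mulr_ge0 // ltW // divr_gt0.
rewrite sgrM (gtr0_sg p) mulr1.
rewrite mulrA -rmorphM -normrEsg.
have -> : `|e| = 1.
  have : `|e| * `|e| = 1 by rewrite -normrM e2 normr1.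
  by have := normr_ge0 e; nra.
rewrite mul1r mulNr; change (pw (2 * s) (xi z * (w z)^-1) = pw (- (2 * s)) (w z) * pw (2 * s) (xi z)).
by rewrite pwM ?pwV 1?mulrC //; exact: ReV_gt0.
Qed.
End matrix.
End pack.

(** * Interface of a cusp entry *)

Section pack.
Variables (R : realType) (d : nat) (E1 Er Eq : disk R).
Notation X := (BE d E1 Er Eq).
Notation Dk := (Dk E1 Er Eq).
Notation closed_disk := (closed_disk E1 Er Eq).
Notation kernel := (@kernel R d E1 Er Eq).
Notation kern := (R[i] -> X -> R[i] -> R[i]).
Implicit Types (f g : X) (y z s : R[i]) (i j : 'I_d).
Variable (chi : 'M[R]_2 -> 'M[R[i]]_d).

Definition pack_total (B Res : nat -> 'I_d -> kern) k i : kern :=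
  fun s f z => B k i s f z + \sum_(l < k) pole_factor (2 * s) l * Res l i s f z.

(** The functions [w t] may depend on s but not on f. Their number n is that of the eigenvalues 1,
    which may be less than m. *)
Definition low_rank m b (Res : 'I_d -> kern) s := exists n (w : 'I_n -> R[i] -> 'cV[R[i]]_d),
  [/\ (n <= m)%N, forall t, good (Dk b) (w t) &
      forall f, exists c : 'I_n -> R[i], forall z i, closed_disk b z ->
        Res i s f z = \sum_t c t * w t z i 0].

(* The cusp entry from the disk [b'] to the disk [b] is [B k] plus the sum over
   [l < k] of the residue parts [Res l], with simple poles as coefficients. *)
Definition cusp_pack b' b (x0 : R) h m (B Res : nat -> 'I_d -> kern) : Prop :=
  [/\ (forall k i, kernel b (halfplane k) (B k i)) /\ (forall l i, kernel b setT (Res l i)),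
      forall k k' i s f z, halfplane k s -> closed_disk b z -> (k <= k')%N ->
        pack_total B Res k' i s f z = pack_total B Res k i s f z,
      forall k i s f z, ~~ sameix b' b -> halfplane k s -> 1 < complex.Re (2 * s) -> closed_disk b z ->
        cvs (fun n => \sum_(j < n) Defs.beta chi x0 s (h ^+ j.+1) (cmp f b') z i 0)
          (pack_total B Res k i s f z),
      forall l s, low_rank m b (Res l) s &
      [\/ forall l i s f z, Res l i s f z = 0 |
          forall l s z, closed_disk b z -> exists f i,
            (forall b'' z i, ~~ sameix b' b'' -> closed_disk b'' z -> cmp f b'' z i 0 = 0) /\
            Res l i s f z != 0]] /\
  forall l i s f z, closed_disk b z -> (forall x j, closed_disk b' x -> cmp f b' x j 0 = 0) -> Res l i s f z = 0.

Lemma low_rank0 m b s : low_rank m b (fun _ _ _ _ => 0) s.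
Proof.
exists 0%N, (fun _ _ => 0); split => // [[]//|f].
by exists (fun=> 0) => z i zb; rewrite big_ord0.
Qed.

(** For the two zero entries of the operator matrix, where source and target disk coincide. *)
Lemma zero_pack b x0 h m : cusp_pack b b x0 h m (fun _ _ _ _ _ => 0) (fun _ _ _ _ _ => 0).
Proof.
split=> //; split.
- by split=> *; exact: kernel0.
- by move=> *; rewrite /pack_total !big1 // => *; rewrite mulr0.
- by move=> k i s f z; case: (b).
- by move=> l s; exact: low_rank0.
- by left.
Qed.

Lemma cusp_pack_ex b' b (sg lam e x0 : R) h (P Q : 'M[R[i]]_d) (v : 'I_d -> R[i]) m :
  sg * sg = 1 -> 0 < lam -> e * e = 1 ->
  (forall n, h ^- n = e ^+ n *: cusp_mx sg (n%:R * (lam / 2))) ->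
  Q *m P = 1%:M -> P *m Q = 1%:M ->
  (forall n, Defs.eta chi (h ^- n) = Q *m diag_mx (\row_i v i ^+ n) *m P) ->
  (forall i, nm (v i) = 1) -> (#|[pred i | v i == 1%R]| <= m)%N ->
  disk_set (Dk b') sg%:C -> (forall z, closed_disk b z -> 0 < complex.Re (1 - sg%:C * z)) ->
  0 < 1 - sg * x0 ->
  (forall n z, closed_disk b z -> disk_set (Dk b') (mobius (h ^- n.+1) z)) ->
  exists B Res, cusp_pack b' b x0 h m B Res.
Proof.
move=> s2 l0 e2 hE QP PQ etaE v1 vm sgD targ x00 mapsh.
have s2C : sg%:C * sg%:C = 1 :> R[i] by rewrite -rmorphM s2 rmorph1.
have k00 : 0 < 2 / lam by rewrite divr_gt0.
have [dl [th [dl0 dl2 th01 sigP]]] := @source_radius R E1 Er Eq b' _ _ s2C k00 sgD.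
pose N := Num.bound (2 / dl).
have N2 : 2 / dl <= N%:R by apply/ltW/archi_boundP; rewrite divr_ge0 // ltW.
have en n : e ^+ n * e ^+ n = 1 by rewrite -expr2 -exprM mulnC exprM expr2 e2 expr1n.
have maps n z : closed_disk b z -> disk_set (Dk b') (sigma sg%:C (2 / lam) (shifted (cusp_coord sg%:C (2 / lam) z) n)^-1).
  move=> zb; have := mapsh n z zb; rewrite hE cusp_mobius //; exact: targ.
have betaE n i s f z : closed_disk b z -> Defs.beta chi x0 s (h ^+ n.+1) (cmp f b') z i 0 =
    term b' sg%:C (2 / lam) P Q v n i s f z.
  move=> zb; rewrite /Defs.beta etaE hE mxE cusp_jfactor //; last exact: targ.
  rewrite cusp_mobius //; last exact: targ.
  rewrite -!mulmxA [X in _ * X]mxE -mulrA /term; congr (_ * _); rewrite mulr_sumr.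
  apply: eq_bigr => j _; rewrite mul_diag_mx !mxE /head_kernel /pull_coord.
  by move: (\sum_j0 _) (Q i j) (v j ^+ _) (pw _ _) => a a1 a2 a3; ring.
exists (base_kernel b' sg%:C (2 / lam) P Q v N dl), (residue_kernel b' sg%:C (2 / lam) P Q v N dl).
split; last first.
  move=> l i s f z zb f0; rewrite /residue_kernel big1 ?mulr0 // => j _.
  rewrite /lead_kernel; have -> : taylor_coef b' sg%:C (2 / lam) P dl f j = fun=> 0.
    apply/funext => k; rewrite /taylor_coef (eq_tc (g := fun y => 0 * y)) ?(ltW dl0) //.
      by rewrite tcZ ?mul0r // => y _; exact: cts_id.
    move=> y /(dl_circle dl0); rewrite subr0 => yd; rewrite mul0r /pull_coord big1 // => j' _.
    have yD := disk_closure (sig_in th01 sigP yd).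
    by rewrite (f0 _ _ yD) mulr0.
  have -> : lead (v j) l (2 * s) (fun=> 0) = 0.
    have := lead_lin (v j) l (2 * s) (fun=> 0) (fun=> 0) (-1).
    have -> : (fun m : nat => -1 * 0 + 0 : R[i]) = fun=> 0.
      by apply/funext => k; rewrite mulr0 addr0.
    by rewrite mulN1r addNr.
  by rewrite !mulr0.
split.
- split=> [k i|l i].
    exact: (kernel_base P Q s2C k00 dl0 dl2 th01 sigP v1 N2 targ maps).
  exact: (kernel_res P Q v k00 dl0 dl2 th01 sigP N2 targ).
- move=> k k' i s f z; exact: (total_kernel_ext P Q k00 dl0 dl2 th01 sigP v1 N2 targ).
- move=> k i s f z _ sk s1 zb.
  rewrite (_ : (fun n => _) = (fun n => \sum_(j < n) term b' sg%:C (2 / lam) P Q v j i s f z)).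
    exact: (total_kernel_cvs P Q k00 dl0 dl2 th01 sigP v1 N2 targ).
  by apply/funext => n; apply: eq_bigr => j _; exact: betaE.
- move=> l s; pose A := [pred j | v j == 1%R].
  pose w (t : 'I_#|A|) z : 'cV[R[i]]_d := \col_i (pw (- (2 * s)) (cusp_coord sg%:C (2 / lam) z) *
    (Q i (enum_val t) * pw (2 * s + l%:R - 1) (shifted (tail_coord sg%:C (2 / lam) N z) 0))).
  exists #|A|, w; split => //.
    move=> t; apply: good_open => z zb i; have tz := targ z zb.
    have -> : (fun z => w t z i 0) = fun z => pw (- (2 * s)) (cusp_coord sg%:C (2 / lam) z) *
      (Q i (enum_val t) * pw (2 * s + l%:R - 1) (shifted (tail_coord sg%:C (2 / lam) N z) 0)).
      by apply/funext => x; rewrite mxE.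
    have cw := cdiff_cusp_coord (2 / lam) tz.
    apply: cdiffM.
      apply: (cdiff_pw (s := fun=> - (2 * s))) => //; first by cd.
      exact/slit_Re/cusp_coord_Re.
    apply: cdiffM; first by cd.
    apply: (cdiff_pw (s := fun=> 2 * s + l%:R - 1)); first by cd.
      by rewrite /shifted; apply: cdiffD; [cd|exact: cdiff_tail_coord].
    exact/slit_Re/(Re_xn_gt0 dl0 dl2)/(tail_coord_wok k00 N2).
  move=> f; exists (fun t => lead_kernel b' sg%:C (2 / lam) P v dl l (enum_val t) s f 0) => z i zb.
  rewrite /residue_kernel (eq_bigl (fun j => j \in A)); last by move=> j; rewrite inE.
  rewrite big_enum_val /= mulr_sumr; apply: eq_bigr => t _; rewrite mxE /lead_kernel.
  by move: (lead _ _ _ _) (Q _ _) (pw _ _) (pw _ _) => a1 a2 a3 a4; ring.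
- have [/existsP[j0 /eqP vj]|] := boolP [exists j, v j == 1].
    right=> l s z zb.
    exact: (residue_nonzero N s2C k00 dl0 th01 sigP PQ l s vj zb).
  rewrite negb_exists => /forallP nv; left => l i s f z; exact: residue_nil.
Qed.
End pack.

(** * The entries of the Hecke transfer operator *)

Section hecke.
Variables (R : realType) (q d : nat) (hq : (3 <= q)%N).
Variables (chi : 'M[R]_2 -> 'M[R[i]]_d) (hchi : unitary_rep q chi).
Variables (E1 Er Eq : disk R) (hE : admissible_disks q E1 Er Eq).
Notation X := (BE d E1 Er Eq).
Notation Dk := (Dk E1 Er Eq).
Notation closed_disk := (closed_disk E1 Er Eq).
Notation kernel := (@kernel R d E1 Er Eq).
Notation lam := (lambda R q).
Implicit Types (f : X) (z s : R[i]) (i j : 'I_d).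

Lemma closure_itv (a b x : R) : a < b -> a <= x <= b ->
  closure [set x%:C | x in `]a, b[%classic] x%:C.
Proof.
move=> ab /andP[ax xb] V /nbhs_ballP[e /= e0 eV].
have eE : e = (complex.Re e)%:C by rewrite RRe_real // gtr0_real.
have er : 0 < complex.Re e by rewrite -ltcR -eE.
pose t := Num.min (1 / 2) (complex.Re e / (2 * (b - a))).
have ba : 0 < b - a by rewrite subr_gt0.
have t0 : 0 < t by rewrite lt_min !divr_gt0 // mulr_gt0.
have t1 : t <= 1 / 2 by rewrite ge_min lexx.
have te : t * (2 * (b - a)) <= complex.Re e.
  by rewrite -ler_pdivlMr ?mulr_gt0 // ge_min lexx orbT.
(* Moving x a little towards the midpoint brings an endpoint into the open interval. *)
pose y := x + t * ((a + b) / 2 - x).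
exists y%:C; split.
  by exists y => //=; rewrite in_itv /=; apply/andP; split; rewrite /y; nra.
apply: eV; rewrite -ball_normE /= nmE eE ltcR -rmorphB nmR /y ltr_norml.
by apply/andP; split; nra.
Qed.

Lemma xlam_lt1 : -1 < xlam R q < 1.
Proof.
have l0 := lambda_gt0 R hq; rewrite /xlam ltr_pdivlMr ?ltr_pdivrMr; lra.
Qed.

Lemma real_in_E1 (x : R) : xlam R q <= x <= 1 -> disk_set E1 x%:C.
Proof.
by move=> h; apply: (adm_E1 hE); apply: closure_itv h; have /andP[] := xlam_lt1.
Qed.

Lemma real_in_Eq (x : R) : -1 <= x <= - xlam R q -> disk_set Eq x%:C.
Proof.
by move=> h; apply: (adm_Eq hE); apply: closure_itv h; have /andP[] := xlam_lt1; lra.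
Qed.

Definition base_point b : R := match b with I1 => x_1 R q | Ir => x_r R | Iq => x_q R q end.

(** For q = 3 the middle interval is empty, hence the condition; the middle sum, for which this is
    used, is then empty too. *)
Lemma base_point_in b : (b = Ir -> (4 <= q)%N) -> disk_set (Dk b) (base_point b)%:C.
Proof.
have l0 := lambda_gt0 R hq; have l1 : 0 < lam + 1 by lra.
case: b => /= h.
- apply: real_in_E1; rewrite /xlam /x_1 ler_pM2r ?invr_gt0 // ler_pdivrMr //.
  by apply/andP; split; lra.
- apply: (adm_Er hE); have l2 := lambda_gt1 R hq (h erefl).
  have x0 : 0 < xlam R q by rewrite divr_gt0 // subr_gt0.
  by apply: closure_itv; rewrite /x_r; [|apply/andP; split]; lra.
- apply: real_in_Eq; rewrite /xlam /x_q !lerN2 ler_pM2r ?invr_gt0 // ler_pdivrMr //.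
  by apply/andP; split; lra.
Qed.

Lemma closure_segment b (x z : R[i]) (t : R) : disk_set (Dk b) x -> closed_disk b z -> 0 < t -> t <= 1 ->
  closed_disk b ((1 - t)%:C * x + t%:C * z).
Proof.
move=> xD zb t0; rewrite le_eqVlt => /orP[/eqP ->|t1].
  by rewrite subrr mul0r mul1r add0r.
apply/disk_closure/disk_setE; move/disk_setE: xD => xD; have zD := closure_ball_le zb.
set c := Defs.center _ in xD zD *.
have -> : (1 - t)%:C * x + t%:C * z - c = (1 - t)%:C * (x - c) + t%:C * (z - c).
  by rewrite rmorphB rmorph1; ring.
apply: le_lt_trans (nmD _ _) _; rewrite !nmM !nmRp; [|lra|lra].
set r := Defs.radius _ in xD zD *.
have h1 : (1 - t) * nm (x - c) < (1 - t) * r by rewrite ltr_pM2l // subr_gt0.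
have h2 : t * nm (z - c) <= t * r by rewrite ler_wpM2l // ltW.
lra.
Qed.

(* A value in ]-oo, 0] at [z] would make the denominator vanish on the segment
   from [x0] to [z]. *)
Lemma slit_den b (g : 'M[R]_2) (x0 : R) : (forall z, closed_disk b z -> mobius_den g z != 0) ->
  disk_set (Dk b) x0%:C -> forall z, closed_disk b z ->
  slit ((Num.sg (g 1 0 * x0 + g 1 1))%:C * mobius_den g z).
Proof.
move=> den xD z zb; set A := g 1 0 * x0 + g 1 1; set v := _ * _.
have dA : mobius_den g x0%:C = A%:C by rewrite /mobius_den /A rmorphD rmorphM.
have A0 : A != 0.
  by have := den _ (disk_closure xD); rewrite dA; apply: contra_neq => ->.
have A1 : 0 < `|A| by rewrite normr_gt0.
rewrite /slit ltNge; apply/negP => sv.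
have vE : v = (complex.Re v)%:C /\ complex.Re v <= 0.
  have n0 := nm_ge0 v; have n1 := nmsqr v; split; last lra.
  have : complex.Im v = 0 by apply/eqP; rewrite -sqrf_eq0; apply/eqP; nra.
  by case: (v) => a b' /= ->.
case: vE => vE v0.
(* The zero of the affine function (1 - t) |A| + t Re v. *)
pose t := `|A| / (`|A| - complex.Re v).
have d0 : 0 < `|A| - complex.Re v by lra.
have t0 : 0 < t by rewrite divr_gt0.
have t1 : t <= 1 by rewrite ler_pdivrMr //; lra.
have := den _ (closure_segment xD zb t0 t1).
have -> : mobius_den g ((1 - t)%:C * x0%:C + t%:C * z) =
    (1 - t)%:C * mobius_den g x0%:C + t%:C * mobius_den g z.
  by rewrite /mobius_den rmorphB rmorph1; ring.
move/negP; apply; have s0 : (Num.sg A)%:C != 0 :> R[i].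
  by rewrite -(rmorph0 (real_complex R)) (inj_eq (@complexI R)) sgr_eq0.
rewrite -(inj_eq (mulfI s0)) mulr0 mulrDr mulrCA dA -rmorphM -normrEsg.
rewrite [X in _ + X]mulrCA -/v vE -!rmorphM -rmorphD -(rmorph0 (real_complex R)).
apply/eqP; congr (_%:C); rewrite /t; field; rewrite gt_eqF //.
Qed.

Lemma cdiff_den (g : 'M[R]_2) z : cdiff (mobius_den g) z.
Proof. by rewrite /mobius_den; cd. Qed.

Lemma kernel_mid b i :
  kernel b setT (fun s f z => mid_sum q chi (base_point b) s (cmp f Ir) z i 0).
Proof.
(* The range is repeated as a predicate, so that the bounds on k are at hand for each summand. *)
have -> : (fun s f z => mid_sum q chi (base_point b) s (cmp f Ir) z i 0) = (fun s f z =>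
   \sum_(2 <= k < q - 1 | (2 <= k < q - 1)%N && true)
     pw (2 * s) ((Num.sg ((helt R q k)^-1 1 0 * base_point b + (helt R q k)^-1 1 1))%:C *
       mobius_den (helt R q k)^-1 z) *
     \sum_j Defs.eta chi (helt R q k)^-1 i j * cmp f Ir (mobius (helt R q k)^-1 z) j 0).
  apply/funext => s; apply/funext => f; apply/funext => z.
  rewrite -big_nat_cond /mid_sum summxE; apply: eq_bigr => k _.
  by rewrite /Defs.beta !mxE /jfactor /cpow mulNr.
apply: kernel_sum => k; rewrite andbT => /andP[k2 kq].
have kq2 : (2 <= k <= q - 2)%N by rewrite k2 -ltnS -subSn ?subSS // ltnW.
set g := (helt R q k)^-1.
have gm : mobius_maps g (closed_disk b) (disk_set Er).
  have [h1 h2 h3] := adm_middle hE kq2.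
  by clear -h1 h2 h3; case: b; [exact: h1|exact: h2|exact: h3].
have xD : disk_set (Dk b) (base_point b)%:C by apply: base_point_in => _; move: (leq_ltn_trans k2 kq); rewrite ltn_subRL.
apply: (kernelM (c := fun s z => pw (2 * s) ((Num.sg (g 1 0 * base_point b + g 1 1))%:C * mobius_den g z))
  (K := fun s f z => \sum_j Defs.eta chi g i j * cmp f Ir (mobius g z) j 0)).
  apply: (coef_pw (k := fun s => 2 * s)
    (x := fun z => (Num.sg (g 1 0 * base_point b + g 1 1))%:C * mobius_den g z)) => [s _|z zb].
    by cd.
  split; first by apply: cdiffM; [cd|exact: cdiff_den].
  by apply: (slit_den (b := b)) => // z' /gm[].
apply: kernel_sum => j _; apply: kernelZ.
apply: (@kernel_comp R d E1 Er Eq b Ir setT (mobius g) j) => z zb.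
have [den mD] := gm z zb; split => //.
by rewrite /mobius; apply: cdiffM; [cd|apply: cdiffV => //; exact: cdiff_den].
Qed.

(** [true] stands for the cusp 1, with h_1 acting on f_1, and [false] for the cusp -1, with h_{q-1}
    acting on f_{q-1}. *)
Definition src (c : bool) := if c then I1 else Iq.
Definition hcusp (c : bool) := if c then helt R q 1 else helt R q (q - 1)%N.

Lemma pack_ex (c : bool) b : exists B Res,
  cusp_pack (E1 := E1) (Er := Er) (Eq := Eq) chi (src c) b (base_point b) (hcusp c) (sd q chi) B Res /\
  (sameix (src c) b -> forall k i s f z, B k i s f z = 0 /\ Res k i s f z = 0).
Proof.
have [/sameixP <-|cb] := boolP (sameix (src c) b).
  by exists (fun _ _ _ _ _ => 0), (fun _ _ _ _ _ => 0); split => //; exact: zero_pack.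
suff [B [Res H]] : exists B Res, cusp_pack (E1 := E1) (Er := Er) (Eq := Eq) chi
    (src c) b (base_point b) (hcusp c) (sd q chi) B Res.
  by exists B, Res; split => // h; move: cb; rewrite h.
have l0 := lambda_gt0 R hq; have l1 : 0 < lam + 1 by lra.
have xq : 0 < lam / (lam + 1) by rewrite divr_gt0.
have Re1B (z : R[i]) : complex.Re (1 - z) = 1 - complex.Re z by rewrite raddfB.
case: c cb => /= cb.
- have [P [Q [v [[QP PQ] etaE v1 vm]]]] := spectral_cusp hq hchi (k := 1) (mem_head _ _).
  apply: (@cusp_pack_ex R d E1 Er Eq chi I1 b 1 lam (-1) (base_point b) (helt R q 1) P Q v) => //.
  + by rewrite mulr1.
  + by rewrite mulrNN mulr1.
  + by move=> n; rewrite helt1_pow /cusp_mx /mP mul1r.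
  + by apply: real_in_E1; have /andP[_ h] := xlam_lt1; rewrite lexx ltW.
  + move=> z zb; rewrite rmorph1 mul1r Re1B subr_gt0.
    case: b cb zb => // _ zb; last exact: (adm_Re_Eq hE).
    by have /andP[] := adm_Re_Er hE zb.
  + by rewrite mul1r; case: b cb => //= _; rewrite /x_r /x_q; lra.
  + move=> n z zb; have [h1 h2] := adm_cusp1 hE (ltn0Sn n).
    by case: b cb zb => // _ zb; [have [] := h1 z zb|have [] := h2 z zb].
- have [P [Q [v [[QP PQ] etaE v1 vm]]]] := spectral_cusp hq hchi (k := (q - 1)%N)
    ltac:(by rewrite !inE eqxx orbT).
  have [e e2 hE'] := heltq_pow R hq.
  apply: (@cusp_pack_ex R d E1 Er Eq chi Iq b (-1) lam e (base_point b) (helt R q (q - 1)%N) P Q v) => //.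
  + by rewrite mulrNN mulr1.
  + by move=> n; rewrite hE' /cusp_mx /mQ mulN1r opprK.
  + by apply: real_in_Eq; have /andP[_ h] := xlam_lt1; rewrite lexx; lra.
  + move=> z zb; rewrite rmorphN1 mulN1r opprK raddfD /=.
    suff : -1 < complex.Re z by lra.
    case: b cb zb => // _ zb; first exact: (adm_Re_E1 hE).
    by have /andP[] := adm_Re_Er hE zb.
  + by rewrite mulN1r opprK; case: b cb => //= _; rewrite /x_r /x_1; lra.
  + move=> n z zb; have [h1 h2] := adm_cuspq hE (ltn0Sn n).
    by case: b cb zb => // _ zb; [have [] := h1 z zb|have [] := h2 z zb].
Qed.
End hecke.

(** * Poles and finite rank *)

Section poles_and_rank.
Variables (R : realType) (d : nat) (E1 Er Eq : disk R).
Notation X := (BE d E1 Er Eq).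
Notation Dk := (Dk E1 Er Eq).
Notation closed_disk := (closed_disk E1 Er Eq).
Implicit Types (f x : X) (z s h : R[i]) (F G : R[i] -> {linear X -> X}).

Lemma nrmZ (a : R[i]) f : nrm (a *: f) = nm a * nrm f.
Proof. by apply: (@complexI R); rewrite -nrmE normrZ nmE nrmE rmorphM. Qed.

Lemma nrmD f x : nrm (f + x) <= nrm f + nrm x.
Proof.
have E : (nrm f + nrm x)%:C = (nrm f)%:C + (nrm x)%:C by exact: (rmorphD (real_complex R)).
have H := @ler_normD R[i] X f x.
rewrite -lecR E.
rewrite !nrmE in H.
exact: H.
Qed.

Lemma nrm_eq0 f : nrm f = 0 -> f = 0.
Proof.
move=> h; have E : `|f| = 0 by rewrite nrmE h.
by apply: normr0_eq0 E.
Qed.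

Lemma nrmB f x : nrm (f - x) = nrm (x - f).
Proof. by have := @distrC R[i] X f x; rewrite !nrmE => /complexI. Qed.

Lemma op_lipschitz F s0 x : op_derivable F s0 -> exists K r : R, [/\ 0 <= K, 0 < r &
  forall h, h != 0 -> nm h < r -> nrm (F (s0 + h) x - F s0 x) <= K * nm h].
Proof.
move=> [D _ /(_ 1 ltr01)/nbhs_ballP[e /= e0 eP]].
have eE : e = (complex.Re e)%:C by rewrite RRe_real // gtr0_real.
exists (nrm x + nrm (D x)), (complex.Re e); split.
- by rewrite addr_ge0 ?nrm_ge0.
- by rewrite -ltcR -eE.
move=> h h0 hr; have := eP h; rewrite -ball_normE /= sub0r normrN nmE eE ltcR.
move=> /(_ hr h0 x); rewrite !nrmE -rmorphM lecR mul1r => H.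
have -> : F (s0 + h) x - F s0 x = h *: ((h^-1 *: (F (s0 + h) x - F s0 x) - D x) + D x).
  by rewrite subrK scalerA divff // scale1r.
rewrite nrmZ mulrC; apply: ler_wpM2r; first exact: nm_ge0.
by apply: le_trans (nrmD _ _) _; rewrite lerD2r; exact: H.
Qed.

Lemma lipschitz_step (a b c K1 K2 t : R) : b <= t * (c + K1 * t) -> a <= b + K2 * t ->
  t * (K1 * t) <= K1 * t -> a <= (c + K1 + K2) * t.
Proof.
rewrite mulrDr !mulrDl [c * t]mulrC; move: (K1 * t) => y.
by move=> h1 h2 h3; lra.
Qed.

(** If F is holomorphic at s0, then (s - s0)^m F tends to 0 along s = s0 + t, so G s0 would vanish
    on every vector. It allows the two cases of [pole_cases] to be told apart by [is_pole]. *)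
Lemma not_pole (U : set R[i]) F s0 : U s0 -> op_holomorphic U F -> ~ is_pole F s0.
Proof.
move=> Us [_ hF] [[//|m] _ [V [G [Vs [oV hG] [x Gx] FG]]]]; apply: Gx; apply: nrm_eq0.
have [_ /(op_lipschitz x)[K [r [K0 r0 KP]]]] := hF s0 Us.
have [_ /(op_lipschitz x)[K' [r' [K'0 r'0 K'P]]]] := hG s0 Vs.
have [r2 r20 r2V] : exists2 r : R, 0 < r & forall s, nm (s - s0) < r -> V s.
  have /nbhs_ballP[e /= e0 eV] : nbhs s0 V by apply: open_nbhs_nbhs.
  have eE : e = (complex.Re e)%:C by rewrite RRe_real // gtr0_real.
  exists (complex.Re e); first by rewrite -ltcR -eE.
  by move=> s ss; apply: eV; rewrite -ball_normE /= nmE eE ltcR nmB.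
pose C := nrm (F s0 x) + K + K'.
have C0 : 0 <= C by rewrite !addr_ge0 ?nrm_ge0.
have H (t : R) : 0 < t -> t < 1 -> t < r -> t < r' -> t < r2 -> nrm (G s0 x) <= C * t.
  move=> t0 t1 tr tr' tr2; have tn : nm t%:C = t by rewrite nmRp // ltW.
  have th0 : t%:C != 0 by rewrite -nm_eq0 tn gt_eqF.
  have e1 := KP t%:C th0; have e2 := K'P t%:C th0; rewrite tn in e1 e2.
  have {}e1 := e1 tr; have {}e2 := e2 tr'.
  have Vt : V (s0 + t%:C) by apply: r2V; rewrite addrC addKr tn.
  have GE : G (s0 + t%:C) x = t%:C ^+ m.+1 *: F (s0 + t%:C) x.
    rewrite FG //; last by rewrite -subr_eq0 [s0 + _]addrC addrK.
    have E : s0 + t%:C - s0 = t%:C by ring.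
    by rewrite E scalerA divff ?scale1r // expf_neq0.
  have n1 : nrm (F (s0 + t%:C) x) <= nrm (F s0 x) + K * t.
    rewrite -[X in nrm X](subrK (F s0 x)); apply: le_trans (nrmD _ _) _.
    by rewrite [leRHS]addrC lerD2r; exact: e1.
  have n2 : nrm (G (s0 + t%:C) x) <= t * (nrm (F s0 x) + K * t).
    rewrite GE nrmZ nmX tn exprS -mulrA ler_pM2l // -[leRHS]mul1r.
    by apply: ler_pM; rewrite ?nrm_ge0 ?exprn_ge0 ?exprn_ile1 // ltW.
  have n3 : nrm (G s0 x) <= nrm (G (s0 + t%:C) x) + K' * t.
    rewrite -[X in nrm X](subrK (G (s0 + t%:C) x)); apply: le_trans (nrmD _ _) _.
    by rewrite [leRHS]addrC lerD2r nrmB; exact: e2.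
  have n4 : t * (K * t) <= K * t.
    by rewrite ler_piMl ?mulr_ge0 // ltW.
  exact: lipschitz_step n2 n3 n4.
apply/eqP; rewrite eq_le nrm_ge0 andbT; apply/ler_addgt0Pl => e e0; rewrite addr0.
pose t := Num.min (Num.min (1 / 2) (e / (C + 1))) (Num.min (r / 2) (Num.min (r' / 2) (r2 / 2))).
have t0 : 0 < t by rewrite !lt_min !divr_gt0 // ltr_wpDl.
have h1 : t <= 1 / 2 by rewrite /t !ge_min lexx.
have h2 : t <= e / (C + 1) by rewrite /t !ge_min lexx !orbT.
have h3 : t <= r / 2 by rewrite /t !ge_min lexx !orbT.
have h4 : t <= r' / 2 by rewrite /t !ge_min lexx !orbT.
have h5 : t <= r2 / 2 by rewrite /t !ge_min lexx !orbT.
have C1 : 0 < C + 1 by rewrite ltr_wpDl.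
apply: (@le_trans _ _ (C * t)); first by apply: H; lra.
by move: h2; rewrite ler_pdivlMr //; lra.
Qed.

(** [rank_le] for plain maps: the blocks of a residue are built pointwise, without a proof of
    linearity. *)
Definition finite_rank m (A : X -> X) := exists e : 'I_m -> X, forall f, exists c : 'I_m -> R[i],
  A f = \sum_(i < m) c i *: e i.

Lemma finite_rankD m n A B : finite_rank m A -> finite_rank n B -> finite_rank (m + n) (fun f => A f + B f).
Proof.
move=> [e eP] [e' e'P]; exists (fun i => match fintype.split i with inl j => e j | inr j => e' j end).
move=> f; have [c ->] := eP f; have [c' ->] := e'P f.
exists (fun i => match fintype.split i with inl j => c j | inr j => c' j end).
rewrite big_split_ord /=; congr (_ + _); apply: eq_bigr => i _.
  by rewrite -[lshift _ _]/(unsplit (inl i)) unsplitK.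
by rewrite -[rshift _ _]/(unsplit (inr i)) unsplitK.
Qed.

Lemma finite_rank_mono m n A : (m <= n)%N -> finite_rank m A -> finite_rank n A.
Proof.
move=> mn; rewrite -(subnKC mn) => H.
have -> : A = fun f => A f + 0 by apply/funext => f; rewrite addr0.
apply: finite_rankD => //; exists (fun=> 0) => f; exists (fun=> 0).
by rewrite big1 // => i _; rewrite scale0r.
Qed.

Lemma emb_good b (g : R[i] -> 'cV[R[i]]_d) : good (Dk b) g ->
  exists e : X, forall b' z i, closed_disk b' z -> cmp e b' z i 0 = if sameix b b' then g z i 0 else 0.
Proof.
move=> gg; pose G b' := if sameix b b' then g else fun=> 0.
have GG b' : good (Dk b') (G b').
  rewrite /G; case: ifP => [/sameixP <- //|_]; apply: good_open => z _ i.
  exact: cdiff_cst.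
pose h b' := sval (cid (holo_ex (GG b'))).
exists (mkBE h) => b' z i zb; rewrite cmp_mk /h; case: cid => /= k ->//.
by rewrite /G; case: ifP => // _; rewrite mxE.
Qed.

Lemma low_rank_finite m b (a : R[i]) Res s (A : X -> X) :
  low_rank m b Res s ->
  (forall f b' z i, closed_disk b' z -> cmp (A f) b' z i 0 = if sameix b b' then a * Res i s f z else 0) ->
  finite_rank m A.
Proof.
move=> [n [w [nm_ wg wR]]] AE; apply: finite_rank_mono nm_ _.
pose e t := sval (cid (emb_good (wg t))).
have eE t b' z i : closed_disk b' z -> cmp (e t) b' z i 0 = if sameix b b' then w t z i 0 else 0.
  by rewrite /e; case: cid => /= k; apply.
exists e => f; have [c cE] := wR f; exists (fun t => a * c t).
apply: BE_eq => b' z zb; apply/colP => i; rewrite AE // cmp_sum.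
have bb1 : sameix b b by case: (b).
case: ifP => [/sameixP bb|nb].
  subst b'; rewrite (cE _ _ zb) mulr_sumr; apply: eq_bigr => t _.
  by rewrite cmpZ (eE _ _ _ _ zb) bb1 mulrA.
by rewrite big1 // => t _; rewrite cmpZ (eE _ _ _ _ zb) nb mulr0.
Qed.
End poles_and_rank.

(** * Assembly of the operator, its poles and residues *)

Section assembly.
Variables (R : realType) (q d : nat) (hq : (3 <= q)%N).
Variables (chi : 'M[R]_2 -> 'M[R[i]]_d).
Variables (E1 Er Eq : disk R) (hE : admissible_disks q E1 Er Eq).
Notation X := (BE d E1 Er Eq).
Notation Dk := (Dk E1 Er Eq).
Notation closed_disk := (closed_disk E1 Er Eq).
Notation kernel := (@kernel R d E1 Er Eq).
Notation kern := (R[i] -> X -> R[i] -> R[i]).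
Implicit Types (f : X) (z s : R[i]) (i j : 'I_d) (U : set R[i]).

Variables B Res : bool -> ix -> nat -> 'I_d -> kern.
Hypothesis packs : forall c b,
  cusp_pack chi (src c) b (base_point R q b) (hcusp R q c) (sd q chi) (B c b) (Res c b) /\
  (sameix (src c) b -> forall k i s f z, B c b k i s f z = 0 /\ Res c b k i s f z = 0).

Definition base_part b k i : kern := fun s f z =>
  mid_sum q chi (base_point R q b) s (cmp f Ir) z i 0 + (B true b k i s f z + B false b k i s f z).
Definition residue_part b l i : kern := fun s f z => Res true b l i s f z + Res false b l i s f z.
(** One shape for all the families needed: the transfer operator itself, the two parts of its
    decomposition at a pole, and its product with s - s0. *)
Definition family_kernel b k (a : R[i] -> R[i]) (kap : nat -> R[i] -> R[i]) i : kern := fun s f z =>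
  a s * base_part b k i s f z + \sum_(l < k) kap l s * residue_part b l i s f z.

Lemma open_nm U : (forall s, U s -> exists2 r : R, 0 < r & forall s', nm (s' - s) < r -> U s') ->
  open U.
Proof.
move=> H; rewrite openE => s /H[r r0 rP]; apply/nbhs_ballP; exists r%:C => /=; first by rewrite ltcR.
by move=> s'; rewrite -ball_normE /= nmE ltcR nmB; exact: rP.
Qed.

Lemma open_halfplane k : open (@halfplane R k).
Proof. by apply: open_nm => s; exact: halfplane_ball. Qed.

Lemma open_disk s0 (r : R) : open [set s | nm (s - s0) < r].
Proof. by apply: open_nm => s /=; exact: subball. Qed.

Lemma fam_ex k a kap U : open U -> (forall s, U s -> halfplane k s) ->
  (forall s, U s -> cdiff a s) -> (forall l s, (l < k)%N -> U s -> cdiff (kap l) s) ->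
  exists F : R[i] -> {linear X -> X},
    [/\ forall s f b z i, U s -> closed_disk b z -> cmp (F s f) b z i 0 = family_kernel b k a kap i s f z,
        op_holomorphic U F & forall s, U s -> nuclear_order0 (F s) /\ continuous (F s)].
Proof.
move=> oU Uk da dk.
have kT b i : kernel b U (family_kernel b k a kap i).
  have P c := (packs c b).1.1.
  apply: kernelD.
    apply: (kernelM (c := fun s _ => a s)); first exact: coef_s.
    apply: kernelD; first exact: (kernel_sub (U := setT)) (kernel_mid hq chi hE b i).
    apply: kernelD; apply: kernel_sub Uk _.
      by have [[h _] _ _ _ _] := P true; exact: h.
    by have [[h _] _ _ _ _] := P false; exact: h.
  apply: kernel_sum => l _; apply: (kernelM (c := fun s _ => kap l s)).
    by apply: coef_s => s; apply: dk.
  apply: (kernel_sub (U := setT)) => //; apply: kernelD.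
    by have [[_ h] _ _ _ _] := P true; exact: h.
  by have [[_ h] _ _ _ _] := P false; exact: h.
have kT' b i : kernel b U (fun s f z => (\col_i family_kernel b k a kap i s f z : 'cV[R[i]]_d) i 0).
  have -> : (fun s f z => (\col_i family_kernel b k a kap i s f z : 'cV[R[i]]_d) i 0) = family_kernel b k a kap i.
    by apply/funext => s; apply/funext => f; apply/funext => z; rewrite mxE.
  exact: kT.
have [F [FE hF nF]] := kernel_op oU kT'.
by exists F; split => // s f b z i Us zb; rewrite FE // mxE.
Qed.

Lemma halfplane_ex s : exists k, halfplane k s.
Proof.
exists (Num.bound `|2 - complex.Re (2 * s)|); rewrite /halfplane /=.
have := archi_boundP (normr_ge0 (2 - complex.Re (2 * s))).
by have := ler_norm (2 - complex.Re (2 * s)); lra.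
Qed.

Notation poles := (fun l s => pole_factor (2 * s) l).
Notation one := (fun=> 1).

Lemma family_kernel_total b k i s f z : family_kernel b k one poles i s f z =
  mid_sum q chi (base_point R q b) s (cmp f Ir) z i 0 +
  (pack_total (B true b) (Res true b) k i s f z + pack_total (B false b) (Res false b) k i s f z).
Proof.
rewrite /family_kernel /base_part /residue_part /pack_total mul1r.
under eq_bigr => l _ do rewrite mulrDr.
by rewrite big_split /= -!addrA; congr (_ + (_ + _)); rewrite addrCA.
Qed.

Lemma family_kernel_ext b k m i s f z : halfplane k s -> closed_disk b z -> (k <= m)%N ->
  family_kernel b m one poles i s f z = family_kernel b k one poles i s f z.
Proof.
move=> ks zb km; rewrite !family_kernel_total.
have [_ h1 _ _ _] := (packs true b).1.1; have [_ h2 _ _ _] := (packs false b).1.1.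
by rewrite (h1 k m) // (h2 k m).
Qed.

Lemma transfer_ex s : exists L : {linear X -> X},
  (forall k f b z i, halfplane k s -> closed_disk b z -> cmp (L f) b z i 0 = family_kernel b k one poles i s f z) /\
  nuclear_order0 L /\ continuous L.
Proof.
have [k ks] := halfplane_ex s.
(* The pole factors are frozen at the given s, so the family exists and only its member at s is
   used, even if s is a pole. *)
have [F [FE _ nF]] := @fam_ex k one (fun l _ => pole_factor (2 * s) l) (@halfplane R k) (@open_halfplane k)
  (fun _ h => h) (fun s _ => cdiff_cst 1 s) (fun l s' _ _ => cdiff_cst (pole_factor (2 * s) l) s').
exists (F s); split; last exact: nF.
move=> m f b z i ms zb; rewrite FE //.
have -> : family_kernel b k one (fun l _ => pole_factor (2 * s) l) i s f z = family_kernel b k one poles i s f z by [].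
by case: (leqP k m) => [km|/ltnW mk]; [rewrite (family_kernel_ext i f ks zb km)|rewrite (family_kernel_ext i f ms zb mk)].
Qed.

Lemma near_poles k s0 : halfplane k s0 -> exists2 r : R, 0 < r & forall s, nm (s - s0) < r ->
  halfplane k s /\ forall l, (l < k)%N -> 2 * s0 + l%:R - 1 != 0 -> 2 * s + l%:R - 1 != 0.
Proof.
move=> /halfplane_ball[r1 r10 r1P].
pose t (l : 'I_k) : R := if 2 * s0 + l%:R - 1 == 0 then 1 else nm (2 * s0 + l%:R - 1) / 4.
have t0 l : 0 < t l by rewrite /t; case: ifPn => // h; rewrite divr_gt0 // nm_gt0.
exists (Num.min r1 (\big[Num.min/1]_l t l)); first by rewrite lt_min r10; apply/bigmin_gtP.
move=> s; rewrite lt_min => /andP[/r1P sk /bigmin_gtP[_ st]]; split => // l lk h.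
have := st (Ordinal lk) isT; rewrite /t /= (negbTE h) => sl.
apply: contraTneq isT => E; have E2 : 2 * s0 + l%:R - 1 = - (2 * (s - s0)).
  by apply/eqP; rewrite -subr_eq0 -E; apply/eqP; ring.
move: sl h; rewrite E2 nmN nmM nmn -nm_gt0 nmN nmM nmn; have := nm_ge0 (s - s0); lra.
Qed.

Section family.
Variable L : R[i] -> {linear X -> X}.
Hypothesis LE : forall s k f b z i, halfplane k s -> closed_disk b z ->
  cmp (L s f) b z i 0 = family_kernel b k one poles i s f z.

(** For Re s > 1/2 the exponent 2 s has real part more than 1, where the cusp series converge to the
    continued formula. *)
Lemma transfer_op s : 1 / 2 < complex.Re s -> is_transfer_op q chi s (L s).
Proof.
move=> s12; have s1 : 1 < complex.Re (2 * s) by rewrite Re2; lra.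
have [k ks] := halfplane_ex s.
have lim c b f z : ~~ sameix (src c) b -> closed_disk b z ->
    cusp_series chi (base_point R q b) s (hcusp R q c) (cmp f (src c)) z @ \oo -->
      (\col_i pack_total (B c b) (Res c b) k i s f z : 'cV[R[i]]_d).
  move=> cb zb; apply/cvgrPdist_le => e e0.
  have eE : e = (complex.Re e)%:C by rewrite RRe_real // gtr0_real.
  have er : 0 < complex.Re e by rewrite -ltcR -eE.
  have [_ _ H _ _] := (packs c b).1.1.
  have : \forall n \near \oo, forall i, nm (\sum_(j < n) Defs.beta chi (base_point R q b) s
      (hcusp R q c ^+ j.+1) (cmp f (src c)) z i 0 - pack_total (B c b) (Res c b) k i s f z) <= complex.Re e.
    apply: filter_forall => i; have [N NP] := H k i s f z cb ks s1 zb _ er.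
    by exists N => // n /= /NP.
  apply: filterS => n h; rewrite eE; apply: norm_le_nm => [|i]; first exact: ltW.
  rewrite !mxE nmB /cusp_series /series /= summxE big_mkord; exact: h.
have limP c b f z : ~~ sameix (src c) b -> closed_disk b z ->
    cvgn (cusp_series chi (base_point R q b) s (hcusp R q c) (cmp f (src c)) z) /\
    cusp_sum chi (base_point R q b) s (hcusp R q c) (cmp f (src c)) z =
      \col_i pack_total (B c b) (Res c b) k i s f z.
  move=> cb zb; have h := lim c b f z cb zb; split; first by apply/cvg_ex; eexists; exact: h.
  exact: cvg_lim h.
have zeroP c b i f z : sameix (src c) b -> pack_total (B c b) (Res c b) k i s f z = 0.
  move=> cb; have h := (packs c b).2 cb; rewrite /pack_total (h _ _ _ _ _).1 add0r big1 // => l _.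
  by rewrite (h _ _ _ _ _).2 mulr0.
have LV b f z : closed_disk b z -> cmp (L s f) b z = mid_sum q chi (base_point R q b) s (cmp f Ir) z +
   (\col_i pack_total (B true b) (Res true b) k i s f z + \col_i pack_total (B false b) (Res false b) k i s f z).
  by move=> zb; apply/colP => i; rewrite (LE _ _ ks zb) family_kernel_total !mxE.
have col0 : \col_(i < d) 0 = 0 :> 'cV[R[i]]_d by apply/colP => i; rewrite !mxE.
move=> f; have L1 := LV I1 f; have L2 := LV Ir f; have L3 := LV Iq f.
have a1 z := limP false I1 f z isT; have a2 z := limP true Ir f z isT.
have a3 z := limP false Ir f z isT; have a4 z := limP true Iq f z isT.
have z1 z : (\col_i pack_total (B true I1) (Res true I1) k i s f z : 'cV[R[i]]_d) = 0.
  by rewrite -col0; apply/colP => i; rewrite !mxE zeroP.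
have z2 z : (\col_i pack_total (B false Iq) (Res false Iq) k i s f z : 'cV[R[i]]_d) = 0.
  by rewrite -col0; apply/colP => i; rewrite !mxE zeroP.
move: L1 L2 L3 a1 a2 a3 a4 z1 z2; clear -s12.
case: (L s f) => [[g1 gr] gq]; case: f => [[f1 fr] fq] /= L1 L2 L3 a1 a2 a3 a4 z1 z2; split.
- move=> z zb; have [h1 h2] := a1 z zb; split; first exact: h1.
  by rewrite (L1 z zb) h2 z1 add0r.
- move=> z zb; have [h1 h2] := a2 z zb; have [h3 h4] := a3 z zb; split; [exact: h1|exact: h3|].
  by rewrite (L2 z zb) h2 h4 addrA [X in X + _]addrC.
- move=> z zb; have [h1 h2] := a4 z zb; split; first exact: h1.
  by rewrite (L3 z zb) h2 z2 addr0 addrC.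
Qed.

Lemma holomorphic_point k s0 : halfplane k s0 ->
  (forall l, (l < k)%N -> 2 * s0 + l%:R - 1 != 0) \/ (forall b l i s f z, residue_part b l i s f z = 0) ->
  exists2 U, U s0 & op_holomorphic U L.
Proof.
move=> ks H; have [r r0 rP] := near_poles ks.
(* If all residue parts vanish, a singular factor may be replaced by 0; otherwise none of them is
   singular at s0. *)
pose kap l s := if 2 * s0 + l%:R - 1 == 0 then 0 else pole_factor (2 * s) l.
have [F [FE hF _]] := @fam_ex k one kap [set s | nm (s - s0) < r] (@open_disk s0 r)
  (fun s h => (rP s h).1) (fun s _ => cdiff_cst 1 s) (fun l s lk h => ltac:(
    rewrite /kap; case: eqVneq => [_|n0]; [cd|
    rewrite /pole_factor; apply: cdiffV; [cd|exact: (rP s h).2 l lk n0]])).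
exists [set s | nm (s - s0) < r]; first by rewrite /= subrr nm0.
apply: op_holomorphic_eq hF => s f sr; apply: BE_eq => b z zb; apply/colP => i.
rewrite FE // (LE _ _ (rP s sr).1 zb) /family_kernel; congr (_ + _); apply: eq_bigr => l _.
case: H => [H|H]; last by rewrite H !mulr0.
by rewrite /kap (negbTE (H l _)).
Qed.

(** The factor 1/2 turns the residue in the variable 2 s into that in s. The four summands are the
    cusp entries off the diagonal, each of rank at most [sd q chi]. *)
Lemma rank_residue (j0 : nat) s (A : X -> X) :
  (forall f b z i, closed_disk b z -> cmp (A f) b z i 0 = 1 / 2 * residue_part b j0 i s f z) ->
  finite_rank (4 * sd q chi) A.
Proof.
move=> AE.
have FX c b : exists F : X -> X, forall f b' z i, closed_disk b' z ->
    cmp (F f) b' z i 0 = if sameix b b' then 1 / 2 * Res c b j0 i s f z else 0.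
  have H f : exists e : X, forall b' z i, closed_disk b' z ->
      cmp e b' z i 0 = if sameix b b' then 1 / 2 * Res c b j0 i s f z else 0.
    have [|e eE] := @emb_good R d E1 Er Eq b (fun z => \col_i (1 / 2 * Res c b j0 i s f z)).
      apply: good_open => z zb i; have [[_ h] _ _ _ _] := (packs c b).1.1.
      have [_ dz _ _] := h j0 i.
      have -> : (fun z => (\col_i (1 / 2 * Res c b j0 i s f z) : 'cV[R[i]]_d) i 0) =
        fun z => 1 / 2 * Res c b j0 i s f z by apply/funext => x; rewrite mxE.
      by apply: cdiffM; [cd|exact: dz].
    by exists e => b' z i zb; rewrite eE // mxE.
  by exists (fun f => sval (cid (H f))) => f; case: cid.
pose F c b := sval (cid (FX c b)).
have FE c b f b' z i : closed_disk b' z ->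
    cmp (F c b f) b' z i 0 = if sameix b b' then 1 / 2 * Res c b j0 i s f z else 0.
  by rewrite /F; case: cid => /= G; apply.
have rF c b : finite_rank (sd q chi) (F c b).
  have [_ _ _ h _] := (packs c b).1.1.
  exact: (low_rank_finite (h j0 s) (FE c b)).
have -> : (4 * sd q chi = sd q chi + (sd q chi + (sd q chi + sd q chi)))%N by rewrite !mulSn mul0n addn0.
have -> : A = fun f => F true Ir f + (F true Iq f + (F false I1 f + F false Ir f)).
  apply/funext => f; apply: BE_eq => b z zb; apply/colP => i.
  rewrite AE // !cmpD !FE // /residue_part; move: zb; case: b => zb /=.
  - by rewrite (((packs true I1).2 isT) j0 i s f z).2 !add0r addr0.
  - by rewrite !add0r mulrDr.
  - by rewrite (((packs false Iq).2 isT) j0 i s f z).2 !addr0 add0r.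
by do !apply: finite_rankD; exact: rF.
Qed.

Lemma pole_point k (j0 : nat) s0 : halfplane k s0 -> (j0 < k)%N -> 2 * s0 + j0%:R - 1 = 0 ->
  exists (U : set R[i]) (A C : R[i] -> {linear X -> X}),
    [/\ U s0, op_holomorphic U A, op_holomorphic U C,
        forall s, U s -> s != s0 -> forall f, L s f = (s - s0)^-1 *: A s f + C s f &
        forall s, U s -> rank_le (4 * sd q chi)%N (A s)] /\
    ((exists b i z f, closed_disk b z /\ residue_part b j0 i s0 f z != 0) -> pole_of_order 1 L s0).
Proof.
move=> ks jk sj; have [r r0 rP] := near_poles ks.
pose U := [set s | nm (s - s0) < r].
have oU : open U by exact: open_disk.
have Uk s : U s -> halfplane k s by move=> /rP[].
have U0 : U s0 by rewrite /U /= subrr nm0.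
have lj (l : nat) : l != j0 -> 2 * s0 + l%:R - 1 != 0.
  move=> lj; apply: contra_neq lj => E.
  have : l%:R = j0%:R :> R[i].
    by apply/eqP; rewrite -subr_eq0; apply/eqP; rewrite -[RHS](subrr 0) -{1}E -sj; ring.
  move=> /(congr1 (@nm R)) E2; rewrite !nmn in E2.
  by apply/eqP; rewrite -(eqr_nat R); apply/eqP.
have dkp l s : (l < k)%N -> U s -> l != j0 -> cdiff (fun s => pole_factor (2 * s) l) s.
  move=> lk Us /lj n0; rewrite /pole_factor; apply: cdiffV; first by cd.
  exact: (rP s Us).2 l lk n0.
pose kA (l : nat) (s : R[i]) : R[i] := if l == j0 then 1 / 2 else 0.
pose kC (l : nat) (s : R[i]) : R[i] := if l == j0 then 0 else pole_factor (2 * s) l.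
(* The coefficients of (s - s0) L; at s0 only the residue is left, so the pole is genuine if the
   residue is nonzero. *)
pose kG (l : nat) (s : R[i]) : R[i] := kA l s + (s - s0) * kC l s.
have dA l s : (l < k)%N -> U s -> cdiff (kA l) s by rewrite /kA; case: eqP => _ _ _; cd.
have dC l s : (l < k)%N -> U s -> cdiff (kC l) s.
  by rewrite /kC => lk Us; case: eqVneq => [_|n]; [cd|exact: dkp].
have dG l s : (l < k)%N -> U s -> cdiff (kG l) s.
  move=> lk Us; apply: cdiffD; first exact: dA.
  by apply: cdiffM; [cd|exact: dC].
have [A [AE hA _]] := @fam_ex k (fun=> 0) kA U oU Uk (fun s _ => cdiff_cst 0 s) dA.
have [C [CE hC _]] := @fam_ex k one kC U oU Uk (fun s _ => cdiff_cst 1 s) dC.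
have ds s : U s -> cdiff (fun s => s - s0) s by move=> _; cd.
have [G [GE hG _]] := @fam_ex k (fun s => s - s0) kG U oU Uk ds dG.
have kpE s : s != s0 -> pole_factor (2 * s) j0 = (s - s0)^-1 * (1 / 2).
  move=> ss; have s1 : s - s0 != 0 by rewrite subr_eq0.
  rewrite /pole_factor; have -> : 2 * s + j0%:R - 1 = 2 * (s - s0) + (2 * s0 + j0%:R - 1) by ring.
  by rewrite sj addr0 invfM mulrC div1r.
exists U, A, C; split; first split => //.
- move=> s Us ss f; apply: BE_eq => b z zb; apply/colP => i.
  rewrite cmpZD AE // CE // (LE _ _ (Uk s Us) zb) /family_kernel mul0r add0r mul1r addrCA; congr (_ + _).
  rewrite mulr_sumr -big_split; apply: eq_bigr => l _ /=.
  rewrite /kA /kC; case: eqVneq => [->|_]; last by rewrite mul0r mulr0 add0r.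
  by rewrite kpE // mul0r addr0 [RHS]mulrA.
- move=> s Us; have [|e eP] := @rank_residue j0 s (A s); last by exists e.
  move=> f b z i zb; rewrite AE // /family_kernel mul0r add0r (bigD1 (Ordinal jk)) //= /kA eqxx.
  rewrite big1 ?addr0 // => l ll; case: eqP => [lE|_]; last by rewrite mul0r.
  by move: ll; rewrite -(inj_eq val_inj) /= lE eqxx.
- move=> [b [i [z [f [zb nz]]]]]; exists U, G; split => //.
    exists f => G0; move: nz; have := GE s0 f b z i U0 zb.
    rewrite G0 cmp0 /family_kernel subrr mul0r add0r (bigD1 (Ordinal jk)) //= /kG subrr mul0r addr0 /kA eqxx.
    rewrite big1 ?addr0 => [|l ll].
      move/esym/eqP; rewrite mulf_eq0 => /orP[|/eqP -> //]; last by rewrite eqxx.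
      by rewrite mulf_eq0 oner_eq0 invr_eq0 pnatr_eq0.
    case: eqP => [lE|_]; last by rewrite !mul0r addr0 mul0r.
    by move: ll; rewrite -(inj_eq val_inj) /= lE eqxx.
  move=> s x Us ss; apply: BE_eq => b' z' zb'; apply/colP => i'.
  rewrite cmpZ expr1 GE // (LE _ _ (Uk s Us) zb') /family_kernel mul1r [RHS]mulrDr [X in _ = X + _]mulrA.
  have s1 : s - s0 != 0 by rewrite subr_eq0.
  rewrite mulVf // mul1r; congr (_ + _); rewrite mulr_sumr; apply: eq_bigr => l _.
  rewrite /kG /kA /kC [RHS]mulrA; congr (_ * _); rewrite [RHS]mulrDr mulKf //.
  by case: eqVneq => [->|_]; rewrite ?kpE ?addr0 // mulr0 add0r.
Qed.

Lemma pole_cases s0 : (exists2 U, U s0 & op_holomorphic U L) \/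
  [/\ pole_of_order 1 L s0, exists k : nat, s0 = (1 - k%:R) / 2 &
    exists (U : set R[i]) (A C : R[i] -> {linear X -> X}),
      [/\ U s0, op_holomorphic U A, op_holomorphic U C,
        forall s, U s -> s != s0 -> forall f, L s f = (s - s0)^-1 *: A s f + C s f &
        forall s, U s -> rank_le (4 * sd q chi)%N (A s)]].
Proof.
have [k ks] := halfplane_ex s0.
have [hz|nz] := pselect (forall c b l i s f z, Res c b l i s f z = 0).
  by left; apply: (holomorphic_point ks); right => b l i s f z; rewrite /residue_part !hz addr0.
have [hp|] := pselect (forall l, (l < k)%N -> 2 * s0 + l%:R - 1 != 0).
  by left; apply: (holomorphic_point ks); left.
move=> /existsNP[j0 /not_implyP[jk /negP]]; rewrite negbK => /eqP sj.
have [U [A [C [H1 H2]]]] := pole_point ks jk sj; right; split; last by exists U, A, C.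
  (* A cusp entry that does not vanish identically has, by the dichotomy in [cusp_pack], a nonzero
     residue for every index and every s. The test function is supported on the source disk of this
     cusp, so the other cusp cannot cancel it. *)
  apply: H2; move/existsNP: nz => [c /existsNP[b nz]].
  have [[_ _ _ _ [//|h]] _] := (packs c b).1.
  have zb : closed_disk b (Defs.center (Dk b)) by exact: center_closure.
  have [f [i [f0 fz]]] := h j0 s0 _ zb.
  exists b, i, (Defs.center (Dk b)), f; split => //.
  have vz c' : c' != c -> Res c' b j0 i s0 f (Defs.center (Dk b)) = 0.
    move=> tel0; have [_ v] := (packs c' b).1; apply: v => // x j xb.
    by apply: f0 => //; case: (c) (c') tel0 => [] [].
  rewrite /residue_part; case: (c) fz vz => fz vz.
    by rewrite (vz false isT) addr0.
  by rewrite (vz true isT) add0r.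
exists j0; have -> : 1 - j0%:R = 2 * s0 by apply/esym/eqP; rewrite -subr_eq0 -sj; apply/eqP; ring.
by rewrite mulrAC divff ?mul1r // pnatr_eq0.
Qed.
End family.
End assembly.

Theorem theorem5p1 (R : realType) (q d : nat) (hq : (3 <= q)%N)
    (chi : 'M[R]_2 -> 'M[R[i]]_d) (hchi : unitary_rep q chi)
    (E1 Er Eq : disk R) (hE : admissible_disks q E1 Er Eq) :
  (forall s : R[i], 1 / 2 < complex.Re s ->
     exists L : {linear BE d E1 Er Eq -> BE d E1 Er Eq},
       [/\ is_transfer_op q chi s L, continuous L & nuclear_order0 L]) /\
  (exists L : R[i] -> {linear BE d E1 Er Eq -> BE d E1 Er Eq},
     [/\ forall s : R[i], 1 / 2 < complex.Re s -> is_transfer_op q chi s (L s),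
         op_meromorphic L,
         forall s0 : R[i], is_pole L s0 ->
           pole_of_order 1 L s0 /\
           exists k : nat, s0 = (1 - k%:R) / 2 &
         forall s0 : R[i], is_pole L s0 ->
           exists (U : set R[i])
             (A B : R[i] -> {linear BE d E1 Er Eq -> BE d E1 Er Eq}),
             [/\ U s0, op_holomorphic U A, op_holomorphic U B,
                 forall s, U s -> s != s0 ->
                   forall f, L s f = (s - s0)^-1 *: A s f + B s f &
                 forall s, U s -> rank_le (4 * sd q chi)%N (A s)]]).
Proof.
pose B c b := sval (cid (pack_ex hq hchi hE c b)).
pose Rs c b := sval (cid (svalP (cid (pack_ex hq hchi hE c b)))).
have packs c b := svalP (cid (svalP (cid (pack_ex hq hchi hE c b)))).
pose L s := sval (cid (transfer_ex hq hE packs s)).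
have [LE LN] : (forall s k f b z i, halfplane k s -> closed_disk E1 Er Eq b z ->
    cmp (L s f) b z i 0 = family_kernel q chi B Rs b k (fun=> 1) (fun l s => pole_factor (2 * s) l) i s f z) /\
    forall s, nuclear_order0 (L s) /\ continuous (L s).
  by split=> s; have [h1 h2] := svalP (cid (transfer_ex hq hE packs s)) => //.
have tr := transfer_op packs LE.
have cases s0 := pole_cases hq hE packs LE s0.
split; first by move=> s s12; exists (L s); have [h1 h2] := LN s; split => //; exact: tr.
exists L; split => //.
- move=> s0; case: (cases s0) => [h|[h _ _]]; [by left|right].
  by exists 1%N.
- move=> s0 pole; case: (cases s0) => [[U Us hU]|[h1 h2 _]]; last by split.
  by case: (not_pole Us hU pole).
- move=> s0 pole; case: (cases s0) => [[U Us hU]|[_ _ h]]; last exact: h.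
  by case: (not_pole Us hU pole).
Qed.
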